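(* Let $$e_*=\min_{\Omega}\frac{\mathcal{E}(\Omega)}{|\Omega|},$$ where the minimum is taken over all measurable sets $\Omega\subset\mathbb{R}^3$ with $0<|\Omega|<\infty$. Then $e_*>(36\pi)^{1/3}$.
   Context: $|\cdot|$ denotes Lebesgue measure. For $\Omega\subset\mathbb{R}^3$ measurable, $\mathcal{E}(\Omega)=P(\Omega)+D(\Omega)$, where $P(\Omega)=\sup\{\int_\Omega \operatorname{div}X : X\in C^1_c(\mathbb{R}^3;\mathbb{R}^3),\ |X|\le 1\}$ is the perimeter and $D(\Omega)=\frac12\iint_{\Omega\times\Omega}\frac{dx\,dy}{|x-y|}$ is the Coulomb energy. *)

(* Defs.v *)
From HB Require Import structures.
From mathcomp Require Import all_boot all_order all_algebra.
From mathcomp Require Import all_classical all_reals all_analysis.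

Set Implicit Arguments.
Unset Strict Implicit.
Unset Printing Implicit Defensive.

Import Order.TTheory GRing.Theory Num.Theory.
Import numFieldNormedType.Exports.

Local Open Scope classical_set_scope.
Local Open Scope ring_scope.

(* The library declares its sigma-finiteness instance for [m1 \x m2] after one
   for subprobabilities, which shadows it. *)
Lemma sigma_finite_product_measure1 d1 d2 (T1 : measurableType d1)
    (T2 : measurableType d2) (R : realType) (m1 : {measure set T1 -> \bar R})
    (m2 : {sigma_finite_measure set T2 -> \bar R}) :
  sigma_finite setT m1 -> sigma_finite setT (m1 \x m2)%E.
Proof.
move=> /sigma_finiteP[F [TF ndF Foo]].
have /sigma_finiteP[G [TG ndG Goo]] := sigma_finiteT m2.
exists (fun n => F n `*` G n) => [|k].
  rewrite -setXTT TF TG predeqE => -[x y]; split.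
    move=> [/= [n _ Fnx] [k _ Gky]]; exists (maxn n k) => //; split.
    - by move: x Fnx; exact/subsetPset/ndF/leq_maxl.
    - by move: y Gky; exact/subsetPset/ndG/leq_maxr.
  by move=> [n _ []/= ? ?]; split; exists n.
have [? ?] := Foo k; have [? ?] := Goo k.
split; first exact: measurableX.
by rewrite product_measure1E// lte_mul_pinfty// ge0_fin_numE.
Qed.

Section liquid_drop.
Context {R : realType}.

(* The library's norm on this product is the sup norm; it is used only for the
   topology and for differentiability. Euclidean lengths are [enorm]. *)
Local Notation R3 := (R * R * R)%type.

Definition enorm (x : R3) : R :=
  Num.sqrt (x.1.1 ^+ 2 + x.1.2 ^+ 2 + x.2 ^+ 2).

Definition borel_lebesgue3 :=
  ((@lebesgue_measure R \x @lebesgue_measure R) \x @lebesgue_measure R)%E.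
HB.instance Definition _ := Measure.on borel_lebesgue3.

(* The completion of the product measure. The sigma-algebra carried by its
   domain is the one of Lebesgue measurable sets, not just the Borel sets. *)
Definition lebesgue3 := @completed_measure_extension _ _ _ borel_lebesgue3.
HB.instance Definition _ := Measure.on lebesgue3.

Let lebesgue3_sigma_finite : sigma_finite setT lebesgue3.
Proof.
apply: completed_measure_extension_sigma_finite.
apply: sigma_finite_product_measure1 => //.
by apply: sigma_finite_product_measure1 => //; exact: sigma_finiteT.
Qed.

HB.instance Definition _ := Measure_isSigmaFinite.Build _ _ _ lebesgue3
  lebesgue3_sigma_finite.

Definition lebesgue_measurable3 (Omega : set R3) : Prop :=
  ((borel_lebesgue3^*)%mu).-cara.-measurable Omega.

Definition e1 : R3 := (1, 0, 0).
Definition e2 : R3 := (0, 1, 0).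
Definition e3 : R3 := (0, 0, 1).

Definition C1 (X : R3 -> R3) : Prop :=
  (forall x, differentiable X x) /\ (forall v, continuous ('D_v X)).

Definition compactly_supported (X : R3 -> R3) : Prop :=
  compact (closure [set x | X x != 0]).

Definition divergence (X : R3 -> R3) (x : R3) : R :=
  ('D_e1 X x).1.1 + ('D_e2 X x).1.2 + ('D_e3 X x).2.

Definition test_field (X : R3 -> R3) : Prop :=
  [/\ C1 X, compactly_supported X & forall x, enorm (X x) <= 1].

Local Open Scope ereal_scope.

Definition perimeter (Omega : set R3) : \bar R :=
  ereal_sup [set \int[lebesgue3]_(x in Omega) (divergence X x)%:E
            | X in test_field].

(* On the diagonal the integrand is 0 (since 0^-1 = 0); the diagonal is a null
   set. *)
Definition coulomb (Omega : set R3) : \bar R :=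
  (2^-1)%:E * \int[lebesgue3 \x lebesgue3]_(z in Omega `*` Omega)
    ((enorm (z.1 - z.2 : R3))^-1)%:E.

Definition energy (Omega : set R3) : \bar R := perimeter Omega + coulomb Omega.

Definition admissible (Omega : set R3) : Prop :=
  [/\ lebesgue_measurable3 Omega, 0 < lebesgue3 Omega & lebesgue3 Omega < +oo].

Definition energy_per_volume : set (\bar R) :=
  [set energy Omega / lebesgue3 Omega | Omega in admissible].

Definition is_minimum (S : set (\bar R)) (e : \bar R) : Prop :=
  S e /\ lbound S e.

End liquid_drop.

Arguments energy_per_volume R : clear implicits.

(* Main.v *)
(** Testing the perimeter of [A] with the convolution of its indicator and the
    kernel [w (|w|^-3 - T^-3)] on [|w| < T] gives
    [4/3 pi T^3 |A| <= G(T) + pi/4 T^4 P(A)], where [G(t)] is the measure of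
    the pairs of points of [A] at distance less than [t].  Integrated against
    [t^-2], this bounds the Coulomb energy below; the choice [T = 4|A|/P(A)]
    yields [E(A)/|A| >= 4/T + pi T^2/3 >= (36 pi)^(1/3)].  In case of equality
    almost all pairs of points of [A] are at distance less than [T] and
    [|A| >= pi T^3/3]; but then [A] fits in a cube of side [T] up to a null set,
    which is impossible because [pi > 3].

    For the existence of a minimizer, fix a bound [M] on the volume.  The
    inequality above shows that a minimizing sequence keeps a fixed amount of
    mass in some ball; a bound on the perimeter gives local compactness, the
    energy is lower semicontinuous, and what escapes to infinity is cut off
    along spheres without loss.  Cutting a minimizer along coordinate planes
    shows that its volume is at most 24, whatever [M] is. *)

(* The kernel w (|w|^-3 - T^-3) has divergence 4 pi delta - 3 T^-3 on |w| < T. For a unit vector nu,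
   the integral of (nu . w)_+ times its radial factor is 3 pi T / 4, which bounds the field. Hence 4
   pi |A| - 3 T^-3 G(T) <= 3 pi T P(A) / 4, the first inequality up to a factor T^3 / 3. In the
   Coulomb energy it yields the lower bound pi |A| T^2 - pi P(A) T^3 / 6, which is largest at T =
   4|A| / P(A).

   The perimeter is accessible only through test fields, so the same inequality does the work of BV
   theory. At small t it bounds the pairs at distance less than t with one point in A and one
   outside, a Poincare-type estimate that gives compactness; at T = 4 / lambda it forbids vanishing.
   The area of a cut is replaced by a density of mass near the level.

   The obstacle for the minimum is that volume can be lost in the limit. Minimizing a ratio makes
   this harmless: a lost piece has energy at least e times its volume. The cap M keeps minimizing
   sequences under control, and a volume bound that does not depend on M removes the cap. *)
From HB Require Import structures.
Require Import Defs.
From mathcomp Require Import all_boot all_order all_algebra.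
From mathcomp Require Import all_classical all_reals all_analysis.
From mathcomp Require Import measurable_realfun ring lra zify.

Set Implicit Arguments.
Unset Strict Implicit.
Unset Printing Implicit Defensive.

Import Order.TTheory GRing.Theory Num.Theory.
Import numFieldNormedType.Exports.
Local Open Scope classical_set_scope.
Local Open Scope ring_scope.

(** * Lebesgue measure on R^3 and its isometries *)

Section leb3.
Context {R : realType}.
Notation lam := (@lebesgue_measure R).
Notation mu := (@borel_lebesgue3 R).
Notation mR := (measurableTypeR R).
Notation E2 := (mR * mR)%type.
Notation E3 := (E2 * mR)%type.
Notation E6 := (E3 * E3)%type.

Let m2 := (lam \x lam)%E.
HB.instance Definition _ := Measure.on m2.

Let m2_sigma_finite : sigma_finite setT m2.
Proof.
by apply: sigma_finite_product_measure1 => //; exact: sigma_finiteT.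
Qed.

HB.instance Definition _ := Measure_isSigmaFinite.Build _ _ _ m2
  m2_sigma_finite.

Definition leb2 : {sigma_finite_measure set E2 -> \bar R} := m2.

Let m3_sigma_finite : sigma_finite setT mu.
Proof.
by apply: sigma_finite_product_measure1 => //; exact: m2_sigma_finite.
Qed.

HB.instance Definition _ := Measure_isSigmaFinite.Build _ _ _ mu
  m3_sigma_finite.

Definition leb3 : {sigma_finite_measure set E3 -> \bar R} := mu.

Let m6 := (leb3 \x leb3)%E.
HB.instance Definition _ := Measure.on m6.

Let m6_sigma_finite : sigma_finite setT m6.
Proof.
by apply: sigma_finite_product_measure1 => //; exact: m3_sigma_finite.
Qed.

HB.instance Definition _ := Measure_isSigmaFinite.Build _ _ _ m6
  m6_sigma_finite.

Definition leb6 : {sigma_finite_measure set E6 -> \bar R} := m6.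

Local Open Scope ereal_scope.

Lemma integral_leb3E (f : E3 -> \bar R) : measurable_fun setT f ->
  (forall x, 0 <= f x) ->
  \int[leb3]_x f x = \int[lam]_a \int[lam]_b \int[lam]_c f (a, b, c).
Proof.
move=> mf f0.
rewrite [LHS](@fubini_tonelli1 _ _ _ _ _ leb2 lam f)//.
rewrite [LHS](@fubini_tonelli1 _ _ mR mR R lam lam
  (fun x => \int[lam]_y f (x, y)))//.
- exact: (@measurable_fun_fubini_tonelli_F _ _ (mR * mR)%type mR R lam f).
- by move=> x; exact: integral_ge0.
Qed.

Lemma measurable_coord1 : measurable_fun setT (fun x : E3 => x.1.1 : R).
Proof. exact: (measurableT_comp measurable_fst measurable_fst). Qed.

Lemma measurable_coord2 : measurable_fun setT (fun x : E3 => x.1.2 : R).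
Proof. exact: (measurableT_comp measurable_snd measurable_fst). Qed.

Lemma measurable_coord3 : measurable_fun setT (fun x : E3 => x.2 : R).
Proof. exact: measurable_snd. Qed.

(** [open] refers to the product topology and [measurable] to the product sigma-algebra. An open set
    is the union of the cubes of rational centre and radius 1 / (k + 1) that it contains, enumerated
    through [pickle]. *)
Lemma open_measurable3 (U : set (R * R * R)) : open U ->
  measurable (U : set E3).
Proof.
move=> oU.
pose B (q : rat * rat * rat) (k : nat) : set E3 :=
  (ball (ratr q.1.1 : R) k.+1%:R^-1 `*` ball (ratr q.1.2 : R) k.+1%:R^-1) `*`
  ball (ratr q.2 : R) k.+1%:R^-1.
have mB q k : measurable (B q k).
  apply: measurableX; last exact: (measurable_ball (ratr q.2 : R)).
  by apply: measurableX; exact: (measurable_ball (_ : R)).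
pose F (n : nat) : set E3 := if unpickle n is Some (q, k) then
  (if `[< B q k `<=` U >] then B q k else set0) else set0.
suff -> : U = \bigcup_n F n.
  apply: bigcup_measurable => n _; rewrite /F.
  case: unpickle => [[q k]|//]; case: ifP => _ //; exact: mB.
apply/seteqP; split => [x Ux|x [n _]]; last first.
  rewrite /F; case: unpickle => [[q k]|//]; case: ifPn => // /asboolP BU.
  exact: BU.
have /nbhs_ballP[e /= e0 xeU] := oU x Ux.
have e20 : (0 < e / 2 :> R)%R by exact: divr_gt0.
have [k] := ltr_add_invr e20; rewrite add0r => ke.
have k0 : (0 < k.+1%:R^-1 :> R)%R by rewrite invr_gt0.
have ex (d y : R) : (0 < d)%R -> exists q : rat, ball (ratr q : R) d y.
  move=> d0; have [|q] := @rat_in_itvoo R (y - d) (y + d); first lra.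
  rewrite in_itv /= => /andP[q1 q2]; exists q.
  by rewrite /ball /= ltr_norml; apply/andP; split; lra.
have [q1 Bq1] := ex _ x.1.1 k0; have [q2 Bq2] := ex _ x.1.2 k0.
have [q3 Bq3] := ex _ x.2 k0.
exists (pickle (q1, q2, q3, k)); first exact: I.
rewrite /F pickleK; case: ifPn => [_|]; first by split => //; split.
move=> /asboolPn[]; move=> y [[/= b1 b2] b3]; apply: xeU.
have aux (u v w : R) : ball u k.+1%:R^-1 v -> ball u k.+1%:R^-1 w ->
    ball v e w.
  rewrite /ball /= => uv uw; rewrite -(subrKA u) (splitr e).
  rewrite (le_lt_trans (ler_normD _ _))// ltrD//; last exact: (lt_trans uw).
  by rewrite distrC (lt_trans uv).
by split; [split|]; [exact: aux Bq1 _|exact: aux Bq2 _|exact: aux Bq3 _].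
Qed.

Lemma continuous_measurable3 (f : R * R * R -> R) : continuous f ->
  measurable_fun setT (f : E3 -> R).
Proof.
move=> /continuousP cf.
apply: (measurability _ (RGenOpens.measurableE R)) => _ [_ [a [b ->] <-]].
rewrite setTI; apply: open_measurable3; exact/cf/interval_open.
Qed.

End leb3.

Section invariance.
Context {R : realType}.
Notation lam := (@lebesgue_measure R).
Notation mR := (measurableTypeR R).
Notation E2 := (mR * mR)%type.
Notation leb2 := (@leb2 R).
Local Open Scope ereal_scope.

Lemma ge0_integral_map d1 d2 (X : measurableType d1) (Y : measurableType d2)
    (m : {measure set X -> \bar R}) (m' : {measure set Y -> \bar R})
    (phi : X -> Y) (f : Y -> \bar R) : measurable_fun setT phi ->
  (forall A, measurable A -> m (phi @^-1` A) = m' A) ->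
  measurable_fun setT f -> (forall y, 0 <= f y) ->
  \int[m]_x f (phi x) = \int[m']_y f y.
Proof.
move=> mphi mE mf f0.
have := @ge0_integral_pushforward _ _ _ _ _ _ mphi m setT f measurableT mf.
rewrite preimage_setT => <-//.
by apply: eq_measure_integral => A mA _; exact: mE.
Qed.

Lemma measurable_addr (a : R) : measurable_fun setT (fun x : mR => (x + a)%R : mR).
Proof. exact: (@measurable_funD _ _ R setT id (cst a)). Qed.

Lemma lebesgue_measure_shift (a : R) (A : set mR) : measurable A ->
  lam ((fun x : mR => (x + a)%R : mR) @^-1` A) = lam A.
Proof.
move=> mA; pose T (x : mR) : mR := (x + a)%R.
have mT : measurable_fun setT T by exact: measurable_addr.
pose nu : {measure set mR -> \bar R} := pushforward lam T.
suff : lam A = nu mT A by [].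
apply: (@lebesgue_measure_unique _ (nu mT)) => //= _ [[b c]] _ <-.
rewrite /pushforward.
have -> : T @^-1` `]b, c]%classic = `](b - a)%R, (c - a)%R]%classic.
  by apply/seteqP; split => x; rewrite /T /= !in_itv/= ltrBlDr lerBrDr.
rewrite !lebesgue_measure_itv/= !lte_fin ltrD2r.
by case: ifPn => // _; rewrite -!EFinB opprB addrA subrK.
Qed.

Lemma integral_shift1 (a : R) (f : mR -> \bar R) : measurable_fun setT f ->
  (forall x, 0 <= f x) -> \int[lam]_x f (x + a)%R = \int[lam]_x f x.
Proof.
apply: ge0_integral_map; first exact: measurable_addr.
exact: lebesgue_measure_shift.
Qed.

Lemma integral_opp1 (f : mR -> \bar R) : measurable_fun setT f ->
  (forall x, 0 <= f x) -> \int[lam]_x f (- x)%R = \int[lam]_x f x.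
Proof.
apply: ge0_integral_map; first exact: oppr_measurable.
exact: lebesgue_measureN.
Qed.

Lemma integral_leb2E (f : E2 -> \bar R) : measurable_fun setT f ->
  (forall x, 0 <= f x) -> \int[leb2]_x f x = \int[lam]_a \int[lam]_b f (a, b).
Proof. by move=> mf f0; rewrite [LHS](fubini_tonelli1 (m1 := lam) (m2 := lam)). Qed.

Lemma integral_leb2E2 (f : E2 -> \bar R) : measurable_fun setT f ->
  (forall x, 0 <= f x) -> \int[leb2]_x f x = \int[lam]_b \int[lam]_a f (a, b).
Proof. by move=> mf f0; rewrite [LHS](fubini_tonelli2 (m1 := lam) (m2 := lam)). Qed.

Lemma measurable_lin2 (a b : R) :
  measurable_fun setT (fun x : E2 => (a * x.1 + b * x.2)%R : mR).
Proof.
by apply: (@measurable_funD _ _ R); exact: measurable_funM.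
Qed.

Lemma measurable_map2 (a b c d : R) : measurable_fun setT
  (fun x : E2 => (a * x.1 + b * x.2, c * x.1 + d * x.2)%R : E2).
Proof. by apply/measurable_fun_pair; exact: measurable_lin2. Qed.

Lemma integral_shear1 (t : R) (f : E2 -> \bar R) : measurable_fun setT f ->
  (forall x, 0 <= f x) ->
  \int[leb2]_x f (x.1 + t * x.2, x.2)%R = \int[leb2]_x f x.
Proof.
move=> mf f0.
have mft : measurable_fun setT (fun x : E2 => f (x.1 + t * x.2, x.2)%R).
  apply: (measurableT_comp mf); have := measurable_map2 1 t 0 1.
  by under eq_fun do rewrite !mul1r mul0r add0r.
rewrite (integral_leb2E2 mf f0) (integral_leb2E2 mft (fun=> f0 _)).
apply: eq_integral => b _ /=; apply: (@integral_shift1 (t * b) (fun a => f (a, b))) => //.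
exact: (measurableT_comp mf (pair2_measurable b)).
Qed.

Lemma integral_shear2 (t : R) (f : E2 -> \bar R) : measurable_fun setT f ->
  (forall x, 0 <= f x) ->
  \int[leb2]_x f (x.1, x.2 + t * x.1)%R = \int[leb2]_x f x.
Proof.
move=> mf f0.
have mft : measurable_fun setT (fun x : E2 => f (x.1, x.2 + t * x.1)%R).
  apply: (measurableT_comp mf); have := measurable_map2 1 0 t 1.
  by under eq_fun do rewrite !mul1r mul0r addr0 addrC.
rewrite (integral_leb2E mf f0) (integral_leb2E mft (fun=> f0 _)).
apply: eq_integral => b _ /=; apply: (@integral_shift1 (t * b) (fun a => f (b, a))) => //.
exact: (measurableT_comp mf (pair1_measurable b)).
Qed.

(* A rotation of the plane by an angle other than pi is a product of three
   shears. *)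
Lemma integral_rot2 (c s : R) (f : E2 -> \bar R) : (c ^+ 2 + s ^+ 2 = 1)%R ->
  (0 <= c)%R -> measurable_fun setT f -> (forall x, 0 <= f x) ->
  \int[leb2]_x f (c * x.1 - s * x.2, s * x.1 + c * x.2)%R = \int[leb2]_x f x.
Proof.
move=> cs c0 mf f0; have c1 : (1 + c != 0)%R by rewrite gt_eqF// ltr_pwDl.
(* For c = cos a and s = sin a, s / (1 + c) is tan (a / 2): the rotation is a shear by - tan (a /
   2), a shear by sin a, and the first one again. *)
pose t := (- (s / (1 + c)))%R.
pose f1 (x : E2) := f (x.1 + t * x.2, x.2)%R.
pose f2 (x : E2) := f1 (x.1, x.2 + s * x.1)%R.
have mf1 : measurable_fun setT f1.
  apply: (measurableT_comp mf); have := measurable_map2 1 t 0 1.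
  by under eq_fun do rewrite !mul1r mul0r add0r.
have mf2 : measurable_fun setT f2.
  apply: (measurableT_comp mf1); have := measurable_map2 1 0 s 1.
  by under eq_fun do rewrite !mul1r mul0r addr0 addrC.
have e2 := integral_shear2 s mf1 (fun x => f0 _).
have e3 := integral_shear1 t mf2 (fun x => f0 _).
apply: etrans (etrans e2 (integral_shear1 t mf f0)); apply: etrans e3.
have ts : (1 + t * s = c)%R.
  have s2 : (s * s = 1 - c * c)%R by lra.
  by rewrite /t mulNr mulrAC s2; field.
have tc : (t * (1 + c) = - s)%R by rewrite /t mulNr divfK.
apply: eq_integral => x _; rewrite /f2 /f1 /=; congr (f (_, _)).
- transitivity ((1 + t * s) * x.1 + t * (1 + (1 + t * s)) * x.2)%R; last by ring.
  by rewrite ts tc mulNr.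
- transitivity (s * x.1 + (1 + t * s) * x.2)%R; last by ring.
  by rewrite ts.
Qed.

End invariance.

Section preserves.
Context {R : realType}.
Local Open Scope ereal_scope.

(** Invariance is stated for integrals of nonnegative functions instead of measures of sets: in this
    form it passes to compositions and, by Tonelli, to products. [preserves_set] recovers the
    version for sets. *)
Definition preserves d (T : measurableType d) (m : set T -> \bar R)
    (phi : T -> T) :=
  measurable_fun setT phi /\
  forall f : T -> \bar R, measurable_fun setT f -> (forall x, 0 <= f x) ->
    \int[m]_x f (phi x) = \int[m]_x f x.

Lemma preserves_id d (T : measurableType d) (m : set T -> \bar R) :
  preserves m id.
Proof. by split. Qed.

Lemma preserves_comp d (T : measurableType d) (m : set T -> \bar R) f g :
  preserves m f -> preserves m g -> preserves m (f \o g).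
Proof.
move=> [mf pf] [mg pg]; split; first exact: measurableT_comp.
move=> h mh h0; apply: etrans (pf _ mh h0).
by apply: (pg (h \o f)) => [|x]; [exact: measurableT_comp|exact: h0].
Qed.

Lemma preserves_prod d1 d2 (T1 : measurableType d1) (T2 : measurableType d2)
    (m1 : {sigma_finite_measure set T1 -> \bar R})
    (m2 : {sigma_finite_measure set T2 -> \bar R}) phi1 phi2 :
  preserves m1 phi1 -> preserves m2 phi2 ->
  preserves (m1 \x m2) (fun x : T1 * T2 => (phi1 x.1, phi2 x.2)).
Proof.
move=> [mphi1 p1] [mphi2 p2]; split.
  by apply/measurable_fun_pair; exact: measurableT_comp.
move=> f mf f0.
have mfphi2 : measurable_fun setT (fun x : T1 * T2 => f (x.1, phi2 x.2)).
  apply: (measurableT_comp mf); apply/measurable_fun_pair => //.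
  exact: measurableT_comp.
have mfphi : measurable_fun setT (fun x : T1 * T2 => f (phi1 x.1, phi2 x.2)).
  by apply: (measurableT_comp mf); apply/measurable_fun_pair;
    exact: measurableT_comp.
transitivity (\int[m1 \x m2]_x f (x.1, phi2 x.2)).
  rewrite (@fubini_tonelli2 _ _ T1 T2 R m1 m2 _ mfphi (fun=> f0 _)).
  rewrite (@fubini_tonelli2 _ _ T1 T2 R m1 m2 _ mfphi2 (fun=> f0 _)).
  apply: eq_integral => y _; apply: (p1 (fun x => f (x, phi2 y))) => //.
  exact: (measurableT_comp mf).
rewrite (@fubini_tonelli1 _ _ T1 T2 R m1 m2 _ mfphi2 (fun=> f0 _)).
rewrite (@fubini_tonelli1 _ _ T1 T2 R m1 m2 _ mf f0).
apply: eq_integral => x _; apply: (p2 (fun y => f (x, y))) => //.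
exact: (measurableT_comp mf).
Qed.

Lemma preserves_set d (T : measurableType d) (m : {measure set T -> \bar R})
    phi (A : set T) : preserves m phi -> measurable A ->
  m (phi @^-1` A) = m A.
Proof.
move=> [mphi p] mA; have := p (fun x => (\1_A x)%:E).
rewrite integral_indic// setIT => <-//; last first.
  exact/measurable_EFinP/measurable_indic.
have mpA : measurable (phi @^-1` A) by rewrite -[X in measurable X]setTI; exact: mphi.
by rewrite -[in LHS](setIT (phi @^-1` A)) -integral_indic.
Qed.

End preserves.

Section invariance3.
Context {R : realType}.
Notation lam := (@lebesgue_measure R).
Notation mR := (measurableTypeR R).
Notation E2 := (mR * mR)%type.
Notation E3 := (E2 * mR)%type.
Notation E6 := (E3 * E3)%type.
Notation leb2 := (@leb2 R).
Notation leb3 := (@leb3 R).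
Notation leb6 := (@leb6 R).
Local Open Scope ereal_scope.

Lemma preserves_shift1 (a : R) : preserves lam (fun x : mR => (x + a)%R : mR).
Proof. by split; [exact: measurable_addr|exact: integral_shift1]. Qed.

Lemma preserves_opp1 : preserves lam (fun x : mR => (- x)%R : mR).
Proof. by split; [exact: oppr_measurable|exact: integral_opp1]. Qed.

Lemma preserves_shift (a : R * R * R) :
  preserves leb3 (fun x : E3 => (x + a)%R : E3).
Proof.
have p2 := @preserves_prod R _ _ mR mR lam lam _ _
  (preserves_shift1 a.1.1) (preserves_shift1 a.1.2).
exact: (@preserves_prod R _ _ E2 mR leb2 lam _ _ p2 (preserves_shift1 a.2)).
Qed.

Lemma preserves_opp : preserves leb3 (fun x : E3 => (- x)%R : E3).
Proof.
have p2 := @preserves_prod R _ _ mR mR lam lam _ _ preserves_opp1 preserves_opp1.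
exact: (@preserves_prod R _ _ E2 mR leb2 lam _ _ p2 preserves_opp1).
Qed.

Lemma preserves_opp3 : preserves leb3 (fun x : E3 => (x.1, (- x.2)%R) : E3).
Proof.
exact: (@preserves_prod R _ _ E2 mR leb2 lam _ _ (preserves_id leb2)
  preserves_opp1).
Qed.

Lemma preserves_shift6 (a : R * R * R) :
  preserves leb6 (fun x : E6 => ((x.1 : R * R * R) + a, (x.2 : R * R * R) + a)%R : E6).
Proof.
exact: (@preserves_prod R _ _ E3 E3 leb3 leb3 _ _ (preserves_shift a)
  (preserves_shift a)).
Qed.

(** A rotation of the plane brings (b, c) onto the second axis, and [s] is its length up to sign.
    The sign is that of c because [integral_rot2] asks for a nonnegative cosine, here c / s. *)
Lemma integral_dir2 (b c : R) : exists2 s : R, (s ^+ 2 = b ^+ 2 + c ^+ 2)%R &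
  forall g : E2 -> \bar R, measurable_fun setT g -> (forall x, 0 <= g x) ->
  \int[leb2]_x g (x.1 ^+ 2 + x.2 ^+ 2, b * x.1 + c * x.2)%R =
  \int[leb2]_x g (x.1 ^+ 2 + x.2 ^+ 2, s * x.2)%R.
Proof.
have [bc0|bc0] := eqVneq (b ^+ 2 + c ^+ 2)%R 0%R.
  exists 0%R; first by rewrite bc0 expr0n.
  move=> g mg g0; move: bc0 => /eqP; rewrite paddr_eq0 ?sqr_ge0//.
  rewrite !sqrf_eq0 => /andP[/eqP-> /eqP->].
  by apply: eq_integral => x _; rewrite !mul0r addr0.
have bcp : (0 < b ^+ 2 + c ^+ 2)%R by rewrite lt_def bc0 addr_ge0 ?sqr_ge0.
pose s := ((if 0 <= c then 1 else -1) * Num.sqrt (b ^+ 2 + c ^+ 2))%R.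
have s2 : (s ^+ 2 = b ^+ 2 + c ^+ 2)%R.
  rewrite /s exprMn sqr_sqrtr ?(ltW bcp)//.
  by case: (0 <= c)%R; rewrite ?sqrrN expr1n mul1r.
have s0 : (s != 0)%R by rewrite -sqrf_eq0 s2.
have cs0 : (0 <= c / s)%R.
  rewrite /s; case: (leP 0%R c) => [c0|]; first by rewrite mul1r divr_ge0 ?sqrtr_ge0.
  by move=> c0; rewrite mulN1r invrN mulrN -mulNr divr_ge0 ?sqrtr_ge0// oppr_ge0 ltW.
exists s => // g mg g0.
have csb : ((c / s) ^+ 2 + (b / s) ^+ 2 = 1)%R.
  by rewrite !expr_div_n -mulrDl s2 addrC divff.
pose f (x : E2) := g (x.1 ^+ 2 + x.2 ^+ 2, s * x.2)%R.
have mf : measurable_fun setT f.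
  apply: (measurableT_comp mg); apply/measurable_fun_pair.
    by apply: (@measurable_funD _ _ R); exact: measurable_funX.
  exact: measurable_funM.
rewrite -[RHS](integral_rot2 csb cs0 mf (fun=> g0 _)).
apply: eq_integral => x _; rewrite /f/=; congr (g (_, _)); last first.
  rewrite mulrDr !mulrA [(s * b)%R]mulrC [(s * c)%R]mulrC !mulfK//.
transitivity (((c / s) ^+ 2 + (b / s) ^+ 2) * (x.1 ^+ 2 + x.2 ^+ 2))%R; last by ring.
by rewrite csb mul1r.
Qed.

Lemma measurable_sqnorm3 :
  measurable_fun setT (fun w : E3 => (w.1.1 ^+ 2 + w.1.2 ^+ 2 + w.2 ^+ 2)%R : mR).
Proof.
apply: (@measurable_funD _ _ R); last exact: measurable_funX.
by apply: (@measurable_funD _ _ R); apply: measurable_funX;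
  [exact: measurable_coord1|exact: measurable_coord2].
Qed.

Lemma integral_leb3E2 (f : E3 -> \bar R) : measurable_fun setT f ->
  (forall x, 0 <= f x) ->
  \int[leb3]_x f x = \int[lam]_a \int[leb2]_p f (a, p.1, p.2).
Proof.
move=> mf f0; rewrite integral_leb3E//; apply: eq_integral => a _.
rewrite integral_leb2E//.
apply: (measurableT_comp mf); apply/measurable_fun_pair; last exact: measurable_snd.
by apply/measurable_fun_pair.
Qed.

Lemma integral_leb3E3 (f : E3 -> \bar R) : measurable_fun setT f ->
  (forall x, 0 <= f x) ->
  \int[leb3]_x f x = \int[lam]_b \int[leb2]_p f (p.1, b, p.2).
Proof.
move=> mf f0; rewrite integral_leb3E//.
rewrite (@fubini_tonelli _ _ mR mR R lam lam (fun p => \int[lam]_c f (p, c))); last 2 first.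
- exact: (@measurable_fun_fubini_tonelli_F _ _ E2 mR R lam f).
- by move=> x; exact: integral_ge0.
apply: eq_integral => b _; rewrite integral_leb2E//.
apply: (measurableT_comp mf); apply/measurable_fun_pair; last exact: measurable_snd.
by apply/measurable_fun_pair.
Qed.

(** Rotation invariance for functions of |w|^2 and nu . w. A rotation in the last two coordinates,
    then one in the first and third, move nu to t e_3 with t = 1 or t = -1; the reflection of the
    last coordinate settles the sign. *)
Lemma integral_dir3 (nu : R * R * R) (F : E2 -> \bar R) :
  (nu.1.1 ^+ 2 + nu.1.2 ^+ 2 + nu.2 ^+ 2 = 1)%R ->
  measurable_fun setT F -> (forall x, 0 <= F x) ->
  \int[leb3]_w F (w.1.1 ^+ 2 + w.1.2 ^+ 2 + w.2 ^+ 2,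
    nu.1.1 * w.1.1 + nu.1.2 * w.1.2 + nu.2 * w.2)%R =
  \int[leb3]_w F (w.1.1 ^+ 2 + w.1.2 ^+ 2 + w.2 ^+ 2, w.2)%R.
Proof.
move: nu => [[a b] c] /= abc1 mF F0.
have [s sE ps] := integral_dir2 b c; have [t tE pt] := integral_dir2 a s.
have mlin (u v w : R) :
    measurable_fun setT (fun x : E3 => (u * x.1.1 + v * x.1.2 + w * x.2)%R : mR).
  apply: (@measurable_funD _ _ R); last exact: measurable_funM.
  by apply: (@measurable_funD _ _ R); apply: measurable_funM => //;
    [exact: measurable_coord1|exact: measurable_coord2].
have mFl (u v w : R) : measurable_fun setT (fun x : E3 =>
    F (x.1.1 ^+ 2 + x.1.2 ^+ 2 + x.2 ^+ 2, u * x.1.1 + v * x.1.2 + w * x.2)%R).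
  apply: (measurableT_comp mF); apply/measurable_fun_pair; last exact: mlin.
  exact: measurable_sqnorm3.
have mG (h : E2 -> R) k : measurable_fun setT (h : E2 -> mR) ->
   measurable_fun setT (k : E2 -> mR) ->
   measurable_fun setT (fun q : E2 => F (h q, k q)).
  by move=> mh mk; apply: (measurableT_comp mF); apply/measurable_fun_pair.
transitivity (\int[leb3]_w F (w.1.1 ^+ 2 + w.1.2 ^+ 2 + w.2 ^+ 2,
    a * w.1.1 + 0 * w.1.2 + s * w.2)%R).
  rewrite (integral_leb3E2 (mFl a b c) (fun=> F0 _)).
  rewrite (integral_leb3E2 (mFl a 0 s)%R (fun=> F0 _)); apply: eq_integral => x _.
  have := ps (fun q => F (x ^+ 2 + q.1, a * x + q.2)%R).
  under eq_integral do rewrite /= !addrA.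
  move=> ->//; last by apply: mG; exact: measurable_funD.
  by apply: eq_integral => q _ /=; rewrite mul0r addr0 addrA.
have t1 : (t ^+ 2 = 1)%R by rewrite tE sE addrA.
transitivity (\int[leb3]_w F (w.1.1 ^+ 2 + w.1.2 ^+ 2 + w.2 ^+ 2,
    0 * w.1.1 + 0 * w.1.2 + t * w.2)%R).
  rewrite (integral_leb3E3 (mFl a 0 s)%R (fun=> F0 _)).
  rewrite (integral_leb3E3 (mFl 0 0 t)%R (fun=> F0 _)); apply: eq_integral => y _.
  have mg : measurable_fun setT (fun q : E2 => F (y ^+ 2 + q.1, q.2)%R).
    by apply: mG => //; exact: measurable_funD.
  have := pt _ mg (fun=> F0 _).
  have eqq (p : E2) : (p.1 ^+ 2 + y ^+ 2 + p.2 ^+ 2 =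
    y ^+ 2 + (p.1 ^+ 2 + p.2 ^+ 2))%R by rewrite addrA [(_ + y ^+ 2)%R]addrC.
  move=> e; transitivity (\int[leb2]_q
      F (y ^+ 2 + (q.1 ^+ 2 + q.2 ^+ 2), a * q.1 + s * q.2)%R).
    by apply: eq_integral => q _ /=; rewrite mul0r addr0 eqq.
  rewrite e; apply: eq_integral => q _ /=.
  by rewrite !mul0r !add0r eqq.
have /orP[/eqP->|/eqP->] : (t == 1)%R || (t == -1)%R by rewrite -sqrf_eq1 t1.
  by apply: eq_integral => w _; rewrite !mul0r !add0r mul1r.
have [_ p3] := preserves_opp3.
have e := p3 _ (mFl 0 0 1)%R (fun=> F0 _).
transitivity (\int[leb3]_w F (w.1.1 ^+ 2 + w.1.2 ^+ 2 + w.2 ^+ 2,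
    0 * w.1.1 + 0 * w.1.2 + 1 * w.2)%R).
  rewrite -e; apply: eq_integral => w _ /=.
  by rewrite !mul0r !add0r mulN1r mul1r sqrrN.
by apply: eq_integral => w _; rewrite !mul0r !add0r mul1r.
Qed.

End invariance3.

(** * Passing from the completed measure to the Borel product measure *)

Section borel_reduction.
Context {R : realType}.
Notation mu := (@borel_lebesgue3 R).
Notation mR := (measurableTypeR R).
Notation E2 := (mR * mR)%type.
Notation E3 := (E2 * mR)%type.
Notation E6 := (E3 * E3)%type.
Notation leb3 := (@leb3 R).
Notation leb6 := (@leb6 R).
Local Open Scope ereal_scope.

Lemma measurable_lebesgue3 (A : set E3) : measurable A -> lebesgue_measurable3 A.
Proof. exact: caratheodory_measurable_mu_ext. Qed.

Lemma lebesgue3E (A : set E3) : measurable A -> lebesgue3 A = leb3 A.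
Proof. by move=> mA; rewrite /lebesgue3 /completed_measure_extension measurable_mu_extE. Qed.

Notation cE3 := (caratheodory_type (mu^*)%mu).

Lemma measurable_cara_id : measurable_fun setT (id : cE3 -> E3).
Proof. by move=> _ B mB; rewrite setTI; exact: measurable_lebesgue3. Qed.

(** The identity from the completed space to the Borel space is measurable and pushes [lebesgue3]
    forward to [leb3]. *)
Lemma ge0_integral_lebesgue3E (f : E3 -> \bar R) (A : set E3) : measurable A ->
  measurable_fun setT f -> (forall x, 0 <= f x) ->
  \int[lebesgue3]_(x in A) f x = \int[leb3]_(x in A) f x.
Proof.
move=> mA mf f0; rewrite integral_mkcond [RHS]integral_mkcond.
apply: (@ge0_integral_map R _ _ cE3 E3 lebesgue3 leb3 id (f \_ A)).
- exact: measurable_cara_id.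
- exact: lebesgue3E.
- by apply/(measurable_restrictT _ mA); exact: measurable_funTS.
- by move=> y; rewrite patchE; case: ifP.
Qed.

Lemma integral_lebesgue3E (f : E3 -> \bar R) (A : set E3) : measurable A ->
  measurable_fun setT f ->
  \int[lebesgue3]_(x in A) f x = \int[leb3]_(x in A) f x.
Proof.
move=> mA mf; rewrite integralE [RHS]integralE.
congr (_ - _); apply: ge0_integral_lebesgue3E => //.
- exact: measurable_funepos.
- exact: measurable_funeneg.
Qed.

Lemma continuous_divergence (X : R * R * R -> R * R * R) : C1 X ->
  continuous (divergence X).
Proof.
move=> [_ cX] x; rewrite /divergence.
have cfst (g : R * R * R -> R * R * R) : continuous g ->
    continuous (fun x => (g x).1.1).
  move=> cg y; apply: (@continuous_comp _ _ _ (fst \o g) fst); last exact: cvg_fst.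
  by apply: continuous_comp; [exact: cg|exact: cvg_fst].
have csnd (g : R * R * R -> R * R * R) : continuous g ->
    continuous (fun x => (g x).1.2).
  move=> cg y; apply: (@continuous_comp _ _ _ (fst \o g) snd); last exact: cvg_snd.
  by apply: continuous_comp; [exact: cg|exact: cvg_fst].
have c1 := cfst _ (cX e1); have c2 := csnd _ (cX e2).
have c3 : continuous (fun x => ('D_e3 X x).2).
  by move=> y; apply: (@continuous_comp _ _ _ ('D_e3 X) snd);
    [exact: cX|exact: cvg_snd].
exact: (cvgD (cvgD (c1 x) (c2 x)) (c3 x)).
Qed.

Lemma measurable_divergence (X : R * R * R -> R * R * R) : C1 X ->
  measurable_fun setT (divergence X : E3 -> R).
Proof. by move=> /continuous_divergence; exact: continuous_measurable3. Qed.

Lemma perimeterE (A : set E3) : measurable A -> perimeter A =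
  ereal_sup [set \int[leb3]_(x in A) (divergence X x)%:E | X in test_field].
Proof.
move=> mA; congr ereal_sup; apply/seteqP; split => _ [X tX <-]; exists X => //.
- rewrite integral_lebesgue3E//; apply/measurable_EFinP.
  by case: tX => + _ _; exact: measurable_divergence.
- rewrite integral_lebesgue3E//; apply/measurable_EFinP.
  by case: tX => + _ _; exact: measurable_divergence.
Qed.

Lemma measurable_inv : measurable_fun setT (fun x : R => x^-1)%R.
Proof.
have -> : setT = [set 0%R] `|` ~` [set (0 : R)%R].
  by rewrite setUCr.
apply/measurable_funU => //; first exact: measurableC.
split; first exact: measurable_fun_set1.
apply: open_continuous_measurable_fun.
  apply: closed_openC; apply: accessible_closed_set1.
  exact/hausdorff_accessible/Rhausdorff.
move=> x; rewrite inE /= => /eqP x0; exact: inv_continuous.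
Qed.

Lemma measurable_enorm : measurable_fun setT (enorm : E3 -> R).
Proof. exact: (measurableT_comp (continuous_measurable_fun (@sqrt_continuous R))
  (@measurable_sqnorm3 R)). Qed.

Lemma measurable_diff3 : measurable_fun setT
  (fun z : E6 => ((z.1 : R * R * R) - z.2)%R : E3).
Proof.
have m1 (g : E3 -> R) : measurable_fun setT g ->
    measurable_fun setT (fun z : E6 => g z.1 - g z.2)%R.
  by move=> mg; apply: measurable_funB; exact: measurableT_comp.
apply/measurable_fun_pair; last exact: (m1 _ (@measurable_coord3 R)).
by apply/measurable_fun_pair; [exact: (m1 _ (@measurable_coord1 R))|
  exact: (m1 _ (@measurable_coord2 R))].
Qed.

Lemma measurable_dist : measurable_fun setT
  (fun z : E6 => enorm ((z.1 : R * R * R) - z.2)%R).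
Proof. exact: (measurableT_comp measurable_enorm measurable_diff3). Qed.

Lemma measurable_kernel : measurable_fun setT
  (fun z : E6 => (enorm ((z.1 : R * R * R) - z.2)%R)^-1%:E).
Proof.
apply/measurable_EFinP; apply: measurableT_comp measurable_dist.
exact: measurable_inv.
Qed.

Lemma measurable_setX6 (A B : set E3) : measurable A -> measurable B ->
  measurable (A `*` B : set E6).
Proof. exact: measurableX. Qed.

Lemma ge0_integral_leb6E (f : E6 -> \bar R) : measurable_fun setT f ->
  (forall x, 0 <= f x) ->
  \int[leb6]_z f z = \int[leb3]_x \int[leb3]_y f (x, y).
Proof.
by move=> mf f0; rewrite [LHS](@fubini_tonelli1 _ _ E3 E3 R leb3 leb3 f).
Qed.

Lemma ge0_integral_leb6E2 (f : E6 -> \bar R) : measurable_fun setT f ->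
  (forall x, 0 <= f x) ->
  \int[leb6]_z f z = \int[leb3]_y \int[leb3]_x f (x, y).
Proof.
by move=> mf f0; rewrite [LHS](@fubini_tonelli2 _ _ E3 E3 R leb3 leb3 f).
Qed.

Lemma measurable_cara_pair_id : measurable_fun setT (id : cE3 * cE3 -> E6).
Proof.
apply/(measurable_fun_pairP (id : cE3 * cE3 -> E6)); split.
- exact: (measurableT_comp measurable_cara_id (@measurable_fst _ _ cE3 cE3)).
- exact: (measurableT_comp measurable_cara_id (@measurable_snd _ _ cE3 cE3)).
Qed.

Lemma ge0_integral_lebesgue6E (f : E6 -> \bar R) : measurable_fun setT f ->
  (forall x, 0 <= f x) ->
  \int[(lebesgue3 \x lebesgue3)]_z f z = \int[leb6]_z f z.
Proof.
move=> mf f0; rewrite ge0_integral_leb6E//.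
have mf' : measurable_fun setT (f : cE3 * cE3 -> \bar R).
  exact: (measurableT_comp mf measurable_cara_pair_id).
rewrite [LHS](@fubini_tonelli1 _ _ cE3 cE3 R lebesgue3 lebesgue3 f)//.
rewrite /fubini_F.
have e (x : E3) : \int[lebesgue3]_y f (x, y) = \int[leb3]_y f (x, y).
  by apply: (@ge0_integral_lebesgue3E (fun y => f (x, y)) setT) => //;
    exact: (measurableT_comp mf).
under eq_integral do rewrite e.
apply: (@ge0_integral_lebesgue3E (fun x => \int[leb3]_y f (x, y)) setT) => //.
  exact: (@measurable_fun_fubini_tonelli_F _ _ E3 E3 R leb3 f).
by move=> x; exact: integral_ge0.
Qed.

Lemma ge0_kernel (z : E6) : 0 <= (enorm ((z.1 : R * R * R) - z.2)%R)^-1%:E.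
Proof. by rewrite lee_fin invr_ge0 sqrtr_ge0. Qed.

Lemma coulombE (A : set E3) : measurable A -> coulomb A = (2^-1)%:E *
  \int[leb6]_(z in A `*` A) ((enorm ((z.1 : R * R * R) - z.2)%R)^-1)%:E.
Proof.
move=> mA; rewrite /coulomb; congr (_ * _).
rewrite integral_mkcond [RHS]integral_mkcond.
apply: ge0_integral_lebesgue6E => [|z].
  apply/(measurable_restrictT _ (measurable_setX6 mA mA)).
  by apply: measurable_funTS; exact: measurable_kernel.
by rewrite patchE; case: ifP => // _; exact: ge0_kernel.
Qed.

(** [lebesgue3] is an outer measure, an infimum over countable measurable covers. The intersection
    of covers that are optimal up to 1 / (n + 1) attains it. *)
Lemma borel_hull (Omega : set E3) : lebesgue3 Omega < +oo ->
  exists B : set E3, [/\ measurable B, Omega `<=` B &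
    lebesgue3 B = lebesgue3 Omega].
Proof.
move=> Ooo.
have ofin : lebesgue3 Omega \is a fin_num.
  by rewrite ge0_fin_numE//; exact: mu_ext_ge0.
have cov (n : nat) : exists A : (set E3)^nat, measurable_cover Omega A /\
    \sum_(k <oo) mu (A k) < lebesgue3 Omega + (n.+1%:R^-1)%:E.
  have [|_ [A cA <-] lt] := @lb_ereal_inf_adherent R
    [set \sum_(k <oo) mu (A k) | A in measurable_cover Omega] n.+1%:R^-1 _ ofin.
    by rewrite invr_gt0.
  by exists A.
have [A /all_and2[cA Alt]] := choice cov.
pose U n : set E3 := \bigcup_k A n k.
have mU n : measurable (U n) by apply: bigcupT_measurable => k; exact: (cA n).1.
have OU n : Omega `<=` U n by exact: (cA n).2.
have UO n : lebesgue3 (U n) <= lebesgue3 Omega + (n.+1%:R^-1)%:E.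
  apply: le_trans (ltW (Alt n)); rewrite lebesgue3E//.
  exact: (@measure_sigma_subadditive _ _ _ leb3 _ _ (cA n).1).
exists (\bigcap_n U n); split.
- by apply: bigcapT_measurable.
- by move=> x Ox n _; exact: OU.
apply/eqP; rewrite eq_le; apply/andP; split; last first.
  by apply: le_mu_ext => x Ox n _; exact: OU.
apply/lee_addgt0Pr => e e0.
have [n] := ltr_add_invr e0; rewrite add0r => ne.
apply: (@le_trans _ _ (lebesgue3 (U n))).
  by apply: le_mu_ext => x; exact.
by apply: (le_trans (UO n)); rewrite leeD2l// lee_fin ltW.
Qed.

End borel_reduction.

(** * Euclidean geometry and differentiation *)

Section euclidean.
Context {R : realType}.
Notation R3 := (R * R * R)%type.
Implicit Types (x y z : R3) (a b c : R).

Definition dot x y : R := x.1.1 * y.1.1 + x.1.2 * y.1.2 + x.2 * y.2.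

Lemma dotC x y : dot x y = dot y x.
Proof. by rewrite /dot; ring. Qed.

Lemma dotDl x y z : dot (x + y) z = dot x z + dot y z.
Proof. by rewrite /dot /=; ring. Qed.

Lemma dotZl a x y : dot (a *: x) y = a * dot x y.
Proof. by rewrite /dot /= /GRing.scale /=; ring. Qed.

Lemma dotDr x y z : dot x (y + z) = dot x y + dot x z.
Proof. by rewrite /dot /=; ring. Qed.

Lemma dotZr a x y : dot x (a *: y) = a * dot x y.
Proof. by rewrite /dot /= /GRing.scale /=; ring. Qed.

Lemma dotNl x y : dot (- x) y = - dot x y.
Proof. by rewrite /dot /=; ring. Qed.

Lemma dotNr x y : dot x (- y) = - dot x y.
Proof. by rewrite /dot /=; ring. Qed.

Lemma dot_ge0 x : 0 <= dot x x.
Proof. by rewrite /dot -!expr2 !addr_ge0 ?sqr_ge0. Qed.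

Lemma enormE x : enorm x = Num.sqrt (dot x x).
Proof. by rewrite /enorm /dot !expr2. Qed.

Lemma enorm_ge0 x : 0 <= enorm x. Proof. exact: sqrtr_ge0. Qed.

Lemma enorm_sqr x : enorm x ^+ 2 = dot x x.
Proof. by rewrite enormE sqr_sqrtr// dot_ge0. Qed.

Lemma enormN x : enorm (- x) = enorm x.
Proof. by rewrite !enormE dotNl dotNr opprK. Qed.

Lemma enormZ a x : enorm (a *: x) = `|a| * enorm x.
Proof.
by rewrite !enormE dotZl dotZr mulrA -expr2 sqrtrM ?sqr_ge0// sqrtr_sqr.
Qed.

Lemma enorm0 : enorm (0 : R3) = 0.
Proof. by rewrite /enorm /= !expr0n /= !addr0 sqrtr0. Qed.

Lemma dot_sqr_le x y : dot x y ^+ 2 <= dot x x * dot y y.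
Proof.
rewrite -subr_ge0.
have -> : dot x x * dot y y - dot x y ^+ 2 =
    (x.1.1 * y.1.2 - x.1.2 * y.1.1) ^+ 2 + (x.1.1 * y.2 - x.2 * y.1.1) ^+ 2 +
    (x.1.2 * y.2 - x.2 * y.1.2) ^+ 2 by rewrite /dot; ring.
by rewrite !addr_ge0 ?sqr_ge0.
Qed.

Lemma norm_dot_le x y : `|dot x y| <= enorm x * enorm y.
Proof.
rewrite -ler_sqr ?nnegrE ?mulr_ge0 ?enorm_ge0//.
by rewrite exprMn !enorm_sqr real_normK ?num_real// dot_sqr_le.
Qed.

Lemma dot_le x y : dot x y <= enorm x * enorm y.
Proof. exact: le_trans (ler_norm _) (norm_dot_le x y). Qed.

Lemma enormD x y : enorm (x + y) <= enorm x + enorm y.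
Proof.
rewrite -ler_sqr ?nnegrE ?addr_ge0 ?enorm_ge0//.
have -> : enorm (x + y) ^+ 2 = enorm x ^+ 2 + 2 * dot x y + enorm y ^+ 2.
  by rewrite !enorm_sqr dotDl !dotDr [dot y x]dotC; ring.
have := dot_le x y; rewrite sqrrD => ?; lra.
Qed.

Lemma norm_coord1_le x : `|x.1.1| <= enorm x.
Proof.
by rewrite -ler_sqr ?nnegrE ?enorm_ge0// enorm_sqr real_normK ?num_real// /dot
  expr2 -addrA lerDl addr_ge0// -expr2 sqr_ge0.
Qed.

Lemma norm_coord2_le x : `|x.1.2| <= enorm x.
Proof.
by rewrite -ler_sqr ?nnegrE ?enorm_ge0// enorm_sqr real_normK ?num_real// /dot
  expr2 addrAC lerDr addr_ge0// -expr2 sqr_ge0.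
Qed.

Lemma norm_coord3_le x : `|x.2| <= enorm x.
Proof.
by rewrite -ler_sqr ?nnegrE ?enorm_ge0// enorm_sqr real_normK ?num_real// /dot
  expr2 lerDr addr_ge0// -expr2 sqr_ge0.
Qed.

Lemma enorm_le_coord x : enorm x <= `|x.1.1| + `|x.1.2| + `|x.2|.
Proof.
rewrite -ler_sqr ?nnegrE ?addr_ge0 ?enorm_ge0// enorm_sqr /dot.
rewrite -[x.1.1 * _]expr2 -[x.1.2 * _]expr2 -[x.2 * _]expr2.
rewrite -(real_normK (num_real x.1.1)) -(real_normK (num_real x.1.2)).
rewrite -(real_normK (num_real x.2)).
have := normr_ge0 x.1.1; have := normr_ge0 x.1.2; have := normr_ge0 x.2.
by move=> *; nra.
Qed.

(** Duality: the length of x is its scalar projection on the direction x / |x|. It reduces the bound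
    on a vector field to bounds on integrals of real functions. *)
Lemma enorm_leP x c : 0 <= c ->
  (forall nu, enorm nu = 1 -> dot nu x <= c) -> enorm x <= c.
Proof.
move=> c0 H; have [->|x0] := eqVneq (enorm x) 0; first by [].
have xp : 0 < enorm x by rewrite lt_def x0 enorm_ge0.
have := H ((enorm x)^-1 *: x); rewrite enormZ ger0_norm ?invr_ge0 ?enorm_ge0//.
by rewrite mulVf// dotZl -enorm_sqr expr2 mulKf//; exact.
Qed.

End euclidean.

Section calculus.
Context {R : realType}.
Notation R3 := (R * R * R)%type.
Implicit Types (f : R3 -> R) (g : R3 -> R3).

Lemma continuous_coord1 g : continuous g -> continuous (fun x => (g x).1.1).
Proof.
move=> cg y; apply: (@continuous_comp _ _ _ (fst \o g) fst); last exact: cvg_fst.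
by apply: continuous_comp; [exact: cg|exact: cvg_fst].
Qed.

Lemma continuous_coord2 g : continuous g -> continuous (fun x => (g x).1.2).
Proof.
move=> cg y; apply: (@continuous_comp _ _ _ (fst \o g) snd); last exact: cvg_snd.
by apply: continuous_comp; [exact: cg|exact: cvg_fst].
Qed.

Lemma continuous_coord3 g : continuous g -> continuous (fun x => (g x).2).
Proof.
by move=> cg y; apply: (@continuous_comp _ _ _ g snd); [exact: cg|exact: cvg_snd].
Qed.

Lemma continuous_pair3 (f1 f2 f3 : R3 -> R) : continuous f1 -> continuous f2 ->
  continuous f3 -> continuous (fun x => (f1 x, f2 x, f3 x)).
Proof.
move=> c1 c2 c3 x; exact: (cvg_pair (cvg_pair (c1 x) (c2 x)) (c3 x)).
Qed.

Lemma continuous_dot g (h : R3 -> R3) : continuous g -> continuous h ->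
  continuous (fun x => dot (g x) (h x)).
Proof.
move=> cg ch; rewrite /dot => x.
have c1 := cvgM (continuous_coord1 cg (x := x)) (continuous_coord1 ch (x := x)).
have c2 := cvgM (continuous_coord2 cg (x := x)) (continuous_coord2 ch (x := x)).
have c3 := cvgM (continuous_coord3 cg (x := x)) (continuous_coord3 ch (x := x)).
exact: (cvgD (cvgD (c1 _) (c2 _)) (c3 _)).
Qed.

(** A C^1 function carried together with its gradient, so that the rules below compute gradients and
    give continuity and differentiability at once. *)
Definition grad3 f g := continuous g /\ forall x, is_diff x f (dot (g x)).

Lemma grad3_continuous f g : grad3 f g -> continuous f.
Proof.
by move=> [_ fg] x; apply: differentiable_continuous; case: (fg x).
Qed.

Lemma grad3_derive f g x v : grad3 f g -> 'D_v f x = dot (g x) v.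
Proof. by move=> [_ /(_ x)[dfx dfE]]; rewrite deriveE// dfE. Qed.

Lemma grad3_cst a : grad3 (cst a) (cst 0).
Proof.
split=> [x|x]; first exact: cvg_cst.
apply: is_diff_eq (is_diff_cst a x) _; apply/funext => v /=.
by rewrite /dot /= !mul0r !addr0.
Qed.

Lemma continuous_id3 : continuous (@id R3).
Proof. by move=> x; exact: cvg_id. Qed.

Lemma is_diff_coord1 (x : R3) : is_diff x (fun y : R3 => y.1.1) (fun y => y.1.1).
Proof.
pose l := [the {linear R3 -> R^o} of fst \o fst].
have cl : continuous l by exact: (@continuous_coord1 id continuous_id3).
by apply: DiffDef; [exact: (linear_differentiable _ cl)|rewrite (diff_lin _ cl)].
Qed.

Lemma is_diff_coord2 (x : R3) : is_diff x (fun y : R3 => y.1.2) (fun y => y.1.2).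
Proof.
pose l := [the {linear R3 -> R^o} of snd \o fst].
have cl : continuous l by exact: (@continuous_coord2 id continuous_id3).
by apply: DiffDef; [exact: (linear_differentiable _ cl)|rewrite (diff_lin _ cl)].
Qed.

Lemma is_diff_coord3 (x : R3) : is_diff x (fun y : R3 => y.2) (fun y => y.2).
Proof.
pose l := [the {linear R3 -> R^o} of snd].
have cl : continuous l by exact: (@continuous_coord3 id continuous_id3).
by apply: DiffDef; [exact: (linear_differentiable _ cl)|rewrite (diff_lin _ cl)].
Qed.

Lemma grad3_coord1 : grad3 (fun x => x.1.1) (cst e1).
Proof.
split=> [x|x]; first exact: cvg_cst.
apply: is_diff_eq (is_diff_coord1 x) _; apply/funext => v /=.
by rewrite /dot /= !mul0r !addr0 mul1r.
Qed.

Lemma grad3_coord2 : grad3 (fun x => x.1.2) (cst e2).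
Proof.
split=> [x|x]; first exact: cvg_cst.
apply: is_diff_eq (is_diff_coord2 x) _; apply/funext => v /=.
by rewrite /dot /= !mul0r !addr0 add0r mul1r.
Qed.

Lemma grad3_coord3 : grad3 (fun x => x.2) (cst e3).
Proof.
split=> [x|x]; first exact: cvg_cst.
apply: is_diff_eq (is_diff_coord3 x) _; apply/funext => v /=.
by rewrite /dot /= !mul0r !add0r mul1r.
Qed.

Lemma grad3D f1 g1 f2 g2 : grad3 f1 g1 -> grad3 f2 g2 ->
  grad3 (fun x => f1 x + f2 x) (fun x => g1 x + g2 x).
Proof.
move=> [c1 d1] [c2 d2]; split=> [x|x]; first by apply: cvgD; [exact: c1|exact: c2].
have := d1 x; have := d2 x => ? ?.
apply: (@is_diff_eq _ _ _ (f1 \+ f2)); apply/funext => v /=.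
by rewrite dotDl.
Qed.

Lemma grad3M f1 g1 f2 g2 : grad3 f1 g1 -> grad3 f2 g2 ->
  grad3 (fun x => f1 x * f2 x) (fun x => f1 x *: g2 x + f2 x *: g1 x).
Proof.
move=> G1 G2; have [c1 d1] := G1; have [c2 d2] := G2.
split=> [x|x].
  by apply: cvgD; apply: cvgZ => //; [exact: grad3_continuous G1 _|exact: c2
    |exact: grad3_continuous G2 _|exact: c1].
have := d1 x; have := d2 x => ? ?.
apply: (@is_diff_eq _ _ _ (f1 * f2)); apply/funext => v /=.
by rewrite dotDl !dotZl.
Qed.

Lemma grad3_comp (b b' : R -> R) f g : (forall u : R, is_derive u (1 : R) b (b' u)) ->
  continuous b' -> grad3 f g ->
  grad3 (b \o f) (fun x => b' (f x) *: g x).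
Proof.
move=> db cb G; have [cg dg] := G; split=> [x|x].
  apply: cvgZ; last exact: cg.
  apply: (@continuous_comp _ _ _ f b'); [exact: grad3_continuous G _|exact: cb].
have dbx : is_diff (f x) b (fun v => v * b' (f x)).
  have [d1 e1] := db (f x).
  have dif : differentiable b (f x) by apply/derivable1_diffP.
  apply: DiffDef => //; rewrite deriv1E//; apply/funext => v /=.
  by rewrite derive1E e1.
have := dg x => ?.
apply: (@is_diff_eq _ _ _ (b \o f)); apply/funext => v /=.
by rewrite dotZl mulrC.
Qed.

End calculus.

Section test_fields.
Context {R : realType}.
Notation R3 := (R * R * R)%type.
Implicit Types (f : R3 -> R) (g X Y : R3 -> R3) (x v w : R3).

Lemma is_diff_field (f1 f2 f3 : R3 -> R) g1 g2 g3 x :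
  grad3 f1 g1 -> grad3 f2 g2 -> grad3 f3 g3 ->
  is_diff x (fun y => (f1 y, f2 y, f3 y))
    (fun v => (dot (g1 x) v, dot (g2 x) v, dot (g3 x) v)).
Proof.
by move=> [_ /(_ x) d1] [_ /(_ x) d2] [_ /(_ x) d3]; exact: is_diff_pair.
Qed.

Lemma field_derive (f1 f2 f3 : R3 -> R) g1 g2 g3 x v :
  grad3 f1 g1 -> grad3 f2 g2 -> grad3 f3 g3 ->
  'D_v (fun y => (f1 y, f2 y, f3 y)) x =
  (dot (g1 x) v, dot (g2 x) v, dot (g3 x) v).
Proof.
move=> G1 G2 G3; have [d dE] := is_diff_field x G1 G2 G3.
by rewrite deriveE// dE.
Qed.

Lemma C1_field (f1 f2 f3 : R3 -> R) g1 g2 g3 :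
  grad3 f1 g1 -> grad3 f2 g2 -> grad3 f3 g3 ->
  C1 (fun y => (f1 y, f2 y, f3 y)).
Proof.
move=> G1 G2 G3; split=> [x|v]; first by have [] := is_diff_field x G1 G2 G3.
rewrite (_ : 'D_v _ = fun x => (dot (g1 x) v, dot (g2 x) v, dot (g3 x) v)).
  by apply: continuous_pair3; apply: continuous_dot => //;
    (exact: (fst G1) || exact: (fst G2) || exact: (fst G3) ||
     move=> x; exact: cvg_cst).
by apply/funext => x; exact: field_derive.
Qed.

Lemma divergence_field (f1 f2 f3 : R3 -> R) g1 g2 g3 x :
  grad3 f1 g1 -> grad3 f2 g2 -> grad3 f3 g3 ->
  divergence (fun y => (f1 y, f2 y, f3 y)) x = (g1 x).1.1 + (g2 x).1.2 + (g3 x).2.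
Proof.
move=> G1 G2 G3; rewrite /divergence !(field_derive _ _ G1 G2 G3) /dot /=.
by rewrite !mulr0 !mulr1 !addr0 !add0r.
Qed.

Definition jac1 X x : R3 :=
  (('D_e1 X x).1.1, ('D_e2 X x).1.1, ('D_e3 X x).1.1).
Definition jac2 X x : R3 :=
  (('D_e1 X x).1.2, ('D_e2 X x).1.2, ('D_e3 X x).1.2).
Definition jac3 X x : R3 := (('D_e1 X x).2, ('D_e2 X x).2, ('D_e3 X x).2).

Lemma C1_deriveE X x v : C1 X ->
  'D_v X x = v.1.1 *: 'D_e1 X x + v.1.2 *: 'D_e2 X x + v.2 *: 'D_e3 X x.
Proof.
move=> [dX _]; rewrite !deriveE// -!linearZ -!linearD; congr ('d X x _).
case: v => [[a b] c]; rewrite /e1 /e2 /e3 /=.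
by congr (_, _, _) => /=; rewrite /GRing.scale/= ?mulr0 ?mulr1 ?addr0 ?add0r.
Qed.

Lemma C1_jac X : C1 X -> [/\ grad3 (fun x => (X x).1.1) (jac1 X),
  grad3 (fun x => (X x).1.2) (jac2 X) & grad3 (fun x => (X x).2) (jac3 X)].
Proof.
move=> cX; have [dX kX] := cX.
have dvE x v : 'd X x v =
    v.1.1 *: 'D_e1 X x + v.1.2 *: 'D_e2 X x + v.2 *: 'D_e3 X x.
  by rewrite -C1_deriveE// deriveE.
have iX x : is_diff x X ('d X x) by exact: differentiableP.
split; split.
- by apply: continuous_pair3; apply: continuous_coord1; exact: kX.
- move=> x; have := iX x => ?.
  have := is_diff_coord1 (X x) => ?.
  apply: (@is_diff_eq _ _ _ ((fun y : R3 => y.1.1) \o X)); apply/funext => v /=.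
  by rewrite dvE /dot /jac1 /= /GRing.scale/= !(mulrC v.1.1) !(mulrC v.1.2) (mulrC v.2).
- by apply: continuous_pair3; apply: continuous_coord2; exact: kX.
- move=> x; have := iX x => ?.
  have := is_diff_coord2 (X x) => ?.
  apply: (@is_diff_eq _ _ _ ((fun y : R3 => y.1.2) \o X)); apply/funext => v /=.
  by rewrite dvE /dot /jac2 /= /GRing.scale/= !(mulrC v.1.1) !(mulrC v.1.2) (mulrC v.2).
- by apply: continuous_pair3; apply: continuous_coord3; exact: kX.
- move=> x; have := iX x => ?.
  have := is_diff_coord3 (X x) => ?.
  apply: (@is_diff_eq _ _ _ ((fun y : R3 => y.2) \o X)); apply/funext => v /=.
  by rewrite dvE /dot /jac3 /= /GRing.scale/= !(mulrC v.1.1) !(mulrC v.1.2) (mulrC v.2).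
Qed.

Definition box (M : R) : set R3 :=
  (`[- M, M] `*` `[- M, M]) `*` `[- M, M].

Lemma boxE M x : box M x <-> [/\ `|x.1.1| <= M, `|x.1.2| <= M & `|x.2| <= M].
Proof.
rewrite /box /=; rewrite !in_itv /= -!ler_norml.
by split=> [[[]]|[]].
Qed.

Lemma box_enorm M x : enorm x <= M -> box M x.
Proof.
by move=> xM; apply/boxE; split; apply: le_trans xM;
  [exact: norm_coord1_le|exact: norm_coord2_le|exact: norm_coord3_le].
Qed.

Lemma compact_box M : compact (box M).
Proof. by apply: compact_setX; [apply: compact_setX|]; exact: segment_compact. Qed.

Lemma closed_box M : closed (box M).
Proof.
apply: compact_closed; last exact: compact_box.
apply: norm_hausdorff.
Qed.

Lemma compactly_supportedP X : compactly_supported X <->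
  exists2 M, 0 < M & forall x, ~ box M x -> X x = 0.
Proof.
split=> [/compact_bounded[N [_ NX]]|[M M0 XM]].
  exists (Num.max 1 (N + 1)); first by rewrite lt_max ltr01.
  move=> x nb; apply/eqP/negP => /negP X0; apply: nb.
  have : `|x| <= Num.max 1 (N + 1).
    apply: NX; first by rewrite lt_max ltrDl ltr01 orbT.
    exact: subset_closure.
  rewrite prod_normE /= ge_max [`|x.1|]prod_normE ge_max.
  by move=> /andP[/andP[a b] c]; apply/boxE.
apply: (@subclosed_compact _ _ (box M)); [exact: closed_closure|exact: compact_box|].
rewrite [X in _ `<=` X]((closure_id (box M)).1 (@closed_box M)).
apply: closureS.
by move=> x /= X0; apply: contrapT => /XM; apply/eqP.
Qed.

Lemma C1_support X M x : (forall x, ~ box M x -> X x = 0) -> ~ box M x ->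
  divergence X x = 0.
Proof.
move=> X0 nb.
have nX : \forall y \near x, X y = cst 0 y.
  have : open (~` box M) by apply: closed_openC; exact: closed_box.
  by move=> /(_ x nb); apply: filterS => y /X0.
by rewrite /divergence !(near_eq_derive _ nX) !derive_cst !addr0.
Qed.

Lemma continuous_box_bounded f M : continuous f ->
  exists2 C, 0 <= C & forall x, box M x -> `|f x| <= C.
Proof.
move=> cf; have : compact (f @` box M).
  by apply: continuous_compact; [exact: continuous_subspaceT|exact: compact_box].
move=> /compact_bounded[N [_ NX]]; exists (Num.max 0 (N + 1)).
  by rewrite le_max lexx.
move=> x bx; apply: (NX (Num.max 0 (N + 1))); last by exists x.
by rewrite lt_max ltrDl ltr01 orbT.
Qed.

Lemma test_field_support X : test_field X ->
  exists M C, [/\ 0 < M, 0 <= C, forall x, ~ box M x -> divergence X x = 0 &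
    forall x, `|divergence X x| <= C].
Proof.
move=> [cX /compactly_supportedP[M M0 XM] _].
have [C C0 XC] := continuous_box_bounded M (continuous_divergence cX).
exists M, C; split=> // x; first exact: C1_support.
have [/XC//|nb] := pselect (box M x).
by rewrite (C1_support XM nb) normr0.
Qed.

Lemma test_field0 : test_field (fun=> 0 : R3).
Proof.
split=> [||x]; last by rewrite enorm0 ler01.
  exact: (C1_field (grad3_cst 0) (grad3_cst 0) (grad3_cst 0)).
by apply/compactly_supportedP; exists 1.
Qed.

Lemma divergence0 x : divergence (fun=> 0 : R3) x = 0.
Proof. by rewrite /divergence !derive_cst !addr0. Qed.

Lemma derive_shift3 X x v a : 'D_v (fun y => X (y - a)) x = 'D_v X (x - a).
Proof.
rewrite /derive; set F := (F in lim (F @ _)); set G := (G in _ = lim (G @ _)).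
by suff -> : F = G by []; apply/funext => h; rewrite /F /G /= addrA.
Qed.

Lemma divergence_shift X x a :
  divergence (fun y => X (y - a)) x = divergence X (x - a).
Proof. by rewrite /divergence !derive_shift3. Qed.

Lemma test_field_shift X a : test_field X -> test_field (fun x => X (x - a)).
Proof.
move=> [[dX cX] /compactly_supportedP[M M0 XM] X1].
have cs : continuous (fun x : R3 => x - a).
  by move=> x; exact: (cvgB (continuous_id3 (x := x)) (cvg_cst a)).
split=> [||x]; last exact: X1.
  split=> [x|v].
    apply: (@differentiable_comp _ _ _ _ (fun x => x - a) X).
    - by apply: differentiableB; [exact: ex_diff|exact: differentiable_cst].
    - exact: dX.
  rewrite (_ : 'D_v _ = 'D_v X \o (fun x => x - a)).
    by move=> x; apply: (@continuous_comp _ _ _ (fun x => x - a) ('D_v X));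
      [exact: cs|exact: cX].
  by apply/funext => x; exact: derive_shift3.
have Ma : 0 <= enorm a by exact: enorm_ge0.
apply/compactly_supportedP; exists (M + enorm a); first by rewrite ltr_pwDl.
move=> x nb; apply: XM => /boxE[b1 b2 b3]; apply: nb; apply/boxE; split.
- rewrite -(subrK a.1.1 x.1.1) (le_trans (ler_normD _ _))// lerD//.
  exact: norm_coord1_le.
- rewrite -(subrK a.1.2 x.1.2) (le_trans (ler_normD _ _))// lerD//.
  exact: norm_coord2_le.
- rewrite -(subrK a.2 x.2) (le_trans (ler_normD _ _))// lerD//.
  exact: norm_coord3_le.
Qed.

End test_fields.

Section line_calculus.
Context {R : realType}.
Notation mu := (@lebesgue_measure R).
Implicit Types (f F : R -> R) (a b : R).

Lemma is_derive_continuous F f : (forall x : R, is_derive x (1 : R) F (f x)) ->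
  continuous F.
Proof.
move=> dF x; have [d _] := dF x.
by apply: differentiable_continuous; exact/derivable1_diffP.
Qed.

Lemma FTC_integral F f a b : a <= b ->
  (forall x : R, is_derive x (1 : R) F (f x)) -> continuous f ->
  (\int[mu]_(x in `[a, b]) (f x)%:E = (F b - F a)%:E)%E.
Proof.
rewrite le_eqVlt => /predU1P[<- *|ab dF cf].
  by rewrite set_itv1 integral_set1 subrr.
have cF := is_derive_continuous dF.
rewrite (continuous_FTC2 (F := F) ab)//.
- exact: continuous_subspaceT.
- split=> [x _||]; first by case: (dF x).
  + exact/cvg_at_right_filter/cF.
  + exact/cvg_at_left_filter/cF.
- by move=> x _; rewrite derive1E; case: (dF x).
Qed.

(** The substitution x = r sin u turns the integrand into r^2 cos^2 u on [- pi / 2, pi / 2]. *)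
Lemma half_disc_integral (r : R) : 0 < r ->
  (\int[mu]_(x in `[(- r)%R, r]) (Num.sqrt (r ^+ 2 - x ^+ 2))%:E =
   (r ^+ 2 * pi / 2)%:E)%E.
Proof.
move=> r0; pose F x := r * sin x.
have dF (x : R) : is_derive x (1 : R) F (r * cos x).
  by rewrite /F; apply: is_derive_eq; rewrite /GRing.scale /= ?mulr0 ?addr0.
have F'E : (derive1 F) = fun x => r * cos x.
  by apply/funext => x; rewrite derive1E; case: (dF x).
have cF' : continuous (derive1 F).
  by rewrite F'E => x; exact: (cvgM (cvg_cst r) (@continuous_cos R x)).
have cF := is_derive_continuous dF.
have Fr : F (pi / 2) = r by rewrite /F sin_pihalf mulr1.
have Fl : F (- (pi / 2)) = - r by rewrite /F sinN sin_pihalf mulrN1.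
have pi2 : - (pi / 2) <= pi / 2 :> R.
  by rewrite ge0_cp// divr_ge0// pi_ge0.
have -> : `[(- r)%R, r]%classic = `[F (- (pi / 2)), F (pi / 2)]%classic.
  by rewrite Fl Fr.
have H1 : {in `[- (pi / 2), pi / 2] &, {homo F : x y / (x < y)%R}}.
  by move=> x y xI yI xy; rewrite ltr_pM2l// ltr_sin.
have H2 : {in `]- (pi / 2), (pi / 2)[, continuous (derive1 F)}.
  by move=> x _; exact: cF'.
have H3 : cvg ((derive1 F) x @[x --> (- (pi / 2))^'+]).
  apply/cvg_ex; exists ((derive1 F) (- (pi / 2))).
  by apply: cvg_at_right_filter; exact: cF'.
have H4 : cvg ((derive1 F) x @[x --> (pi / 2)^'-]).
  apply/cvg_ex; exists ((derive1 F) (pi / 2)).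
  by apply: cvg_at_left_filter; exact: cF'.
have H5 : derivable_oo_LRcontinuous F (- (pi / 2)) (pi / 2).
  split=> [x _||]; first by case: (dF x).
  - exact/cvg_at_right_filter/cF.
  - exact/cvg_at_left_filter/cF.
have cs : continuous (fun x : R => Num.sqrt (r ^+ 2 - x ^+ 2)).
  move=> x; apply: (cvg_comp (fun x : R => r ^+ 2 - x ^+ 2) Num.sqrt).
    exact: (cvgB (cvg_cst _) (@exprn_continuous _ 2 x)).
  exact: sqrt_continuous.
have H6 : {within `[F (- (pi / 2)), F (pi / 2)],
    continuous (fun x => Num.sqrt (r ^+ 2 - x ^+ 2))}.
  exact: continuous_subspaceT.
rewrite (integration_by_substitution_increasing pi2 H1 H2 H3 H4 H5 H6).
pose H (x : R) := r ^+ 2 * (x + sin x * cos x) / 2.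
transitivity (\int[mu]_(x in `[(- (pi / 2))%R, (pi / 2)%R]) (r ^+ 2 * cos x ^+ 2)%:E)%E.
  apply: eq_integral => x; rewrite inE /= in_itv /= => xI.
  have cx : 0 <= cos x by exact: cos_ge0_pihalf.
  rewrite F'E /F; congr (_%:E).
  change (Num.sqrt (r ^+ 2 - (r * sin x) ^+ 2) * (r * cos x) =
    r ^+ 2 * cos x ^+ 2).
  have -> : r ^+ 2 - (r * sin x) ^+ 2 = (r * cos x) ^+ 2.
    by rewrite exprMn [(r * cos x) ^+ 2]exprMn cos2sin2; ring.
  rewrite sqrtr_sqr ger0_norm ?mulr_ge0// ?(ltW r0)//.
  by rewrite -expr2 exprMn.
have dH (x : R) : is_derive x (1 : R) H (r ^+ 2 * cos x ^+ 2).
  rewrite /H; apply: is_derive_eq.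
  rewrite /GRing.scale /= ?mulr0 ?addr0 ?mulr1.
  have sE : sin x * sin x = 1 - cos x * cos x by rewrite -!expr2 sin2cos2.
  by rewrite mulrN sE; field.
have cH : continuous (fun x : R => r ^+ 2 * cos x ^+ 2).
  move=> x; apply: (cvgM (cvg_cst _)).
  exact: (cvg_comp cos (fun y => y ^+ 2) (@continuous_cos R x)
    (@exprn_continuous _ 2 _)).
rewrite (FTC_integral pi2 dH cH).
congr (_%:E); rewrite /H sinN cosN cos_pihalf !mulr0 !addr0.
by field.
Qed.

End line_calculus.

(** * Integration over balls *)

Section ball_volume.
Context {R : realType}.
Notation lam := (@lebesgue_measure R).
Notation mR := (measurableTypeR R).
Notation E2 := (mR * mR)%type.
Notation E3 := (E2 * mR)%type.
Notation leb2 := (@leb2 R).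
Local Open Scope ereal_scope.

Definition ball3 (t : R) : set E3 := [set w | enorm w < t]%R.

Lemma measurable_ball3 t : measurable (ball3 t).
Proof.
have -> : ball3 t = setT `&` (enorm : E3 -> R) @^-1` `]-oo, t[%classic.
  by rewrite setTI; apply/seteqP; split=> x; rewrite /ball3 /= in_itv.
exact: measurable_enorm.
Qed.

Lemma ball3P t (w : E3) : (0 <= t)%R ->
  ball3 t w <-> (w.1.1 ^+ 2 + w.1.2 ^+ 2 + w.2 ^+ 2 < t ^+ 2)%R.
Proof.
move=> t0; rewrite /ball3 /enorm /=; split.
  rewrite -ltr_sqr ?nnegrE ?sqrtr_ge0// sqr_sqrtr//.
  by rewrite !addr_ge0 ?sqr_ge0.
move=> wt; rewrite -ltr_sqr ?nnegrE ?sqrtr_ge0// sqr_sqrtr//.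
by rewrite !addr_ge0 ?sqr_ge0.
Qed.

(** Indexed by the squared radius: the slice of [ball3 t] at height c is then
    [disc (t ^+ 2 - c ^+ 2)], also when the difference is negative and the slice is empty. *)
Definition disc (q : R) : set E2 := [set p | p.1 ^+ 2 + p.2 ^+ 2 < q]%R.

Lemma measurable_disc q : measurable (disc q).
Proof.
pose f (p : E2) : R := (p.1 ^+ 2 + p.2 ^+ 2)%R.
have mf : measurable_fun setT f.
  by apply: measurable_funD; exact: measurable_funX.
have -> : disc q = setT `&` f @^-1` `]-oo, q[%classic.
  by rewrite setTI; apply/seteqP; split=> x; rewrite /disc /f /= in_itv.
exact: mf.
Qed.

Lemma disc_area (q : R) : leb2 (disc q) = (pi * Num.max 0 q)%:E.
Proof.
have [q0|q0] := leP q 0%R.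
  rewrite mulr0 (_ : disc q = set0) ?measure0//.
  apply/seteqP; split=> // x; rewrite /disc /=; apply/negP; rewrite -leNgt.
  by rewrite (le_trans q0)// addr_ge0 ?sqr_ge0.

pose r := Num.sqrt q; have r0 : (0 < r)%R by rewrite sqrtr_gt0.
have rq : (r ^+ 2 = q)%R by rewrite sqr_sqrtr// ltW.
rewrite -[in LHS](setIT (disc q)) -integral_indic//; last exact: measurable_disc.
have mi : measurable_fun setT (fun x : E2 => (\1_(disc q) x : R)%:E).
  by apply/measurable_EFinP; apply: measurable_indic; exact: measurable_disc.
rewrite integral_leb2E//.
have slice (a : R) : \int[lam]_b (\1_(disc q) (a, b) : R)%:E =
    (2 * Num.sqrt (r ^+ 2 - a ^+ 2))%:E.
  set s := Num.sqrt _.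
  transitivity (\int[lam]_b (\1_(`](- s)%R, s[%classic : set mR) b : R)%:E).
    apply: eq_integral => b _; congr (_%:E); rewrite !indicE; congr (nat_of_bool _)%:R.
    apply/idP/idP; rewrite !inE /disc /= in_itv /= -ltr_norml.
    - move=> abq; rewrite -ltr_sqr ?nnegrE ?sqrtr_ge0// real_normK ?num_real//.
      by rewrite sqr_sqrtr rq; have := sqr_ge0 b; lra.
    - move=> bs; have s0 : (0 < s)%R by exact: le_lt_trans bs.
      move: bs; rewrite -ltr_sqr ?nnegrE ?sqrtr_ge0// real_normK ?num_real//.
      rewrite sqr_sqrtr ?rq; first by lra.
      by move: s0; rewrite sqrtr_gt0 rq => /ltW.
  rewrite integral_indic// setIT/= lebesgue_measure_itv /= lte_fin.
  case: ifPn => [_|]; first by rewrite -EFinB; congr (_%:E); ring.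
  have s0 : (0 <= s)%R by exact: sqrtr_ge0.
  by rewrite -leNgt => ?; congr (_%:E); lra.
under eq_integral do rewrite slice.
have := half_disc_integral r0.
rewrite rq; set I := \int[_]_(_ in _) _ => IE.
transitivity (2%:E * I); last by rewrite IE -EFinM; congr (_%:E); field.
rewrite /I -ge0_integralZl//; last first.
  apply: measurable_funTS; apply: (measurableT_comp (@EFin_measurable R setT)).
  apply: (measurableT_comp (continuous_measurable_fun (@sqrt_continuous R))).
  by apply: measurable_funB => //; exact: measurable_funX.
rewrite [RHS]integral_mkcond; apply: eq_integral => x _.
rewrite patchE; case: ifPn => [_|]; first by rewrite EFinM.
rewrite notin_setE /= in_itv /= => /negP; rewrite -ler_norml -ltNge => rx.
rewrite ler0_sqrtr ?mulr0// subr_le0 -rq -[(x ^+ 2)%R]real_normK ?num_real//.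
by rewrite ler_sqr ?nnegrE ?(ltW r0)// ltW.
Qed.

End ball_volume.

Section ball_moments.
Context {R : realType}.
Notation lam := (@lebesgue_measure R).
Notation mR := (measurableTypeR R).
Notation E2 := (mR * mR)%type.
Notation E3 := (E2 * mR)%type.
Notation leb2 := (@leb2 R).
Notation leb3 := (@leb3 R).
Local Open Scope ereal_scope.

Lemma integral_leb3_slice (f : E3 -> \bar R) : measurable_fun setT f ->
  (forall x, 0 <= f x) ->
  \int[leb3]_x f x = \int[lam]_c \int[leb2]_p f (p, c).
Proof.
by move=> mf f0; rewrite [LHS](@fubini_tonelli2 _ _ E2 mR R leb2 lam f).
Qed.

(** The slice at height c has area pi (t^2 - c^2), and evenness of g makes the integral twice the
    one over c >= 0. The density [h] has to agree with g(c) (t^2 - c^2) only there, so g = |.| can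
    be treated with a polynomial primitive [H]. *)
Lemma integral_ball3_slice (t : R) (g h H : R -> R) : (0 <= t)%R ->
  (forall c, 0 <= g c)%R -> continuous g -> g =1 g \o -%R ->
  (forall c : R, is_derive (c : R) (1%R : R) H (h c)) -> continuous h ->
  (forall c, 0 <= c -> h c = g c * (t ^+ 2 - c ^+ 2))%R ->
  \int[leb3]_(w in ball3 t) (g w.2)%:E = (2 * pi * (H t - H 0))%:E.
Proof.
move=> t0 g0 cg ge dH ch hE.
have mg : measurable_fun setT (g : mR -> R) by exact: continuous_measurable_fun.
have mg3 : measurable_fun setT (fun w : E3 => (g w.2)%:E).
  apply: (measurableT_comp (@EFin_measurable R setT)).
  exact: (measurableT_comp mg (@measurable_coord3 R)).
rewrite integral_mkcond integral_leb3_slice; last 2 first.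
- apply/(measurable_restrictT _ (measurable_ball3 t)); exact: measurable_funTS.
- by move=> w; rewrite patchE; case: ifP => // _; rewrite lee_fin.
pose k (c : R) : R := (pi * (g c * Num.max 0 (t ^+ 2 - c ^+ 2)))%R.
have k0 c : (0 <= k c)%R.
  by rewrite !mulr_ge0 ?pi_ge0// le_max lexx.
have ck : continuous k.
  move=> c; apply: (cvgM (cvg_cst _)); apply: (cvgM (cg c)).
  have mE (y : R) : (Num.max 0 y = 2^-1 * (y + `|y|))%R.
    case: (lerP 0%R y) => y0; first by rewrite ger0_norm//; field.
    by rewrite ltr0_norm//; field.
  under [X in X @ _ --> _]eq_fun do rewrite mE.
  rewrite mE; have cq : {for c, continuous (fun c : R => t ^+ 2 - c ^+ 2)%R}.
    exact: (cvgB (cvg_cst _) (@exprn_continuous _ 2 c)).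
  exact: (cvgM (cvg_cst _) (cvgD cq (cvg_norm cq))).
transitivity (\int[lam]_c (k c)%:E).
  apply: eq_integral => c _.
  transitivity (\int[leb2]_p ((g c)%:E * (\1_(disc (t ^+ 2 - c ^+ 2)) p : R)%:E)).
    apply: eq_integral => p _; rewrite patchE -EFinM.
    have -> : ((p, c) \in ball3 t) = (p \in disc (t ^+ 2 - c ^+ 2)).
      apply/idP/idP; rewrite !inE.
      - by move=> /ball3P => /(_ t0)/=; rewrite /disc /= => ?; lra.
      - by move=> d; apply/ball3P => //=; move: d; rewrite /disc /= => ?; lra.
    by rewrite indicE; case: ifP => _; rewrite ?mulr1 ?mulr0.
  rewrite ge0_integralZl_EFin//; last first.
    apply: (measurableT_comp (@EFin_measurable R setT)).
    by apply: measurable_indic; exact: measurable_disc.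
  rewrite integral_indic ?setIT//; last exact: measurable_disc.
  apply: (etrans (congr1 (fun z => (g c)%:E * z) (disc_area _))).
  by rewrite -EFinM; congr (_%:E); rewrite /k; ring.
rewrite (ge0_symfun_integralT k0 ck); last first.
  by move=> c; rewrite /k /= sqrrN (ge c).
have -> : \int[lam]_(x in [set x | (0 <= x)%R]) (k x)%:E =
    \int[lam]_(x in `[0%R, t]) (pi%:E * (h x)%:E).
  rewrite integral_mkcond [RHS]integral_mkcond; apply: eq_integral => x _.
  rewrite !patchE; case: ifPn; rewrite ?inE ?notin_setE /= => x0; last first.
    by rewrite ifF// ; apply/negP; rewrite inE /= in_itv /= => /andP[].
  case: ifPn; rewrite ?inE ?notin_setE /= in_itv /= x0 /= => xt.
    rewrite -EFinM hE// /k max_r// subr_ge0 ler_sqr//.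
  move: xt => /negP; rewrite -ltNge => tx.
  by rewrite /k max_l ?mulr0// subr_le0 ler_sqr ?nnegrE// ltW.
rewrite ge0_integralZl//; last 3 first.
- apply: measurable_funTS; apply: (measurableT_comp (@EFin_measurable R setT)).
  exact: continuous_measurable_fun.
- move=> x /=; rewrite in_itv /= => /andP[x0 xt]; rewrite lee_fin hE//.
  by rewrite mulr_ge0// subr_ge0 ler_sqr.
- by rewrite lee_fin pi_ge0.
by rewrite (FTC_integral t0 dH ch) -!EFinM; congr (_%:E); ring.
Qed.

Lemma ball3_volume (t : R) : (0 <= t)%R -> leb3 (ball3 t) = (4 / 3 * pi * t ^+ 3)%:E.
Proof.
move=> t0; rewrite -[in LHS](setIT (ball3 t)) -integral_indic//; last exact: measurable_ball3.
pose H (c : R) := (t ^+ 2 * c - c ^+ 3 / 3)%R.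
pose h (c : R) := (t ^+ 2 - c ^+ 2)%R.
have dH (c : R) : is_derive c (1%R : R) H (h c).
  rewrite /H /h; apply: is_derive_eq.
  by rewrite /GRing.scale /= ?mulr0 ?addr0 ?mulr1; field.
have ch : continuous h.
  by move=> c; exact: (cvgB (cvg_cst _) (@exprn_continuous _ 2 c)).
transitivity (\int[leb3]_(w in ball3 t) (cst 1%R w.2)%:E).
  rewrite [RHS]integral_mkcond; apply: eq_integral => w _; rewrite patchE indicE.
  by case: ifP.
rewrite (@integral_ball3_slice t (cst 1%R) h H t0 _ _ _ dH ch)//.
- by congr (_%:E); rewrite /H; field.
- by move=> c; exact: cvg_cst.
- by move=> c _; rewrite /= mul1r.
Qed.

Lemma ball3_moment (t : R) : (0 <= t)%R ->
  \int[leb3]_(w in ball3 t) `|w.2|%:E = (pi * t ^+ 4 / 2)%:E.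
Proof.
move=> t0.
pose H (c : R) := (t ^+ 2 * c ^+ 2 / 2 - c ^+ 4 / 4)%R.
pose h (c : R) := (t ^+ 2 * c - c ^+ 3)%R.
have dH (c : R) : is_derive c (1%R : R) H (h c).
  rewrite /H /h; apply: is_derive_eq.
  by rewrite /GRing.scale /= ?mulr0 ?addr0 ?mulr1; field.
have ch : continuous h.
  move=> c.
  exact: (cvgB (cvgM (cvg_cst _) (@cvg_id _ _)) (@exprn_continuous _ 3 c)).
rewrite (@integral_ball3_slice t (fun x => `|x|%R) h H t0 _ _ _ dH ch)//.
- by congr (_%:E); rewrite /H; field.
- by move=> c; exact: norm_continuous.
- by move=> c /=; rewrite normrN.
- by move=> c c0; rewrite ger0_norm// /h; ring.
Qed.

End ball_moments.

(** * Truncated powers as integrals over thresholds *)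

Section layer_cake.
Context {R : realType}.
Notation lam := (@lebesgue_measure R).
Notation mR := (measurableTypeR R).
Local Open Scope ereal_scope.

Lemma integral_power (n : nat) (r T : R) : (0 < r)%R -> (r <= T)%R ->
  \int[lam]_(t in `[r, T]) (n.+1%:R * t ^- n.+2)%:E =
  (r ^- n.+1 - T ^- n.+1)%:E.
Proof.
move=> r0; rewrite le_eqVlt => /predU1P[<-|rT].
  by rewrite set_itv1 integral_set1 subrr.
pose F (t : R) : R := (- t ^- n.+1)%R.
have dF (t : R) : (0 < t)%R -> is_derive t (1%R : R) F (n.+1%:R * t ^- n.+2)%R.
  move=> t0; have tn0 : (t ^+ n.+1 != 0)%R by rewrite expf_neq0// gt_eqF.
  have [d1 d2] : is_derive t (1%R : R) (fun x : R => x ^+ n.+1)%R (n.+1%:R * t ^+ n)%R.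
    apply: DeriveDef; first exact: exprn_derivable.
    by rewrite exp_derive /GRing.scale /= mulr1.
  pose p := (fun x : R => x ^+ n.+1)%R.
  have dV := @derivableV R _ p t 1%R tn0 d1.
  have eV := @deriveV R _ p t 1%R tn0 d1.
  have dN : derivable F t (1%R : R) by exact: (derivableN dV).
  apply: DeriveDef => //.
  have -> : 'D_1%R F t = (- ((- (t ^+ n.+1) ^- 2) * (n.+1%:R * t ^+ n)))%R.
    by rewrite (deriveN dV) eV d2.
  transitivity ((t ^+ n.+1) ^- 2 * (n.+1%:R * t ^+ n))%R.
    have aux (a b : R) : (- (- a * b) = a * b)%R by rewrite mulNr opprK.
    exact: aux.
  rewrite mulrCA; congr (_ * _)%R.
  have tn (k : nat) : (t ^+ k != 0)%R by rewrite expf_neq0// gt_eqF.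
  apply: (mulfI (tn n.+2)); rewrite mulfV// mulrCA mulrC -exprD -exprM.
  by rewrite (_ : (n.+2 + n = n.+1 * 2)%N) ?mulfV//; lia.
have cF (t : R) : (0 < t)%R -> {for t, continuous F}.
  move=> t0; apply: differentiable_continuous; apply/derivable1_diffP.
  by have [] := dF t t0.
rewrite (@continuous_FTC2 R _ F r T)//.
- by rewrite -EFinB; congr (_%:E); rewrite /F opprK addrC.
- apply: continuous_in_subspaceT => t; rewrite inE /= in_itv /= => /andP[rt _].
  have t0 : (0 < t)%R by exact: lt_le_trans rt.
  apply: (cvgM (cvg_cst _)).
  have := @inv_continuous R (t ^+ n.+2)%R; rewrite expf_neq0 ?gt_eqF// => /(_ isT).
  exact: (cvg_comp (fun x : R => x ^+ n.+2)%R _ (@exprn_continuous _ n.+2 t)).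
- split=> [t||].
  + by rewrite in_itv /= => /andP[rt _]; have [] := dF t (lt_trans r0 rt).
  + exact/cvg_at_right_filter/cF.
  + exact/cvg_at_left_filter/cF/(lt_trans r0).
- move=> t; rewrite in_itv /= => /andP[rt _]; rewrite derive1E.
  by have [] := dF t (lt_trans r0 rt).
Qed.

Lemma measurable_npow (n : nat) : measurable_fun setT (fun t : R => n.+1%:R * t ^- n.+2)%R.
Proof.
apply: measurable_funM => //.
apply: (measurableT_comp (@measurable_inv R)).
exact: (@measurable_funX _ _ R setT id).
Qed.

(** The density whose integral over t > r is r^-(n+1) - T^-(n+1) when 0 < r < T. The case n = 2
    produces the kernel of the vector field, the case n = 0 the truncated Coulomb kernel. *)
Definition npow (n : nat) (T t : R) : \bar R :=
  ((n.+1%:R * t ^- n.+2) * \1_(`]0%R, T]%classic) t)%:E.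

Lemma npow_ge0 n T t : 0 <= npow n T t.
Proof.
rewrite /npow lee_fin indicE.
have [|_] := boolP (t \in `]0%R, T]%classic); last by rewrite mulr0.
rewrite inE /= in_itv /= => /andP[t0 _].
by rewrite mulr1 mulr_ge0// invr_ge0 exprn_ge0// ltW.
Qed.

Lemma measurable_npowT n T : measurable_fun setT (npow n T : mR -> \bar R).
Proof.
apply: (measurableT_comp (@EFin_measurable R setT)); apply: measurable_funM.
  exact: measurable_npow.
exact: measurable_indic.
Qed.

Lemma integral_npow (n : nat) (r T : R) : (0 < r)%R ->
  \int[lam]_t (npow n T t * (\1_(`]r, +oo[%classic) t : R)%:E) =
  (if (r < T)%R then r ^- n.+1 - T ^- n.+1 else 0)%:E.
Proof.
move=> r0.
have iE t : (\1_(`]0%R, T]%classic) t * \1_(`]r, +oo[%classic) t =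
    \1_(`]r, T]%classic) t :> R)%R.
  rewrite !indicE -natrM mulnb; congr (nat_of_bool _)%:R.
  apply/andP/idP; rewrite !inE /= !in_itv /= ?andbT.
  - by move=> [/andP[_ ->] ->].
  - by move=> /andP[rt ->]; rewrite rt (lt_trans r0 rt).
transitivity (\int[lam]_t ((n.+1%:R * t ^- n.+2) * \1_(`]r, T]%classic) t)%:E).
  apply: eq_integral => t _; rewrite /npow -EFinM; congr (_%:E).
  by rewrite -[LHS]mulrA; congr (_ * _)%R; exact: iE.
case: ifPn => rT; last first.
  apply: integral0_eq => t _; rewrite indicE memNset ?mulr0//= in_itv /=.
  move=> /andP[rt tT]; move: rT; rewrite -leNgt => Tr.
  by have := lt_le_trans rt (le_trans tT Tr); rewrite ltxx.
rewrite -(integral_power n r0 (ltW rT)) -integral_itv_obnd_cbnd; last first.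
  apply: measurable_funTS; apply/measurable_EFinP; exact: measurable_npow.
rewrite [RHS]integral_mkcond; apply: eq_integral => t _.
by rewrite patchE indicE; case: (t \in _); rewrite ?mulr1 ?mulr0.
Qed.

(* Tonelli for [\int_x h(x) f(rho x)] with [f r = \int_{t > r} g t dt]. *)
Lemma layer_cake d (T : measurableType d) (m : {sigma_finite_measure set T -> \bar R})
    (rho : T -> R) (h : T -> \bar R) (g : mR -> \bar R) :
  measurable_fun setT rho -> measurable_fun setT h -> measurable_fun setT g ->
  (forall x, 0 <= h x) -> (forall t, 0 <= g t) ->
  \int[m]_x (h x * \int[lam]_t (g t * (\1_(`]rho x, +oo[%classic) t : R)%:E)) =
  \int[lam]_t (g t * \int[m]_(x in [set x | (rho x < t)%R]) h x).
Proof.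
move=> mrho mh mg h0 g0.
pose f (p : T * mR) := h p.1 * (g p.2 * (\1_(`]rho p.1, +oo[%classic) p.2 : R)%:E).
have mlt : measurable [set p : T * mR | (rho p.1 < p.2)%R].
  have -> : [set p : T * mR | (rho p.1 < p.2)%R] =
      setT `&` (fun p : T * mR => p.2 - rho p.1)%R @^-1` `]0%R, +oo[%classic.
    by rewrite setTI; apply/seteqP; split=> p /=; rewrite in_itv /= subr_gt0 andbT.
  have : measurable_fun setT (fun p : T * mR => p.2 - rho p.1)%R.
    by apply: measurable_funB => //; exact: measurableT_comp.
  exact.
have mi : measurable_fun setT
    (fun p : T * mR => (\1_(`]rho p.1, +oo[%classic) p.2 : R)%:E).
  apply: (measurableT_comp (@EFin_measurable R setT)).
  rewrite (_ : (fun p => _) = \1_[set p : T * mR | (rho p.1 < p.2)%R]).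
    exact: measurable_indic.
  apply/funext => p; rewrite !indicE; congr (nat_of_bool _)%:R.
  by apply/idP/idP; rewrite !inE /= in_itv /= andbT.
have mf : measurable_fun setT f.
  apply: emeasurable_funM; first exact: measurableT_comp.
  by apply: emeasurable_funM => //; exact: measurableT_comp.
have f0 p : 0 <= f p.
  by rewrite !mule_ge0// lee_fin indicE; case: (_ \in _).
transitivity (\int[m]_x \int[lam]_t f (x, t)).
  apply: eq_integral => x _; rewrite /f /= ge0_integralZl//.
  - apply: emeasurable_funM => //; apply: (measurableT_comp (@EFin_measurable R setT)).
    exact: measurable_indic.
  - by move=> t _; rewrite mule_ge0// lee_fin indicE; case: (_ \in _).
rewrite (@fubini_tonelli _ _ T mR R m lam f)//.
apply: eq_integral => t _; rewrite /f /=.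
have mrt : measurable [set x | (rho x < t)%R].
  have -> : [set x | (rho x < t)%R] = setT `&` rho @^-1` `]-oo, t[%classic.
    by rewrite setTI; apply/seteqP; split=> p /=; rewrite in_itv.
  exact: mrho.
rewrite [in RHS]integral_mkcond -ge0_integralZl//; last 2 first.
- by apply/(measurable_restrictT _ mrt); exact: measurable_funTS.
- by move=> x _; rewrite patchE; case: ifP.
apply: eq_integral => x _; rewrite patchE indicE.
rewrite (_ : (t \in _) = (x \in [set x | (rho x < t)%R])).
  by case: ifP => _; rewrite ?mule1 ?mule0// muleC.
by apply/idP/idP; rewrite !inE /= in_itv /= andbT.
Qed.

End layer_cake.

(** * C^1 cutoffs built from piecewise quadratic functions *)

Section profile.
Context {R : realType}.

(** A quadratic remainder estimate can be checked by cases for a function that is quadratic on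
    either side of a point, such as the square of [pos]. *)
Lemma is_derive_quad (f : R -> R) (x d C : R) : 0 <= C ->
  (forall k, `|f (x + k) - f x - k * d| <= C * k ^+ 2) ->
  is_derive x (1 : R) f d.
Proof.
move=> C0 H.
have cv : (fun h : R => h^-1 *: ((f \o shift x) (h *: (1 : R)) - f x)) @ 0^' --> d.
  apply/cvgrPdist_le => e e0; near=> h.
  have h0 : h != 0 by near: h; exact: nbhs_dnbhs_neq.
  have he : `|h| <= e / (C + 1).
    near: h; apply: dnbhs0_le; rewrite divr_gt0//; lra.
  rewrite /= /GRing.scale /= mulr1 [h + x]addrC.
  have -> : d - h^-1 * (f (x + h) - f x) = - (h^-1 * (f (x + h) - f x - h * d)).
    by field.
  rewrite normrN normrM normfV ler_pdivrMl ?normr_gt0//.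
  apply: (le_trans (H h)); rewrite -[h ^+ 2]real_normK ?num_real// expr2 mulrCA.
  rewrite ler_wpM2l// (le_trans (ler_wpM2l C0 he))//.
  by rewrite mulrA ler_pdivrMr; [nra|lra].
by apply: DeriveDef; [apply/cvg_ex; exists d|exact: cvg_lim].
Unshelve. all: by end_near. Qed.

Definition pos (v : R) := Num.max 0 v.
Definition ramp (v : R) := pos (v + 1) - pos v.
(** The primitive of [ramp] that vanishes up to -1; it is v + 1/2 from 0 on. Differences of
    translates of it are C^1 transitions between two constants. *)
Definition sramp (v : R) := (pos (v + 1) ^+ 2 - pos v ^+ 2) / 2.

Lemma posP v : (0 <= v /\ pos v = v) \/ (v <= 0 /\ pos v = 0).
Proof.
rewrite /pos; case: (leP 0 v) => v0; [left|right]; split=> //.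
exact: ltW.
Qed.

Lemma continuous_pos : continuous pos.
Proof.
have -> : pos = (fun y : R => 2^-1 * (y + `|y|)).
  apply/funext => y; case: (posP y) => -[y0 ->].
    by rewrite ger0_norm//; field.
  by rewrite ler0_norm//; field.
move=> x; apply: (cvgM (cvg_cst _)).
exact: (cvgD (@cvg_id _ _) (@norm_continuous _ _ x)).
Qed.

Lemma ramp_ge0 v : 0 <= ramp v.
Proof. by rewrite /ramp; case: (posP v) => -[? ->]; case: (posP (v + 1)) => -[? ->]; lra. Qed.

Lemma ramp_le1 v : ramp v <= 1.
Proof. by rewrite /ramp; case: (posP v) => -[? ->]; case: (posP (v + 1)) => -[? ->]; lra. Qed.

Lemma rampE1 v : 0 <= v -> ramp v = 1.
Proof. by rewrite /ramp; case: (posP v) => -[? ->]; case: (posP (v + 1)) => -[? ->]; lra. Qed.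

Lemma rampE0 v : v <= -1 -> ramp v = 0.
Proof. by rewrite /ramp; case: (posP v) => -[? ->]; case: (posP (v + 1)) => -[? ->]; lra. Qed.

Lemma rampE v : -1 <= v -> v <= 0 -> ramp v = v + 1.
Proof. by rewrite /ramp; case: (posP v) => -[? ->]; case: (posP (v + 1)) => -[? ->]; lra. Qed.

Lemma srampE1 v : 0 <= v -> sramp v = v + 2^-1.
Proof. by rewrite /sramp; case: (posP v) => -[? ->]; case: (posP (v + 1)) => -[? ->]; nra. Qed.

Lemma srampE0 v : v <= -1 -> sramp v = 0.
Proof. by rewrite /sramp; case: (posP v) => -[? ->]; case: (posP (v + 1)) => -[? ->]; nra. Qed.

Lemma srampE v : -1 <= v -> v <= 0 -> sramp v = (v + 1) ^+ 2 / 2.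
Proof. by rewrite /sramp; case: (posP v) => -[? ->]; case: (posP (v + 1)) => -[? ->]; nra. Qed.

Lemma is_derive_pos_sqr (v : R) : is_derive v (1 : R) (fun u => pos u ^+ 2) (2 * pos v).
Proof.
apply: (@is_derive_quad _ _ _ 1); first by [].
move=> k; rewrite mul1r ler_norml; apply/andP.
by split; case: (posP v) => -[? ->]; case: (posP (v + k)) => -[? ->]; nra.
Qed.

Lemma is_derive_aff (b b' : R -> R) (c d u : R) : (forall v : R, is_derive v (1 : R) b (b' v)) ->
  is_derive u (1 : R) (fun u => b (c * u + d)) (c * b' (c * u + d)).
Proof.
move=> db; have da : is_derive u (1 : R) (fun u => c * u + d) c.
  by apply: is_derive_eq; rewrite /GRing.scale /= ?mulr0 ?addr0 ?mulr1 ?add0r.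
have -> : c * b' (c * u + d) = b' (c * u + d) * c by rewrite mulrC.
exact: (is_derive1_comp (db _) da).
Qed.

Lemma is_derive_sramp (v : R) : is_derive v (1 : R) sramp (ramp v).
Proof.
have d1 := @is_derive_aff _ _ 1 1 v is_derive_pos_sqr.
have d2 := is_derive_pos_sqr v.
rewrite (_ : sramp = fun u => 2^-1 * (pos (1 * u + 1) ^+ 2 - pos u ^+ 2)); last first.
  by apply/funext => u; rewrite /sramp mul1r mulrC.
apply: is_derive_eq; rewrite /GRing.scale /= ?mulr0 ?addr0 ?add0r /ramp !mul1r.
by field.
Qed.

Lemma continuous_ramp : continuous ramp.
Proof.
move=> v; apply: cvgB; last exact: continuous_pos.
apply: (cvg_comp (fun v => v + 1) pos); last exact: continuous_pos.
exact: (cvgD (@cvg_id _ _) (cvg_cst _)).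
Qed.

End profile.

Section kernel_profile.
Context {R : realType}.
Variables (e h T : R).
Hypotheses (e0 : 0 < e) (h0 : 0 < h) (T0 : 0 < T) (he : h <= e ^+ 2)
  (eT : e ^+ 2 + h <= T ^+ 2).

(* A C^1 regularization, at scale h, of the clamping of q to [e^2, T^2]. *)
Definition clamp (q : R) :=
  e ^+ 2 + h * (sramp ((q - e ^+ 2) / h) - sramp ((q - T ^+ 2) / h)).

Definition dclamp (q : R) := ramp ((q - e ^+ 2) / h) - ramp ((q - T ^+ 2) / h).

Let div_ge0 a : 0 <= a -> 0 <= a / h.
Proof. by move=> a0; rewrite divr_ge0// ltW. Qed.

Let div_le0 a : a <= 0 -> a / h <= 0.
Proof. by move=> a0; rewrite pmulr_lle0 ?invr_gt0. Qed.

Let div_leN1 a : a <= - h -> a / h <= -1.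
Proof. by move=> a0; rewrite ler_pdivrMr// mulN1r. Qed.

Let div_geN1 a : - h <= a -> -1 <= a / h.
Proof. by move=> a0; rewrite ler_pdivlMr// mulN1r. Qed.

Let hn0 : h != 0. Proof. by rewrite gt_eqF. Qed.

(** There are five regimes, separated by e^2 - h, e^2, T^2 - h and T^2. The inequality
    [q * dclamp q <= clamp q] is what keeps the divergence of the regularized kernel above -3 T^-3
    in the transition zones. *)
Lemma clamp_facts q : 0 <= q ->
  [/\ e ^+ 2 <= clamp q, clamp q <= T ^+ 2, 0 <= dclamp q &
    q * dclamp q <= clamp q] /\
  [/\ (q < e ^+ 2 - h -> clamp q = e ^+ 2 /\ dclamp q = 0),
    (q < T ^+ 2 -> q <= clamp q) & (T ^+ 2 <= q -> clamp q = T ^+ 2 /\ dclamp q = 0)].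
Proof.
move=> q0; rewrite /clamp /dclamp.
have h2 := h0; have e2 : 0 <= e ^+ 2 by exact: sqr_ge0.
move: he eT => he' eT'.
set E := e ^+ 2 in e2 eT' he' *; set S := T ^+ 2 in eT' *.
have cast (a : R) : h * ((a / h + 1) ^+ 2 / 2) = (a + h) ^+ 2 / (2 * h).
  by field.
have cast2 (a : R) : h * (a / h + 2^-1) = a + h / 2 by field.
have cast3 (a : R) : a / h + 1 = (a + h) / h by field.
have [q1|q1] := lerP q (E - h).
  rewrite (rampE0 (div_leN1 (_ : q - E <= - h))); last by lra.
  rewrite (rampE0 (div_leN1 (_ : q - S <= - h))); last by lra.
  rewrite (srampE0 (div_leN1 (_ : q - E <= - h))); last by lra.
  rewrite (srampE0 (div_leN1 (_ : q - S <= - h))); last by lra.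
  by rewrite !subrr !mulr0 !addr0; do 2 split; try lra; move=> *; split; lra.
have [q2|q2] := lerP q E.
  rewrite (rampE (div_geN1 (_ : - h <= q - E)) (div_le0 (_ : q - E <= 0))); [|lra|lra].
  rewrite (srampE (div_geN1 (_ : - h <= q - E)) (div_le0 (_ : q - E <= 0))); [|lra|lra].
  rewrite (rampE0 (div_leN1 (_ : q - S <= - h))); last by lra.
  rewrite (srampE0 (div_leN1 (_ : q - S <= - h))); last by lra.
  rewrite !subr0 cast cast3.
  set r := (q - E + h) / h; set s := _ / (2 * h).
  have r0 : 0 <= r by apply: div_ge0; lra.
  have r1 : r <= 1 by rewrite /r ler_pdivrMr//; lra.
  have s0 : 0 <= s by rewrite /s divr_ge0 ?sqr_ge0//; lra.
  have sh : s <= h / 2.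
    by rewrite /s ler_pdivrMr ?mulr_gt0//; nra.
  by do 2 split; try lra; try nra; move=> *; split; lra.
have [q3|q3] := lerP q (S - h).
  rewrite (rampE1 (div_ge0 (_ : 0 <= q - E))); last by lra.
  rewrite (srampE1 (div_ge0 (_ : 0 <= q - E))); last by lra.
  rewrite (rampE0 (div_leN1 (_ : q - S <= - h))); last by lra.
  rewrite (srampE0 (div_leN1 (_ : q - S <= - h))); last by lra.
  rewrite !subr0 cast2.
  by do 2 split; try lra; move=> *; split; lra.
have [q4|q4] := ltrP q S.
  rewrite (rampE1 (div_ge0 (_ : 0 <= q - E))); last by lra.
  rewrite (srampE1 (div_ge0 (_ : 0 <= q - E))); last by lra.
  rewrite (rampE (div_geN1 (_ : - h <= q - S)) (div_le0 (_ : q - S <= 0))); [|lra|lra].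
  rewrite (srampE (div_geN1 (_ : - h <= q - S)) (div_le0 (_ : q - S <= 0))); [|lra|lra].
  rewrite mulrBr cast cast2 cast3.
  set r := (q - S + h) / h; set s := _ / (2 * h).
  have r0 : 0 <= r by apply: div_ge0; lra.
  have r1 : r <= 1 by rewrite /r ler_pdivrMr//; lra.
  have rE : r * h = q - S + h by rewrite /r divfK.
  have sE : s * 2 = r * r * h by rewrite /s /r; field.
  have sh : s * 2 <= q - S + h.
    by rewrite sE -rE -mulrA ler_piMl// mulr_ge0 ?(ltW h0).
  have rrh : 0 <= h - 2 * (r * h) + r * r * h.
    have -> : h - 2 * (r * h) + r * r * h = (1 - r) * (1 - r) * h by ring.
    by rewrite mulr_ge0 ?(ltW h0)// -expr2 sqr_ge0.
  have qr : 0 <= q * r by exact: mulr_ge0.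
  by rewrite mulrBr mulr1; do 2 split; try lra; move=> *; split; lra.
rewrite (rampE1 (div_ge0 (_ : 0 <= q - E))); last by lra.
rewrite (srampE1 (div_ge0 (_ : 0 <= q - E))); last by lra.
rewrite (rampE1 (div_ge0 (_ : 0 <= q - S))); last by lra.
rewrite (srampE1 (div_ge0 (_ : 0 <= q - S))); last by lra.
rewrite mulrBr !cast2 subrr mulr0.
by do 2 split; try lra; move=> *; split; lra.
Qed.

Lemma clamp_gt0 q : 0 < clamp q.
Proof.
have [q0|q0] := leP 0 q.
  by have [[c1 _ _ _] _] := clamp_facts q0; apply: lt_le_trans c1; rewrite exprn_gt0.
have e2 : 0 < e ^+ 2 by rewrite exprn_gt0.
rewrite /clamp.
have qT : q - T ^+ 2 <= - h by move: eT => ?; lra.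
rewrite (srampE0 (div_leN1 qT)).
rewrite subr0 ltr_wpDr// mulr_ge0 ?(ltW h0)//.
rewrite /sramp; case: (posP ((q - e ^+ 2) / h)) => -[? ->];
  case: (posP ((q - e ^+ 2) / h + 1)) => -[? ->]; nra.
Qed.

Lemma is_derive_clamp (q : R) : is_derive q (1 : R) clamp (dclamp q).
Proof.
have d1 := @is_derive_aff _ _ _ h^-1 (- (e ^+ 2 / h)) q is_derive_sramp.
have d2 := @is_derive_aff _ _ _ h^-1 (- (T ^+ 2 / h)) q is_derive_sramp.
rewrite (_ : clamp = fun q => e ^+ 2 + h * (sramp (h^-1 * q + (- (e ^+ 2 / h))) -
    sramp (h^-1 * q + (- (T ^+ 2 / h))))); last first.
  by apply/funext => u; rewrite /clamp !mulrBl ![u / h]mulrC.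
apply: is_derive_eq; rewrite /GRing.scale /= ?mulr0 ?addr0 ?add0r.
rewrite /dclamp !mulrBl ![q / h]mulrC.
by field.
Qed.

Lemma continuous_dclamp : continuous dclamp.
Proof.
have c (a : R) : continuous (fun q => ramp ((q - a) / h)).
  move=> q; apply: (cvg_comp (fun q => (q - a) / h) ramp); last exact: continuous_ramp.
  exact: (cvgM (cvgB (@cvg_id _ _) (cvg_cst _)) (cvg_cst _)).
by move=> q; exact: (cvgB (c _ q) (c _ q)).
Qed.

(** At q = |w|^2 this is the radial factor |w|^-3 - T^-3 with |w|^2 replaced by its clamped value:
    constant near the origin and zero for |w| >= T. *)
Definition profile (q : R) := (Num.sqrt (clamp q)) ^- 3 - T ^- 3.
Definition dprofile (q : R) := - (3 / 2) * dclamp q * (Num.sqrt (clamp q)) ^- 5.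

Lemma is_derive_profile (q : R) : is_derive q (1 : R) profile (dprofile q).
Proof.
have c0 := clamp_gt0 q; set r := Num.sqrt (clamp q).
have r0 : 0 < r by rewrite sqrtr_gt0.
have rn0 : r != 0 by rewrite gt_eqF.
have d1 : is_derive q (1 : R) (fun q => Num.sqrt (clamp q)) ((2 * r)^-1 * dclamp q).
  exact: (is_derive1_comp (is_derive1_sqrt c0) (is_derive_clamp q)).
have d2 : is_derive r (1 : R) (fun r => r ^- 3) (- 3 * r ^- 4).
  have d3 : is_derive r (1 : R) (fun x : R => x ^+ 3) (3 * r ^+ 2).
    apply: DeriveDef; first exact: exprn_derivable.
    by rewrite exp_derive /GRing.scale /= mulr1.
  pose p := (fun x : R => x ^+ 3).
  have r3 : r ^+ 3 != 0 by rewrite expf_neq0.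
  have [d4 d4E] := d3.
  have dV := @derivableV R _ p r 1 r3 d4.
  have eV := @deriveV R _ p r 1 r3 d4.
  apply: DeriveDef; first exact: dV.
  rewrite [LHS]eV d4E /GRing.scale /= /p.
  by field.
have d5 : is_derive q (1 : R) (fun q => Num.sqrt (clamp q) ^- 3)
    (- 3 * r ^- 4 * ((2 * r)^-1 * dclamp q)) by exact: (@is_derive1_comp R (fun r => r ^- 3)
      (fun q => Num.sqrt (clamp q)) q _ _ d2 d1).
rewrite /profile; apply: is_derive_eq; rewrite subr0 /dprofile -/r.
by field.
Qed.

Lemma continuous_dprofile : continuous dprofile.
Proof.
move=> q; have c0 := clamp_gt0 q.
have r0 : Num.sqrt (clamp q) ^+ 5 != 0 by rewrite expf_neq0// gt_eqF// sqrtr_gt0.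
apply: cvgM; first exact: (cvgM (cvg_cst _) (continuous_dclamp (x := q))).
apply: (cvg_comp (fun q => Num.sqrt (clamp q) ^+ 5) GRing.inv); last exact: inv_continuous.
apply: (cvg_comp (fun q => Num.sqrt (clamp q)) (fun r => r ^+ 5)); last exact: exprn_continuous.
apply: (cvg_comp clamp Num.sqrt); last exact: sqrt_continuous.
exact: (is_derive_continuous is_derive_clamp).
Qed.

(** The last bound concerns the divergence of w [profile](|w|^2) at |w| = r. With c = s^2 the
    clamped value and d its derivative, this divergence is 3 s^-5 (c - r^2 d) - 3 T^-3. It is 3 e^-3
    - 3 T^-3 near the origin, where the mass of the delta sits, at least -3 T^-3 everywhere, and 0
    beyond T. *)
Lemma profile_facts (r : R) : 0 <= r ->
  [/\ 0 <= profile (r ^+ 2), (T <= r -> profile (r ^+ 2) = 0 /\ dprofile (r ^+ 2) = 0),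
    (0 < r -> r < T -> profile (r ^+ 2) <= r ^- 3 - T ^- 3) &
    3 * (\1_[set r | r ^+ 2 < e ^+ 2 - h] r) * e ^- 3 - 3 * (\1_[set r | r < T] r) * T ^- 3
     <= 3 * profile (r ^+ 2) + 2 * r ^+ 2 * dprofile (r ^+ 2)].
Proof.
move=> r0; have q0 : 0 <= r ^+ 2 by exact: sqr_ge0.
have [[c1 c2 c3 c4] [c5 c6 c7]] := clamp_facts q0.
set c := clamp (r ^+ 2) in c1 c2 c4 c5 c6 c7 *.
set d := dclamp (r ^+ 2) in c3 c4 c5 c7 *.
have c0 : 0 < c by exact: clamp_gt0.
pose s := Num.sqrt c; have s0 : 0 < s by rewrite sqrtr_gt0.
have sc : s ^+ 2 = c by rewrite sqr_sqrtr// ltW.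
have sT : s <= T by rewrite -ler_sqr ?nnegrE ?(ltW s0) ?(ltW T0)// sc.
have es : e <= s by rewrite -ler_sqr ?nnegrE ?(ltW s0) ?(ltW e0)// sc.
have inv_le (a b : R) : 0 < a -> a <= b -> b ^- 3 <= a ^- 3.
  move=> a0 ab; have b0 : 0 < b by exact: lt_le_trans ab.
  by rewrite lef_pV2 ?posrE ?exprn_gt0// lerXn2r ?nnegrE ?(ltW a0) ?(ltW b0).
rewrite /profile /dprofile -/c -/d -/s.
split.
- by rewrite subr_ge0 inv_le.
- move=> Tr; have [cT d0] : c = T ^+ 2 /\ d = 0.
    by apply: c7; rewrite lerXn2r ?nnegrE ?(ltW T0)//.
  have -> : s = T by rewrite /s cT sqrtr_sqr gtr0_norm.
  by rewrite subrr d0 mulr0 mul0r.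
- move=> rp rT; rewrite lerD2r inv_le//.
  rewrite -ler_sqr ?nnegrE ?(ltW rp) ?(ltW s0)// sc; apply: c6.
  by rewrite ltr_sqr ?nnegrE ?(ltW rp) ?(ltW T0).
have D : 3 * (s ^- 3 - T ^- 3) + 2 * r ^+ 2 * (- (3 / 2) * d * s ^- 5) =
    3 * s ^- 5 * (c - r ^+ 2 * d) - 3 * T ^- 3.
  by rewrite -sc; field; rewrite !gt_eqF.
have Dge : - 3 * T ^- 3 <= 3 * (s ^- 3 - T ^- 3) + 2 * r ^+ 2 * (- (3 / 2) * d * s ^- 5).
  rewrite D mulNr lerDr mulr_ge0 ?subr_ge0//.
  by rewrite mulr_ge0// invr_ge0 exprn_ge0// ltW.
have ind (P : pred R) : \1_[set r | P r] r = (P r)%:R :> R.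
  by rewrite indicE; congr (nat_of_bool _)%:R; apply/idP/idP; rewrite inE.
rewrite (ind (fun r => r ^+ 2 < e ^+ 2 - h)) (ind (fun r => r < T)).
have [rT|Tr] := ltP r T; last first.
  have Tr2 : T ^+ 2 <= r ^+ 2 by rewrite lerXn2r ?nnegrE ?(ltW T0).
  have [cT d0] := c7 Tr2.
  have -> : s = T by rewrite /s cT sqrtr_sqr gtr0_norm.
  rewrite subrr d0 !(mulr0, mul0r, addr0).
  have nlt : (r ^+ 2 < e ^+ 2 - h) = false.
    by apply/negbTE; rewrite -leNgt; move: eT h0 => ? ?; lra.
  rewrite nlt /=; lra.
have [re|er] := ltP (r ^+ 2) (e ^+ 2 - h); last by rewrite mulr0 mul0r mulr1; lra.
have [ce d0] := c5 re.
have -> : s = e by rewrite /s ce sqrtr_sqr gtr0_norm.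
by rewrite d0 !(mulr0, mul0r, addr0) !mulr1; lra.
Qed.

End kernel_profile.

(** * Convolutions as test fields *)

Section uniform_continuity.
Context {R : realType}.
Notation R3 := (R * R * R)%type.

Lemma nbhs_enorm (x : R3) (P : set R3) : nbhs x P <->
  exists2 d, 0 < d & forall v, enorm v < d -> P (x + v).
Proof.
split.
  move=> /nbhs_ballP[d /= d0 dP]; exists d => // v vd; apply: dP.
  split; [split|]; rewrite /ball /= opprD addrA subrr sub0r normrN;
    apply: le_lt_trans vd; [exact: norm_coord1_le|exact: norm_coord2_le|exact: norm_coord3_le].
move=> [d d0 dP]; apply/nbhs_ballP; exists (d / 3) => /=; first by rewrite divr_gt0.
move=> y [[/= b1 b2] b3]; rewrite -(subrK x y) addrC; apply: dP.
apply: (le_lt_trans (enorm_le_coord _)).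
move: b1 b2 b3; rewrite /ball /= => b1 b2 b3.
rewrite [X in X + _ + _]distrC [X in _ + X + _]distrC [X in _ + _ + X]distrC.
lra.
Qed.

(** Compactness of [box (M + 1)] gives a uniform radius there. From a point outside it, a shift by
    less than 1 does not reach [box M], so both values of g are 0. *)
Lemma unif_cont3 (g : R3 -> R) M : continuous g -> (forall x, ~ box M x -> g x = 0) ->
  forall eps, 0 < eps -> exists2 d, 0 < d &
    forall x v, enorm v < d -> `|g (x + v) - g x| <= eps.
Proof.
move=> cg g0 eps eps0.
have : compact (box (M + 1) : set R3) by exact: compact_box.
move/compact_near_coveringP => nc.
have HX : forall x, box (M + 1) x -> \forall x' \near x & v \near nbhs (0 : R3),
    `|g (x' + v) - g x'| <= eps.
  move=> x _.
  have : g y @[y --> x] --> g x by exact: cg.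
  move=> /cvgrPdist_lt /(_ _ (divr_gt0 eps0 (ltr0Sn R 1))).
  move=> /nbhs_enorm[d d0 dP].
  exists ([set y | exists2 v, enorm v < d / 2 & y = x + v], [set v | enorm v < d / 2]).
    split => /=; first by apply/nbhs_enorm; exists (d / 2);
      [rewrite divr_gt0|move=> v vd; exists v].
    apply/nbhs_enorm; exists (d / 2); first by rewrite divr_gt0.
    by move=> v vd /=; rewrite add0r.
  move=> [y v] /= [[u ud ->] vd].
  have d1 : enorm u < d by lra.
  have d2 : enorm (u + v) < d by apply: le_lt_trans (enormD _ _) _; lra.
  have := dP _ d1; have := dP _ d2 => /= A B.
  rewrite -addrA -(subrKA (g x)) (le_trans (ler_normD _ _))//.
  by rewrite [X in X + _]distrC; lra.
have [d d0 dP] := (nbhs_enorm (0 : R3) _).1 (nc R3 (nbhs (0 : R3))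
  (fun v x => `|g (x + v) - g x| <= eps) _ HX).
exists (Num.min d 1); first by rewrite lt_min d0 ltr01.
move=> x v; rewrite lt_min => /andP[vd v1].
have [bx|nb] := pselect (box (M + 1) x).
  by have := dP _ vd; rewrite add0r; apply.
rewrite (g0 (x + v)) ?(g0 x) ?subrr ?normr0 ?(ltW eps0)//.
  move=> b; apply: nb; apply/boxE; move/boxE : b => -[b1 b2 b3].
  by split; lra.
move=> /boxE [/= b1 b2 b3]; apply: nb; apply/boxE.
have v11 := norm_coord1_le v; have v12 := norm_coord2_le v.
have v13 := norm_coord3_le v.
split.
- by rewrite -[x.1.1](addrK v.1.1) (le_trans (ler_normB _ _))//; lra.
- by rewrite -[x.1.2](addrK v.1.2) (le_trans (ler_normB _ _))//; lra.
- by rewrite -[x.2](addrK v.2) (le_trans (ler_normB _ _))//; lra.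
Qed.

Lemma is_diff_approx (f : R3 -> R) (G x : R3) :
  (forall eps, 0 < eps -> exists2 d, 0 < d &
    forall v, enorm v < d -> `|f (x + v) - f x - dot G v| <= eps * enorm v) ->
  is_diff x f (dot G).
Proof.
move=> H.
have lin : linear_for *%R (dot G).
  by move=> a u v; rewrite dotDr dotZr.
pose L : {linear R3 -> R^o} := HB.pack (dot G : R3 -> R^o)
  (GRing.isLinear.Build _ _ _ _ (dot G : R3 -> R^o) lin).
have cL : continuous L.
  by apply: continuous_dot; [move=> y; exact: cvg_cst|exact: continuous_id3].
have fE : (f : R3 -> R^o) \o shift x = cst (f x) + L +o_ (0 : R3) id.
  apply/eqaddoP => e e0; have e30 : 0 < e / 3 by rewrite divr_gt0.
  have [d d0 dP] := H _ e30.
  apply/nbhs_enorm; exists d => // v vd; rewrite add0r.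
  have := dP _ vd.
  have -> : (f \o shift x - (cst (f x) + L)) v = f (x + v) - f x - dot G v.
    rewrite -[LHS]/(f (v + x) - (f x + dot G v)) opprD addrA.
    by congr (f _ - _ - _); exact: addrC.
  move=> /le_trans; apply; change (e / 3 * enorm v <= e * `|v|).
  have n1 : `|v.1.1| <= `|v| by rewrite !prod_normE !le_max lexx.
  have n2 : `|v.1.2| <= `|v| by rewrite !prod_normE !le_max lexx orbT.
  have n3 : `|v.2| <= `|v| by rewrite !prod_normE !le_max lexx orbT.
  have vN : enorm v <= 3 * `|v| by have := enorm_le_coord v; lra.
  have := ler_wpM2l (ltW e30) vN; lra.
have dE := diff_unique cL fE.
apply: DiffDef; last exact: dE.
by apply/diff_locallyP; rewrite dE; split.
Qed.

Lemma MVT3 (k : R3 -> R) (g : R3 -> R3) (w v : R3) : grad3 k g ->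
  exists2 t : R, 0 <= t <= 1 & k (w + v) - k w = dot (g (w + t *: v)) v.
Proof.
move=> G; pose f (t : R) := k (w + t *: v).
have df (t : R) : is_derive t (1 : R) f (dot (g (w + t *: v)) v).
  have [_ /(_ (w + t *: v)) [kd kE]] := G.
  have dv : derivable k (w + t *: v) v by exact: diff_derivable.
  have E : (fun h : R => h^-1 *: ((f \o shift t) (h *: (1 : R)) - f t)) =
      (fun h : R => h^-1 *: ((k \o shift (w + t *: v)) (h *: v) - k (w + t *: v))).
    apply/funext => h; rewrite /f /=; congr (_ *: (k _ - _)).
    have -> : h *: (1 : R) = h by exact: mulr1.
    by rewrite scalerDl addrCA.
  apply: DeriveDef; first by rewrite /derivable E.
  by rewrite /derive E -(grad3_derive _ v G).
have cw : {within `[0, 1], continuous f}.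
  by apply: continuous_subspaceT; exact: is_derive_continuous df.
have [t t01 tE] := MVT ltr01 (fun x _ => df x) cw.
exists t; first by move: t01; rewrite in_itv /= => /andP[/ltW-> /ltW->].
by move: tE; rewrite /f scale1r scale0r addr0 subr0 mulr1.
Qed.

End uniform_continuity.

Section convolution.
Context {R : realType}.
Notation mR := (measurableTypeR R).
Notation E2 := (mR * mR)%type.
Notation E3 := (E2 * mR)%type.
Notation leb3 := (@leb3 R).

Notation R3 := (R * R * R)%type.

Lemma integrable_bounded (A : set E3) (f : E3 -> R) C : measurable A ->
  (leb3 A < +oo)%E -> measurable_fun setT f -> (forall x, `|f x| <= C) ->
  leb3.-integrable A (EFin \o f).
Proof.
move=> mA Aoo mf fC; apply: measurable_bounded_integrable => //.
  exact: measurable_funTS.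
exists C; split; first exact: num_real.
by move=> x Cx y _; exact: le_trans (fC y) (ltW Cx).
Qed.

Variables (A : set E3).
Hypotheses (mA : measurable A) (Aoo : (leb3 A < +oo)%E).

Definition conv (k : R3 -> R) (x : R3) : R :=
  (\int[leb3]_(y in A) k (x - (y : R3)))%R.

Let a := fine (leb3 A).

Lemma continuous_reflect (k : R3 -> R) x : continuous k ->
  continuous (fun y : R3 => k (x - y)).
Proof.
move=> ck y; apply: (cvg_comp (fun y : R3 => x - y) k); last exact: ck.
exact: (cvgB (cvg_cst _) (@cvg_id _ _)).
Qed.

Lemma measurable_reflect (k : R3 -> R) x : continuous k ->
  measurable_fun setT (fun y : E3 => k (x - (y : R3)) : R).
Proof. by move=> ck; apply: continuous_measurable3; exact: continuous_reflect. Qed.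

Lemma integrable_reflect (k : R3 -> R) C x : continuous k ->
  (forall w, `|k w| <= C) ->
  leb3.-integrable A (EFin \o (fun y : E3 => k (x - (y : R3)))).
Proof.
move=> ck kC; apply: (@integrable_bounded _ _ C) => //.
exact: measurable_reflect.
Qed.

Lemma norm_Rintegral_le (f : E3 -> R) c : measurable_fun setT f ->
  (forall x, `|f x| <= c) -> `|(\int[leb3]_(y in A) f y)%R| <= c * a.
Proof.
move=> mf fc.
apply: le_trans; first by apply: le_normr_Rintegral => //; exact: integrable_bounded.
have c0 : 0 <= c by exact: le_trans (normr_ge0 _) (fc (0, 0, 0)).
apply: (@le_trans _ _ (\int[leb3]_(y in A) cst c y)%R); last by rewrite Rintegral_cst.
apply: le_Rintegral => //.
- apply: (@integrable_bounded _ (fun x => `|f x|) c) => //.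
    exact: measurableT_comp.
  by move=> x; rewrite normr_id.
- apply: (@integrable_bounded _ (cst c) c) => // x.
  by rewrite ger0_norm.
Qed.

Lemma conv_dist (k : R3 -> R) C (c : R) x v : continuous k -> (forall w, `|k w| <= C) ->
  (forall w, `|k (w + v) - k w| <= c) -> `|conv k (x + v) - conv k x| <= c * a.
Proof.
move=> ck kC kc; rewrite /conv -RintegralB//; [|exact: integrable_reflect..].
apply: norm_Rintegral_le.
  by apply: measurable_funB; exact: measurable_reflect.
by move=> y; rewrite (_ : x + v - y = x - y + v) ?kc// addrAC.
Qed.

Let a0 : 0 <= a. Proof. exact: fine_ge0. Qed.

Lemma conv_continuous (k : R3 -> R) C : continuous k -> (forall w, `|k w| <= C) ->
  (forall eps, 0 < eps -> exists2 d, 0 < d &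
    forall x v, enorm v < d -> `|k (x + v) - k x| <= eps) ->
  continuous (conv k).
Proof.
move=> ck kC uk x; apply/cvgrPdist_le => e e0.
have e1 : 0 < e / (a + 1) by rewrite divr_gt0// ltr_wpDl.
have [d d0 dP] := uk _ e1.
apply/(nbhs_enorm x); exists d => // v vd /=; rewrite distrC.
apply: (le_trans (conv_dist (c := e / (a + 1)) x ck kC _)).
  by move=> w; exact: dP.
by rewrite mulrAC ler_pdivrMr ?ltr_wpDl//; nra.
Qed.

(** Differentiation under the integral: by the mean value theorem the first-order error of k at x -
    y is controlled by the oscillation of g over a distance at most |v|, which is small uniformly in
    y. Integrating over A costs a factor |A|, and the three components a factor 3. *)
Lemma conv_grad (k : R3 -> R) (g : R3 -> R3) C M : grad3 k g ->
  (forall w, `|k w| <= C) -> (forall w, enorm (g w) <= C) ->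
  (forall w, ~ box M w -> g w = 0) ->
  grad3 (conv k) (fun x => (conv (fun w => (g w).1.1) x,
    conv (fun w => (g w).1.2) x, conv (fun w => (g w).2) x)).
Proof.
move=> G kC gC g0; have [cg _] := G; have ck := grad3_continuous G.
have c1 := continuous_coord1 cg; have c2 := continuous_coord2 cg.
have c3 := continuous_coord3 cg.
have C1 w : `|(g w).1.1| <= C by exact: le_trans (norm_coord1_le _) _.
have C2 w : `|(g w).1.2| <= C by exact: le_trans (norm_coord2_le _) _.
have C3 w : `|(g w).2| <= C by exact: le_trans (norm_coord3_le _) _.
have u1 := @unif_cont3 R (fun w => (g w).1.1) M c1
  (fun w nb => congr1 (fun z : R3 => z.1.1) (g0 w nb)).
have u2 := @unif_cont3 R (fun w => (g w).1.2) M c2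
  (fun w nb => congr1 (fun z : R3 => z.1.2) (g0 w nb)).
have u3 := @unif_cont3 R (fun w => (g w).2) M c3
  (fun w nb => congr1 (fun z : R3 => z.2) (g0 w nb)).
split.
  by apply: continuous_pair3; [exact: (conv_continuous c1 C1 u1)|
    exact: (conv_continuous c2 C2 u2)|exact: (conv_continuous c3 C3 u3)].
move=> x; apply: is_diff_approx => e e0.
have e1 : 0 < e / (3 * (a + 1)) by rewrite divr_gt0// mulr_gt0// ltr_wpDl.
have [d1 d10 d1P] := u1 _ e1; have [d2 d20 d2P] := u2 _ e1.
have [d3 d30 d3P] := u3 _ e1.
exists (Num.min d1 (Num.min d2 d3)); first by rewrite !lt_min d10 d20 d30.
move=> v; rewrite !lt_min => /and3P[v1 v2 v3].
have i1 := integrable_reflect x c1 C1.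
have i2 := integrable_reflect x c2 C2.
have i3 := integrable_reflect x c3 C3.
pose f (y : E3) := k (x + v - (y : R3)) - k (x - (y : R3)) - dot (g (x - (y : R3))) v.
have mdot : measurable_fun setT (fun y : E3 => dot (g (x - (y : R3))) v).
  by apply: (@measurable_reflect (fun w => dot (g w) v)); apply: continuous_dot => // ?; exact: cvg_cst.
have mf : measurable_fun setT f.
  by apply: measurable_funB => //; apply: measurable_funB; exact: measurable_reflect.
have dotE : (\int[leb3]_(y in A) dot (g (x - (y : R3))) v)%R =
    dot (conv (fun w => (g w).1.1) x, conv (fun w => (g w).1.2) x,
     conv (fun w => (g w).2) x) v.
  have ip (u : R3 -> R) c : continuous u -> (forall w, `|u w| <= C) ->
      leb3.-integrable A (EFin \o (fun y : E3 => u (x - (y : R3)) * c)).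
    move=> cu uC; apply: (@integrable_bounded _ _ (C * `|c|)) => //.
      by apply: measurable_funM => //; exact: measurable_reflect.
    by move=> y; rewrite normrM ler_wpM2r.
  rewrite /dot /= RintegralD//; [|apply: (@integrable_bounded _ _ (C * `|v.1.1| + C * `|v.1.2|)) => //|exact: (ip (fun w => (g w).2))].
  - rewrite RintegralD//; [|exact: (ip (fun w => (g w).1.1))|
      exact: (ip (fun w => (g w).1.2))].
    by rewrite !RintegralZr.
  - apply: measurable_funD; apply: measurable_funM => //.
      exact: (measurable_reflect x c1).
    exact: (measurable_reflect x c2).
  - move=> y; apply: (le_trans (ler_normD _ _)); rewrite !normrM.
    by apply: lerD; rewrite ler_wpM2r.
have dC w : `|dot (g w) v| <= C * enorm v.
  by apply: le_trans (norm_dot_le _ _) _; rewrite ler_wpM2r ?enorm_ge0.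
have -> : conv k (x + v) - conv k x - dot (conv (fun w => (g w).1.1) x,
    conv (fun w => (g w).1.2) x, conv (fun w => (g w).2) x) v =
    (\int[leb3]_(y in A) f y)%R.
  rewrite -dotE /conv /f -RintegralB//; [|exact: integrable_reflect..].
  rewrite -RintegralB//.
  - by have := integrableB mA (integrable_reflect (x + v) ck kC)
      (integrable_reflect x ck kC); apply: eq_integrable.
  - by apply: (@integrable_bounded _ _ (C * enorm v)).
apply: (le_trans (norm_Rintegral_le (c := e / (a + 1) * enorm v) mf _)).
  move=> y; rewrite /f (_ : x + v - y = x - y + v); last by rewrite addrAC.
  have [t /andP[t0 t1] ->] := MVT3 (x - y : R3) v G.
  have tv : enorm (t *: v) <= enorm v.
    by rewrite enormZ ger0_norm// ler_piMl ?enorm_ge0.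
  rewrite -dotNl -dotDl; apply: le_trans (norm_dot_le _ _) _.
  rewrite ler_wpM2r ?enorm_ge0//; apply: (le_trans (enorm_le_coord _)).
  have := d1P (x - y) _ (le_lt_trans tv v1).
  have := d2P (x - y) _ (le_lt_trans tv v2).
  have := d3P (x - y) _ (le_lt_trans tv v3).
  rewrite /=; have -> : e / (a + 1) = 3 * (e / (3 * (a + 1))).
    by field; rewrite gt_eqF// ltr_wpDl.
  by move=> b3 b2 b1; clear -b1 b2 b3; lra.
rewrite mulrAC ler_wpM2r ?enorm_ge0//.
by rewrite mulrAC ler_pdivrMr ?ltr_wpDl//; nra.
Qed.

End convolution.

Section conv_fields.
Context {R : realType}.
Notation mR := (measurableTypeR R).
Notation E2 := (mR * mR)%type.
Notation E3 := (E2 * mR)%type.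
Notation leb3 := (@leb3 R).

Notation R3 := (R * R * R)%type.

(** For a unit vector nu, nu . X(x) is the integral over A of nu . k(x - y). Dropping the negative
    part and enlarging A to the whole space bounds it by the integral of the positive part of nu .
    k. For an odd kernel this is half of the integral of |nu . k|, which makes the constant
    sharp. *)
Lemma conv_test_field (A : set E3) (N M C : R) (k1 k2 k3 : R3 -> R) (g1 g2 g3 : R3 -> R3) :
  measurable A -> (leb3 A < +oo)%E -> A `<=` box N -> 0 <= N -> 0 < M ->
  grad3 k1 g1 -> grad3 k2 g2 -> grad3 k3 g3 ->
  (forall w, [/\ `|k1 w| <= C, `|k2 w| <= C & `|k3 w| <= C]) ->
  (forall w, [/\ enorm (g1 w) <= C, enorm (g2 w) <= C & enorm (g3 w) <= C]) ->
  (forall w, ~ box M w ->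
    [/\ k1 w = 0, k2 w = 0, k3 w = 0 & [/\ g1 w = 0, g2 w = 0 & g3 w = 0]]) ->
  (forall nu, enorm nu = 1 ->
    (\int[leb3]_w (pos (dot nu (k1 w, k2 w, k3 w)))%:E <= 1)%E) ->
  let X := fun x => (conv A k1 x, conv A k2 x, conv A k3 x) in
  test_field X /\
  forall x, divergence X x = conv A (fun w => (g1 w).1.1 + (g2 w).1.2 + (g3 w).2) x.
Proof.
move=> mA Aoo AN N0 M0 G1 G2 G3 kC gC kM H X.
have K1 w : `|k1 w| <= C by case: (kC w).
have K2 w : `|k2 w| <= C by case: (kC w).
have K3 w : `|k3 w| <= C by case: (kC w).
have D1 w : enorm (g1 w) <= C by case: (gC w).
have D2 w : enorm (g2 w) <= C by case: (gC w).
have D3 w : enorm (g3 w) <= C by case: (gC w).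
have Z1 w : ~ box M w -> g1 w = 0 by move=> /kM[_ _ _ []].
have J1 := conv_grad mA Aoo G1 K1 D1 Z1.
have Z2 w : ~ box M w -> g2 w = 0 by move=> /kM[_ _ _ []].
have J2 := conv_grad mA Aoo G2 K2 D2 Z2.
have Z3 w : ~ box M w -> g3 w = 0 by move=> /kM[_ _ _ []].
have J3 := conv_grad mA Aoo G3 K3 D3 Z3.
have c1 := grad3_continuous G1; have c2 := grad3_continuous G2.
have c3 := grad3_continuous G3.
have [cg1 _] := G1; have [cg2 _] := G2; have [cg3 _] := G3.
have integ (u : R3 -> R) x : continuous u -> (forall w, `|u w| <= C) ->
    leb3.-integrable A (EFin \o (fun y : E3 => u (x - (y : R3)))).
  by move=> cu uC; exact: (integrable_reflect mA Aoo x cu uC).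
split; last first.
  move=> x; rewrite (divergence_field x J1 J2 J3) /=.
  have i1 := integ _ x (continuous_coord1 cg1) (fun w => le_trans (norm_coord1_le _) (D1 w)).
  have i2 := integ _ x (continuous_coord2 cg2) (fun w => le_trans (norm_coord2_le _) (D2 w)).
  have i3 := integ _ x (continuous_coord3 cg3) (fun w => le_trans (norm_coord3_le _) (D3 w)).
  rewrite /conv [in RHS]RintegralD//.
    by rewrite [in RHS]RintegralD.
  by have := integrableD mA i1 i2; apply: eq_integrable.
split.
- exact: C1_field J1 J2 J3.
- apply/compactly_supportedP; exists (M + N); first by rewrite ltr_pwDl.
  move=> x nb.
  have tri (a b : R) : `|a - b| <= M -> `|b| <= N -> `|a| <= M + N.
    by move=> ab bN; rewrite -[a](subrK b) (le_trans (ler_normD _ _))// lerD.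
  have z (k : R3 -> R) : (forall w, ~ box M w -> k w = 0) -> conv A k x = 0.
    move=> k0; rewrite /conv (@eq_Rintegral _ _ _ leb3 _ (cst 0)).
      by rewrite Rintegral_cst// mul0r.
    move=> y; rewrite inE => /AN/boxE[n1 n2 n3]; apply: k0 => /boxE[/= m1 m2 m3].
    apply: nb; apply/boxE; split.
    + exact: tri m1 n1.
    + exact: tri m2 n2.
    + exact: tri m3 n3.
  by rewrite /X !z// => w /kM[].
- move=> x; apply: enorm_leP => // nu nu1.
  pose K w := dot nu (k1 w, k2 w, k3 w).
  have cK : continuous K.
    by apply: continuous_dot; [move=> ?; exact: cvg_cst|exact: continuous_pair3].
  have -> : dot nu (X x) = (\int[leb3]_(y in A) K (x - (y : R3)))%R.
    have i1 := integ _ x c1 K1; have i2 := integ _ x c2 K2; have i3 := integ _ x c3 K3.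
    have j (u : R3 -> R) c : continuous u -> (forall w, `|u w| <= C) ->
        leb3.-integrable A (EFin \o (fun y : E3 => c * u (x - (y : R3)))).
      move=> cu uC; apply: (@integrable_bounded _ _ _ (`|c| * C)) => //.
        by apply: measurable_funM => //; exact: measurable_reflect.
      by move=> y; rewrite normrM ler_wpM2l.
    rewrite /K /dot /= RintegralD//; [|apply: (@integrable_bounded _ _ _ (`|nu.1.1| * C + `|nu.1.2| * C)) => //|exact: (j k3)].
    - rewrite RintegralD//; [|exact: (j k1)|exact: (j k2)].
      by rewrite !RintegralZl.
    - apply: measurable_funD; apply: measurable_funM => //.
        exact: (measurable_reflect x c1).
      exact: (measurable_reflect x c2).
    - move=> y; apply: (le_trans (ler_normD _ _)); rewrite !normrM.
      by apply: lerD; rewrite ler_wpM2l.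
  have KC w : `|K w| <= enorm nu * (3 * C).
    apply: le_trans (norm_dot_le _ _) _; rewrite ler_wpM2l ?enorm_ge0//.
    apply: (le_trans (enorm_le_coord _)) => /=.
    by have := K1 w; have := K2 w; have := K3 w; lra.
  have iK := integrable_reflect mA Aoo x cK KC.
  rewrite -lee_fin /Rintegral fineK; last exact: integrable_fin_num iK.
  have mposK : measurable_fun setT (fun w : E3 => (pos (K w))%:E).
    apply: (measurableT_comp (@EFin_measurable R setT)).
    apply: continuous_measurable3 => y.
    apply: (cvg_comp K pos); [exact: cK|exact: continuous_pos].
  have [mo po] := @preserves_opp R; have [ms ps] := @preserves_shift R x.
  have pos0 w : (0 <= (pos (K w))%:E)%E.
    by rewrite lee_fin /pos le_max lexx.
  have e1 := po _ mposK pos0.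
  have mpos2 : measurable_fun setT (fun w : E3 => (pos (K (- (w : R3))))%:E).
    exact: (measurableT_comp mposK mo).
  apply: le_trans (H nu nu1).
  rewrite -[leRHS]e1.
  have [ms' ps'] := @preserves_shift R (- x).
  have e3 := ps' _ mpos2 (fun w => pos0 _); rewrite /= in e3.
  rewrite -[leRHS]e3.
  apply: (@le_trans _ _ (\int[leb3]_(y in A) (pos (K (x - (y : R3))))%:E)%E).
    apply: le_integral => //.
    - apply: integrable_bounded => //.
      + apply: continuous_measurable3 => y.
        apply: (cvg_comp (fun y : R3 => K (x - y)) pos); last exact: continuous_pos.
        exact: continuous_reflect.
      + move=> y; apply: (le_trans _ (KC (x - y))).
        by rewrite /pos; case: (lerP 0 (K (x - y))) => // ?; rewrite normr0.
    - by move=> y _; rewrite lee_fin /pos le_max lexx orbT.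
  rewrite (_ : (fun y : E3 => (pos (K (- ((y : R3) - x))))%:E) =
    (fun y : E3 => (pos (K (x - (y : R3))))%:E)); last first.
    by apply/funext => y; rewrite opprB.
  apply: ge0_subset_integral => //.
  have := measurableT_comp mpos2 ms'; apply: eq_measurable_fun => y _ /=.
  by rewrite opprB.
Qed.

End conv_fields.

(** * First moments of the radial kernel *)

Section moments.
Context {R : realType}.
Notation lam := (@lebesgue_measure R).
Notation mR := (measurableTypeR R).
Notation E2 := (mR * mR)%type.
Notation E3 := (E2 * mR)%type.
Notation leb3 := (@leb3 R).
Local Open Scope ereal_scope.
Notation R3 := (R * R * R)%type.

Lemma measurable_lt (d : measure_display) (T : measurableType d) (f : T -> R) (t : R) :
  measurable_fun setT f -> measurable [set x | (f x < t)%R].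
Proof.
move=> mf; have -> : [set x | (f x < t)%R] = setT `&` f @^-1` `]-oo, t[%classic.
  by rewrite setTI; apply/seteqP; split=> p /=; rewrite in_itv.
exact: mf.
Qed.

(** Layer cake with density 3 t^-4 on ]0, T]: the moment of |w_3| over the ball of radius t is pi
    t^4 / 2, so every t contributes the same amount 3 pi / 2. *)
Lemma integral_norm_coord3 (kap : R -> R) (T : R) : (0 < T)%R ->
  measurable_fun setT kap ->
  (forall r, 0 <= r -> 0 <= kap (r ^+ 2))%R ->
  (forall r, T <= r -> kap (r ^+ 2) = 0)%R ->
  (forall r, 0 < r -> r < T -> kap (r ^+ 2) <= r ^- 3 - T ^- 3)%R ->
  \int[leb3]_w (`|w.2| * kap (w.1.1 ^+ 2 + w.1.2 ^+ 2 + w.2 ^+ 2))%:E <=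
  (3 * pi / 2 * T)%:E.
Proof.
move=> T0 mk k0 kT kr.
have mw : measurable_fun setT (fun w : E3 => (`|w.2|)%:E).
  apply: (measurableT_comp (@EFin_measurable R setT)).
  exact: measurableT_comp.
have enq (w : R3) : (w.1.1 ^+ 2 + w.1.2 ^+ 2 + w.2 ^+ 2 = enorm w ^+ 2)%R.
  by rewrite enorm_sqr /dot !expr2.
have LC := @layer_cake R _ E3 leb3 enorm (fun w => (`|w.2|)%:E) (npow 2 T)
  (@measurable_enorm R) mw (measurable_npowT 2 T) (fun w => normr_ge0 _) (npow_ge0 2 T).
apply: (@le_trans _ _ (\int[leb3]_x (`|x.2|%:E *
   \int[lam]_t (npow 2 T t * (\1_(`](enorm x), +oo[%classic) t : R)%:E)))).
  apply: ge0_le_integral => //.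
  - move=> w _; rewrite lee_fin mulr_ge0//.
    by rewrite enq k0// enorm_ge0.
  - apply: (measurableT_comp (@EFin_measurable R setT)); apply: measurable_funM.
      exact: measurableT_comp.
    exact: (measurableT_comp mk (@measurable_sqnorm3 R)).
  - apply: emeasurable_funM => //.
    pose f (p : E3 * mR) : \bar R := (npow 2 T p.2 * (\1_[set p : E3 * mR | (enorm p.1 < p.2)%R] p : R)%:E).
    have mf : measurable_fun setT f.
      apply: emeasurable_funM.
        exact: (measurableT_comp (measurable_npowT 2 T)).
      apply: (measurableT_comp (@EFin_measurable R setT)); apply: measurable_indic.
      have := @measurable_lt _ (E3 * mR)%type (fun p => enorm p.1 - p.2)%R 0%R.
      under eq_set do rewrite subr_lt0.
      apply; apply: measurable_funB => //.
      exact: (measurableT_comp (@measurable_enorm R)).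
    have f0 p : 0 <= f p.
      by rewrite mule_ge0 ?npow_ge0// lee_fin indicE ler0n.
    have := @measurable_fun_fubini_tonelli_F _ _ E3 mR R lam f mf f0.
    apply: eq_measurable_fun => w _; apply: eq_integral => t _.
    rewrite /f !indicE; congr (_ * (nat_of_bool _)%:R%:E).
    by apply/idP/idP; rewrite !inE /= in_itv /= andbT.
  - move=> w _; have [w0|w0] := eqVneq (enorm w) 0%R.
      have := norm_coord3_le w; rewrite w0 normr_le0 => /eqP ->.
      by rewrite normr0 mul0r mul0e.
    have wp : (0 < enorm w)%R by rewrite lt_def w0 enorm_ge0.
    rewrite integral_npow// -EFinM lee_fin ler_wpM2l// enq.
    case: ltP => wT; first exact: kr.
    by rewrite kT.
rewrite LC.
have -> : \int[lam]_t (npow 2 T t * \int[leb3]_(x in [set x | (enorm x < t)%R]) `|x.2|%:E) =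
    \int[lam]_t ((3 * pi / 2) * \1_(`]0%R, T]%classic) t)%:E.
  apply: eq_integral => t _; rewrite /npow !indicE.
  have [|_] := boolP (t \in `]0%R, T]%classic); last by rewrite !mulr0 mul0e.
  rewrite inE /= in_itv /= => /andP[t0 tT]; rewrite !mulr1.
  have := ball3_moment (ltW t0); rewrite /ball3 => ->.
  by rewrite -EFinM; congr (_%:E); field; rewrite gt_eqF.
under eq_integral do rewrite EFinM.
rewrite ge0_integralZl_EFin//.
- rewrite integral_indic// setIT/= lebesgue_measure_itv /= lte_fin T0 -EFinB subr0.
  by rewrite -EFinM.
- by apply: (measurableT_comp (@EFin_measurable R setT)); exact: measurable_indic.
- by rewrite divr_ge0// mulr_ge0// pi_ge0.
Qed.

(** Rotate nu to e_3, then average with the reflection of the last coordinate: [pos u + pos (- u)]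
    is |u|, which gains the factor 2. *)
Lemma integral_pos_dot (kap : R -> R) (nu : R3) c : measurable_fun setT kap ->
  (forall r, 0 <= r -> 0 <= kap (r ^+ 2))%R -> enorm nu = 1%R ->
  \int[leb3]_w (`|w.2| * kap (w.1.1 ^+ 2 + w.1.2 ^+ 2 + w.2 ^+ 2))%:E <= (2 * c)%:E ->
  \int[leb3]_w (pos (dot nu w) * kap (w.1.1 ^+ 2 + w.1.2 ^+ 2 + w.2 ^+ 2))%:E <= c%:E.
Proof.
move=> mk k0 nu1 H.
have enq (w : R3) : (w.1.1 ^+ 2 + w.1.2 ^+ 2 + w.2 ^+ 2 = enorm w ^+ 2)%R.
  by rewrite enorm_sqr /dot !expr2.
pose kp q := pos (kap q).
have kpE (w : R3) : kp (enorm w ^+ 2)%R = kap (enorm w ^+ 2)%R.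
  by rewrite /kp /pos max_r// k0// enorm_ge0.
have pos_ge0 (u : R) : (0 <= pos u)%R by rewrite /pos le_max lexx.
have mpos : measurable_fun setT (pos : mR -> R) by apply: continuous_measurable_fun; exact: continuous_pos.
have mkp : measurable_fun setT kp by exact: measurableT_comp.
pose F (p : E2) : \bar R := (pos p.2 * kp p.1)%:E.
have mF : measurable_fun setT F.
  apply: (measurableT_comp (@EFin_measurable R setT)).
  by apply: measurable_funM; exact: measurableT_comp.
have F0 p : 0 <= F p by rewrite lee_fin; apply: mulr_ge0; exact: pos_ge0.
have nu2 : (nu.1.1 ^+ 2 + nu.1.2 ^+ 2 + nu.2 ^+ 2 = 1)%R by rewrite enq nu1 expr1n.
have := integral_dir3 nu2 mF F0; rewrite /F /= => D.
have -> : \int[leb3]_w (pos (dot nu w) * kap (w.1.1 ^+ 2 + w.1.2 ^+ 2 + w.2 ^+ 2))%:E =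
    \int[leb3]_w (pos w.2 * kp (w.1.1 ^+ 2 + w.1.2 ^+ 2 + w.2 ^+ 2))%:E.
  by rewrite -D; apply: eq_integral => w _; rewrite enq kpE.
set I := \int[leb3]_w _.
have [mo po] := @preserves_opp3 R.
have mG : measurable_fun setT (fun w : E3 => (pos w.2 * kp (w.1.1 ^+ 2 + w.1.2 ^+ 2 + w.2 ^+ 2))%:E).
  apply: (measurableT_comp (@EFin_measurable R setT)); apply: measurable_funM.
    exact: measurableT_comp.
  exact: (measurableT_comp mkp (@measurable_sqnorm3 R)).
have G0 (w : E3) : 0 <= (pos w.2 * kp (w.1.1 ^+ 2 + w.1.2 ^+ 2 + w.2 ^+ 2))%:E.
  by rewrite lee_fin; apply: mulr_ge0; exact: pos_ge0.
have e1 := po _ mG G0.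
have : I + I <= (2 * c)%:E.
  rewrite {1}/I -e1 -ge0_integralD//; last exact: (measurableT_comp mG mo).
  apply: le_trans H; apply: ge0_le_integral => //.
  - by move=> w _; rewrite adde_ge0// ?G0//= lee_fin mulr_ge0.
  - by apply: emeasurable_funD => //; exact: (measurableT_comp mG mo).
  - apply: (measurableT_comp (@EFin_measurable R setT)); apply: measurable_funM.
      exact: measurableT_comp.
    exact: (measurableT_comp mk (@measurable_sqnorm3 R)).
  - move=> w _ /=; rewrite sqrrN !enq kpE -EFinD lee_fin -mulrDl ler_wpM2r//.
      by rewrite k0// enorm_ge0.
    case: (posP (w.2 : R)) => -[w0 ->]; case: (posP (- (w.2 : R))%R) => -[w1 ->].
    + by rewrite ger0_norm//; lra.
    + by rewrite ger0_norm//; lra.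
    + by rewrite ler0_norm//; lra.
    + by rewrite ler0_norm//; lra.
have I0 : 0 <= I by apply: integral_ge0 => w _; exact: G0.
case: I I0 => [x| |]//= x0; rewrite -EFinD !lee_fin; lra.
Qed.

End moments.

(** * Close pairs and the perimeter *)

Section near.
Context {R : realType}.
Notation mR := (measurableTypeR R).
Notation E2 := (mR * mR)%type.
Notation E3 := (E2 * mR)%type.
Notation E6 := (E3 * E3)%type.
Notation leb3 := (@leb3 R).
Notation leb6 := (@leb6 R).
Notation R3 := (R * R * R)%type.
Local Open Scope ereal_scope.

Definition pairs (A B : set E3) (t : R) : set E6 :=
  [set z | [/\ A z.1, B z.2 & enorm ((z.1 : R3) - z.2) < t]%R].

(** [near_pairs A A] is the function G of the overview. The second set is kept separate because it
    is later cut off by a box, or replaced by the complement of A. *)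
Definition near_pairs (A B : set E3) (t : R) : \bar R := leb6 (pairs A B t).

Definition vic (B : set E3) (t : R) (x : E3) : set E3 :=
  [set y | B y /\ enorm ((x : R3) - y) < t]%R.

Lemma measurable_pairs A B t : measurable A -> measurable B ->
  measurable (pairs A B t).
Proof.
move=> mA mB.
have -> : pairs A B t = (A `*` B) `&` [set z | enorm ((z.1 : R3) - z.2) < t]%R.
  by apply/seteqP; split=> z /=; [move=> []|move=> [[]]].
apply: measurableI; first exact: measurable_setX6.
exact: measurable_lt (@measurable_dist R).
Qed.

Lemma measurable_vic B t x : measurable B -> measurable (vic B t x).
Proof.
move=> mB; have := measurable_xsection x (measurable_pairs t measurableT mB).
by congr measurable; apply/seteqP; split=> y; rewrite /xsection /pairs /vic /= inE /=; case.
Qed.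

Lemma nearE A B t : measurable A -> measurable B ->
  near_pairs A B t = \int[leb3]_(x in A) leb3 (vic B t x).
Proof.
move=> mA mB; rewrite /near_pairs.
transitivity (\int[leb3]_x leb3 (xsection (pairs A B t) x)); first by [].
rewrite [RHS]integral_mkcond; apply: eq_integral => x _; rewrite patchE.
case: ifPn; rewrite ?inE ?notin_setE => Ax.
  congr (leb3 _); apply/seteqP; split=> y; rewrite /xsection /pairs /vic /= inE /=.
    by move=> [].
  by move=> [].
rewrite (_ : xsection _ _ = set0) ?measure0//; apply/seteqP; split=> // y.
by rewrite /xsection /pairs /= inE /= => -[].
Qed.

Lemma measurable_fun_vic B t : measurable B ->
  measurable_fun setT (fun x => leb3 (vic B t x)).
Proof.
move=> mB.
have := measurable_fun_xsection leb3 (measurable_pairs t measurableT mB).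
apply: eq_measurable_fun => x _ /=; congr (leb3 _).
by apply/seteqP; split=> y; rewrite /xsection /pairs /vic /= inE /=; [move=> []|move=> []].
Qed.

Lemma vic_setT t (x : R3) : leb3 (vic setT t x) = leb3 (ball3 t).
Proof.
have P := preserves_comp (@preserves_shift R x) (@preserves_opp R).
rewrite -[RHS](preserves_set P (measurable_ball3 t)).
by congr (leb3 _); apply/seteqP; split => y; rewrite /ball3 /vic /= addrC => // -[].
Qed.

Lemma le_near A A' B B' t : measurable A -> measurable A' -> measurable B ->
  measurable B' -> A `<=` A' -> B `<=` B' -> near_pairs A B t <= near_pairs A' B' t.
Proof.
move=> mA mA' mB mB' AA BB; apply: le_measure; rewrite ?inE;
  [exact: measurable_pairs..|].
by move=> z [/AA ? /BB ?].
Qed.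

Lemma near_setT A t : measurable A -> near_pairs A setT t = leb3 A * leb3 (ball3 t).
Proof.
move=> mA; rewrite nearE//.
under eq_integral do rewrite vic_setT.
by rewrite muleC; exact: (@integral_cst _ _ _ leb3 A mA).
Qed.

Lemma near_split A B C t : measurable A -> measurable B -> measurable C ->
  near_pairs A B t = near_pairs A (B `&` C) t + near_pairs A (B `\` C) t.
Proof.
move=> mA mB mC; rewrite /near_pairs.
have -> : pairs A B t = pairs A (B `&` C) t `|` pairs A (B `\` C) t.
  apply/seteqP; split=> z; rewrite /pairs /=.
    by move=> [a b c]; case: (pselect (C z.2)); [left|right].
  by move=> [[a [b1 b2] c]|[a [b1 b2] c]].
apply: (@measureU _ _ _ leb6).
- by apply: measurable_pairs => //; exact: measurableI.
- by apply: measurable_pairs => //; exact: measurableD.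
- by apply/seteqP; split=> z // [[_ [_ c] _] [_ [_ nc] _]].
Qed.

Lemma grad3_sqnorm : grad3 (fun w : R3 => dot w w) (fun w => 2 *: w)%R.
Proof.
have G1 := @grad3_coord1 R; have G2 := @grad3_coord2 R; have G3 := @grad3_coord3 R.
have [c d] := grad3D (grad3D (grad3M G1 G1) (grad3M G2 G2)) (grad3M G3 G3).
have E (w : R3) : ((w.1.1 *: e1 + w.1.1 *: e1 + (w.1.2 *: e2 + w.1.2 *: e2) +
    (w.2 *: e3 + w.2 *: e3)) = 2 *: w)%R.
  by case: w => -[a b] z; rewrite /e1 /e2 /e3 /=; congr (_, _, _) => /=;
    rewrite /GRing.scale/=; ring.
split.
  move=> x; have := c x; rewrite /continuous_at /= E.
  by under [X in X @ _ --> _]eq_fun do rewrite E.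
by move=> x; have := d x; rewrite /= E.
Qed.

Lemma perimeter_ge (A : set E3) X : measurable A -> test_field X ->
  \int[leb3]_(x in A) (divergence X x)%:E <= perimeter A.
Proof. by move=> mA tX; rewrite perimeterE//; apply: ereal_sup_ubound; exists X. Qed.

Lemma integrable_divergence (A : set E3) (X : R3 -> R3) : measurable A ->
  test_field X -> leb3 A < +oo -> leb3.-integrable A (EFin \o divergence X).
Proof.
move=> mA tX Aoo; have [M [C [_ _ _ XC]]] := test_field_support tX.
apply: (@integrable_bounded _ _ _ C) => //.
by apply: measurable_divergence; case: tX.
Qed.

End near.

Section key_estimate.
Context {R : realType}.
Notation mR := (measurableTypeR R).
Notation E2 := (mR * mR)%type.
Notation E3 := (E2 * mR)%type.
Notation leb3 := (@leb3 R).
Notation R3 := (R * R * R)%type.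
Local Open Scope ereal_scope.

Lemma measure_vic_lty B t (x : R3) : measurable B -> leb3 (vic B t x) < +oo.
Proof.
move=> mB; apply: (@le_lt_trans _ _ (leb3 (vic setT t x))).
  by apply: le_measure; rewrite ?inE; [exact: measurable_vic..|move=> y []].
rewrite vic_setT; have [t0|t0] := leP 0%R t; first by rewrite ball3_volume// ltry.
rewrite (_ : ball3 t = set0) ?measure0//; apply/seteqP; split=> // w.
by rewrite /ball3 /= => /(le_lt_trans (enorm_ge0 _)) /(lt_trans t0); rewrite ltxx.
Qed.

Lemma grad3_ext (f f' : R3 -> R) (g g' : R3 -> R3) : grad3 f g -> f' =1 f ->
  g' =1 g -> grad3 f' g'.
Proof. by move=> G /funext -> /funext ->. Qed.

Lemma measurable_box N : measurable (box N : set E3).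
Proof.
rewrite -[box N]setCK; apply: measurableC; apply: open_measurable3.
by apply: closed_openC; exact: closed_box.
Qed.

Lemma sqnormE (w : R3) : (w.1.1 ^+ 2 + w.1.2 ^+ 2 + w.2 ^+ 2 = enorm w ^+ 2)%R.
Proof. by rewrite enorm_sqr /dot !expr2. Qed.

(* The field is the convolution of 1_A with the radial kernel
   w (|w|^-3 - T^-3), cut off at |w| = T and regularized below |w| = e. *)
Lemma kernel_field (A : set E3) (N e h T : R) : measurable A -> leb3 A < +oo ->
  A `<=` box N -> (0 <= N)%R -> (0 < e)%R -> (0 < h)%R -> (0 < T)%R ->
  (h < e ^+ 2)%R -> (e ^+ 2 + h <= T ^+ 2)%R ->
  exists X d, [/\ test_field X, continuous d,
    (exists C, forall w, (`|d w| <= C)%R),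
    (forall x, divergence X x = conv A d x) &
    forall w, ((3 * pi / 4 * T)^-1 * (
       3 * (\1_[set r | r ^+ 2 < e ^+ 2 - h] (enorm w)) * e ^- 3 -
       3 * (\1_[set r | r < T] (enorm w)) * T ^- 3) <= d w)%R].
Proof.
move=> mA Aoo AN N0 e0 h0 T0 he eT.
pose kap := profile e h T; pose dkap := dprofile e h T.
have he' := ltW he.
have dkapE (u : R) : is_derive u (1%R : R) kap (dkap u).
  exact: is_derive_profile.
have cdkap : continuous dkap := continuous_dprofile e0 h0 he' eT.
have ckap : continuous kap := is_derive_continuous dkapE.
(* Half of the moment 3 pi / 2 * T, by [integral_pos_dot]; dividing the kernel by [c] makes the
   field of length at most 1. *)
pose c : R := (3 * pi / 4 * T)%R.
have c0 : (0 < c)%R by rewrite !mulr_gt0 ?invr_gt0 ?pi_gt0.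
have GK := grad3_comp dkapE cdkap (@grad3_sqnorm R).
have GM (f : R3 -> R) g : grad3 f g -> grad3 (fun w => c^-1 * (f w * kap (dot w w)))%R
    (fun w => c^-1 *: (f w *: (dkap (dot w w) *: (2 *: w)) + kap (dot w w) *: g w))%R.
  move=> Gf; apply: (grad3_ext (grad3M (grad3_cst c^-1%R) (grad3M Gf GK))) => // w.
  by rewrite /= scaler0 addr0.
have G1 := GM _ _ (@grad3_coord1 R); have G2 := GM _ _ (@grad3_coord2 R).
have G3 := GM _ _ (@grad3_coord3 R).
set k1 := (fun w : R3 => c^-1 * (w.1.1 * kap (dot w w)))%R in G1.
set k2 := (fun w : R3 => c^-1 * (w.1.2 * kap (dot w w)))%R in G2.
set k3 := (fun w : R3 => c^-1 * (w.2 * kap (dot w w)))%R in G3.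
set g1 := (X in grad3 k1 X) in G1; set g2 := (X in grad3 k2 X) in G2.
set g3 := (X in grad3 k3 X) in G3.
have facts (w : R3) := profile_facts e0 h0 T0 he' eT (enorm_ge0 w).
have out (w : R3) : ~ box T w -> kap (dot w w) = 0%R /\ dkap (dot w w) = 0%R.
  move=> nb; have [_ + _ _] := facts w; rewrite enorm_sqr; apply.
  by rewrite leNgt; apply/negP => /ltW /box_enorm.
have zk (w : R3) : ~ box T w ->
    [/\ k1 w = 0%R, k2 w = 0%R, k3 w = 0%R & [/\ g1 w = 0%R, g2 w = 0%R & g3 w = 0%R]].
  by move=> /out[k0 d0]; split; [..|split]; rewrite /k1 /k2 /k3 /g1 /g2 /g3 ?k0 ?d0
    ?(scale0r, scaler0, mulr0, addr0).
have bnd (f : R3 -> R) : continuous f -> (forall w, ~ box T w -> f w = 0%R) ->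
    exists2 C, (0 <= C)%R & forall w, (`|f w| <= C)%R.
  move=> cf f0; have [C C0 fC] := continuous_box_bounded T cf.
  exists C => // w; have [/fC//|/f0 ->] := pselect (box T w).
  by rewrite normr0.
have [cg1 _] := G1; have [cg2 _] := G2; have [cg3 _] := G3.
have bg (g : R3 -> R3) : continuous g -> (forall w, ~ box T w -> g w = 0%R) ->
    exists2 C, (0 <= C)%R & forall w, (enorm (g w) <= C)%R.
  move=> cg g0.
  have [|C1 C10 H1] := bnd _ (continuous_coord1 cg); first by move=> w /g0 ->.
  have [|C2 C20 H2] := bnd _ (continuous_coord2 cg); first by move=> w /g0 ->.
  have [|C3 C30 H3] := bnd _ (continuous_coord3 cg); first by move=> w /g0 ->.
  exists (C1 + C2 + C3)%R; first by rewrite !addr_ge0.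
  by move=> w; rewrite (le_trans (enorm_le_coord _))// !lerD.
have [|C1 C10 K1] := bnd _ (grad3_continuous G1); first by move=> w /zk[].
have [|C2 C20 K2] := bnd _ (grad3_continuous G2); first by move=> w /zk[].
have [|C3 C30 K3] := bnd _ (grad3_continuous G3); first by move=> w /zk[].
have [|C4 C40 K4] := bg _ cg1; first by move=> w /zk[_ _ _ []].
have [|C5 C50 K5] := bg _ cg2; first by move=> w /zk[_ _ _ []].
have [|C6 C60 K6] := bg _ cg3; first by move=> w /zk[_ _ _ []].
pose C := (C1 + C2 + C3 + C4 + C5 + C6)%R.
have kC w : [/\ `|k1 w| <= C, `|k2 w| <= C & `|k3 w| <= C]%R.
  have := K1 w; have := K2 w; have := K3 w; rewrite /C.
  move: `|k1 w|%R `|k2 w|%R `|k3 w|%R => a1 a2 a3 h3 h2 h1.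
  by clear -h1 h2 h3 C10 C20 C30 C40 C50 C60; split; lra.
have gC w : [/\ enorm (g1 w) <= C, enorm (g2 w) <= C & enorm (g3 w) <= C]%R.
  have := K4 w; have := K5 w; have := K6 w; rewrite /C.
  move: (enorm (g1 w)) (enorm (g2 w)) (enorm (g3 w)) => a1 a2 a3 h3 h2 h1.
  by clear -h1 h2 h3 C10 C20 C30 C40 C50 C60; split; lra.
have kap0 r : (0 <= r -> 0 <= kap (r ^+ 2))%R.
  by move=> r0; have [] := profile_facts e0 h0 T0 he' eT r0.
have mkap : measurable_fun setT kap by exact: continuous_measurable_fun.
have M1 : \int[leb3]_w (`|w.2| * kap (w.1.1 ^+ 2 + w.1.2 ^+ 2 + w.2 ^+ 2))%:E <=
    (2 * c)%:E.
  have -> : (2 * c = 3 * pi / 2 * T)%R by rewrite /c; field.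
  apply: integral_norm_coord3 => // [r Tr|r r0 rT].
    by have [_ /(_ Tr)[]] := profile_facts e0 h0 T0 he' eT (le_trans (ltW T0) Tr).
  by have [_ _ + _] := profile_facts e0 h0 T0 he' eT (ltW r0); exact.
have H (nu : R3) : enorm nu = 1%R ->
    \int[leb3]_w (pos (dot nu (k1 w, k2 w, k3 w)))%:E <= 1.
  move=> nu1.
  have M2 := integral_pos_dot mkap kap0 nu1 M1.
  have -> : \int[leb3]_w (pos (dot nu (k1 w, k2 w, k3 w)))%:E =
      \int[leb3]_w (c^-1%:E *
        (pos (dot nu w) * kap (w.1.1 ^+ 2 + w.1.2 ^+ 2 + w.2 ^+ 2))%:E).
    apply: eq_integral => w _; rewrite -EFinM; congr (_%:E).
    rewrite sqnormE; have kw := kap0 _ (enorm_ge0 w).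
    have -> : dot nu (k1 w, k2 w, k3 w) = (c^-1 * (dot nu w * kap (enorm w ^+ 2)))%R.
      by rewrite enorm_sqr /k1 /k2 /k3 /dot /=; ring.
    have ci : (0 <= c^-1)%R by rewrite invr_ge0 ltW.
    case: (posP (dot nu w)) => -[d0 ->].
      by rewrite /pos max_r// !mulr_ge0.
    by rewrite mul0r mulr0 /pos max_l// mulr_ge0_le0// mulr_le0_ge0.
  rewrite ge0_integralZl_EFin//.
  - rewrite -(mulVf (lt0r_neq0 c0)) EFinM lee_pmul//.
    + by rewrite lee_fin invr_ge0 ltW.
    + apply: integral_ge0 => w _; rewrite lee_fin sqnormE mulr_ge0 ?kap0 ?enorm_ge0//.
      by rewrite /pos le_max lexx.
  - move=> w _; rewrite lee_fin sqnormE mulr_ge0 ?kap0 ?enorm_ge0//.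
    by rewrite /pos le_max lexx.
  - apply/measurable_EFinP; apply: measurable_funM.
      apply: continuous_measurable3 => w.
      apply: (cvg_comp (dot nu) pos); last exact: continuous_pos.
      by apply: continuous_dot; [move=> ?; exact: cvg_cst|exact: continuous_id3].
    exact: (measurableT_comp mkap (@measurable_sqnorm3 R)).
  - by rewrite invr_ge0 ltW.
have [tX dX] := conv_test_field mA Aoo AN N0 T0 G1 G2 G3 kC gC zk H.
pose d w := ((g1 w).1.1 + (g2 w).1.2 + (g3 w).2)%R.
exists (fun x => (conv A k1 x, conv A k2 x, conv A k3 x)), d; split=> //.
- have c1 := continuous_coord1 cg1; have c2 := continuous_coord2 cg2.
  have c3 := continuous_coord3 cg3.
  by move=> w; exact: (cvgD (cvgD (c1 w) (c2 w)) (c3 w)).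
- exists (C + C + C)%R => w; have [a b z] := gC w.
  apply: (le_trans (ler_normD _ _)); apply: lerD.
    apply: (le_trans (ler_normD _ _)); apply: lerD.
      exact: le_trans (norm_coord1_le _) a.
    exact: le_trans (norm_coord2_le _) b.
  exact: le_trans (norm_coord3_le _) z.
- move=> w; have [_ _ _ F] := facts w.
  have -> : d w = (c^-1 * (3 * kap (enorm w ^+ 2) + 2 * enorm w ^+ 2 * dkap (enorm w ^+ 2)))%R.
    rewrite enorm_sqr /d /g1 /g2 /g3 /e1 /e2 /e3 /dot /= /GRing.scale /=; ring.
  by rewrite ler_wpM2l// invr_ge0 ltW.
Qed.

End key_estimate.

Section key_ineq.
Context {R : realType}.
Notation mR := (measurableTypeR R).
Notation E2 := (mR * mR)%type.
Notation E3 := (E2 * mR)%type.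
Notation leb3 := (@leb3 R).
Notation leb6 := (@leb6 R).
Notation R3 := (R * R * R)%type.
Local Open Scope ereal_scope.

Lemma near_lty A B t : measurable A -> measurable B -> leb3 A < +oo ->
  near_pairs A B t < +oo.
Proof.
move=> mA mB Aoo; apply: (@le_lt_trans _ _ (near_pairs A setT t)).
  exact: le_near.
rewrite (near_setT t mA); have := @measure_vic_lty R setT t 0%R measurableT.
rewrite vic_setT => Boo; apply: (lte_mul_pinfty (measure_ge0 leb3 A) _ Boo).
by rewrite (ge0_fin_numE (measure_ge0 leb3 A)).
Qed.

Lemma near_ge0 (A B : set E3) t : 0 <= near_pairs A B t.
Proof. exact: (@measure_ge0 _ _ R leb6). Qed.

Lemma near_fin_num A B t : measurable A -> measurable B -> leb3 A < +oo ->
  near_pairs A B t \is a fin_num.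
Proof. by move=> mA mB Aoo; rewrite (ge0_fin_numE (near_ge0 A B t)); exact: near_lty. Qed.

Lemma Rintegral_vic (B : set E3) t (x : R3) : measurable B ->
  (\int[leb3]_(y in B) (\1_[set r | r < t] (enorm (x - (y : R3)))))%R =
  fine (leb3 (vic B t x)).
Proof.
move=> mB; rewrite /Rintegral; congr fine.
transitivity (\int[leb3]_(y in B) (\1_(vic B t x) y : R)%:E).
  apply: eq_integral => y; rewrite inE => By; congr (_%:E).
  rewrite !indicE; congr (nat_of_bool _)%:R.
  by apply/idP/idP; rewrite !inE /vic /=; [split|move=> []].
rewrite (integral_indic _ mB (measurable_vic t x mB)).
by rewrite (_ : _ `&` _ = vic B t x)//; apply/setIidl => y [].
Qed.

Lemma integrable_vic (A B : set E3) t : measurable A -> measurable B ->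
  leb3 A < +oo ->
  leb3.-integrable A (EFin \o (fun x => fine (leb3 (vic B t x)))).
Proof.
move=> mA mB Aoo; apply: (@integrable_bounded _ _ _ (fine (leb3 (vic setT t 0%R)))) => //.
  by apply: (measurableT_comp (@fine_measurable _ setT measurableT)); exact: measurable_fun_vic.
move=> x; rewrite (ger0_norm (fine_ge0 (measure_ge0 leb3 _))).
have vfin C y : measurable C -> leb3 (vic C t y) \is a fin_num.
  by move=> mC; rewrite (ge0_fin_numE (measure_ge0 leb3 _)); exact: measure_vic_lty.
apply: fine_le; [exact: vfin|exact: vfin|].
rewrite vic_setT -(vic_setT t x).
by apply: le_measure; rewrite ?inE; [exact: measurable_vic..|move=> y []].
Qed.

Lemma integral_vic (A B : set E3) t : measurable A -> measurable B ->
  \int[leb3]_(x in A) (fine (leb3 (vic B t x)))%:E = near_pairs A B t.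
Proof.
move=> mA mB; rewrite nearE//; apply: eq_integral => x _; rewrite fineK//.
by rewrite ge0_fin_numE//; exact: measure_vic_lty.
Qed.

(** The field is built from [A] cut off by [box N], which gives it compact support, but its
    divergence is integrated over all of A. The bound of [kernel_field] on the divergence then
    counts pairs: those closer than sqrt (e^2 - h) with weight 3 e^-3, those closer than T with
    weight -3 T^-3. *)
Lemma key_ineq (A : set E3) (p N e h T : R) : measurable A -> leb3 A < +oo ->
  perimeter A <= p%:E ->
  (0 <= N)%R -> (0 < e)%R -> (0 < h)%R -> (0 < T)%R -> (h < e ^+ 2)%R ->
  (e ^+ 2 + h <= T ^+ 2)%R ->
  (3 * e ^- 3 * fine (near_pairs A (A `&` box N) (Num.sqrt (e ^+ 2 - h))) <=
  3 * T ^- 3 * fine (near_pairs A A T) + 3 * pi / 4 * T * p)%R.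
Proof.
move=> mA Aoo Ap N0 e0 h0 T0 he eT.
set AN := A `&` box N; set del := Num.sqrt _.
have mAN : measurable AN by apply: measurableI => //; exact: measurable_box.
have ANA : AN `<=` A by move=> x [].
have ANoo : leb3 AN < +oo by apply: le_lt_trans Aoo; apply: le_measure; rewrite ?inE.
pose c : R := (3 * pi / 4 * T)%R.
have c0 : (0 < c)%R by rewrite !mulr_gt0 ?invr_gt0 ?pi_gt0.
have [X [d [tX cd [C dC] divX dge]]] := kernel_field mAN ANoo (@subIsetr _ _ _) N0 e0 h0 T0 he eT.
have {}dge w : (c^-1 * (3 * e ^- 3) * (\1_[set r | r < del] (enorm w)) -
    c^-1 * (3 * T ^- 3) * (\1_[set r | r < T] (enorm w)) <= d w)%R.
  apply: le_trans (dge w); rewrite -/c le_eqVlt; apply/orP; left; apply/eqP.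
  have -> : \1_[set r | (r < del)%R] (enorm w) =
      \1_[set r | (r ^+ 2 < e ^+ 2 - h)%R] (enorm w) :> R.
    rewrite !indicE; congr (nat_of_bool _)%:R.
    have -> : (e ^+ 2 - h = del ^+ 2)%R by rewrite sqr_sqrtr// subr_ge0 ltW.
    apply/idP/idP; rewrite !inE /=; first by move=> ?; rewrite ltr_sqr ?nnegrE ?sqrtr_ge0 ?enorm_ge0.
    by rewrite ltr_sqr ?nnegrE ?sqrtr_ge0 ?enorm_ge0.
  by ring.
pose u x := fine (leb3 (vic AN del x)); pose v x := fine (leb3 (vic AN T x)).
pose f (x : E3) := (c^-1 * (3 * e ^- 3) * u x - c^-1 * (3 * T ^- 3) * v x)%R.
have iind (x : E3) (t : R) : leb3.-integrable AN
    (EFin \o (fun y : E3 => \1_[set r | (r < t)%R] (enorm ((x : R3) - y)%R) : R)).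
  apply: (@integrable_bounded _ _ _ 1%R) => //.
    have -> : (fun y : E3 => \1_[set r | (r < t)%R] (enorm ((x : R3) - y)%R) : R) = \1_(vic setT t x).
      apply/funext => y; rewrite !indicE; congr (nat_of_bool _)%:R.
      by apply/idP/idP; rewrite !inE /vic /=; [split|move=> []].
    by apply: measurable_indic; exact: measurable_vic.
  by move=> y; rewrite indicE; case: (_ \in _); rewrite ?normr1 ?normr0.
have fdiv x : (f x <= divergence X x)%R.
  rewrite divX /f /u /v -!Rintegral_vic// -!RintegralZl//.
  have z t a : leb3.-integrable AN (EFin \o (fun y : E3 => a * \1_[set r | (r < t)%R] (enorm ((x : R3) - y)%R))%R).
    by have := integrableZl mAN a (iind x t); apply: eq_integrable.
  rewrite -RintegralB//; apply: le_Rintegral => //.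
  - by have := integrableB mAN (z del (c^-1 * (3 * e ^- 3))%R) (z T (c^-1 * (3 * T ^- 3))%R); apply: eq_integrable.
  - exact: (integrable_reflect mAN ANoo x cd dC).
have iu := integrable_vic del mA mAN Aoo; have iv := integrable_vic T mA mAN Aoo.
have zu : leb3.-integrable A (EFin \o (fun x => c^-1 * (3 * e ^- 3) * u x)%R).
  by have := integrableZl mA (c^-1 * (3 * e ^- 3))%R iu; apply: eq_integrable.
have zv : leb3.-integrable A (EFin \o (fun x => c^-1 * (3 * T ^- 3) * v x)%R).
  by have := integrableZl mA (c^-1 * (3 * T ^- 3))%R iv; apply: eq_integrable.
have H : (\int[leb3]_(x in A) f x <= p)%R.
  have if_ : leb3.-integrable A (EFin \o f).
    by have := integrableB mA zu zv; apply: eq_integrable.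
  have idv := integrable_divergence mA tX Aoo.
  apply: (@le_trans _ _ (\int[leb3]_(x in A) divergence X x)%R).
    by apply: le_Rintegral => // x _; exact: fdiv.
  rewrite -lee_fin /Rintegral fineK; last exact: integrable_fin_num.
  exact: le_trans (perimeter_ge mA tX) Ap.
move: H; rewrite /f (RintegralB mA zu zv) (RintegralZl _ mA iu) (RintegralZl _ mA iv) /Rintegral.
rewrite !integral_vic// => H.
have f1 := near_fin_num T mA mAN Aoo; have f2 := near_fin_num T mA mA Aoo.
have mono := fine_le f1 f2 (le_near T mA mA mAN mA (@subset_refl _ A) ANA).
have T3 : (0 <= 3 * T ^- 3)%R by rewrite mulr_ge0// invr_ge0 exprn_ge0// ltW.
move: H; rewrite -!(mulrA c^-1%R) -mulrBr ler_pdivrMl// -/c lerBlDl => /le_trans.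
by apply; rewrite lerD2r ler_wpM2l.
Qed.

End key_ineq.

(** * Continuity of translations in measure *)

Section translation.
Context {R : realType}.
Notation lam := (@lebesgue_measure R).
Notation mR := (measurableTypeR R).
Notation E2 := (mR * mR)%type.
Notation E3 := (E2 * mR)%type.
Notation leb2 := (@leb2 R).
Notation leb3 := (@leb3 R).
Notation R3 := (R * R * R)%type.
Local Open Scope ereal_scope.

Lemma measure_subU d (T : measurableType d) (m : {measure set T -> \bar R})
    (A B C : set T) : measurable A -> measurable B -> measurable C ->
  A `<=` B `|` C -> m A <= m B + m C.
Proof.
move=> mA mB mC ABC; apply: le_trans (measureU2 m mB mC).
by apply: le_measure; rewrite ?inE//; exact: measurableU.
Qed.

Lemma cvge_near_lt (u : nat -> \bar R) (l b : \bar R) : u n @[n --> \oo] --> l ->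
  l < b -> exists n, u n < b.
Proof.
move=> ul lb; have : \forall n \near \oo, u n < b.
  by have := ul _ (open_ereal_lt' lb).
by move=> [n _ /(_ n (leqnn n))]; exists n.
Qed.

Lemma leb3_setX (A B C : set mR) : measurable A -> measurable B -> measurable C ->
  leb3 ((A `*` B) `*` C) = lam A * lam B * lam C.
Proof.
move=> mA mB mC; have mAB : measurable (A `*` B : set E2) by exact: measurableX.
rewrite [LHS](@product_measure1E _ _ _ _ _ leb2 lam _ _ mAB mC).
by congr (_ * _); exact: (@product_measure1E _ _ _ _ _ lam lam _ _ mA mB).
Qed.

Lemma lebesgue_measure_seg (a b : R) : (a <= b)%R -> lam `[a, b] = (b - a)%:E.
Proof.
rewrite le_eqVlt => /predU1P[->|ab].
  by rewrite subrr set_itv1 lebesgue_measure_set1.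
by rewrite lebesgue_measure_itv /= lte_fin ab -EFinB.
Qed.

Lemma leb3_brick (a1 b1 a2 b2 a3 b3 : R) : (a1 <= b1)%R -> (a2 <= b2)%R ->
  (a3 <= b3)%R ->
  leb3 ((`[a1, b1] `*` `[a2, b2]) `*` `[a3, b3]) =
  ((b1 - a1) * (b2 - a2) * (b3 - a3))%:E.
Proof. by move=> *; rewrite leb3_setX// !lebesgue_measure_seg// -!EFinM. Qed.

Lemma measurable_shift3 (w : R3) (A : set E3) : measurable A ->
  measurable [set x : E3 | A ((x : R3) - w)%R].
Proof.
move=> mA; have [ms _] := @preserves_shift R (- w)%R.
by rewrite -[X in measurable X]setTI; exact: ms.
Qed.

Lemma leb3_shift (w : R3) (A : set E3) : measurable A ->
  leb3 [set x : E3 | A ((x : R3) - w)%R] = leb3 A.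
Proof. by move=> mA; exact: (preserves_set (@preserves_shift R (- w)%R) mA). Qed.

Definition changes (A : set E3) (w : R3) : set E3 :=
  [set x : E3 | A x <> A ((x : R3) - w)%R].

Lemma changesP A w x : changes A w x <->
  (A x /\ ~ A ((x : R3) - w)%R) \/ (~ A x /\ A ((x : R3) - w)%R).
Proof.
split; last by move=> [[a na]|[na a]] e; [apply: na; rewrite -e|apply: na; rewrite e].
move=> ne; have [a|na] := pselect (A x); [left|right]; split => //.
  by move=> b; apply: ne; apply/propext.
apply: contrapT => nb; apply: ne; apply/propext; tauto.
Qed.

Lemma measurable_changes A w : measurable A -> measurable (changes A w).
Proof.
move=> mA; have mS := measurable_shift3 w mA.
have -> : changes A w = (A `\` [set x : E3 | A ((x : R3) - w)%R]) `|`
    ([set x : E3 | A ((x : R3) - w)%R] `\` A).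
  by apply/seteqP; split=> x; rewrite changesP /= /setD /=; tauto.
by apply: measurableU; exact: measurableD.
Qed.

(** Local continuity in measure under small translations. Measurability is part of the property so
    that the sets satisfying it can be shown to form a sigma-algebra; only half-spaces then remain
    to be checked. *)
Definition transl_cont (A : set E3) := measurable A /\
  forall N eps : R, (0 < N -> 0 < eps ->
    exists2 d, 0 < d & forall w, enorm w < d ->
      (leb3 (box N `&` changes A w) <= eps%:E)%E)%R.

Lemma measurable_box_changes N A w : measurable A ->
  measurable (box N `&` changes A w : set E3).
Proof.
by move=> mA; apply: measurableI; [exact: measurable_box|exact: measurable_changes].
Qed.

Lemma transl_cont0 : transl_cont set0.
Proof.
split=> // N eps N0 e0; exists 1%R => // w _.
by rewrite (_ : _ `&` _ = set0) ?measure0 ?lee_fin ?ltW//; apply/seteqP; split=> // x [_ []].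
Qed.

Lemma transl_contC A : transl_cont A -> transl_cont (~` A).
Proof.
move=> [mA H]; split; first exact: measurableC.
move=> N eps N0 e0; have [d d0 dP] := H N eps N0 e0; exists d => // w /dP.
rewrite (_ : changes (~` A) w = changes A w)//.
apply/seteqP; split=> x; rewrite !changesP /setC /=;
  have := pselect (A x); have := pselect (A ((x : R3) - w)%R); tauto.
Qed.

Lemma transl_contU A B : transl_cont A -> transl_cont B -> transl_cont (A `|` B).
Proof.
move=> [mA HA] [mB HB]; split; first exact: measurableU.
move=> N eps N0 e0; have e20 : (0 < eps / 2)%R by rewrite divr_gt0.
have [d1 d10 dP1] := HA _ _ N0 e20; have [d2 d20 dP2] := HB _ _ N0 e20.
exists (Num.min d1 d2); first by rewrite lt_min d10 d20.
move=> w; rewrite lt_min => /andP[/dP1 w1 /dP2 w2].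
rewrite (splitr eps) EFinD; apply: (le_trans _ (leeD w1 w2)).
have mAB := measurableU _ _ mA mB.
apply: (measure_subU leb3 (measurable_box_changes N w mAB)
  (measurable_box_changes N w mA) (measurable_box_changes N w mB)).
move=> x [bx]; rewrite changesP /setU /setI /= !changesP.
have := pselect (A x); have := pselect (A ((x : R3) - w)%R).
have := pselect (B x); have := pselect (B ((x : R3) - w)%R); tauto.
Qed.

Lemma box_lty N : leb3 (box N) < +oo.
Proof.
have [N0|N0] := leP 0%R N.
  have NN : (- N <= N)%R by rewrite ge0_cp.
  by rewrite [X in X < _](leb3_brick NN NN NN) ltry.
rewrite (_ : box N = set0) ?measure0//; apply/seteqP; split=> // x /boxE[h _ _].
by have := le_lt_trans h N0; rewrite normr_lt0.
Qed.

(** A finite union G n is handled by [transl_contU]. What it misses inside [box (N + 1)] is [H n],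
    of small measure by continuity from above. The larger box contains x - w for x in [box N] and
    |w| < 1, so [H n] and its translate account for all remaining changes: hence eps / 2 + eps / 4 +
    eps / 4. *)
Lemma transl_cont_bigcup (F : (set E3)^nat) : (forall n, transl_cont (F n)) ->
  transl_cont (\bigcup_n F n).
Proof.
move=> HF; have mF n : measurable (F n) := (HF n).1.
have mU : measurable (\bigcup_n F n) by exact: bigcupT_measurable.
split=> // N eps N0 e0.
pose G n := \big[setU/set0]_(i < n) F i.
have GT n : transl_cont (G n).
  rewrite /G; elim: n => [|n IH]; first by rewrite big_ord0; exact: transl_cont0.
  by rewrite big_ord_recr /=; exact: transl_contU.
have mG n : measurable (G n) := (GT n).1.
have GE n : G n = \bigcup_(i in `I_n) F i by rewrite bigcup_mkord.
pose H n : set E3 := box (N + 1)%R `&` ((\bigcup_n F n) `\` G n).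
have mH n : measurable (H n).
  by apply: measurableI; [exact: measurable_box|exact: measurableD].
have H0 : \bigcap_n H n = set0.
  apply/seteqP; split=> // x hx; have [_ [[n _ Fnx] _]] := hx 0%N I.
  have [_ [_]] := hx n.+1 I; rewrite GE; apply; exists n => //=.
have cvH : leb3 (H n) @[n --> \oo] --> 0.
  rewrite -(@measure0 _ _ _ leb3) -H0; apply: (@nonincreasing_cvg_mu _ _ _ leb3).
  - by apply: (le_lt_trans _ (box_lty (N + 1))); apply: le_measure;
      rewrite ?inE; [exact: mH|exact: measurable_box|move=> x []].
  - exact: mH.
  - by rewrite H0.
  - move=> m n mn; apply/subsetPset => x [bx [Ux nG]]; split=> //; split=> //.
    move=> Gm; apply: nG; move: Gm; rewrite !GE => -[i /= im Fi]; exists i => //=.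
    exact: leq_trans im mn.
have e40 : (0 < eps / 4)%R by rewrite divr_gt0.
have [n Hn] : exists n, leb3 (H n) <= (eps / 4)%:E.
  by have [|n /ltW] := cvge_near_lt cvH (b := (eps / 4)%:E); [rewrite lte_fin|exists n].
have e20 : (0 < eps / 2)%R by rewrite divr_gt0.
have [d d0 dP] := (GT n).2 _ _ N0 e20.
exists (Num.min d 1)%R; first by rewrite lt_min d0 ltr01.
move=> w; rewrite lt_min => /andP[/dP wd w1].
have mHw := measurable_shift3 w (mH n).
have Hw := leb3_shift w (mH n).
have -> : eps = (eps / 2 + (eps / 4 + eps / 4))%R by field.
rewrite !EFinD; apply: (@le_trans _ _ (leb3 (box N `&` changes (G n) w) +
    (leb3 (H n) + leb3 [set x : E3 | H n ((x : R3) - w)%R]))); last first.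
  by rewrite Hw; apply: leeD => //; exact: leeD.
apply: (@le_trans _ _ (leb3 (box N `&` changes (G n) w) + leb3 (H n `|` [set x : E3 | H n ((x : R3) - w)%R]))).
  apply: (measure_subU leb3 (measurable_box_changes N w mU)
    (measurable_box_changes N w (mG n)) (measurableU _ _ (mH n) mHw)).
  move=> x [bx]; have GU y : G n y -> (\bigcup_n F n) y.
    by rewrite GE => -[i _ Fi]; exists i.
  have /boxE[b1 b2 b3] := bx.
  have bx1 : box (N + 1) x.
    by apply/boxE; split; [apply: (le_trans b1)|apply: (le_trans b2)|apply: (le_trans b3)];
      rewrite lerDl.
  have bxw : box (N + 1) (x - w)%R.
    have [n1 n2 n3] := And3 (norm_coord1_le w) (norm_coord2_le w) (norm_coord3_le w).
    apply/boxE; split; apply: (le_trans (ler_normB _ _)).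
    - exact: (lerD b1 (le_trans n1 (ltW w1))).
    - exact: (lerD b2 (le_trans n2 (ltW w1))).
    - exact: (lerD b3 (le_trans n3 (ltW w1))).
  rewrite changesP => h; have [] := pselect (changes (G n) w x); first by left.
  rewrite changesP /H /setI /setD /setU /= => nc.
  have Gx := GU x; have Gxw := GU (x - w)%R; right; tauto.
by rewrite leeD2l//; exact: (measureU2 leb3 (mH n) mHw).
Qed.

End translation.

Section small_distances.
Context {R : realType}.
Notation mR := (measurableTypeR R).
Notation E2 := (mR * mR)%type.
Notation E3 := (E2 * mR)%type.
Notation E6 := (E3 * E3)%type.
Notation leb3 := (@leb3 R).
Notation R3 := (R * R * R)%type.
Local Open Scope ereal_scope.

Let transl_sigma_algebra : sigma_algebra setT (@transl_cont R).
Proof.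
split; [exact: transl_cont0| |exact: transl_cont_bigcup].
by move=> A tA; rewrite setTD; exact: transl_contC.
Qed.

(** A point changes side only if it lies in the slab |proj x - a| <= |w|, which meets the box in
    volume at most 2 |w| (2 N)^2. *)
Let transl_cont_halfspace (proj : E3 -> R) :
  measurable_fun setT proj ->
  (forall x w : R3, proj (x - w) = proj x - proj w)%R ->
  (forall x, `|proj x| <= enorm x)%R ->
  (forall N a eta : R, (0 <= N -> 0 <= eta -> exists2 Q : set E3,
     measurable Q /\ leb3 Q = (2 * eta * (N + N) ^+ 2)%:E &
     box N `&` [set x | `|proj x - a| <= eta] `<=` Q)%R) ->
  forall a, transl_cont [set x | proj x < a]%R.
Proof.
move=> mp linp lep brick a; have mA : measurable [set x | proj x < a]%R.
  exact: measurable_lt.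
split=> // N eps N0 e0.
have c0 : (0 < 2 * (N + N) ^+ 2)%R by rewrite mulr_gt0// exprn_gt0// addr_gt0.
exists (eps / (2 * (N + N) ^+ 2))%R; first by rewrite divr_gt0.
move=> w wd; have [Q [mQ QE] sub] := brick N a (enorm w) (ltW N0) (enorm_ge0 w).
apply: (@le_trans _ _ (leb3 Q)).
  apply: le_measure; rewrite ?inE//; first exact: measurable_box_changes.
  move=> x [bx]; rewrite changesP /= linp => h; apply: sub; split=> //=.
  have := lep w; move: (enorm w) => e; rewrite !ler_norml => /andP[l1 l2].
  case: h => -[h1 h2].
    by apply/andP; move: h2 => /negP; rewrite -leNgt => h2; split; lra.
  by apply/andP; move: h1 => /negP; rewrite -leNgt => h1; split; lra.
rewrite QE lee_fin (_ : (2 * enorm w * (N + N) ^+ 2 = enorm w * (2 * (N + N) ^+ 2))%R).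
  by rewrite -ler_pdivlMr// ltW.
by ring.
Qed.

Let transl_cont_coord1 (a : R) : transl_cont [set x : E3 | x.1.1 < a]%R.
Proof.
apply: transl_cont_halfspace => //; [exact: measurable_coord1|exact: norm_coord1_le|].
move=> N b eta N0 eta0; exists ((`[b - eta, b + eta] `*` `[- N, N]) `*` `[- N, N])%R.
  split; first by apply: measurableX => //; exact: measurableX.
  by rewrite leb3_brick ?opprK ?ge0_cp//; [congr (_%:E); ring|lra].
move=> x [/boxE[b1 b2 b3]] /=; rewrite !in_itv /= -!ler_norml ler_distl => /andP[l1 l2].
by rewrite b2 b3 l1 l2.
Qed.

Let transl_cont_coord2 (a : R) : transl_cont [set x : E3 | x.1.2 < a]%R.
Proof.
apply: transl_cont_halfspace => //; [exact: measurable_coord2|exact: norm_coord2_le|].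
move=> N b eta N0 eta0; exists ((`[- N, N] `*` `[b - eta, b + eta]) `*` `[- N, N])%R.
  split; first by apply: measurableX => //; exact: measurableX.
  by rewrite leb3_brick ?opprK ?ge0_cp//; [congr (_%:E); ring|lra].
move=> x [/boxE[b1 b2 b3]] /=; rewrite !in_itv /= -!ler_norml ler_distl => /andP[l1 l2].
by rewrite b1 b3 l1 l2.
Qed.

Let transl_cont_coord3 (a : R) : transl_cont [set x : E3 | x.2 < a]%R.
Proof.
apply: transl_cont_halfspace => //; [exact: norm_coord3_le|].
move=> N b eta N0 eta0; exists ((`[- N, N] `*` `[- N, N]) `*` `[b - eta, b + eta])%R.
  split; first by apply: measurableX => //; exact: measurableX.
  by rewrite leb3_brick ?opprK ?ge0_cp//; [congr (_%:E); ring|lra].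
move=> x [/boxE[b1 b2 b3]] /=; rewrite !in_itv /= -!ler_norml ler_distl => /andP[l1 l2].
by rewrite b1 b2 l1 l2.
Qed.

(** The coordinates are measurable for the sigma-algebra of translation-continuous sets, hence so is
    the identity into the product space, which therefore pulls every measurable set back into that
    sigma-algebra. *)
Lemma measurable_transl_cont (A : set E3) : measurable A -> transl_cont A.
Proof.
pose T := g_sigma_algebraType (@transl_cont R).
have mco (f : E3 -> R) : (forall a, transl_cont [set x | f x < a]%R) ->
    measurable_fun setT (f : T -> mR).
  move=> tf; apply: (measurability _ (RGenInftyO.measurableE R)).
  move=> _ [_ [a ->] <-]; rewrite setTI; apply: sub_sigma_algebra.
  have -> : f @^-1` `]-oo, a[%classic = [set x | f x < a]%R.
    by apply/seteqP; split=> x /=; rewrite in_itv.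
  exact: tf.
have mid : measurable_fun setT (fun x : T => ((x : E3).1.1, (x : E3).1.2, (x : E3).2) : E3).
  apply/measurable_fun_pair; last exact: (mco (fun x => x.2) transl_cont_coord3).
  apply/measurable_fun_pair; first exact: (mco (fun x => x.1.1) transl_cont_coord1).
  exact: (mco (fun x => x.1.2) transl_cont_coord2).
move=> mA; have := mid measurableT _ mA.
rewrite setTI; rewrite (_ : _ @^-1` A = A); last by apply/seteqP; split=> -[[a b] c].
by rewrite /measurable /= (sigma_algebra_id transl_sigma_algebra).
Qed.

Lemma tail_small (A : set E3) eps : measurable A -> leb3 A < +oo -> (0 < eps)%R ->
  exists n : nat, leb3 (A `\` box n%:R) < eps%:E.
Proof.
move=> mA Aoo e0; have mb n : measurable (box n : set E3) := measurable_box n.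
have cv : leb3 (A `\` box n%:R) @[n --> \oo] --> 0.
  have E0 : \bigcap_n (A `\` box n%:R) = set0.
    apply/seteqP; split=> // x hx; have [_] := hx (Num.truncn (enorm x)).+1 I.
    by apply; apply: box_enorm; apply/ltW; rewrite truncnS_gt.
  rewrite -(@measure0 _ _ _ leb3) -E0; apply: (@nonincreasing_cvg_mu _ _ _ leb3).
  - apply: (le_lt_trans _ Aoo); apply: le_measure; rewrite ?inE//.
    exact: measurableD.
  - by move=> i; exact: measurableD.
  - by rewrite E0.
  - move=> m n mn; apply/subsetPset => x [Ax nb]; split=> // bm; apply: nb.
    have mn' : (m%:R <= n%:R :> R)%R by rewrite ler_nat.
    by move/boxE: bm => -[b1 b2 b3]; apply/boxE; split; apply: le_trans mn'.
by have [|n] := cvge_near_lt cv (b := eps%:E); [rewrite lte_fin|exists n].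
Qed.

(** Tonelli before and after the change of variables w = x - y. *)
Lemma nearE_shift (A B : set E3) t : measurable A -> measurable B ->
  near_pairs A B t =
  \int[leb3]_(w in ball3 t) leb3 [set x : E3 | A x /\ B ((x : R3) - w)%R].
Proof.
move=> mA mB.
pose S : set E6 := [set z | [/\ A z.1, B ((z.1 : R3) - z.2)%R & enorm z.2 < t]%R].
have mS : measurable S.
  have -> : S = (A `*` ball3 t) `&` (fun z : E6 => ((z.1 : R3) - z.2)%R : E3) @^-1` B.
    apply/seteqP; split=> z; rewrite /S /ball3 /=; first by move=> [].
    by move=> [[]].
  apply: measurableI; first by apply: measurable_setX6 => //; exact: measurable_ball3.
  by rewrite -[X in measurable X]setTI; exact: (@measurable_diff3 R).
have mi : measurable_fun setT (fun z : E6 => (\1_S z : R)%:E).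
  by apply/measurable_EFinP; exact: measurable_indic.
have i0 (z : E6) : 0 <= (\1_S z : R)%:E by rewrite lee_fin indicE ler0n.
have e1 := ge0_integral_leb6E mi i0; have e2 := ge0_integral_leb6E2 mi i0.
have ind (Q : set E3) : measurable Q -> \int[leb3]_x (\1_Q x : R)%:E = leb3 Q.
  by move=> mQ; rewrite (integral_indic _ measurableT mQ) setIT.
transitivity (\int[leb3]_x \int[leb3]_y (\1_S (x, y) : R)%:E).
  rewrite (nearE t mA mB) [LHS]integral_mkcond; apply: eq_integral => x _; rewrite patchE.
  have P := preserves_comp (@preserves_shift R x) (@preserves_opp R).
  case: ifPn; rewrite ?inE ?notin_setE => Ax.
    rewrite -(preserves_set P (measurable_vic t x mB)).
    apply: (etrans (esym (ind _ _))).
      by rewrite -[X in measurable X]setTI; apply: P.1 => //; exact: measurable_vic.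
    apply: eq_integral => y _; congr (_%:E); rewrite !indicE; congr (nat_of_bool _)%:R.
    by apply/idP/idP; rewrite !inE /S /vic /= ![(- _ + _)%R]addrC opprB addrCA subrr addr0;
      [move=> []|move=> [_]].
  by apply/esym/integral0_eq => y _; rewrite indicE memNset// => -[].
rewrite -e1 e2 [RHS]integral_mkcond; apply: eq_integral => w _; rewrite patchE.
case: ifPn; rewrite ?inE ?notin_setE /ball3 /= => wt.
  apply: etrans (ind _ (measurableI _ _ mA (measurable_shift3 w mB))).
  apply: eq_integral => y _; congr (_%:E); rewrite !indicE; congr (nat_of_bool _)%:R.
  by apply/idP/idP; rewrite !inE /S /=; [move=> []|move=> [? ?]; split].
by apply: integral0_eq => y _; rewrite indicE memNset// => -[].
Qed.

End small_distances.

Section near_pairs_bound.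
Context {R : realType}.
Notation mR := (measurableTypeR R).
Notation E2 := (mR * mR)%type.
Notation E3 := (E2 * mR)%type.
Notation E6 := (E3 * E3)%type.
Notation leb3 := (@leb3 R).
Notation R3 := (R * R * R)%type.
Local Open Scope ereal_scope.

(** For |w| < d a shift by w moves at most eps of the mass of B = A inside [box N] out of B. The
    integrand of [nearE_shift] is thus at least |B| - eps on the whole ball of radius t. *)
Lemma near_small (A : set E3) N eps : measurable A -> leb3 A < +oo ->
  (0 < N)%R -> (0 < eps)%R -> exists2 d, (0 < d)%R & forall t, (0 < t)%R -> (t < d)%R ->
  ((fine (leb3 (A `&` box N)) - eps) * (4 / 3 * pi * t ^+ 3) <=
   fine (near_pairs A (A `&` box N) t))%R.
Proof.
move=> mA Aoo N0 e0; set B := A `&` box N.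
have mB : measurable B by apply: measurableI => //; exact: measurable_box.
have BA : B `<=` A by move=> x [].
have Boo : leb3 B < +oo by apply: le_lt_trans Aoo; apply: le_measure; rewrite ?inE.
have [d d0 dP] := (measurable_transl_cont mB).2 N eps N0 e0.
exists d => // t t0 td.
have Bfin : leb3 B \is a fin_num by rewrite (ge0_fin_numE (measure_ge0 leb3 B)).
have [u0|u0] := leP (fine (leb3 B) - eps)%R 0%R.
  apply: (le_trans _ (fine_ge0 (near_ge0 A B t))).
  by rewrite mulr_le0_ge0// !mulr_ge0 ?exprn_ge0 ?pi_ge0// ltW.
rewrite -lee_fin (fineK (near_fin_num t mA mB Aoo)).
rewrite (nearE_shift t mA mB) EFinM -(ball3_volume (ltW t0)).
rewrite -(@integral_cst _ _ _ leb3 _ (measurable_ball3 t)).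
have mS w : measurable [set x : E3 | A x /\ B ((x : R3) - w)%R].
  exact: measurableI (measurable_shift3 w mB).
apply: ge0_le_integral => //.
- exact: measurable_ball3.
- by move=> w _; rewrite lee_fin ltW.
- apply: measurable_funTS.
  pose S : set E6 := [set z | A z.1 /\ B ((z.1 : R3) - z.2)%R].
  have mS6 : measurable S.
    have -> : S = (A `*` setT) `&` (fun z : E6 => ((z.1 : R3) - z.2)%R : E3) @^-1` B.
      by apply/seteqP; split=> z; rewrite /S /=; [move=> []|move=> [[]]].
    apply: measurableI; first exact: measurable_setX6.
    by rewrite -[X in measurable X]setTI; exact: (@measurable_diff3 R).
  have := measurable_fun_ysection leb3 mS6.
  apply: eq_measurable_fun => w _ /=; congr (leb3 _).
  by apply/seteqP; split=> x; rewrite /ysection /S /= inE.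
- move=> w wt; rewrite EFinB fineK// leeBlDr//.
  apply: (@le_trans _ _ (leb3 [set x : E3 | A x /\ B ((x : R3) - w)%R] +
    leb3 (box N `&` changes B w))).
    apply: (measure_subU leb3 mB (mS w) (measurable_box_changes N w mB)).
    move=> x Bx; have [h|h] := pselect (B ((x : R3) - w)%R); [left|right].
      by split=> //; exact: BA.
    by split; [case: Bx|rewrite changesP; left].
  by rewrite leeD2l//; apply: dP; exact: lt_trans td.
Qed.

(** The limit of [key_ineq] as e tends to 0 and N to infinity: by [near_small] the term 3 e^-3 G is
    asymptotically at least 4 pi |A|. The result is then multiplied by T^3 / 3. *)
Lemma key_estimate (A : set E3) (p T : R) : measurable A -> leb3 A < +oo ->
  perimeter A <= p%:E -> (0 < T)%R ->
  (4 / 3 * pi * T ^+ 3 * fine (leb3 A) <= fine (near_pairs A A T) + pi / 4 * T ^+ 4 * p)%R.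
Proof.
move=> mA Aoo Ap T0; set V := fine (leb3 A); set G := fine (near_pairs A A T).
have V0 : (0 <= V)%R by exact: fine_ge0 (measure_ge0 leb3 A).
have G0 : (0 <= G)%R by exact: fine_ge0 (near_ge0 A A T).
have p0 : (0 <= p)%R.
  rewrite -lee_fin; apply: le_trans Ap.
  apply: le_trans (perimeter_ge mA (@test_field0 R)).
  by apply: integral_ge0 => x _; rewrite divergence0.
pose K : R := (3 * T ^- 3 * G + 3 * pi / 4 * T * p)%R.
have K0 : (0 <= K)%R.
  by rewrite addr_ge0// !mulr_ge0 ?invr_ge0 ?exprn_ge0 ?pi_ge0 ?(ltW T0).
have step eps : (0 < eps)%R -> (eps < 1)%R ->
    (4 * pi * (V - eps * (2 + 3 * V)) <= K)%R.
  move=> e0 e1; have [n nA] := tail_small mA Aoo e0.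
  pose N : R := n.+1%:R; have N0 : (0 < N)%R by [].
  have mB : measurable (A `&` box N : set E3).
    by apply: measurableI => //; exact: measurable_box.
  have mC : measurable (A `\` box n%:R : set E3).
    by apply: measurableD => //; exact: measurable_box.
  have Bfin : leb3 (A `&` box N) \is a fin_num.
    rewrite (ge0_fin_numE (measure_ge0 leb3 _)); apply: le_lt_trans Aoo.
    by apply: le_measure; rewrite ?inE.
  have VN : (V - eps <= fine (leb3 (A `&` box N)))%R.
    rewrite lerBlDr -lee_fin EFinD !fineK ?(ge0_fin_numE (measure_ge0 leb3 A))//.
    apply: (@le_trans _ _ (leb3 (A `&` box N) + leb3 (A `\` box n%:R))).
      apply: (measure_subU leb3 mA mB mC) => x Ax.
      have [h|h] := pselect (box n%:R x); [left|right] => //; split=> //.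
      have nN : (n%:R <= N :> R)%R by rewrite ler_nat.
      by move/boxE: h => -[b1 b2 b3]; apply/boxE; split; apply: le_trans nN.
    by rewrite leeD2l// ltW.
  have [d d0 dP] := near_small mA Aoo N0 e0.
  (* [h] below is chosen so that sqrt (e^2 - h) = th * e, a radius close to e. The losses combine as
     (V - 2 eps) th^3 >= V - eps (2 + 3 V), since th^3 >= 1 - 3 eps. *)
  pose th : R := (1 - eps)%R; have th0 : (0 < th)%R by rewrite /th; lra.
  have th1 : (th < 1)%R by rewrite /th; lra.
  pose e := (Num.min d T / 2)%R.
  have m0 : (0 < Num.min d T)%R by rewrite lt_min d0 T0.
  have eT : (2 * e <= T)%R by rewrite /e mulrC divfK// ge_min lexx orbT.
  have ed : (2 * e <= d)%R by rewrite /e mulrC divfK// ge_min lexx.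
  have ep : (0 < e)%R by rewrite divr_gt0.
  pose h := (e ^+ 2 - (th * e) ^+ 2)%R.
  have h1 : (0 < h)%R.
    have -> : (h = (1 - th) * (1 + th) * e ^+ 2)%R by rewrite /h; ring.
    by rewrite !mulr_gt0 ?exprn_gt0//; clear -th0 th1; lra.
  have h2 : (h < e ^+ 2)%R by rewrite /h gtrBl exprn_gt0// mulr_gt0.
  have h3 : (e ^+ 2 + h <= T ^+ 2)%R.
    have : ((2 * e) ^+ 2 <= T ^+ 2)%R by rewrite lerXn2r ?nnegrE ?(ltW T0)// mulr_ge0// ltW.
    rewrite /h (_ : (2 * e) ^+ 2 = 4 * e ^+ 2)%R; last by ring.
    by have := sqr_ge0 e; have := sqr_ge0 (th * e)%R; move=> *; lra.
  have the : (0 < th * e)%R by rewrite mulr_gt0.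
  have H2 : (3 * e ^- 3 * fine (near_pairs A (A `&` box N) (th * e)) <= K)%R.
    have := key_ineq mA Aoo Ap (ltW N0) ep h1 T0 h2 h3.
    rewrite (_ : e ^+ 2 - h = (th * e) ^+ 2)%R; last by rewrite /h; ring.
    by rewrite sqrtr_sqr (gtr0_norm the).
  have thd : (th * e < d)%R by apply: lt_le_trans ed; nra.
  have H1 := dP _ the thd.
  move: (fine (leb3 (A `&` box N))) VN H1 => VN VNle H1.
  move: (fine (near_pairs A (A `&` box N) (th * e))) H1 H2 => Gn H1 H2; apply: le_trans H2.
  have e3 : (0 <= 3 * e ^- 3)%R by rewrite mulr_ge0// invr_ge0 exprn_ge0// ltW.
  apply: le_trans (ler_wpM2l e3 H1).
  have -> : (3 * e ^- 3 * ((VN - eps) * (4 / 3 * pi * (th * e) ^+ 3)) =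
     4 * pi * ((VN - eps) * th ^+ 3))%R.
    by field; rewrite gt_eqF.
  have p4 : (0 <= 4 * pi :> R)%R by rewrite mulr_ge0// pi_ge0.
  apply: (ler_wpM2l p4).
  apply: (@le_trans _ _ ((V - 2 * eps) * th ^+ 3)%R); last first.
    by rewrite ler_wpM2r ?exprn_ge0 ?(ltW th0)//; clear -VNle; lra.
  have t3 : (1 - 3 * eps <= th ^+ 3)%R by rewrite /th; nra.
  have t31 : (th ^+ 3 <= 1)%R by rewrite exprn_ile1// ltW.
  have t30 : (0 <= th ^+ 3)%R by rewrite exprn_ge0// ltW.
  move: (th ^+ 3)%R t3 t31 t30 => t t3 t31 t30.
  by nra.
have fin : (4 * pi * V <= K)%R.
  apply/ler_addgt0Pr => x x0.
  have c0 : (0 < 4 * pi * (2 + 3 * V) + 1)%R.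
    by rewrite ltr_wpDl// !mulr_ge0 ?pi_ge0// addr_ge0// mulr_ge0.
  pose eps := Num.min (2^-1)%R (x / (4 * pi * (2 + 3 * V) + 1))%R.
  have e0 : (0 < eps)%R by rewrite lt_min invr_gt0 ltr0n divr_gt0.
  have e1 : (eps < 1)%R by rewrite gt_min; apply/orP; left; lra.
  have := step _ e0 e1.
  have ex : (eps * (4 * pi * (2 + 3 * V) + 1) <= x)%R.
    by rewrite -ler_pdivlMr// ge_min lexx orbT.
  move: ex; rewrite mulrBr !mulrDr mulr1; lra.
have T3 : (0 < T ^+ 3 / 3)%R by rewrite divr_gt0// exprn_gt0.
have := ler_wpM2l (ltW T3) fin.
have -> : (T ^+ 3 / 3 * K = G + pi / 4 * T ^+ 4 * p)%R by rewrite /K; field; rewrite gt_eqF.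
by apply: le_trans; rewrite le_eqVlt; apply/orP; left; apply/eqP; field.
Qed.

End near_pairs_bound.

(** * Cutting a set along level sets *)

Section cut.
Context {R : realType}.
Notation mR := (measurableTypeR R).
Notation E2 := (mR * mR)%type.
Notation E3 := (E2 * mR)%type.
Notation R3 := (R * R * R)%type.
Local Open Scope ereal_scope.

Lemma grad3B (f1 f2 : R3 -> R) (g1 g2 : R3 -> R3) : grad3 f1 g1 -> grad3 f2 g2 ->
  grad3 (fun x => f1 x - f2 x)%R (fun x => g1 x - g2 x)%R.
Proof.
move=> G1 G2; apply: (grad3_ext (grad3D G1 (grad3M (grad3_cst (-1)%R) G2))) => x /=.
  by rewrite mulN1r.
by rewrite scaler0 addr0 scaleN1r.
Qed.

(** A C^1 transition from 0 for u <= t to 1 for u >= t + 2 / n. Its derivative is n times a tent of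
    height 1, so the slope stays below n on a strip of width 2 / n. *)
Definition step (n : nat) (t u : R) : R :=
  (sramp (n%:R * u + (- (n%:R * t) - 1)) - sramp (n%:R * u + (- (n%:R * t) - 2)))%R.
Definition dstep (n : nat) (t u : R) : R :=
  (n%:R * ramp (n%:R * u + (- (n%:R * t) - 1)) -
   n%:R * ramp (n%:R * u + (- (n%:R * t) - 2)))%R.

Lemma is_derive_step n t (u : R) : is_derive u (1%R : R) (step n t) (dstep n t u).
Proof.
have d1 := @is_derive_aff _ _ _ n%:R (- (n%:R * t) - 1)%R u is_derive_sramp.
have d2 := @is_derive_aff _ _ _ n%:R (- (n%:R * t) - 2)%R u is_derive_sramp.
by rewrite /step; apply: is_derive_eq.
Qed.

Lemma continuous_dstep n t : continuous (dstep n t).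
Proof.
have c a : continuous (fun u : R => n%:R * ramp (n%:R * u + a))%R.
  move=> u; apply: (cvgM (cvg_cst _)).
  apply: (cvg_comp (fun u => n%:R * u + a)%R ramp); last exact: continuous_ramp.
  exact: (cvgD (cvgM (cvg_cst _) (@cvg_id _ _)) (cvg_cst _)).
by move=> u; exact: (cvgB (c _ u) (c _ u)).
Qed.

Lemma step_facts n (t u : R) : (0 < n)%N -> [/\ 0 <= step n t u <= 1,
  `|dstep n t u| <= n%:R, u <= t -> step n t u = 0 /\ dstep n t u = 0 &
  t + 2 / n%:R <= u -> step n t u = 1 /\ dstep n t u = 0]%R.
Proof.
move=> n0; have n0' : (0 < n%:R :> R)%R by rewrite ltr0n.
rewrite /step /dstep.
have -> : (n%:R * u + (- (n%:R * t) - 2) = n%:R * u + (- (n%:R * t) - 1) - 1)%R by ring.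
have H1 : (u <= t -> n%:R * u + (- (n%:R * t) - 1) <= -1)%R.
  by move=> /(ler_wpM2l (ltW n0')); lra.
have H2 : (t + 2 / n%:R <= u -> 1 <= n%:R * u + (- (n%:R * t) - 1))%R.
  move=> /(ler_wpM2l (ltW n0')).
  have -> : (n%:R * (t + 2 / n%:R) = n%:R * t + 2)%R by field; rewrite gt_eqF.
  lra.
move: (n%:R * u + _)%R H1 H2 => v H1 H2.
have r0 := ramp_ge0 v; have r1 := ramp_le1 v.
have s0 := ramp_ge0 (v - 1); have s1 := ramp_le1 (v - 1).
split.
- have [v0|v0] := lerP v (-1).
    by rewrite (srampE0 v0) srampE0; [rewrite subrr lexx ler01|lra].
  have [v1|v1] := lerP v 0.
    rewrite (srampE (ltW v0) v1) srampE0; last lra.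
    by rewrite subr0 divr_ge0 ?sqr_ge0//= ler_pdivrMr//; nra.
  have [v2|v2] := lerP v 1.
    rewrite (srampE1 (ltW v1)) (srampE (_ : -1 <= v - 1)%R (_ : v - 1 <= 0)%R); [|lra|lra].
    by apply/andP; split; nra.
  rewrite (srampE1 (ltW v1)) (srampE1 (_ : 0 <= v - 1)%R); last lra.
  by apply/andP; split; lra.
- rewrite -mulrBr normrM ger0_norm ?(ltW n0')// ler_piMr// ?(ltW n0')// ler_norml.
  by apply/andP; split; lra.
- move=> /H1 v1; rewrite (srampE0 v1) (rampE0 v1) srampE0 ?rampE0; [|lra|lra].
  by rewrite !subrr.
- move=> /H2 v1; rewrite !srampE1 ?rampE1; [|lra..].
  by rewrite subrr; split=> //; lra.
Qed.

Lemma measurable_sublevel (psi : R3 -> R) (t : R) : continuous psi ->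
  measurable [set x : E3 | (psi x <= t)%R].
Proof.
move=> /continuous_measurable3 mf.
have -> : [set x | (psi x <= t)%R] = setT `&` psi @^-1` `]-oo, t]%classic.
  by rewrite setTI; apply/seteqP; split=> p /=; rewrite in_itv.
exact: mf.
Qed.

Definition strip (psi : R3 -> R) (t h : R) : set E3 :=
  [set x : E3 | (t < psi x)%R /\ (psi x <= t + h)%R].

Lemma stripE psi t h : strip psi t h = [set x | (psi x <= t + h)%R] `\` [set x | (psi x <= t)%R].
Proof.
apply/seteqP; split=> x; rewrite /strip /setD /=; first by move=> [? ->]; split=> //; apply/negP; rewrite -ltNge.
by move=> [-> /negP]; rewrite -ltNge.
Qed.

Lemma measurable_strip psi t h : continuous psi -> measurable (strip psi t h).
Proof. by move=> cpsi; rewrite stripE; apply: measurableD; exact: measurable_sublevel. Qed.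

Let interp_le (S D E w K : R) : (0 <= S -> S <= 1 -> - K <= w ->
  E <= D + S * (E - D) + w + (`|D| + `|E| + K))%R.
Proof.
move=> s0 s1 w1.
have h1 : (0 <= (1 - S) * (`|E| - E))%R by rewrite mulr_ge0 ?subr_ge0 ?ler_norm.
have h2 : (0 <= (1 - S) * (`|D| + D))%R.
  by rewrite mulr_ge0 ?subr_ge0// -lerBlDr sub0r -normrN ler_norm.
have h3 := mulr_ge0 s0 (normr_ge0 D); have h4 := mulr_ge0 s0 (normr_ge0 E).
lra.
Qed.

(* Z interpolates between X (where psi <= t) and Y (where psi >= t + 2/n). *)
Lemma glue_fields (psi : R3 -> R) (g : R3 -> R3) (t L : R) n X Y : (0 < n)%N ->
  grad3 psi g -> (forall x, t < psi x -> psi x <= t + 2 -> enorm (g x) <= L)%R ->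
  test_field X -> test_field Y -> exists Z, test_field Z /\
  forall x, [/\ (psi x <= t -> divergence Z x = divergence X x)%R,
    (t + 2 / n%:R < psi x -> divergence Z x = divergence Y x)%R &
    (strip psi t (2 / n%:R) x -> divergence Y x <= divergence Z x +
      (`|divergence X x| + `|divergence Y x| + 2 * n%:R * L))%R].
Proof.
move=> n0 Gpsi gL [C1X sX X1] [C1Y sY Y1].
have [GX1 GX2 GX3] := C1_jac C1X; have [GY1 GY2 GY3] := C1_jac C1Y.
pose s x := step n t (psi x); pose ds x : R3 := dstep n t (psi x) *: g x.
have Gs : grad3 s ds.
  exact: (grad3_comp (is_derive_step n t) (@continuous_dstep n t) Gpsi).
have G1 := grad3D GX1 (grad3M Gs (grad3B GY1 GX1)).
have G2 := grad3D GX2 (grad3M Gs (grad3B GY2 GX2)).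
have G3 := grad3D GX3 (grad3M Gs (grad3B GY3 GX3)).
pose Z x : R3 := ((X x).1.1 + s x * ((Y x).1.1 - (X x).1.1),
  (X x).1.2 + s x * ((Y x).1.2 - (X x).1.2), (X x).2 + s x * ((Y x).2 - (X x).2))%R.
have ZE x : Z x = ((1 - s x) *: X x + s x *: Y x)%R.
  by congr (_, _, _); rewrite /= /GRing.scale /=; ring.
have n0' : (0 < n%:R :> R)%R by rewrite ltr0n.
have F x := step_facts t (psi x) n0.
exists Z; split.
  split; first exact: C1_field G1 G2 G3.
  - have [M M0 HX] := (compactly_supportedP _).1 sX.
    have [M' M'0 HY] := (compactly_supportedP _).1 sY.
    apply/compactly_supportedP; exists (M + M')%R; first by rewrite addr_gt0.
    move=> x nb; rewrite ZE HX ?HY ?scaler0 ?addr0// => /boxE[b1 b2 b3];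
      apply: nb; apply/boxE;
      (split; [apply: (le_trans b1)|apply: (le_trans b2)|apply: (le_trans b3)]);
      by rewrite ?lerDl ?lerDr ltW.
  - move=> x; have [/andP[s0 s1] _ _ _] := F x; rewrite -/(s x) in s0 s1.
    rewrite ZE; apply: (le_trans (enormD _ _)); rewrite !enormZ.
    rewrite (ger0_norm s0) ger0_norm ?subr_ge0//.
    by have := X1 x; have := Y1 x; nra.
move=> x.
have dZ : divergence Z x = (divergence X x + s x * (divergence Y x - divergence X x) +
    dot (Y x - X x) (ds x))%R.
  rewrite (divergence_field x G1 G2 G3) /divergence /dot /jac1 /jac2 /jac3.
  move: ('D_e1 X x) ('D_e2 X x) ('D_e3 X x) ('D_e1 Y x) ('D_e2 Y x) ('D_e3 Y x).
  move: (X x) (Y x) (s x) (ds x) => [[x1 x2] x3] [[y1 y2] y3] z [[d1 d2] d3].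
  move=> [[a11 a12] a13] [[a21 a22] a23] [[a31 a32] a33].
  move=> [[b11 b12] b13] [[b21 b22] b23] [[b31 b32] b33] /=.
  rewrite /GRing.scale /=; ring.
have [/andP[s0 s1] d1 f1 f2] := F x; rewrite -/(s x) in s0 s1 f1 f2.
have dot0 v : dot v (0 *: g x : R3) = 0%R by rewrite dotZr mul0r.
split.
- by move=> /f1[z1 z2]; rewrite dZ z1 /ds z2 dot0 mul0r !addr0.
- by move=> /ltW/f2[z1 z2]; rewrite dZ z1 /ds z2 dot0 mul1r addr0 addrC subrK.
- move=> [tx xt]; have gx : (enorm (g x) <= L)%R.
    apply: gL => //; apply: (le_trans xt); rewrite lerD2l ler_pdivrMr// ler_peMr//.
    by rewrite ler1n.
  have L0 : (0 <= L)%R by exact: le_trans (enorm_ge0 _) gx.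
  have dle : (`|dot (Y x - X x) (ds x)| <= 2 * n%:R * L)%R.
    apply: le_trans (norm_dot_le _ _) _; rewrite /ds enormZ -mulrA.
    apply: ler_pM; rewrite ?enorm_ge0 ?mulr_ge0 ?enorm_ge0//.
      apply: (le_trans (enormD _ _)); rewrite enormN.
      by rewrite (_ : 2 = 1 + 1)%R//; exact: lerD.
    by apply: ler_pM; rewrite ?enorm_ge0.
  rewrite dZ; apply: interp_le => //.
  by move: dle; rewrite ler_norml => /andP[].
Qed.

End cut.

Section cut_lemma.
Context {R : realType}.
Notation mR := (measurableTypeR R).
Notation E2 := (mR * mR)%type.
Notation E3 := (E2 * mR)%type.
Notation leb3 := (@leb3 R).
Notation R3 := (R * R * R)%type.
Local Open Scope ereal_scope.

Lemma perimeter_ge0 (A : set E3) : measurable A -> 0 <= perimeter A.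
Proof.
move=> mA; apply: le_trans (perimeter_ge mA (@test_field0 R)).
by apply: integral_ge0 => x _; rewrite divergence0.
Qed.

Lemma perimeter_le (A : set E3) (K : \bar R) : measurable A ->
  (forall X, test_field X -> \int[leb3]_(x in A) (divergence X x)%:E <= K) ->
  perimeter A <= K.
Proof.
by move=> mA H; rewrite perimeterE//; apply: ge_ereal_sup => _ [X tX <-]; exact: H.
Qed.

(** The two suprema are taken one after the other. The choice X = 0 first shows that [perimeter B]
    is finite, so that it can be moved to the other side. *)
Lemma perimeter_add_le (A B : set E3) (K : R) : measurable A -> measurable B ->
  leb3 A < +oo -> leb3 B < +oo ->
  (forall X Y, test_field X -> test_field Y ->
    (\int[leb3]_(x in A) divergence X x + \int[leb3]_(x in B) divergence Y x <= K)%R) ->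
  perimeter A + perimeter B <= K%:E.
Proof.
move=> mA mB Aoo Boo H.
have fin (C : set E3) X : measurable C -> leb3 C < +oo -> test_field X ->
    \int[leb3]_(x in C) (divergence X x)%:E = (\int[leb3]_(x in C) divergence X x)%R%:E.
  move=> mC Coo tX; rewrite /Rintegral fineK//.
  exact: integrable_fin_num (integrable_divergence mC tX Coo).
have HB X : test_field X -> perimeter B <= (K - \int[leb3]_(x in A) divergence X x)%R%:E.
  move=> tX; apply: perimeter_le => // Y tY; rewrite fin// lee_fin.
  by rewrite lerBrDl H.
have pB : perimeter B \is a fin_num.
  rewrite (ge0_fin_numE (perimeter_ge0 mB)).
  by apply: le_lt_trans (HB _ (@test_field0 R)) _; rewrite ltry.
rewrite -leeBrDr//; apply: perimeter_le => // X tX; rewrite fin// leeBrDr//.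
by rewrite -leeBrDl// -EFinB HB.
Qed.

(** Fields for the two pieces are glued into one field for A. The error is the strip measure, at
    most c / n, times CX + CY + 2 n L: the first two terms vanish for large n and the last leaves 2
    L c. The strips have to be thin only for infinitely many n, which is what a lower limit
    provides. *)
Lemma perimeter_cut (A : set E3) (psi : R3 -> R) (g : R3 -> R3) (t L c p : R) :
  measurable A -> leb3 A < +oo -> perimeter A <= p%:E -> grad3 psi g ->
  (0 <= L)%R -> (0 <= c)%R ->
  (forall x, t < psi x -> psi x <= t + 2 -> enorm (g x) <= L)%R ->
  (forall N : nat, exists2 n, (N < n)%N &
    leb3 (A `&` strip psi t (2 / n%:R)) <= (c / n%:R)%:E) ->
  perimeter (A `&` [set x : E3 | psi x <= t]%R) +
  perimeter (A `\` [set x : E3 | psi x <= t]%R) <= (p + 2 * L * c)%:E.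
Proof.
move=> mA Aoo Ap Gpsi L0 c0 gL Hc.
have cpsi := grad3_continuous Gpsi.
set S := [set x : E3 | psi x <= t]%R; have mS : measurable S by exact: measurable_sublevel.
have mAS : measurable (A `&` S) by exact: measurableI.
have mAD : measurable (A `\` S) by exact: measurableD.
have ASoo : leb3 (A `&` S) < +oo.
  by apply: le_lt_trans Aoo; apply: le_measure; rewrite ?inE.
have ADoo : leb3 (A `\` S) < +oo.
  by apply: le_lt_trans Aoo; apply: le_measure; rewrite ?inE.
apply: perimeter_add_le => // X Y tX tY.
have [_ [CX [_ CX0 _ XC]]] := test_field_support tX.
have [_ [CY [_ CY0 _ YC]]] := test_field_support tY.
apply/ler_addgt0Pr => eps e0.
have [n] := Hc (Num.truncn ((CX + CY) * c / eps)).+1; move=> nN leS.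
have n0 : (0 < n)%N by apply: leq_ltn_trans nN.
have n0' : (0 < n%:R :> R)%R by rewrite ltr0n.
have nC : ((CX + CY) * c / n%:R <= eps)%R.
  rewrite ler_pdivrMr// [leRHS]mulrC -ler_pdivrMr//.
  apply: (le_trans (ltW (truncnS_gt ((CX + CY) * c / eps)%R))).
  by rewrite ler_nat ltnW.
set T := strip psi t (2 / n%:R) in leS.
have mT : measurable T by exact: measurable_strip.
have [Z [tZ ZE]] := glue_fields n0 Gpsi gL tX tY.
pose K : R := (CX + CY + 2 * n%:R * L)%R.
have K0 : (0 <= K)%R by rewrite !addr_ge0// !mulr_ge0.
pose f (x : E3) := if (psi x <= t)%R then divergence X x else divergence Y x.
have mdiv W : test_field W -> measurable_fun setT (divergence W : E3 -> R).
  by move=> [C1W _ _]; exact: measurable_divergence.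
have iX : leb3.-integrable A (EFin \o f).
  apply: (@integrable_bounded _ _ _ (CX + CY)%R) => //.
    apply: measurable_fun_ifT; [|exact: mdiv|exact: mdiv].
    by apply: measurable_fun_ler => //; exact: continuous_measurable3.
  move=> x; rewrite /f; have := XC x; have := YC x.
  by case: ifP => _ h1 h2; apply: le_trans; [exact: h2|rewrite lerDl|exact: h1|rewrite lerDr].
have iZ := integrable_divergence mA tZ Aoo.
have iK : leb3.-integrable A (EFin \o (fun x => K * \1_T x)%R).
  apply: (@integrable_bounded _ _ _ K) => //.
    by apply: measurable_funM => //; exact: measurable_indic.
  by move=> x; rewrite normrM ger0_norm// ler_piMr// indicE; case: (_ \in _); rewrite ?normr1 ?normr0.
have splitA : A = (A `&` S) `|` (A `\` S) by rewrite setUIDK.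
have dj : [disjoint A `&` S & A `\` S].
  by apply/disj_setPS => x [[_ s] [_ ns]]; exact: ns.
have intf : (\int[leb3]_(x in A) f x = \int[leb3]_(x in A `&` S) divergence X x +
    \int[leb3]_(x in A `\` S) divergence Y x)%R.
  rewrite [in LHS]splitA Rintegral_setU//; last by rewrite -splitA.
  congr (_ + _)%R; apply: eq_Rintegral => x; rewrite inE => -[_ xs]; rewrite /f.
    by rewrite ifT.
  by rewrite ifF//; exact/negP.
rewrite -intf.
have ub : (\int[leb3]_(x in A) f x <= \int[leb3]_(x in A) (divergence Z x + K * \1_T x))%R.
  apply: le_Rintegral => //.
    by have := integrableD mA iZ iK; apply: eq_integrable.
  move=> x Ax; rewrite /f; have [z1 z2 z3] := ZE x.
  have KT : (0 <= K * \1_T x)%R by rewrite mulr_ge0// indicE ler0n.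
  case: ifPn => [/z1 ->|]; first by rewrite lerDl.
  rewrite -ltNge => tx; have [xT|xT] := leP (psi x) (t + 2 / n%:R)%R.
    have Tx : T x := conj tx xT.
    have -> : \1_T x = 1%R :> R by rewrite indicE (mem_set Tx).
    apply: (le_trans (z3 Tx)); rewrite mulr1.
    exact: (lerD (lexx _) (lerD (lerD (XC x) (YC x)) (lexx _))).
  by rewrite (z2 xT) lerDl.
apply: (le_trans ub); rewrite RintegralD// -addrA lerD//.
  rewrite -lee_fin /Rintegral fineK; last exact: integrable_fin_num.
  exact: le_trans (perimeter_ge mA tZ) Ap.
rewrite RintegralZl//; last first.
  apply: (@integrable_bounded _ _ _ 1%R) => // x.
  by rewrite indicE; case: (_ \in _); rewrite ?normr1 ?normr0.
rewrite /Rintegral (integral_indic _ mA mT) setIC.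
have uS : (fine (leb3 (A `&` T)) <= c / n%:R)%R.
  rewrite -lee_fin fineK// (ge0_fin_numE (measure_ge0 leb3 _)).
  by apply: le_lt_trans leS _; rewrite ltry.
apply: (le_trans (ler_wpM2l K0 uS)).
have -> : (K * (c / n%:R) = 2 * L * c + (CX + CY) * c / n%:R)%R.
  by rewrite /K; field; rewrite gt_eqF.
by rewrite lerD2l.
Qed.

End cut_lemma.

(** * The price of a cut and its average over levels *)

Section coarea.
Context {R : realType}.
Notation lam := (@lebesgue_measure R).
Notation mR := (measurableTypeR R).
Notation E2 := (mR * mR)%type.
Notation E3 := (E2 * mR)%type.
Notation leb3 := (@leb3 R).
Notation R3 := (R * R * R)%type.
Local Open Scope ereal_scope.

Lemma integral_indic_T d (T : measurableType d) (m : {measure set T -> \bar R})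
    (A : set T) : measurable A -> \int[m]_x (\1_A x : R)%:E = m A.
Proof. by move=> mA; rewrite integral_indic// setIT. Qed.

(** Tonelli: a point x lies in the strip exactly for the levels t in [psi x - h, psi x[, an interval
    of length h. *)
Lemma integral_strip (A : set E3) (psi : R3 -> R) (h : R) : measurable A ->
  continuous psi -> (0 < h)%R ->
  measurable_fun setT (fun t : mR => leb3 (A `&` strip psi t h)) /\
  \int[lam]_t leb3 (A `&` strip psi t h) = h%:E * leb3 A.
Proof.
move=> mA cpsi h0; have mpsi := continuous_measurable3 cpsi.
pose S : set (E3 * mR) := [set z | A z.1 /\ (z.2 < psi z.1 <= z.2 + h)%R].
have mS : measurable S.
  have m1 : measurable_fun setT (fun z : E3 * mR => psi z.1 : mR).
    exact: (measurableT_comp mpsi).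
  have -> : S = (A `*` setT) `&` ([set z : E3 * mR | z.2 - psi z.1 < 0]%R `&`
     ~` [set z : E3 * mR | z.2 + h - psi z.1 < 0]%R).
    apply/seteqP; split=> z; rewrite /S /setI /setC /=.
      move=> [Az /andP[z1 z2]]; split=> //; rewrite subr_lt0 z1; split=> //.
      by apply/negP; rewrite subr_lt0 -leNgt.
    move=> [[Az _] [z1 /negP z2]]; split=> //; move: z1 z2.
    by rewrite !subr_lt0 -leNgt => -> ->.
  apply: measurableI; first exact: measurableX.
  apply: measurableI; last apply: measurableC; apply: measurable_lt.
    exact: measurable_funB.
  by apply: measurable_funB => //; exact: measurable_funD.
have Ey t : ysection S t = A `&` strip psi t h.
  apply/seteqP; split=> x; rewrite /ysection /S /strip /= inE /=.
    by move=> [? /andP[]].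
  by move=> [? [-> ->]].
have mf : measurable_fun setT (fun t : mR => leb3 (A `&` strip psi t h)).
  have := measurable_fun_ysection leb3 mS.
  by apply: eq_measurable_fun => t _; rewrite /= Ey.
split => //.
have mi : measurable_fun setT (fun z : E3 * mR => (\1_S z : R)%:E).
  by apply/measurable_EFinP; exact: measurable_indic.
have i0 (z : E3 * mR) : 0 <= (\1_S z : R)%:E by rewrite lee_fin indicE ler0n.
have F := @fubini_tonelli _ _ E3 mR R leb3 lam _ mi i0.
transitivity (\int[lam]_t \int[leb3]_x (\1_S (x, t) : R)%:E).
  apply: eq_integral => t _; rewrite -Ey.
  have mSt : measurable (ysection S t) by exact: measurable_ysection.
  apply: (etrans (esym (@integral_indic_T _ _ leb3 _ mSt))).
  apply: eq_integral => x _; congr (_%:E); rewrite !indicE; congr (nat_of_bool _)%:R.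
  by rewrite /ysection; apply/idP/idP; rewrite !inE /= ?inE.
rewrite -F -(@integral_cst _ _ _ leb3 _ mA) [RHS]integral_mkcond.
apply: eq_integral => x _; rewrite patchE; case: ifPn; rewrite ?inE ?notin_setE => Ax.
  transitivity (\int[lam]_t (\1_(`[(psi x - h)%R, psi x[%classic : set mR) t : R)%:E).
    apply: eq_integral => t _; congr (_%:E); rewrite !indicE; congr (nat_of_bool _)%:R.
    by apply/idP/idP; rewrite !inE /S /= in_itv /= lerBlDr;
      [move=> [_]|move=> ?; split=> //]; rewrite andbC.
  rewrite (integral_indic _ measurableT)//= setIT lebesgue_measure_itv /= lte_fin.
  by rewrite gtrBl h0 -EFinB opprB addrC subrK.
by apply: integral0_eq => t _; rewrite indicE memNset// => -[].
Qed.

(** Twice the lower density, per unit of psi, of the mass of A just above level t. It stands in for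
    the area of the cut at that level. *)
Definition cost (psi : R3 -> R) (A : set E3) (t : R) : \bar R :=
  limn_einf (fun n => n.+1%:R%:E * leb3 (A `&` strip psi t (2 / n.+1%:R))).

Lemma cost_ge0 psi A t : 0 <= cost psi A t.
Proof.
rewrite /cost limn_einf_lim; apply: lime_ge; first exact: is_cvg_einfs.
apply: nearW => n; apply: le_ereal_inf_tmp => _ [k _ <-].
by rewrite mule_ge0// lee_fin.
Qed.

Lemma measurable_cost psi A : measurable A -> continuous psi ->
  measurable_fun setT (cost psi A : mR -> \bar R).
Proof.
move=> mA cpsi; apply: measurableT_comp => //; apply: measurable_fun_limn_esup => n.
apply: measurableT_comp => //; apply: emeasurable_funM => //.
have h0 : (0 < 2 / n.+1%:R :> R)%R by [].
by have [] := integral_strip mA cpsi h0.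
Qed.

(** Fatou's lemma applied to [integral_strip]: with h = 2 / n every term of the sequence has
    integral exactly 2 |A|. *)
Lemma coarea psi A : measurable A -> continuous psi ->
  \int[lam]_t cost psi A t <= 2%:E * leb3 A.
Proof.
move=> mA cpsi.
pose f n (t : mR) : \bar R := n.+1%:R%:E * leb3 (A `&` strip psi t (2 / n.+1%:R)).
have h0 n : (0 < 2 / n.+1%:R :> R)%R by [].
have mf n : measurable_fun setT (f n).
  by apply: emeasurable_funM => //; have [] := integral_strip mA cpsi (h0 n).
have f0 n t : 0 <= f n t by rewrite /f mule_ge0// lee_fin.
apply: (le_trans (fatou lam measurableT mf (fun n t _ => f0 n t))).
rewrite (_ : (fun n => _) = cst (2%:E * leb3 A)); last first.
  apply/funext => n; rewrite /f; have [ms E] := integral_strip mA cpsi (h0 n).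
  have k0 : 0 <= n.+1%:R%:E :> \bar R by rewrite lee_fin.
  apply: (etrans (ge0_integralZl lam measurableT ms (fun t _ => measure_ge0 leb3 _) k0)).
  by rewrite E muleA -EFinM mulrC divfK.
by rewrite (cvg_limn_einf_sup (cvg_cst _)).1.
Qed.

(** If the cost is finite, any c' above it bounds n times the strip measure for infinitely many n,
    as [perimeter_cut] requires; then c' decreases to the cost. *)
Lemma perimeter_cut_cost (A : set E3) (psi : R3 -> R) (g : R3 -> R3) (t L p : R) :
  measurable A -> leb3 A < +oo -> perimeter A <= p%:E -> grad3 psi g ->
  (0 < L)%R ->
  (forall x, t < psi x -> psi x <= t + 2 -> enorm (g x) <= L)%R ->
  perimeter (A `&` [set x : E3 | psi x <= t]%R) +
  perimeter (A `\` [set x : E3 | psi x <= t]%R) <= p%:E + (2 * L)%:E * cost psi A t.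
Proof.
move=> mA Aoo Ap Gpsi L0 gL; have c0 := cost_ge0 psi A t.
have L2 : (0 < 2 * L)%R by rewrite mulr_gt0.
case E : (cost psi A t) c0 => [c| |] // c0; last first.
  by rewrite gt0_muley ?lte_fin// addey// leey.
rewrite -EFinM -EFinD; apply/lee_addgt0Pr => e e0.
pose c' := (c + e / (2 * L))%R.
have cc' : (c < c')%R by rewrite ltrDl divr_gt0.
have -> : (p + 2 * L * c)%:E + e%:E = (p + 2 * L * c')%:E.
  by rewrite -EFinD /c'; congr (_%:E); field; rewrite gt_eqF.
apply: (perimeter_cut mA Aoo Ap Gpsi (ltW L0) _ gL).
  by move: c0; rewrite lee_fin => c0; exact: le_trans c0 (ltW cc').
move=> N; pose u n := n.+1%:R%:E * leb3 (A `&` strip psi t (2 / n.+1%:R)).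
have : ereal_inf (sdrop u N) < c'%:E.
  apply: (le_lt_trans _ (_ : cost psi A t < c'%:E)); last by rewrite E lte_fin.
  rewrite /cost limn_einf_lim -/u.
  rewrite (cvg_lim (@ereal_hausdorff R) (@cvg_einfs_sup R u)).
  by apply: ereal_sup_ubound; exists N.
move=> /ereal_inf_lt[_ [k /= Nk <-] uk]; exists k.+1 => //.
have k0 : (0 < k.+1%:R :> R)%R by [].
rewrite -(@lee_pmul2l _ k.+1%:R%:E)// -[leRHS]EFinM.
have -> : (k.+1%:R * (c' / k.+1%:R) = c')%R by rewrite mulrC divfK ?gt_eqF.
exact: ltW.
Qed.

End coarea.

(** * The Coulomb energy *)

Section coulomb_layers.
Context {R : realType}.
Notation lam := (@lebesgue_measure R).
Notation mR := (measurableTypeR R).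
Notation E2 := (mR * mR)%type.
Notation E3 := (E2 * mR)%type.
Notation E6 := (E3 * E3)%type.
Notation leb3 := (@leb3 R).
Notation leb6 := (@leb6 R).
Notation R3 := (R * R * R)%type.
Local Open Scope ereal_scope.

Definition dist (z : E6) : R := enorm ((z.1 : R3) - z.2)%R.

Definition coul (A B : set E3) : \bar R := \int[leb6]_(z in A `*` B) (dist z)^-1%:E.

Lemma dist_ge0 z : (0 <= dist z)%R. Proof. exact: enorm_ge0. Qed.

Definition offdiag : set E6 := [set z | 0 < dist z]%R.

Lemma measurable_offdiag : measurable offdiag.
Proof.
have -> : offdiag = setT `&` dist @^-1` `]0%R, +oo[%classic.
  by rewrite setTI; apply/seteqP; split=> p /=; rewrite in_itv /= andbT.
exact: (@measurable_dist R).
Qed.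

Lemma near_le_ball A B t : measurable A -> measurable B -> (0 <= t)%R ->
  near_pairs A B t <= leb3 A * (4 / 3 * pi * t ^+ 3)%:E.
Proof.
move=> mA mB t0; rewrite -(ball3_volume t0) -(near_setT t mA).
exact: (le_near t mA mA mB measurableT (@subset_refl _ A) (@subsetT _ B)).
Qed.

(** The diagonal is null: for each s > 0 its pairs are at distance less than s, and such pairs have
    measure at most |A| 4/3 pi s^3. It has to be removed because the layer-cake formula for 1 / r
    holds only for r > 0. *)
Lemma near_offdiag A B t : measurable A -> measurable B -> leb3 A < +oo ->
  leb6 (pairs A B t `&` offdiag) = near_pairs A B t.
Proof.
move=> mA mB Aoo; have mP := measurable_pairs t mA mB.
have mPo : measurable (pairs A B t `&` offdiag).
  by apply: measurableI => //; exact: measurable_offdiag.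
have mPd : measurable (pairs A B t `\` offdiag).
  by apply: measurableD => //; exact: measurable_offdiag.
have d0 : leb6 (pairs A B t `\` offdiag) = 0.
  apply/eqP; rewrite eq_le (measure_ge0 leb6) andbT.
  apply/lee_addgt0Pr => e e0; rewrite add0e.
  pose V := fine (leb3 A); have V0 : (0 <= V)%R := fine_ge0 (measure_ge0 leb3 A).
  have VE : leb3 A = V%:E by rewrite fineK// (ge0_fin_numE (measure_ge0 leb3 A)).
  pose c := (V * (4 / 3 * pi) + 1)%R.
  have c0 : (0 < c)%R by rewrite ltr_wpDl// !mulr_ge0 ?pi_ge0.
  pose s := Num.min 1%R (e / c)%R.
  have s0 : (0 < s)%R by rewrite lt_min ltr01 divr_gt0.
  have s1 : (s <= 1)%R by rewrite ge_min lexx.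
  have sc : (s * c <= e)%R by rewrite -ler_pdivlMr// ge_min lexx orbT.
  apply: (@le_trans _ _ (near_pairs A B s)).
    apply: le_measure; rewrite ?inE //; first exact: measurable_pairs.
    move=> z [[Az Bz _] nd]; split=> //.
    apply: le_lt_trans s0; rewrite leNgt; exact/negP.
  apply: (le_trans (near_le_ball mA mB (ltW s0))).
  rewrite VE -EFinM lee_fin; apply: le_trans sc.
  have s3 : (s ^+ 3 <= s)%R by rewrite ler_iXnr// ltW.
  have q0 : (0 <= V * (4 / 3 * pi))%R by rewrite !mulr_ge0 ?pi_ge0.
  have -> : (s * c = V * (4 / 3 * pi) * s + s)%R by rewrite /c; ring.
  rewrite mulrA; by apply: le_trans (ler_wpM2l q0 s3) _; rewrite lerDl ltW.
apply/eqP; rewrite eq_le; apply/andP; split.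
  by apply: le_measure; rewrite ?inE// => z [].
apply: (@le_trans _ _ (leb6 (pairs A B t `&` offdiag) + leb6 (pairs A B t `\` offdiag))).
  apply: (measure_subU leb6 mP mPo mPd) => z Pz.
  by have [h|h] := pselect (offdiag z); [left|right].
by rewrite d0 adde0.
Qed.

(** For r > 0 this is the positive part of 1 / r - 1 / T, the integral of [npow 0 T] over t > r. *)
Definition phi (T r : R) : R := if (0 < r)%R && (r < T)%R then (r^-1 - T^-1)%R else 0%R.

Lemma phi_ge0 T r : (0 <= phi T r)%R.
Proof.
rewrite /phi; case: ifPn => // /andP[r0 rT].
by rewrite subr_ge0 lef_pV2 ?posrE ?ltW// (lt_trans r0).
Qed.

Lemma measurable_phi T : measurable_fun setT (phi T : mR -> mR).
Proof.
apply: measurable_fun_ifT => //.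
- by apply: measurable_and; exact: measurable_fun_ltr.
- by apply: measurable_funB => //; exact: measurable_inv.
Qed.

Lemma coul_layer (A B : set E3) T : measurable A -> measurable B -> leb3 A < +oo ->
  \int[leb6]_(z in A `*` B) (phi T (dist z))%:E =
  \int[lam]_t (npow 0 T t * near_pairs A B t).
Proof.
move=> mA mB Aoo; have mAB := measurable_setX6 mA mB.
have mo := measurable_offdiag; have mD := measurableI _ _ mAB mo.
pose h (z : E6) : \bar R := (\1_((A `*` B) `&` offdiag) z)%:E.
have mh : measurable_fun setT h by apply/measurable_EFinP; exact: measurable_indic.
have h0 z : 0 <= h z by rewrite lee_fin indicE ler0n.
have := @layer_cake R _ E6 leb6 dist h (npow 0 T) (@measurable_dist R) mh
  (measurable_npowT 0 T) h0 (npow_ge0 0 T).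
set L := \int[leb6]_x _ => LE.
transitivity L.
  rewrite /L [LHS]integral_mkcond; apply: eq_integral => z _; rewrite patchE.
  have [zo|zo] := pselect (offdiag z); last first.
    have nD : ~ ((A `*` B) `&` offdiag) z by case.
    rewrite /h indicE (memNset nD) mul0e.
    have -> : phi T (dist z) = 0%R by rewrite /phi; case: ifPn => // /andP[d0 _]; case: zo.
    by case: ifP.
  rewrite (integral_npow 0 T zo) /h indicE in_setI (mem_set zo) andbT.
  case: ifP => _; rewrite ?mul1e ?mul0e//.
  by rewrite /phi (zo : (0 < dist z)%R) /=; case: ifP.
rewrite LE; apply: eq_integral => t _; congr (_ * _).
have mt : measurable [set x | (dist x < t)%R] := measurable_lt t (@measurable_dist R).
rewrite /h (integral_indic _ mt mD) -(near_offdiag t mA mB Aoo); congr (leb6 _).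
apply/seteqP; split=> z; rewrite /pairs /setI /setX /=.
  by move=> [[[? ?] ?] ?].
by move=> [[? ? ?] ?].
Qed.

Lemma measurable_near (A B : set E3) : measurable A -> measurable B ->
  measurable_fun setT (fun t : mR => near_pairs A B t).
Proof.
move=> mA mB; pose S : set (E6 * mR) := [set z | (A `*` B) z.1 /\ (dist z.1 < z.2)%R].
have mS : measurable S.
  have -> : S = ((A `*` B) `*` setT) `&` [set z : E6 * mR | dist z.1 - z.2 < 0]%R.
    apply/seteqP; split=> z; rewrite /S /setI /= subr_lt0; first by move=> [].
    by move=> [[]].
  apply: measurableI; first by apply: measurableX => //; exact: measurable_setX6.
  apply: measurable_lt; apply: measurable_funB => //.
  exact: (measurableT_comp (@measurable_dist R)).
have := measurable_fun_ysection leb6 mS.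
apply: eq_measurable_fun => t _ /=; congr (leb6 _).
apply/seteqP; split=> z; rewrite /ysection /S /pairs /= inE /=.
  by move=> [[? ?] ?].
by move=> [? ? ?].
Qed.

End coulomb_layers.

Section coulomb_bounds.
Context {R : realType}.
Notation lam := (@lebesgue_measure R).
Notation mR := (measurableTypeR R).
Notation E2 := (mR * mR)%type.
Notation E3 := (E2 * mR)%type.
Notation E6 := (E3 * E3)%type.
Notation leb3 := (@leb3 R).
Notation leb6 := (@leb6 R).
Local Open Scope ereal_scope.

Lemma leb6_setX (A B : set E3) : measurable A -> measurable B ->
  leb6 (A `*` B) = leb3 A * leb3 B.
Proof. by move=> mA mB; exact: (@product_measure1E _ _ _ _ _ leb3 leb3 _ _ mA mB). Qed.

Lemma measurable_idist : measurable_fun setT (fun z : E6 => (dist z)^-1%:E).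
Proof. exact: (@measurable_kernel R). Qed.

Lemma idist_ge0 (z : E6) : 0 <= (dist z)^-1%:E.
Proof. by rewrite lee_fin invr_ge0 dist_ge0. Qed.

Lemma measurable_phi_dist (T : R) : measurable_fun setT (fun z : E6 => (phi T (dist z))%:E).
Proof.
apply/measurable_EFinP; apply: (measurableT_comp (@measurable_phi R T)).
exact: (@measurable_dist R).
Qed.

(** The singularity is integrable: 1 / r <= phi 1 r + 1, and in the layer-cake form of the first
    term t^-2 is compensated by [near_pairs], which is at most |A| 4/3 pi t^3. *)
Lemma coul_lty (A B : set E3) : measurable A -> measurable B -> leb3 A < +oo ->
  leb3 B < +oo -> coul A B < +oo.
Proof.
move=> mA mB Aoo Boo; have mAB := measurable_setX6 mA mB.
have VA : leb3 A = (fine (leb3 A))%:E by rewrite fineK// (ge0_fin_numE (measure_ge0 leb3 A)).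
have VB : leb3 B = (fine (leb3 B))%:E by rewrite fineK// (ge0_fin_numE (measure_ge0 leb3 B)).
set a := fine (leb3 A) in VA; set b := fine (leb3 B) in VB.
have a0 : (0 <= a)%R := fine_ge0 (measure_ge0 leb3 A).
apply: (@le_lt_trans _ _ (\int[leb6]_(z in A `*` B) ((phi 1 (dist z))%:E + 1%:E))).
  apply: ge0_le_integral => //.
  - by move=> z _; exact: idist_ge0.
  - by apply: measurable_funTS; exact: measurable_idist.
  - apply: measurable_funTS; apply: emeasurable_funD => //.
    exact: measurable_phi_dist.
  - move=> z _; rewrite -EFinD lee_fin /phi.
    have := dist_ge0 z; rewrite le_eqVlt => /predU1P[<-|d0].
      by rewrite ltxx invr0 add0r ler01.
    rewrite d0 /=; case: ltP => d1; first by rewrite invr1 subrK.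
    by rewrite add0r invf_le1.
rewrite ge0_integralD//; last 2 first.
- by move=> z _; rewrite lee_fin phi_ge0.
- by apply: measurable_funTS; exact: measurable_phi_dist.
rewrite (coul_layer 1 mA mB Aoo) (@integral_cst _ _ _ leb6 _ mAB).
have S6 : leb6 (A `*` B) < +oo by rewrite (leb6_setX mA mB) VA VB -EFinM ltry.
apply: lte_add_pinfty; last by rewrite mul1e; exact: S6.
apply: (@le_lt_trans _ _ (\int[lam]_t ((a * (4 / 3 * pi)) * \1_(`]0%R, 1%R]%classic) t)%:E)).
  apply: ge0_le_integral => //.
  - by move=> t _; rewrite mule_ge0 ?npow_ge0 ?near_ge0.
  - by apply: emeasurable_funM; [exact: measurable_npowT|exact: measurable_near].
  - apply/measurable_EFinP; apply: measurable_funM => //; exact: measurable_indic.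
  - move=> t _; rewrite /npow indicE; have [|_] := boolP (t \in `]0%R, 1%R]%classic); last first.
      by rewrite !mulr0 mul0e.
    rewrite inE /= in_itv /= => /andP[t0 t1]; rewrite !mulr1 mul1r.
    have t2 : 0 <= (t ^- 2)%:E by rewrite lee_fin invr_ge0 exprn_ge0// ltW.
    apply: (le_trans (lee_wpmul2l t2 (near_le_ball mA mB (ltW t0)))).
    rewrite VA -!EFinM lee_fin.
    have -> : (t ^- 2 * (a * (4 / 3 * pi * t ^+ 3)) = a * (4 / 3 * pi) * t)%R.
      by field; rewrite gt_eqF.
    by rewrite ler_piMr// !mulr_ge0 ?pi_ge0.
under eq_integral do rewrite EFinM.
rewrite ge0_integralZl_EFin//.
- by rewrite integral_indic// setIT/= lebesgue_measure_itv /= lte_fin ltr01 -EFinB -EFinM ltry.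
- by apply/measurable_EFinP; exact: measurable_indic.
- by rewrite !mulr_ge0 ?pi_ge0.
Qed.

Definition far (A : set E3) (T : R) : set E6 := (A `*` A) `&` [set z | T <= dist z]%R.

Lemma measurable_far A T : measurable A -> measurable (far A T).
Proof.
move=> mA; apply: measurableI; first exact: measurable_setX6.
rewrite -[X in measurable X]setCK; apply: measurableC.
have -> : ~` [set z : E6 | T <= dist z]%R = [set z : E6 | dist z < T]%R.
  by apply/seteqP; split=> z /=; [move/negP; rewrite -ltNge|move=> h; apply/negP; rewrite -ltNge].
exact: measurable_lt (@measurable_dist R).
Qed.

(** For 0 < r < T write 1 / r = (1 / r - 1 / T) + 1 / T. The term of the far pairs is kept because
    its vanishing characterizes the case of equality. *)
Lemma coul_split (A : set E3) (T : R) : measurable A -> leb3 A < +oo -> (0 < T)%R ->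
  coul A A = \int[lam]_t (npow 0 T t * near_pairs A A t) +
    (T^-1)%:E * near_pairs A A T + \int[leb6]_(z in far A T) (dist z)^-1%:E.
Proof.
move=> mA Aoo T0; have mAA := measurable_setX6 mA mA.
have mP : measurable (pairs A A T `&` offdiag).
  by apply: measurableI; [exact: measurable_pairs|exact: measurable_offdiag].
pose f2 (z : E6) : \bar R := (T^-1)%:E * (\1_(pairs A A T `&` offdiag) z)%:E.
pose f3 (z : E6) : \bar R := ((fun z => (dist z)^-1%:E) \_ (far A T)) z.
have Ti : (0 <= T^-1)%R by rewrite invr_ge0 ltW.
have f20 z : 0 <= f2 z by rewrite /f2 mule_ge0// lee_fin.
have f30 z : 0 <= f3 z.
  by rewrite /f3 patchE; case: ifP => // _; exact: idist_ge0.
have mf2 : measurable_fun setT f2.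
  by apply: emeasurable_funM => //; apply/measurable_EFinP; exact: measurable_indic.
have mf3 : measurable_fun setT f3.
  apply/(measurable_restrictT _ (measurable_far T mA)).
  by apply: measurable_funTS; exact: measurable_idist.
transitivity (\int[leb6]_(z in A `*` A) ((phi T (dist z))%:E + f2 z + f3 z)).
  apply: eq_integral => z; rewrite inE => -[Az1 Az2].
  rewrite /f2 /f3 patchE.
  have [dT|Td] := ltP (dist z) T; last first.
    have fz : far A T z by split.
    have nP : ~ (pairs A A T `&` offdiag) z by move=> [[_ _]]; rewrite ltNge Td.
    rewrite (mem_set fz) indicE (memNset nP) mule0.
    by rewrite /phi [(dist z < T)%R]ltNge Td andbF !add0e.
  have nf : ~ far A T z by move=> [_ /=]; rewrite leNgt dT.
  rewrite (memNset nf) adde0 /phi dT andbT indicE; have [d0|d0] := ltP 0%R (dist z).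
    have Pz : (pairs A A T `&` offdiag) z by split.
    by rewrite (mem_set Pz) mule1 -EFinD subrK.
  have nP : ~ (pairs A A T `&` offdiag) z by move=> [_]; rewrite /offdiag /= ltNge d0.
  have -> : dist z = 0%R by apply/eqP; rewrite eq_le d0 dist_ge0.
  by rewrite invr0 add0e (memNset nP) mule0.
have mph : measurable_fun (A `*` A) (fun z : E6 => (phi T (dist z))%:E).
  by apply: measurable_funTS; exact: measurable_phi_dist.
have ph0 (z : E6) : (A `*` A) z -> 0 <= (phi T (dist z))%:E by rewrite lee_fin phi_ge0.
have mf2A : measurable_fun (A `*` A) f2 by exact: measurable_funTS.
have mf3A : measurable_fun (A `*` A) f3 by exact: measurable_funTS.
have s0 (z : E6) : (A `*` A) z -> 0 <= (phi T (dist z))%:E + f2 z.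
  by move=> Az; apply: adde_ge0; [exact: ph0|exact: f20].
rewrite (ge0_integralD leb6 mAA s0 (emeasurable_funD mph mf2A) (fun z _ => f30 z) mf3A).
rewrite (ge0_integralD leb6 mAA ph0 mph (fun z _ => f20 z) mf2A).
rewrite (coul_layer T mA mA Aoo); congr (_ + _ + _).
  rewrite ge0_integralZl//; last first.
    by apply: measurable_funTS; apply/measurable_EFinP; exact: measurable_indic.
  rewrite (integral_indic _ mAA mP) -(near_offdiag T mA mA Aoo); congr (_ * leb6 _).
  by apply/seteqP; split=> [z []|z [[? ? ?] ?]].
rewrite /f3 [RHS]integral_mkcond [LHS]integral_mkcond; apply: eq_integral => z _.
rewrite !patchE; case: ifPn => //; rewrite notin_setE => nz.
by rewrite ifF//; apply/negP; rewrite inE => -[].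
Qed.

(** [key_estimate] divided by t^2 and integrated over ]0, T]. The condition p T <= 4 |A| makes the
    lower bound nonnegative on [0, T], as the comparison of integrals asks. *)
Lemma near_integral_ge (A : set E3) (p T : R) : measurable A -> leb3 A < +oo ->
  perimeter A <= p%:E -> (0 < T)%R -> (p * T <= 4 * fine (leb3 A))%R ->
  (2 / 3 * pi * fine (leb3 A) * T ^+ 2 - pi / 12 * p * T ^+ 3)%:E <=
  \int[lam]_t (npow 0 T t * near_pairs A A t).
Proof.
move=> mA Aoo Ap T0; set V := fine (leb3 A) => pT.
have V0 : (0 <= V)%R := fine_ge0 (measure_ge0 leb3 A).
pose F (t : R) : R := (2 / 3 * pi * V * t ^+ 2 - pi / 12 * p * t ^+ 3)%R.
pose f (t : R) : R := (4 / 3 * pi * V * t - pi / 4 * p * t ^+ 2)%R.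
have dF (t : R) : is_derive t (1%R : R) F (f t).
  rewrite /F /f; apply: is_derive_eq.
  by rewrite /GRing.scale /= ?mulr0 ?addr0 ?mulr1; field.
have cf : continuous f.
  move=> t; apply: cvgB; apply: (cvgM (cvg_cst _)); first exact: cvg_id.
  exact: exprn_continuous.
have := FTC_integral (ltW T0) dF cf.
have -> : F 0%R = 0%R by rewrite /F !expr0n /= !mulr0 subrr.
rewrite subr0 => <-; rewrite integral_mkcond.
apply: ge0_le_integral => //.
- move=> t _; rewrite patchE; case: ifPn => //; rewrite inE /= in_itv /= => /andP[t0 tT].
  rewrite lee_fin /f; have -> : (4 / 3 * pi * V * t - pi / 4 * p * t ^+ 2 =
    pi * t * (4 / 3 * V - p * t / 4))%R by field.
  apply: mulr_ge0; first by rewrite mulr_ge0 ?pi_ge0.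
  have [p0|p0] := leP 0%R p; last by have := mulr_le0_ge0 (ltW p0) t0; lra.
  by have := ler_wpM2l p0 tT; lra.
- apply/(measurable_restrictT _ (measurable_itv _)); apply: measurable_funTS.
  by apply/measurable_EFinP; exact: continuous_measurable_fun.
- by apply: emeasurable_funM; [exact: measurable_npowT|exact: measurable_near].
- move=> t _; rewrite patchE; case: ifPn; rewrite ?inE ?notin_setE /= in_itv /=; last first.
    by move=> _; rewrite mule_ge0 ?npow_ge0 ?near_ge0.
  move=> /andP[]; rewrite le_eqVlt => /predU1P[<- _|t0 tT].
    have -> : f 0%R = 0%R by rewrite /f !expr0n /= !mulr0 subrr.
    by rewrite mule_ge0 ?npow_ge0 ?near_ge0.
  rewrite /npow indicE mem_set; last by rewrite /= in_itv /= t0 tT.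
  rewrite mulr1 mul1r.
  have nE : near_pairs A A t = (fine (near_pairs A A t))%:E.
    by rewrite fineK//; exact: near_fin_num.
  have := key_estimate mA Aoo Ap t0; rewrite -/V nE -EFinM lee_fin /=.
  move: (fine (near_pairs A A t)) => G; rewrite -lerBlDr => H.
  have t2 : (0 <= t ^- 2)%R by rewrite invr_ge0 exprn_ge0// ltW.
  apply: le_trans (ler_wpM2l t2 H); rewrite le_eqVlt; apply/orP; left; apply/eqP.
  by rewrite /f; field; rewrite gt_eqF.
Qed.

End coulomb_bounds.

(** * The perimeter of a cube, for a competitor of finite energy *)

Section box_perimeter.
Context {R : realType}.
Notation lam := (@lebesgue_measure R).
Notation mR := (measurableTypeR R).
Notation E2 := (mR * mR)%type.
Notation E3 := (E2 * mR)%type.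
Notation leb2 := (@leb2 R).
Notation leb3 := (@leb3 R).
Notation R3 := (R * R * R)%type.
Local Open Scope ereal_scope.

Lemma is_derive_line (k : R3 -> R) (g : R3 -> R3) (w v : R3) (t : R) : grad3 k g ->
  is_derive t (1%R : R) (fun t : R => k (w + t *: v)%R) (dot (g (w + t *: v)%R) v).
Proof.
move=> G; have [_ /(_ (w + t *: v)%R) [kd kE]] := G.
have dv : derivable k (w + t *: v)%R v by exact: diff_derivable.
have E : (fun h : R => h^-1 *: (((fun t : R => k (w + t *: v)) \o shift t) (h *: (1 : R)) -
      k (w + t *: v)))%R =
    (fun h : R => h^-1 *: ((k \o shift (w + t *: v)) (h *: v) - k (w + t *: v)))%R.
  apply/funext => h /=; congr (_ *: (k _ - _))%R.
  have -> : (h *: (1 : R) = h)%R by exact: mulr1.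
  by rewrite scalerDl addrCA.
apply: DeriveDef; first by rewrite /derivable E.
by rewrite /derive E -(grad3_derive _ v G).
Qed.

Lemma is_derive_line_eq (k : R3 -> R) (g : R3 -> R3) (w v : R3) (l : R -> R3) (t d : R) :
  grad3 k g -> (forall t, w + t *: v = l t)%R -> dot (g (l t)) v = d ->
  is_derive t (1%R : R) (fun t : R => k (l t)) d.
Proof.
move=> G E <-; have := is_derive_line w v t G; rewrite E.
by under eq_fun do rewrite E.
Qed.

Lemma dot_e1 (v : R3) : dot v e1 = v.1.1.
Proof. by rewrite /dot /= !mulr0 !addr0 mulr1. Qed.

Lemma dot_e2 (v : R3) : dot v e2 = v.1.2.
Proof. by rewrite /dot /= !mulr0 addr0 add0r mulr1. Qed.

Lemma dot_e3 (v : R3) : dot v e3 = v.2.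
Proof. by rewrite /dot /= !mulr0 !add0r mulr1. Qed.

Lemma preserves_swap2 : preserves leb2 (fun p : E2 => (p.2, p.1) : E2).
Proof.
have ms : measurable_fun setT (fun p : E2 => (p.2, p.1) : E2) by exact/measurable_fun_pair.
split=> // f mf f0.
by rewrite (integral_leb2E2 mf f0) (integral_leb2E (measurableT_comp mf ms) (fun=> f0 _)).
Qed.

Lemma preserves_swap23 : preserves leb3 (fun x : E3 => (x.1.1, x.2, x.1.2) : E3).
Proof.
have ms : measurable_fun setT (fun x : E3 => (x.1.1, x.2, x.1.2) : E3).
  by apply/measurable_fun_pair; [apply/measurable_fun_pair => //; exact: measurable_coord1|
    exact: measurable_coord2].
split=> // f mf f0.
rewrite (integral_leb3E2 mf f0) (integral_leb3E2 (measurableT_comp mf ms) (fun=> f0 _)).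
apply: eq_integral => a _ /=; have [_] := preserves_swap2.
apply=> //; apply: (measurableT_comp mf); apply/measurable_fun_pair => //.
exact/measurable_fun_pair.
Qed.

Lemma preserves_swap12 : preserves leb3 (fun x : E3 => (x.1.2, x.1.1, x.2) : E3).
Proof.
exact: (@preserves_prod R _ _ E2 mR leb2 lam _ _ preserves_swap2 (preserves_id lam)).
Qed.

(** On each vertical segment of length 2 the derivative integrates to at most 2, and the segments
    cross a square of area 4. The constant C makes the integrand nonnegative so that Tonelli
    applies. *)
Lemma integral_box_derive3 (U f : R3 -> R) (C : R) : continuous f -> (0 <= C)%R ->
  (forall x, `|U x| <= 1)%R -> (forall x, box 1 x -> `|f x| <= C)%R ->
  (forall p : R * R, forall c : R, is_derive c (1%R : R) (fun c : R => U (p, c)) (f (p, c))) ->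
  \int[leb3]_(x in box 1) (f x + C)%:E <= (8 + 8 * C)%:E.
Proof.
move=> cf C0 U1 fC dU; have mf := continuous_measurable3 cf.
have mb := @measurable_box R 1%R.
pose F (x : E3) : \bar R := ((fun x : E3 => (f x + C)%:E) \_ (box 1)) x.
have fC0 x : box 1 x -> (0 <= f x + C)%R by move=> /fC; rewrite ler_norml => /andP[? _]; lra.
have mfC : measurable_fun setT (fun x : E3 => (f x + C)%:E).
  by apply/measurable_EFinP; exact: measurable_funD.
have mF : measurable_fun setT F.
  by apply/(measurable_restrictT _ mb); exact: measurable_funTS.
have F0 x : 0 <= F x by rewrite /F patchE; case: ifPn => // /set_mem bx; rewrite lee_fin fC0.
rewrite integral_mkcond -/F.
rewrite [X in X <= _](@fubini_tonelli1 _ _ E2 mR R leb2 lam F mF F0).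
pose Q : set E2 := `[(-1)%R, 1%R] `*` `[(-1)%R, 1%R].
have mQ : measurable Q by exact: measurableX.
have QE : leb2 Q = 4%:E.
  have m11 : (-1 <= 1 :> R)%R by lra.
  transitivity (lam `[(-1)%R, 1%R] * lam `[(-1)%R, 1%R]).
    exact: (@product_measure1E _ _ mR mR R lam lam).
  by rewrite (lebesgue_measure_seg m11) -EFinM; congr (_%:E); ring.
have K0 : (0 <= 2 + 2 * C)%R by rewrite addr_ge0// mulr_ge0.
apply: (@le_trans _ _ (\int[leb2]_p ((2 + 2 * C) * \1_Q p)%:E)).
  apply: ge0_le_integral => //.
  - by move=> p _; exact: integral_ge0.
  - exact: (@measurable_fun_fubini_tonelli_F _ _ E2 mR R lam F mF F0).
  - by apply/measurable_EFinP; apply: measurable_funM => //; exact: measurable_indic.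
  - move=> p _; rewrite /fubini_F indicE; have [Qp|Qp] := boolP (p \in Q); last first.
      rewrite integral0_eq ?mulr0// => c _; rewrite /F patchE ifF//.
      by apply/negP; rewrite inE => -[h _]; move: Qp; rewrite notin_setE; exact.
    rewrite mulr1.
    apply: (@le_trans _ _ (\int[lam]_(c in `[(-1)%R, 1%R]) (f (p, c) + C)%:E)).
      rewrite [leRHS]integral_mkcond le_eqVlt; apply/orP; left; apply/eqP.
      apply: eq_integral => c _; rewrite /F !patchE.
      rewrite (_ : ((p, c) \in box 1) = (c \in `[(-1)%R, 1%R]%classic))//.
      by apply/idP/idP; rewrite !inE; [case|split=> //; rewrite inE in Qp].
    pose G (c : R) : R := (U (p, c) + C * c)%R.
    have dG (c : R) : is_derive c (1%R : R) G (f (p, c) + C)%R.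
      have := dU p c => ?; rewrite /G; apply: is_derive_eq.
      by rewrite /GRing.scale /= mulr1.
    have cG : continuous (fun c : R => f (p, c) + C)%R.
      move=> c; apply: cvgD; last exact: cvg_cst.
      apply: (cvg_comp (fun c : R => (p, c)) f); last exact: cf.
      exact: (cvg_pair (cvg_cst p) (@cvg_id _ _)).
    have m11 : (-1 <= 1 :> R)%R by lra.
    rewrite (FTC_integral m11 dG cG) lee_fin /G.
    by have := U1 (p, 1%R); have := U1 (p, (-1)%R); rewrite !ler_norml => /andP[? ?] /andP[? ?]; lra.
under eq_integral do rewrite EFinM.
rewrite ge0_integralZl_EFin//; last by apply/measurable_EFinP; exact: measurable_indic.
by rewrite (etrans (integral_indic_T leb2 mQ) QE) -EFinM lee_fin; lra.
Qed.

(** Each of the three terms of the divergence contributes at most 8, for a total equal to the area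
    of the six faces. Permutations of the coordinates reduce the first two terms to the third. *)
Lemma perimeter_box : perimeter (box 1 : set E3) <= 24%:E.
Proof.
have mb := @measurable_box R 1%R; have boo := @box_lty R 1%R.
apply: perimeter_le => // X tX; have [cX sX X1] := tX.
have [GX1 GX2 GX3] := C1_jac cX.
have boxE8 : leb3 (box 1) = 8%:E.
  have m11 : (-1 <= 1 :> R)%R by lra.
  by apply: (etrans (leb3_brick m11 m11 m11)); congr (_%:E); ring.
pose f1 x := (jac1 X x).1.1; pose f2 x := (jac2 X x).1.2; pose f3 x := (jac3 X x).2.
have cf1 : continuous f1 := continuous_coord1 GX1.1.
have cf2 : continuous f2 := continuous_coord2 GX2.1.
have cf3 : continuous f3 := continuous_coord3 GX3.1.
have [K1 K10 B1] := continuous_box_bounded 1 cf1.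
have [K2 K20 B2] := continuous_box_bounded 1 cf2.
have [K3 K30 B3] := continuous_box_bounded 1 cf3.
pose C := (K1 + K2 + K3)%R; have C0 : (0 <= C)%R by rewrite !addr_ge0.
have sw (s : E3 -> E3) (f : R3 -> R) : preserves leb3 s -> continuous f ->
    (forall x, box 1 (s x) <-> box 1 x) -> (forall x, box 1 x -> `|f x| <= C)%R ->
    \int[leb3]_(x in box 1) (f x + C)%:E = \int[leb3]_(x in box 1) (f (s x) + C)%:E.
  move=> [ms ps] cf bs fC; pose F (x : E3) : \bar R := ((fun x : E3 => (f x + C)%:E) \_ (box 1)) x.
  have mF : measurable_fun setT F.
    apply/(measurable_restrictT _ mb); apply: measurable_funTS; apply/measurable_EFinP.
    by apply: measurable_funD => //; exact: continuous_measurable3.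
  have F0 x : 0 <= F x.
    rewrite /F patchE; case: ifPn => // /set_mem /fC.
    by rewrite ler_norml lee_fin => /andP[? _]; lra.
  rewrite integral_mkcond [RHS]integral_mkcond -[LHS](ps F mF F0).
  apply: eq_integral => x _; rewrite /F !patchE.
  by rewrite (_ : (s x \in box 1) = (x \in box 1))//; apply/idP/idP; rewrite !inE bs.
have leC i : (0 <= i -> 0 <= C - i -> forall r, r <= i -> r <= C)%R.
  by move=> _ h r ri; apply: le_trans ri _; rewrite -subr_ge0.
have C1b x : box 1 x -> (`|f1 x| <= C)%R.
  by move=> /B1 /le_trans; apply; rewrite /C -addrA lerDl addr_ge0.
have C2b x : box 1 x -> (`|f2 x| <= C)%R.
  by move=> /B2 /le_trans; apply; rewrite /C addrAC lerDr addr_ge0.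
have C3b x : box 1 x -> (`|f3 x| <= C)%R.
  by move=> /B3 /le_trans; apply; rewrite /C lerDr addr_ge0.
pose s1 (x : E3) : E3 := (x.2, x.1.1, x.1.2).
pose s2 (x : E3) : E3 := (x.1.1, x.2, x.1.2).
have bs1 x : box 1 (s1 x) <-> box 1 x by split=> /boxE[? ? ?]; apply/boxE.
have bs2 x : box 1 (s2 x) <-> box 1 x by split=> /boxE[? ? ?]; apply/boxE.
have ps1 : preserves leb3 s1 by exact: (preserves_comp preserves_swap12 preserves_swap23).
have ps2 : preserves leb3 s2 by exact: preserves_swap23.
have id3 := @continuous_id3 R.
have cs1 : continuous (s1 : R3 -> R3).
  exact: (continuous_pair3 (continuous_coord3 id3) (continuous_coord1 id3) (continuous_coord2 id3)).
have cs2 : continuous (s2 : R3 -> R3).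
  exact: (continuous_pair3 (continuous_coord1 id3) (continuous_coord3 id3) (continuous_coord2 id3)).
have T1 : \int[leb3]_(x in box 1) (f1 (s1 x) + C)%:E <= (8 + 8 * C)%:E.
  apply: (@integral_box_derive3 (fun x => (X (s1 x)).1.1) (fun x => f1 (s1 x))).
  - by move=> x; apply: (cvg_comp s1 f1); [exact: cs1|exact: cf1].
  - exact: C0.
  - by move=> x; apply: le_trans (norm_coord1_le _) _.
  - by move=> x /bs1 /C1b.
  - move=> p c; apply: (is_derive_line_eq (w := (0%R, p.1, p.2)) (v := e1) (l := fun c => (c, p.1, p.2)) GX1).
      by move=> t; congr (_, _, _); rewrite /= /GRing.scale /=; ring.
    exact: dot_e1.
have T2 : \int[leb3]_(x in box 1) (f2 (s2 x) + C)%:E <= (8 + 8 * C)%:E.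
  apply: (@integral_box_derive3 (fun x => (X (s2 x)).1.2) (fun x => f2 (s2 x))).
  - by move=> x; apply: (cvg_comp s2 f2); [exact: cs2|exact: cf2].
  - exact: C0.
  - by move=> x; apply: le_trans (norm_coord2_le _) _.
  - by move=> x /bs2 /C2b.
  - move=> p c; apply: (is_derive_line_eq (w := (p.1, 0%R, p.2)) (v := e2) (l := fun c => (p.1, c, p.2)) GX2).
      by move=> t; congr (_, _, _); rewrite /= /GRing.scale /=; ring.
    exact: dot_e2.
have T3 : \int[leb3]_(x in box 1) (f3 x + C)%:E <= (8 + 8 * C)%:E.
  apply: (@integral_box_derive3 (fun x => (X x).2) f3) => //.
  - by move=> x; apply: le_trans (norm_coord3_le _) _.
  - move=> p c; apply: (is_derive_line_eq (w := (p, 0%R)) (v := e3) (l := fun c => (p, c)) GX3).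
      by case: p => p1 p2 t; congr (_, _, _); rewrite /= /GRing.scale /=; ring.
    exact: dot_e3.
rewrite -(sw s1 f1 ps1 cf1 bs1 C1b) in T1; rewrite -(sw s2 f2 ps2 cf2 bs2 C2b) in T2.
have mfC f : continuous f -> measurable_fun (box 1) (fun x : E3 => (f x + C)%:E).
  move=> cf; apply: measurable_funTS; apply/measurable_EFinP.
  by apply: measurable_funD => //; exact: continuous_measurable3.
have fC0 (f : R3 -> R) : (forall x, box 1 x -> `|f x| <= C)%R ->
    forall x : E3, box 1 x -> 0 <= (f x + C)%:E.
  by move=> fC x /fC; rewrite ler_norml lee_fin => /andP[? _]; lra.
have i12 := ge0_integralD leb3 mb (fC0 _ C1b) (mfC _ cf1) (fC0 _ C2b) (mfC _ cf2).
have p12 (x : E3) : box 1 x -> 0 <= (f1 x + C)%:E + (f2 x + C)%:E.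
  by move=> bx; apply: adde_ge0; [exact: fC0 C1b x bx|exact: fC0 C2b x bx].
have i123 := ge0_integralD leb3 mb p12 (emeasurable_funD (mfC _ cf1) (mfC _ cf2))
  (fC0 _ C3b) (mfC _ cf3).
have iX := integrable_divergence mb tX boo.
have iC : leb3.-integrable (box 1) (EFin \o cst (3 * C)%R).
  by apply: (@integrable_bounded _ _ _ (3 * C)%R) => // x; rewrite ger0_norm// mulr_ge0.
have IC : \int[leb3]_(x in box 1) (EFin \o cst (3 * C)%R) x = (24 * C)%:E.
  apply: (etrans (integral_cst leb3 mb (3 * C)%:E)).
  by apply: (etrans (congr1 _ boxE8)); rewrite -EFinM; congr (_%:E); ring.
have := integralD mb iX iC.
have -> : \int[leb3]_(x in box 1) ((EFin \o divergence X) x + (EFin \o cst (3 * C)%R) x) =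
    \int[leb3]_(x in box 1) ((f1 x + C)%:E + (f2 x + C)%:E + (f3 x + C)%:E).
  apply: eq_integral => x _; rewrite /= -!EFinD; congr (_%:E).
  rewrite /divergence /f1 /f2 /f3 /jac1 /jac2 /jac3.
  move: ('D_e1 X x) ('D_e2 X x) ('D_e3 X x) => [[a1 a2] a3] [[b1 b2] b3] [[c1 c2] c3] /=.
  ring.
rewrite IC => E0; have T := leeD (leeD T1 T2) T3.
rewrite -(@leeD2rE _ (24 * C)%:E)//; apply: (@le_trans _ _ (\int[leb3]_(x in box 1) (f1 x + C)%:E +
  \int[leb3]_(x in box 1) (f2 x + C)%:E + \int[leb3]_(x in box 1) (f3 x + C)%:E)).
  by rewrite -i12 -i123 E0.
apply: (le_trans T); rewrite -!EFinD lee_fin le_eqVlt; apply/orP; left; apply/eqP; ring.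
Qed.

End box_perimeter.

(** * Compactness and lower semicontinuity *)

Section cells.
Context {R : realType}.
Notation lam := (@lebesgue_measure R).
Notation mR := (measurableTypeR R).
Notation E2 := (mR * mR)%type.
Notation E3 := (E2 * mR)%type.
Notation leb3 := (@leb3 R).
Notation R3 := (R * R * R)%type.
Local Open Scope ereal_scope.

(** The label q makes the sets S i disjoint, since a point belongs at most to the one carrying its
    own label. The next lemma is the converse bound, where the labels describe a cover. *)
Lemma sum_measure_fiber d (T : measurableType d) (m : {measure set T -> \bar R})
    (I : finType) (q : T -> I) (S : I -> set T) (U : set T) :
  (forall i, measurable (S i)) -> measurable U ->
  (forall i x, S i x -> q x = i /\ U x) -> \sum_i m (S i) <= m U.
Proof.
move=> mS mU SU.
have mi (A : set T) : measurable A -> measurable_fun setT (fun x => (\1_A x : R)%:E).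
  by move=> mA; apply/measurable_EFinP; exact: measurable_indic.
rewrite -(integral_indic_T m mU).
under eq_bigr => i _ do rewrite -(integral_indic_T m (mS i)).
rewrite -ge0_integral_sum//; last by move=> i; exact: mi.
apply: ge0_le_integral => //.
- by move=> x _; apply: sume_ge0 => i _; rewrite lee_fin.
- by apply: emeasurable_sum => i; exact: mi.
- exact: mi.
move=> x _; rewrite (bigD1 (q x))//= big1 ?adde0; last first.
  by move=> i iq; rewrite indicE memNset// => /SU[qi _]; move: iq; rewrite qi eqxx.
rewrite lee_fin !indicE ler_nat; case: (boolP (x \in S (q x))) => // /set_mem/SU[_ Ux].
by rewrite mem_set.
Qed.

Lemma measure_le_fiber d (T : measurableType d) (m : {measure set T -> \bar R})
    (I : finType) (q : T -> I) (S : I -> set T) (U : set T) :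
  (forall i, measurable (S i)) -> measurable U ->
  (forall x, U x -> S (q x) x) -> m U <= \sum_i m (S i).
Proof.
move=> mS mU SU.
have mi (A : set T) : measurable A -> measurable_fun setT (fun x => (\1_A x : R)%:E).
  by move=> mA; apply/measurable_EFinP; exact: measurable_indic.
rewrite -(integral_indic_T m mU).
under eq_bigr => i _ do rewrite -(integral_indic_T m (mS i)).
rewrite -ge0_integral_sum//; last by move=> i; exact: mi.
apply: ge0_le_integral => //.
- exact: mi.
- by apply: emeasurable_sum => i; exact: mi.
move=> x _; rewrite (bigD1 (q x))//=; apply: (@le_trans _ _ (\1_(S (q x)) x)%:E).
  rewrite lee_fin !indicE ler_nat; case: (boolP (x \in U)) => // /set_mem/SU Sx.
  by rewrite mem_set.
by rewrite leeDl// sume_ge0// => i _; rewrite lee_fin.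
Qed.

Definition symd (A B : set E3) : set E3 := (A `\` B) `|` (B `\` A).

Lemma measurable_symd A B : measurable A -> measurable B -> measurable (symd A B).
Proof. by move=> mA mB; apply: measurableU; exact: measurableD. Qed.

Let compl_le (V G N : \bar R) (c e : R) : V \is a fin_num -> G \is a fin_num ->
  N \is a fin_num -> V * c%:E = G + N -> (c * fine V <= fine G + e)%R -> N <= e%:E.
Proof. by case: V G N => [V| |] [G| |] [N| |]//= _ _ _ []; rewrite lee_fin; lra. Qed.

(** All pairs at distance less than t with first point in A have measure |A| 4/3 pi t^3. What
    [key_estimate] says is missing from G(t) bounds the pairs that leave A; this plays the part of a
    Poincare inequality in the proof of compactness. *)
Lemma near_compl (A : set E3) p t : measurable A -> leb3 A < +oo ->
  perimeter A <= p%:E -> (0 < t)%R -> near_pairs A (~` A) t <= (pi / 4 * t ^+ 4 * p)%:E.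
Proof.
move=> mA Aoo Ap t0; have mC := measurableC mA.
have E : leb3 A * (4 / 3 * pi * t ^+ 3)%:E = near_pairs A A t + near_pairs A (~` A) t.
  rewrite -(ball3_volume (ltW t0)) -(near_setT t mA) (near_split t mA measurableT mA).
  by rewrite setTI setTD.
have Afin : leb3 A \is a fin_num by rewrite (ge0_fin_numE (measure_ge0 leb3 A)).
exact: (compl_le Afin (near_fin_num t mA mA Aoo) (near_fin_num t mA mC Aoo) E
  (key_estimate mA Aoo Ap t0)).
Qed.

(* The cubes of side 1/k tiling [-J, J[^3 (and a bit more). *)
Definition cside (J k : nat) := (2 * J * k).+1.
Definition citv (J k : nat) (i : nat) : set mR :=
  `[(i%:R / k%:R - J%:R)%R, (i.+1%:R / k%:R - J%:R)%R[%classic.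
Definition cindex (J k : nat) := ('I_(cside J k) * 'I_(cside J k) * 'I_(cside J k))%type.
Definition cell (J k : nat) (i : cindex J k) : set E3 :=
  (citv J k i.1.1 `*` citv J k i.1.2) `*` citv J k i.2.

Definition cpos (J k : nat) (u : R) : nat := Num.truncn ((u + J%:R) * k%:R)%R.
Definition clocate (J k : nat) (x : E3) : cindex J k :=
  (inord (cpos J k x.1.1), inord (cpos J k x.1.2), inord (cpos J k x.2)).

Lemma citvP (J k i : nat) u : (0 < k)%N ->
  citv J k i u <-> (i%:R <= (u + J%:R) * k%:R < i.+1%:R)%R.
Proof.
move=> k0; have k0' : (0 < k%:R :> R)%R by rewrite ltr0n.
by rewrite /citv /= in_itv /= lerBlDr ltrBrDr ler_pdivrMr// ltr_pdivlMr.
Qed.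

Lemma cell_locate (J k : nat) (i : cindex J k) x : (0 < k)%N -> cell i x ->
  clocate J k x = i.
Proof.
move=> k0; case: i => -[i1 i2] i3 [[/= /(citvP _ _ _ k0) h1 /(citvP _ _ _ k0) h2] /(citvP _ _ _ k0) h3].
rewrite /clocate /cpos (truncn_def h1) (truncn_def h2) (truncn_def h3).
by rewrite !inord_val.
Qed.

Lemma box_cell (J k : nat) (x : E3) : (0 < k)%N -> box J%:R x ->
  cell (clocate J.+1 k x) x.
Proof.
move=> k0 /boxE[b1 b2 b3].
have k0' : (0 < k%:R :> R)%R by rewrite ltr0n.
have H u : (`|u| <= J%:R)%R -> citv J.+1 k (inord (cpos J.+1 k u) : 'I_(cside J.+1 k)) u.
  rewrite ler_norml => /andP[u1 u2].
  have u0 : (0 <= (u + J.+1%:R) * k%:R)%R.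
    by rewrite mulr_ge0// -addn1 natrD; lra.
  have /andP[t1 t2] := truncn_itv u0; apply/citvP => //.
  rewrite inordK ?t1//; rewrite /cside ltnS -(ler_nat R); apply: (le_trans t1).
  rewrite natrM ler_wpM2r// -addn1 mulnDr !natrD natrM; lra.
by split; [split|]; exact: H.
Qed.

Lemma measurable_cell J k (i : cindex J k) : measurable (cell i).
Proof.
have mc n : measurable (citv J k n) by exact: measurable_itv.
exact: measurableX (measurableX (mc _) (mc _)) (mc _).
Qed.

Lemma leb3_cell J k (i : cindex J k) : (0 < k)%N -> leb3 (cell i) = (k%:R ^- 3)%:E.
Proof.
move=> k0; have k0' : (0 < k%:R :> R)%R by rewrite ltr0n.
have H n : lam (citv J k n) = (k%:R^-1)%:E.
  rewrite /citv lebesgue_measure_itv /= lte_fin ltrD2r ltr_pM2r ?invr_gt0// ltr_nat ltnSn.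
  rewrite -EFinB; congr (_%:E); rewrite -(natr1 n); field; rewrite gt_eqF//.
have mc n : measurable (citv J k n) by exact: measurable_itv.
transitivity (lam (citv J k i.1.1) * lam (citv J k i.1.2) * lam (citv J k i.2)).
  exact: (leb3_setX (mc _) (mc _) (mc _)).
rewrite !H -!EFinM; congr (_%:E); field.
by rewrite gt_eqF.
Qed.

Lemma cell_dist J k (i : cindex J k) (x y : R3) : (0 < k)%N -> cell i x -> cell i y ->
  (enorm (x - y) < 2 / k%:R)%R.
Proof.
move=> k0 Qx Qy; have k0' : (0 < k%:R :> R)%R by rewrite ltr0n.
have H n (u v : R) : citv J k n u -> citv J k n v -> ((u - v) ^+ 2 <= k%:R ^- 2)%R.
  rewrite /citv /= !in_itv /= => /andP[u1 u2] /andP[v1 v2].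
  have d : (n.+1%:R / k%:R = n%:R / k%:R + k%:R^-1 :> R)%R.
    by rewrite -(natr1 n); field; rewrite gt_eqF.
  rewrite d in u2 v2; rewrite -exprVn -(real_normK (num_real (u - v)%R)).
  rewrite lerXn2r ?nnegrE ?invr_ge0 ?(ltW k0')// ler_norml.
  by apply/andP; split; lra.
have [[/= x1 x2] x3] := Qx; have [[/= y1 y2] y3] := Qy.
have h1 := H _ _ _ x1 y1; have h2 := H _ _ _ x2 y2; have h3 := H _ _ _ x3 y3.
rewrite -ltr_sqr ?nnegrE ?enorm_ge0 ?divr_ge0// -sqnormE /=.
rewrite expr_div_n; have : (0 < k%:R ^- 2 :> R)%R by rewrite invr_gt0 exprn_gt0.
move: (k%:R ^- 2)%R h1 h2 h3 => K h1 h2 h3 K0.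
have -> : (2 ^+ 2 * K = 4 * K)%R by ring.
by lra.
Qed.

End cells.

Section symd_cells.
Context {R : realType}.
Notation mR := (measurableTypeR R).
Notation E2 := (mR * mR)%type.
Notation E3 := (E2 * mR)%type.
Notation leb3 := (@leb3 R).
Notation leb6 := (@leb6 R).
Local Open Scope ereal_scope.

(** Here q is the volume of a cell, a and b are the masses of two sets in it, and s that of their
    symmetric difference. If both sets fill at most half of the cell, or both at least half, s is
    bounded by the smaller parts, and q a <= 2 a (q - a) when a <= q / 2. Otherwise a and b are on
    opposite sides of q / 2 and q |a - b| makes up the rest. *)
Let cell_arith (q a b s : R) : (0 <= a -> a <= q -> 0 <= b -> b <= q ->
  s <= a + b -> s <= (q - a) + (q - b) -> s <= q ->
  q * s <= 2 * (a * (q - a)) + 2 * (b * (q - b)) + q * `|a - b|)%R.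
Proof.
move=> a0 aq b0 bq s1 s2 s3; have q0 : (0 <= q)%R by lra.
have H1 := ler_wpM2l q0 s1; have H2 := ler_wpM2l q0 s2; have H3 := ler_wpM2l q0 s3.
have n0 : (0 <= q * `|a - b|)%R by rewrite mulr_ge0.
have A1 : (a <= q / 2 -> q * a <= 2 * (a * (q - a)))%R by move=> h; nra.
have A2 : (q / 2 <= a -> q * (q - a) <= 2 * (a * (q - a)))%R by move=> h; nra.
have B1 : (b <= q / 2 -> q * b <= 2 * (b * (q - b)))%R by move=> h; nra.
have B2 : (q / 2 <= b -> q * (q - b) <= 2 * (b * (q - b)))%R by move=> h; nra.
have N1 := ler_wpM2l q0 (ler_norm (a - b)%R).
have N2 := ler_wpM2l q0 (ler_norm (b - a)%R); rewrite distrC in N2.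
have [ha|ha] := lerP a (q / 2)%R; have [hb|hb] := lerP b (q / 2)%R.
- by have := A1 ha; have := B1 hb; move: H1; rewrite mulrDr; lra.
- by have := A1 ha; have := B2 (ltW hb); move: N2 H3; rewrite !mulrBr; lra.
- by have := A2 (ltW ha); have := B1 hb; move: N1 H3; rewrite !mulrBr; lra.
- by have := A2 (ltW ha); have := B2 (ltW hb); move: H2; rewrite mulrDr; lra.
Qed.

Lemma fine_leb3 (A : set E3) : leb3 A < +oo -> leb3 A = (fine (leb3 A))%:E.
Proof. by move=> Aoo; rewrite fineK// (ge0_fin_numE (measure_ge0 leb3 A)). Qed.

Let sub_lty (A B : set E3) : measurable A -> measurable B -> A `<=` B ->
  leb3 B < +oo -> leb3 A < +oo.
Proof. by move=> mA mB AB; apply: le_lt_trans; apply: le_measure; rewrite ?inE. Qed.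

Section one_set.
Variables (A : set E3) (J k : nat) (p : R).
Hypotheses (mA : measurable A) (Aoo : leb3 A < +oo) (Ap : perimeter A <= p%:E)
  (k0 : (0 < k)%N).

Definition cmass (i : cindex J k) : R := fine (leb3 (A `&` cell i)).

Let q : R := (k%:R ^- 3)%R.

Let mAC (i : cindex J k) : measurable (A `&` cell i).
Proof. exact: (measurableI _ _ mA (measurable_cell i)). Qed.

Let mDC (i : cindex J k) : measurable (cell i `\` A).
Proof. exact: (measurableD (measurable_cell i) mA). Qed.

Lemma cmass_ge0 i : (0 <= cmass i)%R.
Proof. exact: (fine_ge0 (measure_ge0 leb3 _)). Qed.

Lemma cmassE i : leb3 (A `&` cell i) = (cmass i)%:E.
Proof. apply: fine_leb3; apply: (sub_lty (mAC i) mA) => //. Qed.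

Lemma cmassC i : leb3 (cell i `\` A) = (q - cmass i)%:E.
Proof.
have : leb3 (cell i) = leb3 (cell i `\` A) + leb3 (cell i `&` A).
  exact: (measureDI leb3 (measurable_cell i) mA).
rewrite (leb3_cell i k0) [cell i `&` A]setIC cmassE -/q.
have : leb3 (cell i `\` A) < +oo.
  have Qoo : leb3 (cell i) < +oo by rewrite (leb3_cell i k0) ltry.
  exact: (sub_lty (mDC i) (measurable_cell i) (@subDsetl _ _ _) Qoo).
move=> /fine_leb3 ->; rewrite -EFinD => -[->].
by rewrite addrK.
Qed.

Lemma cmass_le i : (cmass i <= q)%R.
Proof.
rewrite -lee_fin -cmassE -(leb3_cell i k0).
by apply: le_measure; rewrite ?inE; [exact: mAC|exact: measurable_cell|exact: subIsetr].
Qed.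

(** Each summand is the measure of the pairs in one cell with one point in A and one outside. Two
    points of a cell are at distance less than 2 / k, so [near_compl] at t = 2 / k bounds all these
    pairs together. *)
Lemma sum_cmass : (\sum_i cmass i * (q - cmass i) <= 4 * pi * p / k%:R ^+ 4)%R.
Proof.
have k0' : (0 < k%:R :> R)%R by rewrite ltr0n.
rewrite -lee_fin -sumEFin; have t0 : (0 < 2 / k%:R :> R)%R by rewrite divr_gt0.
have mC := measurableC mA.
have := near_compl mA Aoo Ap t0.
have -> : (pi / 4 * (2 / k%:R) ^+ 4 * p = 4 * pi * p / k%:R ^+ 4)%R.
  by field; rewrite gt_eqF.
apply: le_trans.
apply: (@le_trans _ _ (\sum_(i : cindex J k) leb6 ((A `&` cell i) `*` (cell i `\` A)))).
  apply: lee_sum => i _.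
  by rewrite (leb6_setX (mAC i) (mDC i)) cmassE cmassC -EFinM.
apply: (@sum_measure_fiber R _ _ leb6 _ (fun z => clocate J k z.1)).
- by move=> i; exact: measurable_setX6.
- exact: measurable_pairs.
- move=> i z [[Az Qz] [Qz2 nAz]]; split; first exact: cell_locate.
  by split=> //; exact: (cell_dist k0 Qz Qz2).
Qed.

End one_set.

(** Sum [cell_arith] over the cells and divide by the volume k^-3 of a cell: the products of
    [sum_cmass], taken twice for each of the two sets, give 16 pi p / k. *)
Lemma symd_cells (A B : set E3) (J k : nat) (p delta : R) :
  measurable A -> leb3 A < +oo -> perimeter A <= p%:E ->
  measurable B -> leb3 B < +oo -> perimeter B <= p%:E -> (0 < k)%N ->
  (forall i : cindex J.+1 k, `|cmass A i - cmass B i| <= delta)%R ->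
  leb3 (box J%:R `&` symd A B) <=
    (16 * pi * p / k%:R + delta *+ #|{: cindex J.+1 k}|)%:E.
Proof.
move=> mA Aoo Ap mB Boo Bp k0 ab.
have k0' : (0 < k%:R :> R)%R by rewrite ltr0n.
have ms := measurable_symd mA mB; have mb := @measurable_box R J%:R.
pose q : R := (k%:R ^- 3)%R; have q0 : (0 < q)%R by rewrite invr_gt0 exprn_gt0.
have mS (i : cindex J.+1 k) : measurable (cell i `&` symd A B).
  exact: (measurableI _ _ (measurable_cell i) ms).
pose s (i : cindex J.+1 k) := fine (leb3 (cell i `&` symd A B)).
have sE i : leb3 (cell i `&` symd A B) = (s i)%:E.
  have Qoo : leb3 (cell i) < +oo by rewrite (leb3_cell i k0) ltry.
  exact: (fine_leb3 (sub_lty (mS i) (measurable_cell i) (@subIsetl _ _ _) Qoo)).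
have mAC i : measurable (A `&` cell i) := measurableI _ _ mA (measurable_cell (i : cindex J.+1 k)).
have mBC i : measurable (B `&` cell i) := measurableI _ _ mB (measurable_cell (i : cindex J.+1 k)).
have mAD i : measurable (cell i `\` A) := measurableD (measurable_cell (i : cindex J.+1 k)) mA.
have mBD i : measurable (cell i `\` B) := measurableD (measurable_cell (i : cindex J.+1 k)) mB.
have step i : (q * s i <= 2 * (cmass A i * (q - cmass A i)) +
    2 * (cmass B i * (q - cmass B i)) + q * delta)%R.
  apply: (@le_trans _ _ (2 * (cmass A i * (q - cmass A i)) +
    2 * (cmass B i * (q - cmass B i)) + q * `|cmass A i - cmass B i|)%R); last first.
    by rewrite lerD2l ler_pM2l.
  apply: cell_arith.
  - exact: cmass_ge0.
  - exact: cmass_le.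
  - exact: cmass_ge0.
  - exact: cmass_le.
  - rewrite -lee_fin -sE EFinD -!cmassE//.
    by apply: (measure_subU leb3 (mS i) (mAC i) (mBC i)) => x [Qx [[Ax _]|[Bx _]]]; [left|right].
  - rewrite -lee_fin -sE EFinD -!cmassC//.
    by apply: (measure_subU leb3 (mS i) (mAD i) (mBD i)) => x [Qx [[Ax nB]|[Bx nA]]]; [right|left].
  - rewrite -lee_fin -sE -(leb3_cell i k0).
    by apply: le_measure; rewrite ?inE; [exact: mS|exact: measurable_cell|exact: subIsetl].
apply: (@le_trans _ _ (\sum_(i : cindex J.+1 k) leb3 (cell i `&` symd A B))).
  apply: (@measure_le_fiber R _ _ leb3 _ (clocate J.+1 k)) => //.
    exact: measurableI.
  by move=> x [bx sx]; split=> //; exact: box_cell.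
under eq_bigr do rewrite sE.
rewrite sumEFin lee_fin -(ler_pM2l q0) mulr_sumr.
apply: (le_trans (ler_sum _ (fun i _ => step i))).
rewrite !big_split /= -!mulr_sumr sumr_const.
have HA := sum_cmass J.+1 mA Aoo Ap k0.
have HB := sum_cmass J.+1 mB Boo Bp k0.
rewrite mulrDr; apply: lerD; last by rewrite mulrnAr.
have -> : (q * (16 * pi * p / k%:R) = 2 * (4 * pi * p / k%:R ^+ 4) + 2 * (4 * pi * p / k%:R ^+ 4))%R.
  by rewrite /q; field; rewrite gt_eqF.
have t0 : (0 <= 2 :> R)%R by [].
exact: (lerD (ler_wpM2l t0 HA) (ler_wpM2l t0 HB)).
Qed.

End symd_cells.

Section compactness.
Context {R : realType}.
Notation mR := (measurableTypeR R).
Notation E2 := (mR * mR)%type.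
Notation E3 := (E2 * mR)%type.
Notation leb3 := (@leb3 R).
Local Open Scope ereal_scope.

Lemma ultra_real_limit (U : set_system nat) (f : nat -> R) (b : R) : UltraFilter U ->
  (forall n, 0 <= f n <= b)%R ->
  exists nu : R, forall delta, (0 < delta)%R -> U [set n | `|f n - nu| <= delta]%R.
Proof.
move=> UU fb; have PF : ProperFilter (f @ U) by exact: fmap_proper_filter.
have fU : (f @ U) `[0%R, b]%classic.
  suff : U [set n | `[0%R, b]%classic (f n)] by [].
  by rewrite (_ : [set n | _] = setT); [exact: filterT|
    apply/seteqP; split=> // n _ /=; rewrite in_itv /=; exact: fb].
have [] := @segment_compact R 0%R b (f @ U) PF fU.
move=> nu [_ cl]; exists nu => delta d0.
have [//|nS] := in_ultra_setVsetC [set n | `|f n - nu| <= delta]%R UU.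
have [y [yA yB]] := cl [set y | ~ (`|y - nu| <= delta)%R] (ball nu delta) nS
  (nbhsx_ballx nu delta d0).
by exfalso; apply: yA; rewrite distrC ltW.
Qed.

(** Along an ultrafilter finer than the neighbourhoods of infinity, the masses of all cells at all
    scales converge at once, which takes the place of a diagonal extraction. For each scale j the
    indices whose cell masses agree up to [delta j] form a set S j of the ultrafilter. *)
Lemma perimeter_compact (A : nat -> set E3) (p : R) :
  (forall n, measurable (A n)) -> (forall n, leb3 (A n) < +oo) ->
  (forall n, perimeter (A n) <= p%:E) ->
  exists nn : nat -> nat, forall j, (j <= nn j)%N /\
    leb3 (box j%:R `&` symd (A (nn j)) (A (nn j.+1))) <= (2^-1 ^+ j)%:E.
Proof.
move=> mA Aoo Ap.
have p0 : (0 <= p)%R by rewrite -lee_fin; exact: le_trans (perimeter_ge0 (mA 0%N)) (Ap 0%N).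
have [U [UU Uoo]] := @ultraFilterLemma nat (nbhs \oo) _.
have FU : Filter U := @filter_filter _ _ (@ultra_proper _ _ UU).
pose eta (j : nat) : R := (2^-1 ^+ j)%R.
have eta0 j : (0 < eta j)%R by rewrite exprn_gt0// invr_gt0.
(* [k] and [delta] share the error of [symd_cells] evenly: 16 pi p / k is at most eta / 2, and so is
   [delta] summed over all cells. *)
pose k (j : nat) := (Num.truncn (16 * pi * p * 2 / eta j)%R).+1.
pose I j := cindex j.+1 (k j).
pose delta (j : nat) : R := (eta j / 2 / (#|{: I j}|).+1%:R)%R.
have delta0 j : (0 < delta j)%R by rewrite !divr_gt0.
have lim j (i : I j) : exists nu : R,
    U [set n | `|cmass (A n) i - nu| <= delta j / 2]%R.
  have [|nu nuP] := @ultra_real_limit U (fun n => cmass (A n) i) ((k j)%:R ^- 3)%R UU.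
    by move=> n; rewrite cmass_ge0 (cmass_le (mA n)).
  by exists nu; apply: nuP; rewrite divr_gt0.
pose good j (S : set nat) := U S /\ forall n m, S n -> S m ->
    forall i : I j, (`|cmass (A n) i - cmass (A m) i| <= delta j)%R.
have exgood j : exists S, good j S.
  have [nu nuP] := choice (lim j).
  exists [set n | forall i : I j, (`|cmass (A n) i - nu i| <= delta j / 2)%R]; split.
    suff H (s : seq (I j)) : U [set n | forall i, i \in s -> (`|cmass (A n) i - nu i| <= delta j / 2)%R].
      by apply: (filterS _ (H (enum {: I j}))) => n h i; apply: h; rewrite mem_enum.
    elim: s => [|i s IH]; first by apply: (filterS _ filterT).
    apply: (filterS _ (filterI (nuP i) IH)) => n [h1 h2] l; rewrite inE => /predU1P[->|] //.
    exact: h2.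
  move=> n m Sn Sm i; rewrite -(subrKA (nu i)) (le_trans (ler_normD _ _))//.
  by rewrite [leRHS]splitr lerD// distrC.
have [S SP] := choice exgood.
(* Taking nn j in both S j and S j.+1 ensures that nn j and nn j.+1 lie together in S j.+1, where
   they can be compared. *)
have ex j : exists n, [/\ S j n, S j.+1 n & (j <= n)%N].
  have [|n [[n1 n2] n3]] := @filter_ex _ U _ (S j `&` S j.+1 `&` [set n | (j <= n)%N]).
    apply: filterI; first by apply: filterI; exact: (SP _).1.
    by apply: Uoo; exists j.
  by exists n.
have [nn nnP] := choice ex.
exists nn => j; have [_ s1 jn] := nnP j; split=> //.
have [s2 _ _] := nnP j.+1.
have sub : box j%:R `&` symd (A (nn j)) (A (nn j.+1)) `<=`
    box j.+1%:R `&` symd (A (nn j)) (A (nn j.+1)).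
  have jS : (j%:R <= j.+1%:R :> R)%R by rewrite ler_nat.
  move=> x [/boxE[b1 b2 b3] sx]; split=> //.
  by apply/boxE; split; apply: le_trans jS.
have ms := measurable_symd (mA (nn j)) (mA (nn j.+1)).
have mbs i : measurable (box i%:R `&` symd (A (nn j)) (A (nn j.+1))).
  by apply: measurableI => //; exact: measurable_box.
apply: (@le_trans _ _ (leb3 (box j.+1%:R `&` symd (A (nn j)) (A (nn j.+1))))).
  by apply: le_measure; rewrite ?inE; [exact: mbs|exact: mbs|exact: sub].
have k0 : (0 < k j.+1)%N by [].
apply: (le_trans (symd_cells (mA _) (Aoo _) (Ap _) (mA _) (Aoo _) (Ap _) k0
  ((SP j.+1).2 _ _ s1 s2))).
rewrite lee_fin; apply: (@le_trans _ _ (eta j.+1)); last first.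
  by rewrite /eta exprS ler_piMl ?exprn_ge0// invf_le1// ler1n.
rewrite [leRHS]splitr; apply: lerD.
  rewrite ler_pdivrMr// [leRHS]mulrC -ler_pdivrMr ?divr_gt0//.
  apply: (le_trans _ (ltW (truncnS_gt (16 * pi * p * 2 / eta j.+1)%R))).
  by rewrite le_eqVlt; apply/orP; left; apply/eqP; field; rewrite gt_eqF.
rewrite /delta -[leLHS]mulr_natr -[leLHS]mulrA ler_piMr ?divr_ge0 ?(ltW (eta0 _))//.
by rewrite mulrC ler_pdivrMr// mul1r ler_nat.
Qed.

End compactness.

Section limit_set.
Context {R : realType}.
Notation mR := (measurableTypeR R).
Notation E2 := (mR * mR)%type.
Notation E3 := (E2 * mR)%type.
Notation leb3 := (@leb3 R).
Local Open Scope ereal_scope.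

(** The limit is chosen as a lower limit of sets so that each of its points belongs to all A j from
    some index on; this is the form in which Fatou's lemma is applied to the Coulomb energy. *)
Definition liminf_set (A : nat -> set E3) : set E3 :=
  \bigcup_m \bigcap_(j in [set j | (m <= j)%N]) A j.

Lemma liminf_setP A x : liminf_set A x <-> exists m, forall j, (m <= j)%N -> A j x.
Proof. by split=> [[m _ h]|[m h]]; [exists m => j; exact: h|exists m => // j; exact: h]. Qed.

Lemma measurable_liminf_set A : (forall n, measurable (A n)) -> measurable (liminf_set A).
Proof.
move=> mA; apply: bigcupT_measurable => m; apply: bigcap_measurable; last by move=> k _.
by exists m => /=.
Qed.

(** A point of [box j] that avoids every [E i] has the same membership in all A n with n >= j, hence
    in the limit. The measures of the [E i] form a geometric series starting at 2^-j. *)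
Lemma leb3_limit_set (A : nat -> set E3) : (forall n, measurable (A n)) ->
  (forall j, leb3 (box j%:R `&` symd (A j) (A j.+1)) <= (2^-1 ^+ j)%:E) ->
  forall j, leb3 (box j%:R `&` symd (A j) (liminf_set A)) <= (2 * 2^-1 ^+ j)%:E.
Proof.
move=> mA HA j; pose E i := box (i + j)%:R `&` symd (A (i + j)%N) (A (i + j).+1).
have mE i : measurable (E i).
  apply: measurableI; [exact: measurable_box|exact: measurable_symd].
have mL : measurable (box j%:R `&` symd (A j) (liminf_set A)).
  apply: measurableI; first exact: measurable_box.
  by apply: measurable_symd => //; exact: measurable_liminf_set.
have sub : box j%:R `&` symd (A j) (liminf_set A) `<=` \bigcup_i E i.
  move=> x [bx sx]; apply: contrapT => nE.
  have eqA i : A (i + j)%N x <-> A (i + j).+1 x.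
    have bi : box (i + j)%:R x.
      have ij : (j%:R <= (i + j)%:R :> R)%R by rewrite ler_nat leq_addl.
      by move/boxE: bx => -[b1 b2 b3]; apply/boxE; split; apply: le_trans ij.
    have ns : ~ symd (A (i + j)%N) (A (i + j).+1) x.
      by move=> h; apply: nE; exists i.
    split=> h; apply: contrapT => h'; apply: ns; [left|right]; split=> //.
  have eqj i : A (i + j)%N x <-> A j x.
    by elim: i => [|i IH] //; rewrite addSn -eqA.
  case: sx => -[h1 h2].
    apply: h2; apply/liminf_setP; exists j => i ji.
    by rewrite -(subnK ji); apply/eqj.
  move: h1 => /liminf_setP[m h]; apply: h2.
  by apply/(eqj m)/h; exact: leq_addr.
apply: (le_trans (measure_sigma_subadditive leb3 mE mL sub)).
have := @cvg_geometric_eseries_half R 2 j.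
have -> : (fun k => (2 / (2 ^ (k + j.+1))%:R)%:E : \bar R) = (fun k => (2^-1 ^+ (k + j))%:E).
  apply/funext => k; congr (_%:E); rewrite addnS expnS natrM natrX exprVn.
  by field; rewrite ?expf_neq0//= pnatr_eq0.
move=> /cvg_lim; move=> /(_ (@ereal_hausdorff R)).
have -> : (2 / 2 ^+ j = 2 * 2^-1 ^+ j :> R)%R by rewrite exprVn.
move=> <-; apply: lee_nneseries => i _ //.
exact: HA.
Qed.

End limit_set.

Section semicontinuity.
Context {R : realType}.
Notation mR := (measurableTypeR R).
Notation E2 := (mR * mR)%type.
Notation E3 := (E2 * mR)%type.
Notation E6 := (E3 * E3)%type.
Notation leb3 := (@leb3 R).
Notation leb6 := (@leb6 R).
Local Open Scope ereal_scope.

Let arith1 (c s i i' a e : R) : (i' + 2^-1 * c <= a + e / 2 -> i <= i' + s ->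
  s <= e / 2 -> c <= 2 * (a + e - i))%R.
Proof. by lra. Qed.

Let arith2 (c i a e : R) : (c <= 2 * (a + e - i) -> i + 2^-1 * c <= a + e)%R.
Proof. by lra. Qed.

Let arith3 (d C : R) (a b : bool) : (- C <= d -> d <= C ->
  d * a%:R <= d * b%:R + C * (a && ~~ b || b && ~~ a)%:R)%R.
Proof. by case: a; case: b => /=; rewrite ?mulr1 ?mulr0; lra. Qed.

(** Fatou: at a pair of points of Om, the indicator of A n x A n is 1 for all large n, so the kernel
    restricted to Om x Om is below the lower limit of the restricted kernels. *)
Lemma coul_lsc (A : nat -> set E3) (Om : set E3) (K : \bar R) :
  (forall n, measurable (A n)) -> measurable Om ->
  (forall x, Om x -> exists m, forall j, (m <= j)%N -> A j x) ->
  (exists m, forall j, (m <= j)%N -> coul (A j) (A j) <= K) -> coul Om Om <= K.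
Proof.
move=> mA mO HO [m0 HK].
have mAA (B : set E3) : measurable B -> measurable (B `*` B : set E6).
  by move=> mB; exact: measurable_setX6.
pose f n (z : E6) : \bar R := ((fun z => (dist z)^-1%:E) \_ (A n `*` A n)) z.
have mf n : measurable_fun setT (f n).
  apply/(measurable_restrictT _ (mAA _ (mA n))).
  by apply: measurable_funTS; exact: measurable_idist.
have f0 n z : 0 <= f n z by rewrite /f patchE; case: ifP => // _; exact: idist_ge0.
pose g (z : E6) : \bar R := ((fun z => (dist z)^-1%:E) \_ (Om `*` Om)) z.
have mg : measurable_fun setT g.
  apply/(measurable_restrictT _ (mAA _ mO)).
  by apply: measurable_funTS; exact: measurable_idist.
have g0 z : 0 <= g z by rewrite /g patchE; case: ifP => // _; exact: idist_ge0.
have ml : measurable_fun setT (fun z => limn_einf (f ^~ z)).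
  apply: measurableT_comp => //; apply: measurable_fun_limn_esup => n.
  exact: measurableT_comp.
have -> : coul Om Om = \int[leb6]_z g z by rewrite /coul integral_mkcond.
apply: (@le_trans _ _ (\int[leb6]_z limn_einf (f ^~ z))).
  apply: ge0_le_integral => //.
  move=> z _; rewrite /g patchE; case: ifPn => [/set_mem[/= /HO[m1 h1] /HO[m2 h2]]|_]; last first.
    rewrite limn_einf_lim; apply: lime_ge; first exact: is_cvg_einfs.
    by apply: nearW => n; apply: le_ereal_inf_tmp => _ [k _ <-].
  rewrite limn_einf_lim; apply: lime_ge; first exact: is_cvg_einfs.
  exists (maxn m1 m2) => // n /=; rewrite geq_max => /andP[n1 n2].
  apply: le_ereal_inf_tmp => _ [k /= nk <-]; rewrite /f patchE ifT//.
  by apply: mem_set; split; [apply: h1|apply: h2]; exact: leq_trans nk.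
apply: (le_trans (fatou leb6 measurableT mf (fun n z _ => f0 n z))).
rewrite limn_einf_lim; apply: lime_le; first exact: is_cvg_einfs.
apply: nearW => n; apply: (@le_trans _ _ (coul (A (maxn n m0)) (A (maxn n m0)))).
  apply: ereal_inf_lbound; exists (maxn n m0) => /=; first exact: leq_maxl.
  by rewrite /coul [RHS]integral_mkcond.
by apply: HK; exact: leq_maxr.
Qed.

Lemma divergence_symd (A B : set E3) X M C : measurable A -> measurable B ->
  leb3 A < +oo -> leb3 B < +oo -> test_field X ->
  (forall x, ~ box M x -> divergence X x = 0%R) -> (forall x, `|divergence X x| <= C)%R ->
  (0 <= C)%R ->
  (\int[leb3]_(x in A) divergence X x <= \int[leb3]_(x in B) divergence X x +
    C * fine (leb3 (box M `&` symd A B)))%R.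
Proof.
move=> mA mB Aoo Boo tX supp bnd C0.
have mS : measurable (box M `&` symd A B).
  by apply: measurableI; [exact: measurable_box|exact: measurable_symd].
have Soo : leb3 (box M `&` symd A B) < +oo.
  apply: le_lt_trans (box_lty M); apply: le_measure; rewrite ?inE; [|exact: measurable_box|].
    exact: mS.
  by move=> x [].
pose U := A `|` B; have mU : measurable U by exact: measurableU.
have Uoo : leb3 U < +oo.
  exact: le_lt_trans (measureU2 leb3 mA mB) (lte_add_pinfty Aoo Boo).
have mdX : measurable_fun setT (divergence X : E3 -> R).
  by case: tX => + _ _; exact: measurable_divergence.
have rs (D : set E3) : measurable D -> D `<=` U ->
    (\int[leb3]_(x in D) divergence X x = \int[leb3]_(x in U) (divergence X x * \1_D x))%R.
  move=> mD DU; rewrite Rintegral_mkcond [RHS]Rintegral_mkcond; apply: eq_Rintegral => x _.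
  rewrite !patchE indicE; have [Dx|nDx] := boolP (x \in D).
    by rewrite mulr1 ifT//; apply: mem_set; apply: DU; exact: set_mem.
  by rewrite mulr0; case: ifP.
have ii (D : set E3) : measurable D ->
    leb3.-integrable U (EFin \o (fun x => divergence X x * \1_D x)%R).
  move=> mD; apply: (@integrable_bounded _ _ _ C) => //.
    by apply: measurable_funM => //; exact: measurable_indic.
  move=> x; rewrite normrM (le_trans _ (bnd x))// ler_piMr// indicE.
  by case: (_ \in _); rewrite ?normr1 ?normr0.
have iS : leb3.-integrable U (EFin \o (fun x => C * \1_(box M `&` symd A B) x)%R).
  apply: (@integrable_bounded _ _ _ C) => //.
    by apply: measurable_funM => //; exact: measurable_indic.
  by move=> x; rewrite normrM ger0_norm// ler_piMr// indicE; case: (_ \in _); rewrite ?normr1 ?normr0.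
rewrite (rs A mA (@subsetUl _ _ _)) (rs B mB (@subsetUr _ _ _)).
have SE : (\int[leb3]_(x in U) (C * \1_(box M `&` symd A B) x) =
    C * fine (leb3 (box M `&` symd A B)))%R.
  rewrite RintegralZl//; last first.
    apply: (@integrable_bounded _ _ _ 1%R) => // x.
    by rewrite indicE; case: (_ \in _); rewrite ?normr1 ?normr0.
  rewrite /Rintegral (integral_indic leb3 mU mS); congr (_ * fine (leb3 _))%R.
  by apply/setIidl => x [_ [[Ax _]|[Bx _]]]; [left|right].
rewrite -SE -RintegralD//; [|exact: ii].
apply: le_Rintegral => //.
- exact: ii.
- by have := integrableD mU (ii B mB) iS; apply: eq_integrable.
move=> x Ux; have [bx|/supp ->] := pselect (box M x); last first.
  by rewrite !mul0r add0r mulr_ge0// indicE ler0n.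
have := bnd x; rewrite ler_norml => /andP[b1 b2].
rewrite !indicE in_setI (mem_set bx) /symd in_setU !in_setD /=.
exact: arith3.
Qed.

(** Only the sum of the two energies is controlled, so they are not passed to the limit separately.
    One test field X for Om is fixed; its flux through A j is almost that through Om, and
    subtracting it from the bound on the sum leaves a bound on [coul (A j) (A j)] to which
    [coul_lsc] applies. *)
Lemma energy_lsc (A : nat -> set E3) (Om : set E3) (a : R) :
  (forall n, measurable (A n)) -> (forall n, leb3 (A n) < +oo) ->
  measurable Om -> leb3 Om < +oo ->
  (forall x, Om x -> exists m, forall j, (m <= j)%N -> A j x) ->
  (forall (N : nat) eps, (0 < eps)%R -> exists m, forall j, (m <= j)%N ->
     leb3 (box N%:R `&` symd Om (A j)) <= eps%:E) ->
  (forall eps, (0 < eps)%R -> exists m, forall j, (m <= j)%N ->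
    perimeter (A j) + (2^-1)%:E * coul (A j) (A j) <= (a + eps)%:E) ->
  perimeter Om + (2^-1)%:E * coul Om Om <= a%:E.
Proof.
move=> mA Aoo mO Ooo H1 H2 H3.
have cfin : (2^-1)%:E * coul Om Om \is a fin_num.
  by rewrite fin_numM// ge0_fin_numE ?coul_lty// integral_ge0// => z _; exact: idist_ge0.
rewrite -leeBrDr//; apply: perimeter_le => // X tX; rewrite leeBrDr//.
have [M [C [M0 C0 supp bnd]]] := test_field_support tX.
pose I B := (\int[leb3]_(x in B) divergence X x)%R.
have IE B : measurable B -> leb3 B < +oo ->
    \int[leb3]_(x in B) (divergence X x)%:E = (I B)%:E.
  move=> mB Boo; rewrite /I /Rintegral fineK//.
  exact: integrable_fin_num (integrable_divergence mB tX Boo).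
rewrite IE//; apply/lee_addgt0Pr => eps e0.
have e40 : (0 < eps / 2)%R by rewrite divr_gt0.
have eC0 : (0 < eps / 2 / (C + 1))%R by rewrite divr_gt0// ltr_wpDl.
pose N := (Num.truncn M).+1.
have MN : (M <= N%:R)%R := ltW (truncnS_gt M).
have suppN x : ~ box N%:R x -> divergence X x = 0%R.
  move=> nb; apply: supp => /boxE[b1 b2 b3]; apply: nb.
  by apply/boxE; split; apply: le_trans MN.
have [m2 h2] := H2 N _ eC0; have [m3 h3] := H3 _ e40.
have K : coul Om Om <= (2 * (a + eps - I Om))%:E.
  apply: (coul_lsc mA mO H1); exists (maxn m2 m3) => j; rewrite geq_max => /andP[j2 j3].
  have symfin : leb3 (box N%:R `&` symd Om (A j)) \is a fin_num.
    rewrite (ge0_fin_numE (measure_ge0 leb3 _)).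
    by apply: le_lt_trans (h2 j j2) _; rewrite ltry.
  have hI := divergence_symd mO (mA j) Ooo (Aoo j) tX suppN bnd C0.
  have hs : (C * fine (leb3 (box N%:R `&` symd Om (A j))) <= eps / 2)%R.
    have : (fine (leb3 (box N%:R `&` symd Om (A j))) <= eps / 2 / (C + 1))%R.
      by rewrite -lee_fin fineK//; exact: h2.
    move=> /(ler_wpM2l C0) /le_trans; apply.
    rewrite mulrA ler_pdivrMr ?ltr_wpDl// mulrC ler_wpM2l ?(ltW e40)//.
    by rewrite lerDl.
  have hP : (I (A j))%:E <= perimeter (A j).
    by rewrite -IE//; exact: perimeter_ge.
  have hE := le_trans (leeD hP (lexx ((2^-1)%:E * coul (A j) (A j)))) (h3 j j3).
  have cj : coul (A j) (A j) \is a fin_num.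
    by rewrite ge0_fin_numE ?coul_lty// integral_ge0// => z _; exact: idist_ge0.
  move: hE hI hs; rewrite -/(I Om) -/(I (A j)) -(fineK cj) -EFinM -EFinD !lee_fin.
  exact: arith1.
have cO : coul Om Om \is a fin_num.
  by rewrite ge0_fin_numE ?coul_lty// integral_ge0// => z _; exact: idist_ge0.
move: K; rewrite -(fineK cO) -EFinM -!EFinD !lee_fin.
exact: arith2.
Qed.

End semicontinuity.

(** * Existence of minimizers *)

Section nonvanishing.
Context {R : realType}.
Notation mR := (measurableTypeR R).
Notation E2 := (mR * mR)%type.
Notation E3 := (E2 * mR)%type.
Notation leb3 := (@leb3 R).
Notation R3 := (R * R * R)%type.
Local Open Scope ereal_scope.

Definition benergy (A : set E3) : \bar R := perimeter A + (2^-1)%:E * coul A A.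

Lemma coul_ge0 (A B : set E3) : 0 <= coul A B.
Proof. by apply: integral_ge0 => z _; exact: idist_ge0. Qed.

Lemma benergyE (A : set E3) : measurable A -> energy A = benergy A.
Proof. by move=> mA; rewrite /energy /benergy coulombE. Qed.

Lemma benergy_ge0 A : measurable A -> 0 <= benergy A.
Proof. by move=> mA; rewrite adde_ge0 ?perimeter_ge0// mule_ge0 ?coul_ge0. Qed.

Lemma perimeter_le_benergy A : measurable A -> perimeter A <= benergy A.
Proof. by move=> mA; rewrite leeDl// mule_ge0 ?coul_ge0. Qed.

Lemma preserves_integral d (T : measurableType d) (m : {measure set T -> \bar R})
    (h : T -> T) (f : T -> \bar R) : preserves m h -> measurable_fun setT f ->
  \int[m]_x f (h x) = \int[m]_x f x.
Proof.
move=> [mh ph] mf; rewrite integralE [RHS]integralE; congr (_ - _).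
- rewrite -(ph _ (measurable_funepos mf)); last by move=> x; exact: funepos_ge0.
  by apply: eq_integral => x _; rewrite !funeposE.
- rewrite -(ph _ (measurable_funeneg mf)); last by move=> x; exact: funeneg_ge0.
  by apply: eq_integral => x _; rewrite !funenegE.
Qed.

(** This is A - a: the point a is moved to the origin. *)
Definition translate (a : R3) (A : set E3) : set E3 := [set x : E3 | A ((x : R3) + a)%R].

Lemma measurable_translate a A : measurable A -> measurable (translate a A).
Proof.
move=> mA; have [ms _] := @preserves_shift R a.
by rewrite -[X in measurable X]setTI; exact: ms.
Qed.

Lemma leb3_translate a A : measurable A -> leb3 (translate a A) = leb3 A.
Proof. by move=> mA; exact: (preserves_set (@preserves_shift R a) mA). Qed.

Lemma perimeter_translate a A : measurable A -> perimeter (translate a A) <= perimeter A.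
Proof.
move=> mA; have mT := measurable_translate a mA; apply: perimeter_le => // X tX.
apply: le_trans (perimeter_ge mA (test_field_shift a tX)).
have mdX : measurable_fun setT (fun x => (divergence (fun y => X (y - a)) x)%:E : \bar R).
  apply/measurable_EFinP; case: (test_field_shift a tX) => + _ _.
  exact: measurable_divergence.
pose F (y : E3) : \bar R :=
  ((fun x => (divergence (fun y => X (y - a)) x)%:E) \_ A) y.
have mF : measurable_fun setT F.
  by apply/(measurable_restrictT _ mA); exact: measurable_funTS.
have FE := @preserves_integral _ _ leb3 _ F (@preserves_shift R a) mF.
rewrite integral_mkcond [leRHS]integral_mkcond.
apply: (eq_ind _ (fun y => _ <= y) _ _ FE).
rewrite le_eqVlt; apply/orP; left; apply/eqP; apply: eq_integral => x _.
rewrite /F !patchE divergence_shift addrK.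
by rewrite (_ : (x \in translate a A) = ((((x : R3) + a)%R : E3) \in A))//; apply/idP/idP; rewrite !inE.
Qed.

Lemma coul_translate a A : measurable A -> coul (translate a A) (translate a A) = coul A A.
Proof.
move=> mA; have mT := measurable_translate a mA.
have mAA := measurable_setX6 mA mA.
rewrite /coul integral_mkcond [RHS]integral_mkcond.
have [_ ps] := @preserves_shift6 R a.
rewrite -[RHS]ps; last 2 first.
- by apply/(measurable_restrictT _ mAA); apply: measurable_funTS; exact: measurable_idist.
- by move=> z; rewrite patchE; case: ifP => // _; exact: idist_ge0.
apply: eq_integral => z _; rewrite !patchE /dist /=.
have -> : ((z.1 : R3) + a - ((z.2 : R3) + a) = (z.1 : R3) - z.2)%R.
  by rewrite opprD addrACA subrr addr0.
by [].
Qed.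

Lemma benergy_translate a A : measurable A -> benergy (translate a A) <= benergy A.
Proof.
move=> mA; rewrite /benergy (coul_translate a mA).
exact: leeD (perimeter_translate a mA) (lexx _).
Qed.

(** With T = 4 / lambda and P(A) <= lambda |A|, [key_estimate] gives G(T) >= pi / 3 T^3 |A|. So the
    mean over x in A of the mass within distance T of x is at least pi / 3 T^3, and some x reaches
    half of it. *)
Lemma nonvanishing (A : set E3) (lambda : R) : measurable A -> leb3 A < +oo ->
  0 < leb3 A -> (0 < lambda)%R -> perimeter A <= (lambda * fine (leb3 A))%:E ->
  exists x, (pi / 6 * (4 / lambda) ^+ 3)%:E <= leb3 (vic A (4 / lambda) x).
Proof.
move=> mA Aoo A0 l0 Ap; apply: contrapT => H; set T := (4 / lambda)%R.
have T0 : (0 < T)%R by rewrite divr_gt0.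
have V0 : (0 < fine (leb3 A))%R by apply: fine_gt0; rewrite A0 Aoo.
have K := key_estimate mA Aoo Ap T0.
have c0 : 0 <= (pi / 6 * T ^+ 3)%:E.
  by rewrite lee_fin mulr_ge0 ?exprn_ge0 ?(ltW T0)// divr_ge0// pi_ge0.
have N : near_pairs A A T <= (pi / 6 * T ^+ 3)%:E * leb3 A.
  rewrite (nearE T mA mA) -(@integral_cst _ _ _ leb3 _ mA); apply: ge0_le_integral => //.
  - by apply: measurable_funTS; exact: measurable_fun_vic.
  - by move=> x _; apply: ltW; rewrite ltNge; apply/negP => h; apply: H; exists x.
have {}N : (fine (near_pairs A A T) <= pi / 6 * T ^+ 3 * fine (leb3 A))%R.
  rewrite -lee_fin (fineK (near_fin_num T mA mA Aoo)) EFinM fineK//.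
  by rewrite (ge0_fin_numE (measure_ge0 leb3 A)).
have lE : (lambda = 4 / T)%R by rewrite /T; field; rewrite gt_eqF.
move: K N; rewrite lE; move: (fine (near_pairs A A T)) (fine (leb3 A)) V0 => G V V0 K N.
have : (pi / 3 * T ^+ 3 * V <= pi / 6 * T ^+ 3 * V)%R.
  apply: le_trans N; rewrite -(lerD2r (pi / 4 * T ^+ 4 * (4 / T * V))).
  apply: le_trans K; rewrite le_eqVlt; apply/orP; left; apply/eqP; field.
  by rewrite gt_eqF.
have := pi_gt0 R => p0; have T3 : (0 < pi / 6 * T ^+ 3 * V)%R.
  by rewrite !mulr_gt0 ?exprn_gt0 ?invr_gt0.
have -> : (pi / 3 * T ^+ 3 * V = 2 * (pi / 6 * T ^+ 3 * V))%R by field.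
by move: T3; move: (_ * _)%R => c; lra.
Qed.

End nonvanishing.

Section cutting.
Context {R : realType}.
Notation lam := (@lebesgue_measure R).
Notation mR := (measurableTypeR R).
Notation E2 := (mR * mR)%type.
Notation E3 := (E2 * mR)%type.
Notation E6 := (E3 * E3)%type.
Notation leb3 := (@leb3 R).
Notation leb6 := (@leb6 R).
Notation R3 := (R * R * R)%type.
Local Open Scope ereal_scope.

(** Otherwise the cost would exceed its bound on all of [a, b] and its integral would be at least 2
    |A| + 1, against [coarea]; the 1 makes this contradiction strict. *)
Lemma cost_select (A : set E3) (psi : R3 -> R) (a b : R) : measurable A ->
  leb3 A < +oo -> continuous psi -> (a < b)%R ->
  exists2 t, (a <= t <= b)%R & cost psi A t <= ((2 * fine (leb3 A) + 1) / (b - a))%:E.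
Proof.
move=> mA Aoo cpsi ab; apply: contrapT => H.
have ba : (0 < b - a)%R by rewrite subr_gt0.
have V0 : (0 <= fine (leb3 A))%R := fine_ge0 (measure_ge0 leb3 A).
have VE := fine_leb3 Aoo; set V := fine (leb3 A) in V0 VE H.
pose K : R := ((2 * V + 1) / (b - a))%R.
have K0 : (0 <= K)%R by rewrite divr_ge0 ?(ltW ba)// addr_ge0// mulr_ge0.
have : (2 * V + 1)%:E <= 2%:E * leb3 A.
  apply: le_trans (coarea mA cpsi).
  apply: (@le_trans _ _ (\int[lam]_(t in `[a, b]) K%:E)).
    rewrite integral_cst//= lebesgue_measure_itv /= lte_fin ab -EFinB -EFinM lee_fin.
    by rewrite /K divfK// gt_eqF.
  rewrite integral_mkcond; apply: ge0_le_integral => //.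
  - by move=> t _; rewrite patchE; case: ifP => // _; rewrite lee_fin.
  - by apply/(measurable_restrictT _ (measurable_itv _)).
  - exact: measurable_cost.
  - move=> t _; rewrite patchE; case: ifPn => [|_]; last exact: cost_ge0.
    rewrite inE /= in_itv /= => tab; apply: ltW; rewrite ltNge.
    by apply/negP => h; apply: H; exists t.
by rewrite VE -EFinM lee_fin; lra.
Qed.

Lemma coul_mem (A B : set E3) : coul A B =
  \int[leb6]_z ((dist z)^-1%:E * (\1_(A `*` B) z)%:E).
Proof.
rewrite /coul integral_mkcond; apply: eq_integral => z _; rewrite patchE indicE.
by case: (z \in _); rewrite ?mule1 ?mule0.
Qed.

Lemma measurable_idist_indic (Q : set E6) : measurable Q ->
  measurable_fun setT (fun z => (dist z)^-1%:E * (\1_Q z)%:E).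
Proof.
move=> mQ; apply: emeasurable_funM; first exact: measurable_idist.
by apply/measurable_EFinP; exact: measurable_indic.
Qed.

Lemma idist_indic_ge0 (Q : set E6) z : 0 <= (dist z)^-1%:E * (\1_Q z)%:E.
Proof. by rewrite mule_ge0 ?idist_ge0// lee_fin indicE ler0n. Qed.

Lemma coul_sub_cut (A S : set E3) : measurable A -> measurable S ->
  coul (A `&` S) (A `&` S) + coul (A `\` S) (A `\` S) +
    (coul (A `&` S) (A `\` S) + coul (A `\` S) (A `&` S)) = coul A A.
Proof.
move=> mA mS; have mI := measurableI _ _ mA mS; have mD := measurableD mA mS.
have m2 := measurable_setX6.
have f0 (B C : set E3) z : 0 <= (dist z)^-1%:E * (\1_(B `*` C) z)%:E := idist_indic_ge0 _ z.
have mf (B C : set E3) : measurable B -> measurable C ->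
    measurable_fun setT (fun z => (dist z)^-1%:E * (\1_(B `*` C) z)%:E).
  by move=> mB mC; apply: measurable_idist_indic; exact: measurable_setX6.
rewrite !coul_mem.
rewrite -(ge0_integralD leb6 measurableT (fun z _ => f0 _ _ z) (mf _ _ mI mI)
  (fun z _ => f0 _ _ z) (mf _ _ mD mD)).
rewrite -(ge0_integralD leb6 measurableT (fun z _ => f0 _ _ z) (mf _ _ mI mD)
  (fun z _ => f0 _ _ z) (mf _ _ mD mI)).
rewrite -(ge0_integralD leb6 measurableT (fun z _ => adde_ge0 (f0 _ _ z) (f0 _ _ z))
  (emeasurable_funD (mf _ _ mI mI) (mf _ _ mD mD))
  (fun z _ => adde_ge0 (f0 _ _ z) (f0 _ _ z))
  (emeasurable_funD (mf _ _ mI mD) (mf _ _ mD mI))).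
apply: eq_integral => z _; rewrite -!EFinM -!EFinD; congr (_%:E).
rewrite !indicE !in_setX !in_setD !in_setI.
by case: (z.1 \in A); case: (z.1 \in S); case: (z.2 \in A); case: (z.2 \in S) => /=;
  rewrite ?mulr0 ?mulr1 ?addr0 ?add0r.
Qed.

Definition sublevel (psi : R3 -> R) (t : R) : set E3 := [set x : E3 | psi x <= t]%R.

Let arrange (a b c d e f P K : \bar R) : a + b <= P + K ->
  (a + c) + (b + d) + (e + f) <= P + (c + d + (e + f)) + K.
Proof.
move=> H; rewrite [(a + c + _)%E]addeACA -[leLHS]addeA [leRHS]addeAC.
exact: leeD H (lexx _).
Qed.

(** Cutting adds area and saves the interaction between the pieces. The interaction is dropped when
    mass far away is cut off in [truncated_energy], and is the main term in [cross_le_cost]. *)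
Lemma benergy_cut (A : set E3) (psi : R3 -> R) (g : R3 -> R3) (t L : R) :
  measurable A -> leb3 A < +oo -> benergy A < +oo -> grad3 psi g -> (0 < L)%R ->
  (forall x, t < psi x -> psi x <= t + 2 -> enorm (g x) <= L)%R ->
  benergy (A `&` sublevel psi t) + benergy (A `\` sublevel psi t) +
    (2^-1)%:E * (coul (A `&` sublevel psi t) (A `\` sublevel psi t) +
      coul (A `\` sublevel psi t) (A `&` sublevel psi t)) <=
  benergy A + (2 * L)%:E * cost psi A t.
Proof.
move=> mA Aoo Eoo Gpsi L0 gL; set S := sublevel psi t.
have mS : measurable S by apply: measurable_sublevel; exact: grad3_continuous Gpsi.
have Pfin : perimeter A \is a fin_num.
  rewrite (ge0_fin_numE (perimeter_ge0 mA)).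
  exact: le_lt_trans (perimeter_le_benergy mA) Eoo.
have := perimeter_cut_cost mA Aoo (_ : perimeter A <= (fine (perimeter A))%:E) Gpsi L0 gL.
rewrite (fineK Pfin) => /(_ (lexx _)) H.
have c2 (B C : set E3) : 0 <= (2^-1)%:E * coul B C by rewrite mule_ge0 ?coul_ge0.
rewrite /benergy -(coul_sub_cut mA mS) -/S.
rewrite !(ge0_muleDr _ (adde_ge0 (coul_ge0 _ _) (coul_ge0 _ _)) (adde_ge0 (coul_ge0 _ _) (coul_ge0 _ _))).
rewrite !(ge0_muleDr _ (coul_ge0 _ _) (coul_ge0 _ _)).
exact: arrange.
Qed.

End cutting.

Section minimizer_limit.
Context {R : realType}.
Notation mR := (measurableTypeR R).
Notation E2 := (mR * mR)%type.
Notation E3 := (E2 * mR)%type.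
Notation leb3 := (@leb3 R).
Notation R3 := (R * R * R)%type.
Local Open Scope ereal_scope.

Let quarter_lt (J : R) : (0 < J -> J ^+ 2 / 4 < J ^+ 2)%R.
Proof. by move=> J0; rewrite ltr_pdivrMr// ltr_pMr ?exprn_gt0//; lra. Qed.

Let sq_le (J t : R) : (0 < J -> t <= J ^+ 2 -> t + 2 <= (J + 2) ^+ 2)%R.
Proof. by move=> *; rewrite sqrrD; lra. Qed.

Let lin_le (J : R) : (1 <= J -> 2 * (2 * (J + 2)) <= 12 * J)%R.
Proof. by lra. Qed.

Let sqdot (x : R3) : R := dot x x.

(* One term of the minimizing sequence, truncated to a ball of radius about J;
   the discarded part has energy at least e times its volume. *)
Lemma truncated_energy (Q : set E3) (e M : R) (J : nat) : (0 < J)%N -> (0 <= e)%R -> (0 <= M)%R ->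
  measurable Q -> leb3 Q <= M%:E -> benergy Q <= (e * fine (leb3 Q) + M / J%:R)%:E ->
  (forall A, measurable A -> leb3 A <= M%:E -> (e * fine (leb3 A))%:E <= benergy A) ->
  exists2 t : R, (J%:R ^+ 2 / 4 <= t <= J%:R ^+ 2)%R &
  benergy (Q `&` sublevel sqdot t) <=
    (e * fine (leb3 (Q `&` sublevel sqdot t)) + (M + 16 * (2 * M + 1)) / J%:R)%:E.
Proof.
move=> J0 e0 M0 mQ QM Qe Hmin; have J0' : (0 < J%:R :> R)%R by rewrite ltr0n.
have Qoo : leb3 Q < +oo by apply: le_lt_trans QM _; rewrite ltry.
have Eoo : benergy Q < +oo by apply: le_lt_trans Qe _; rewrite ltry.
have cpsi : continuous sqdot := grad3_continuous (@grad3_sqnorm R).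
have JJ : (J%:R ^+ 2 / 4 < J%:R ^+ 2 :> R)%R by exact: quarter_lt.
have [t tJ ct] := cost_select mQ Qoo cpsi JJ.
exists t => //.
set S := sublevel sqdot t; have mS : measurable S by exact: measurable_sublevel.
have mI := measurableI _ _ mQ mS; have mD := measurableD mQ mS.
have Ioo : leb3 (Q `&` S) <= M%:E.
  by apply: le_trans QM; apply: le_measure; rewrite ?inE; [exact: mI|exact: mQ|exact: subIsetl].
have Doo : leb3 (Q `\` S) <= M%:E.
  by apply: le_trans QM; apply: le_measure; rewrite ?inE; [exact: mD|exact: mQ|exact: subDsetl].
(* The gradient of |x|^2 is 2 x, and |x|^2 <= t + 2 <= (J + 2)^2 in the strips of the cut. *)
pose L : R := (2 * (J%:R + 2))%R; have L0 : (0 < L)%R by rewrite mulr_gt0// addr_gt0.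
have gL (x : R3) : (t < sqdot x -> sqdot x <= t + 2 -> enorm (2 *: x) <= L)%R.
  move=> _ xt; rewrite enormZ ger0_norm// ler_pM2l//.
  rewrite -ler_sqr ?nnegrE ?enorm_ge0 ?addr_ge0// enorm_sqr; apply: (le_trans xt).
  by case/andP: tJ => _ tJ; exact: sq_le.
have := benergy_cut mQ Qoo Eoo (@grad3_sqnorm R) L0 gL; rewrite -/S => H.
have V0 : (0 <= fine (leb3 Q))%R := fine_ge0 (measure_ge0 leb3 Q).
have VM : (fine (leb3 Q) <= M)%R by move: QM; rewrite {1}(fine_leb3 Qoo) lee_fin.
(* The levels of |x|^2 fill an interval of length 3/4 J^2 while the gradient is only of order J, so
   the cut costs O(1 / J); the constant is 12 * 4 / 3 = 16. *)
have cost2 : (2 * L)%:E * cost sqdot Q t <= (16 * (2 * M + 1) / J%:R)%:E.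
  have L20 : 0 <= (2 * L)%:E by rewrite lee_fin mulr_ge0// ltW.
  apply: (le_trans (lee_wpmul2l L20 ct)); rewrite -EFinM lee_fin.
  have -> : (J%:R ^+ 2 - J%:R ^+ 2 / 4 = 3 / 4 * J%:R ^+ 2 :> R)%R by field.
  apply: (@le_trans _ _ (2 * L * ((2 * M + 1) / (3 / 4 * J%:R ^+ 2)))%R).
    rewrite ler_wpM2l ?mulr_ge0 ?(ltW L0)// ler_wpM2r ?invr_ge0 ?mulr_ge0//.
    by rewrite lerD2r ler_pM2l.
  have L3 : (2 * L <= 12 * J%:R)%R by apply: lin_le; rewrite ler1n.
  apply: (@le_trans _ _ (12 * J%:R * ((2 * M + 1) / (3 / 4 * J%:R ^+ 2)))%R).
    by rewrite ler_wpM2r// divr_ge0 ?mulr_ge0 ?addr_ge0 ?mulr_ge0.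
  by rewrite le_eqVlt; apply/orP; left; apply/eqP; field; rewrite gt_eqF.
have VS : (fine (leb3 Q) = fine (leb3 (Q `&` S)) + fine (leb3 (Q `\` S)))%R.
  have E : leb3 Q = leb3 (Q `\` S) + leb3 (Q `&` S) := measureDI leb3 mQ mS.
  rewrite E fineD; first by rewrite addrC.
    by rewrite (ge0_fin_numE (measure_ge0 leb3 _)); apply: le_lt_trans Doo _; rewrite ltry.
  by rewrite (ge0_fin_numE (measure_ge0 leb3 _)); apply: le_lt_trans Ioo _; rewrite ltry.
have HD := Hmin _ mD Doo.
have cr0 : 0 <= (2^-1)%:E * (coul (Q `&` S) (Q `\` S) + coul (Q `\` S) (Q `&` S)).
  by apply: mule_ge0 => //; apply: adde_ge0; exact: coul_ge0.
have {H cr0} H : benergy (Q `&` S) + benergy (Q `\` S) <=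
    (e * fine (leb3 Q) + M / J%:R + 16 * (2 * M + 1) / J%:R)%:E.
  by apply: le_trans (leeDl _ cr0) _; apply: (le_trans H); rewrite EFinD; exact: leeD.
have {H} H := le_trans (leeD (lexx (benergy (Q `&` S))) HD) H.
rewrite -leeBrDr// -EFinB in H; apply: le_trans H _; rewrite lee_fin VS.
rewrite le_eqVlt; apply/orP; left; apply/eqP.
move: (fine (leb3 (Q `&` S))) (fine (leb3 (Q `\` S))) => v w; field.
by rewrite gt_eqF.
Qed.

End minimizer_limit.

Section limit_minimizer.
Context {R : realType}.
Notation mR := (measurableTypeR R).
Notation E2 := (mR * mR)%type.
Notation E3 := (E2 * mR)%type.
Notation leb3 := (@leb3 R).
Notation R3 := (R * R * R)%type.
Local Open Scope ereal_scope.

Let half_pow_le (j : nat) : (2^-1 ^+ j <= j.+1%:R^-1 :> R)%R.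
Proof.
rewrite exprVn lef_pV2 ?posrE ?exprn_gt0// -natrX ler_nat.
exact: ltn_expl.
Qed.

Let archi (K eps : R) : (0 < eps)%R -> exists m : nat, forall j : nat, (m <= j)%N ->
  (K / j.+1%:R <= eps)%R.
Proof.
move=> e0; exists (Num.truncn (K / eps)) => j mj.
rewrite ler_pdivrMr// [leRHS]mulrC -ler_pdivrMr//.
by apply: (le_trans (ltW (truncnS_gt (K / eps)%R))); rewrite ler_nat ltnS.
Qed.

Let six_le (r a b c N : R) : (r <= a + b + c -> a <= N -> b <= N -> c <= N ->
  2 * r <= 6 * N)%R.
Proof. by lra. Qed.

Lemma leb3_le_boxes (A : set E3) (M : R) : measurable A ->
  (forall n : nat, leb3 (A `&` box n%:R) <= M%:E) -> leb3 A <= M%:E.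
Proof.
move=> mA H.
have mF n : measurable (A `&` box n%:R) by apply: measurableI => //; exact: measurable_box.
have E : \bigcup_n (A `&` box n%:R) = A.
  apply/seteqP; split=> [x [n _ []]//|x Ax].
  exists (Num.truncn (enorm x)).+1 => //; split=> //.
  by apply: box_enorm; apply/ltW; rewrite truncnS_gt.
have cv : leb3 (A `&` box n%:R) @[n --> \oo] --> leb3 A.
  rewrite -[X in _ --> leb3 X]E; apply: (@nondecreasing_cvg_mu _ _ _ leb3) => //.
    by rewrite E.
  move=> m n mn; apply/subsetPset => x [Ax bm]; split=> //.
  have mn' : (m%:R <= n%:R :> R)%R by rewrite ler_nat.
  by move/boxE: bm => -[b1 b2 b3]; apply/boxE; split; apply: le_trans mn'.
by apply: (cvge_to_le cv); apply: nearW.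
Qed.

Lemma symd_sub_le (A B : set E3) (N r : R) : measurable A -> measurable B ->
  leb3 (box N `&` symd A B) <= r%:E -> leb3 (A `&` box N) <= leb3 B + r%:E.
Proof.
move=> mA mB H; have mb := @measurable_box R N.
have mS := measurableI _ _ mb (measurable_symd mA mB).
apply: le_trans (leeD (lexx _) H).
apply: (measure_subU leb3 (measurableI _ _ mA mb) mB mS) => x [Ax bx].
by have [Bx|nB] := pselect (B x); [left|right; split=> //; left].
Qed.

Lemma symdC (A B : set E3) : symd A B = symd B A.
Proof. by rewrite /symd setUC. Qed.

(** The sets [Q j] converge locally to Om, but part of their volume may escape, and semicontinuity
    alone would bound the energy of Om by e times the larger volume. [truncated_energy] therefore
    cuts [Q j.+1] down to [A j], whose excess energy still tends to 0 and whose volume exceeds that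
    of Om by o(1) only. The mass c kept in a fixed box makes Om nonnull. *)
Lemma limit_minimizer (e M c : R) (T : nat) (O : nat -> set E3) : (0 <= e)%R -> (0 <= M)%R ->
  (0 < c)%R ->
  (forall A, measurable A -> leb3 A <= M%:E -> (e * fine (leb3 A))%:E <= benergy A) ->
  (forall n, [/\ measurable (O n), leb3 (O n) <= M%:E,
    benergy (O n) <= (e * fine (leb3 (O n)) + M / n.+1%:R)%:E &
    c%:E <= leb3 (O n `&` box T%:R)]) ->
  exists Om, [/\ measurable Om, 0 < leb3 Om, leb3 Om <= M%:E &
    benergy Om <= (e * fine (leb3 Om))%:E].
Proof.
move=> e0 M0 c0 Hmin HO.
have mO n : measurable (O n) by case: (HO n).
have OM n : leb3 (O n) <= M%:E by case: (HO n).
have Oe n : benergy (O n) <= (e * fine (leb3 (O n)) + M / n.+1%:R)%:E by case: (HO n).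
have Oc n : c%:E <= leb3 (O n `&` box T%:R) by case: (HO n).
have lty A : leb3 A <= M%:E -> leb3 A < +oo by move=> h; apply: le_lt_trans h _; rewrite ltry.
have VM A : leb3 A <= M%:E -> (fine (leb3 A) <= M)%R.
  by move=> h; move: (h); rewrite {1}(fine_leb3 (lty _ h)) lee_fin.
have Op n : perimeter (O n) <= (e * M + M)%:E.
  apply: le_trans (perimeter_le_benergy (mO n)) _; apply: (le_trans (Oe n)).
  rewrite lee_fin lerD ?ler_wpM2l ?VM//.
  by rewrite ler_piMr// invf_le1// ler1n.
have [nn nnP] := perimeter_compact mO (fun n => lty _ (OM n)) Op.
pose Q j := O (nn j); have mQ j : measurable (Q j) := mO _.
have symQ := leb3_limit_set mQ (fun j => (nnP j).2).
pose Om := liminf_set Q; have mOm : measurable Om := measurable_liminf_set mQ.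
have {}symQ j : leb3 (box j%:R `&` symd (Q j) Om) <= (2 / j.+1%:R)%:E.
  by apply: (le_trans (symQ j)); rewrite lee_fin ler_wpM2l// half_pow_le.
have subbox (A : set E3) (m n : R) : measurable A -> (m <= n)%R ->
    leb3 (box m `&` A) <= leb3 (box n `&` A).
  move=> mA mn; apply: le_measure; rewrite ?inE; [apply: measurableI => //; exact: measurable_box..|].
  by move=> x [/boxE[b1 b2 b3] Ax]; split=> //; apply/boxE; split; apply: le_trans mn.
have natle (m n : nat) : (m <= n)%N -> (m%:R <= n%:R :> R)%R by rewrite ler_nat.
have OmM : leb3 Om <= M%:E.
  apply: leb3_le_boxes => // n; apply/lee_addgt0Pr => eps eps0.
  have [m hm] := @archi 2 eps eps0; pose j := maxn m n.
  have jm := hm j (leq_maxl m n).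
  apply: (@le_trans _ _ (leb3 (Q j) + eps%:E)); last exact: leeD (OM _) (lexx _).
  apply: symd_sub_le => //; rewrite symdC.
  apply: (le_trans (subbox _ _ _ (measurable_symd (mQ j) mOm) (natle _ _ (leq_maxr m n)))).
  by apply: (le_trans (symQ j)); rewrite lee_fin.
have Omoo := lty _ OmM.
have Om0 : 0 < leb3 Om.
  have c20 : (0 < c / 2)%R by rewrite divr_gt0.
  have [m hm] := archi 2 c20; pose j := maxn m T.
  have jm := hm j (leq_maxl m T).
  have : leb3 (Q j `&` box T%:R) <= leb3 Om + (c / 2)%:E.
    apply: symd_sub_le => //.
    apply: (le_trans (subbox _ _ _ (measurable_symd (mQ j) mOm) (natle _ _ (leq_maxr m T)))).
    by apply: (le_trans (symQ j)); rewrite lee_fin.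
  move=> /(le_trans (Oc (nn j))); rewrite -leeBlDr// -EFinB => /(lt_le_trans _); apply.
  by rewrite lte_fin subr_gt0 ltr_pdivrMr// ltr_pMr// ltr1n.
have hQ j : benergy (Q j.+1) <= (e * fine (leb3 (Q j.+1)) + M / j.+1%:R)%:E.
  apply: (le_trans (Oe _)); rewrite lee_fin lerD2l ler_wpM2l//.
  rewrite lef_pV2 ?posrE// ler_nat ltnS.
  exact: leq_trans (leqnSn j) (nnP j.+1).1.
have cut j : exists t : R, (j.+1%:R ^+ 2 / 4 <= t <= j.+1%:R ^+ 2)%R /\
    benergy (Q j.+1 `&` sublevel (fun x => dot x x) t) <=
    (e * fine (leb3 (Q j.+1 `&` sublevel (fun x => dot x x) t)) + (M + 16 * (2 * M + 1)) / j.+1%:R)%:E.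
  have [t t1 t2] := truncated_energy (ltn0Sn j) e0 M0 (mQ j.+1) (OM _) (hQ j) Hmin.
  by exists t.
have [t tP] := choice cut.
pose A j := Q j.+1 `&` sublevel (fun x => dot x x) (t j).
have cpsi : continuous (fun x : R3 => dot x x) := grad3_continuous (@grad3_sqnorm R).
have mA j : measurable (A j) by apply: measurableI => //; exact: measurable_sublevel.
have AM j : leb3 (A j) <= M%:E.
  by apply: le_trans (OM (nn j.+1)); apply: le_measure; rewrite ?inE; [exact: mA|exact: mO|exact: subIsetl].
have Abox j : A j `<=` box j.+1%:R.
  move=> x [_ xt]; apply: box_enorm; rewrite -ler_sqr ?nnegrE ?enorm_ge0//.
  by rewrite enorm_sqr; apply: (le_trans xt); have [/andP[]] := tP j.
(* [A j] is contained in [box j.+1], the region where [Q j.+1] is known to be close to Om. *)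
have VA j : (fine (leb3 (A j)) <= fine (leb3 Om) + 2 / j.+1%:R)%R.
  rewrite -lee_fin EFinD -(fine_leb3 (lty _ (AM j))) -(fine_leb3 Omoo).
  have : leb3 (Q j.+1 `&` box j.+1%:R) <= leb3 Om + (2 / j.+1%:R)%:E.
    apply: symd_sub_le => //; apply: (le_trans (symQ _)); rewrite lee_fin ler_wpM2l//.
    by rewrite lef_pV2 ?posrE// ler_nat.
  apply: le_trans; apply: le_measure; rewrite ?inE; [exact: mA| |].
    by apply: measurableI => //; exact: measurable_box.
  by move=> x Ax; split; [case: Ax|exact: Abox].
exists Om; split=> //; apply: (energy_lsc mA (fun j => lty _ (AM j)) mOm Omoo).
- move=> x /liminf_setP[m hm].
  pose k := (Num.truncn (2 * enorm x)).+1; exists (maxn m k) => j.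
  rewrite geq_max => /andP[jm jk]; split; first by apply: hm; exact: leq_trans jm _.
  rewrite /sublevel /= -enorm_sqr; have [/andP[h _] _] := tP j; apply: le_trans h.
  rewrite ler_pdivlMr// (_ : enorm x ^+ 2 * 4 = (2 * enorm x) ^+ 2)%R; last by ring.
  rewrite lerXn2r ?nnegrE ?mulr_ge0 ?enorm_ge0//.
  apply: (le_trans (ltW (truncnS_gt (2 * enorm x)%R))); rewrite ler_nat.
  exact: leq_trans jk _.
- move=> N eps eps0; have [m hm] := archi 2 eps0.
  (* The cut radius is at least (j + 1) / 2, and a point of [box N] has length at most 3 N; so from
     j >= 6 N on the truncation does not affect [box N]. *)
  exists (maxn m (6 * N)%N) => j; rewrite geq_max => /andP[jm jN].
  have mS1 := measurable_symd mOm (mA j); have mS2 := measurable_symd (mQ j.+1) mOm.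
  apply: (@le_trans _ _ (leb3 (box j.+1%:R `&` symd (Q j.+1) Om))); last first.
    apply: (le_trans (symQ _)); rewrite lee_fin; apply: le_trans (hm j jm).
    by rewrite ler_wpM2l// lef_pV2 ?posrE// ler_nat.
  have jN' : (6 * N%:R <= j.+1%:R :> R)%R by rewrite -natrM ler_nat leqW.
  apply: le_measure; rewrite ?inE; [apply: measurableI => //; exact: measurable_box..|].
  move=> x [/boxE[b1 b2 b3] sx]; have N0 : (0 <= N%:R :> R)%R by [].
  have xs : sublevel (fun x => dot x x) (t j) x.
    rewrite /sublevel /= -enorm_sqr; have [/andP[h _] _] := tP j; apply: le_trans h.
    rewrite ler_pdivlMr// (_ : enorm x ^+ 2 * 4 = (2 * enorm x) ^+ 2)%R; last by ring.
    rewrite lerXn2r ?nnegrE ?mulr_ge0 ?enorm_ge0//.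
    apply: le_trans jN'; exact: (six_le (enorm_le_coord x) b1 b2 b3).
  have NJ : (N%:R <= j.+1%:R :> R)%R.
    by apply: le_trans jN'; rewrite ler_peMl// ler1n.
  split; first by apply/boxE; split; apply: le_trans NJ.
  case: sx => -[h1 h2]; [right|left]; split=> //.
    by move=> h; apply: h2.
  by case: h1.
- move=> eps eps0; set K := (M + 16 * (2 * M + 1))%R in tP.
  have [m hm] := archi (2 * e + K) eps0; exists m => j jm.
  have [_ h] := tP j; apply: (le_trans h); rewrite lee_fin -/(A j).
  apply: le_trans (lerD (ler_wpM2l e0 (VA j)) (lexx _)) _.
  have -> : (e * (fine (leb3 Om) + 2 / j.+1%:R) + K / j.+1%:R =
     e * fine (leb3 Om) + (2 * e + K) / j.+1%:R)%R.
    by move: (fine _) => v; field; rewrite gt_eqF.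
  by rewrite lerD2l; exact: hm.
Qed.

End limit_minimizer.

Section existence.
Context {R : realType}.
Notation mR := (measurableTypeR R).
Notation E2 := (mR * mR)%type.
Notation E3 := (E2 * mR)%type.
Notation leb3 := (@leb3 R).
Notation R3 := (R * R * R)%type.
Local Open Scope ereal_scope.

Lemma benergy_box_lty : benergy (box 1 : set E3) < +oo.
Proof.
have mb := @measurable_box R 1%R; have boo := @box_lty R 1%R.
apply: lte_add_pinfty; first exact: le_lt_trans (@perimeter_box R) (ltry _).
apply: lte_mul_pinfty => //; exact: coul_lty.
Qed.

Lemma leb3_box1 : leb3 (box 1 : set E3) = 8%:E.
Proof.
have m11 : (-1 <= 1 :> R)%R by lra.
by apply: (etrans (leb3_brick m11 m11 m11)); congr (_%:E); ring.
Qed.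

(** Since 1 / (n + 1) <= 1, the perimeter is at most (e + 1) |A|, and [nonvanishing] finds a point
    around which a definite amount of mass sits; this point is translated to the origin. *)
Lemma centered_competitor (A : set E3) (e M : R) (n T : nat) : (0 <= e)%R ->
  measurable A -> 0 < leb3 A -> leb3 A <= M%:E ->
  benergy A <= ((e + n.+1%:R^-1) * fine (leb3 A))%:E -> (4 / (e + 1) <= T%:R)%R ->
  exists O, [/\ measurable O, leb3 O <= M%:E,
    benergy O <= (e * fine (leb3 O) + M / n.+1%:R)%:E &
    (pi / 6 * (4 / (e + 1)) ^+ 3)%:E <= leb3 (O `&` box T%:R)].
Proof.
move=> e0 mA A0 AM Ae eT; have e10 : (0 < e + 1)%R by rewrite ltr_wpDl.
have Aoo : leb3 A < +oo by apply: le_lt_trans AM _; rewrite ltry.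
have V0 : (0 <= fine (leb3 A))%R := fine_ge0 (measure_ge0 leb3 A).
have VM : (fine (leb3 A) <= M)%R by move: AM; rewrite {1}(fine_leb3 Aoo) lee_fin.
have Ap : perimeter A <= ((e + 1) * fine (leb3 A))%:E.
  apply: le_trans (perimeter_le_benergy mA) _; apply: (le_trans Ae).
  by rewrite lee_fin ler_wpM2r// lerD2l invf_le1// ler1n.
have [x xP] := nonvanishing mA Aoo A0 e10 Ap.
have mO := measurable_translate x mA.
exists (translate x A); split; first exact: mO.
- by rewrite leb3_translate.
- apply: le_trans (benergy_translate x mA) _; apply: (le_trans Ae).
  rewrite leb3_translate// lee_fin mulrDl lerD2l [leRHS]mulrC.
  by apply: ler_wpM2l => //; rewrite invr_ge0 ler0n.
- apply: (le_trans xP); rewrite -(leb3_translate x (measurable_vic _ x mA)).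
  apply: le_measure; rewrite ?inE.
  + exact: (measurable_translate x (measurable_vic _ x mA)).
  + exact: (measurableI _ _ mO (measurable_box _)).
  move=> y [Ay yT]; split; first exact: Ay.
  have E : ((x : R3) - ((y : R3) + x) = - (y : R3))%R by rewrite opprD addrCA subrr addr0.
  apply: box_enorm; rewrite -enormN -E.
  exact: le_trans (ltW yT) eT.
Qed.

(** [e] is the infimum of the finite energies per volume under the cap M. The cube [box 1], of
    volume 8 and finite energy, shows that there are such values. Almost minimizing sets are
    recentred by [centered_competitor] and passed to [limit_minimizer]. *)
Lemma constrained_minimizer (M : R) : (8 <= M)%R -> exists e Om, [/\ (0 <= e)%R,
  [/\ measurable Om, 0 < leb3 Om & leb3 Om <= M%:E],
  benergy Om <= (e * fine (leb3 Om))%:E &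
  forall A, measurable A -> leb3 A <= M%:E -> (e * fine (leb3 A))%:E <= benergy A].
Proof.
move=> M8; have M0 : (0 <= M)%R by apply: le_trans M8.
pose S := [set r : R | exists A, [/\ measurable A, 0 < leb3 A, leb3 A <= M%:E &
  benergy A = (r * fine (leb3 A))%:E]].
have lty A : leb3 A <= M%:E -> leb3 A < +oo by move=> h; apply: le_lt_trans h _; rewrite ltry.
have ratio A : measurable A -> 0 < leb3 A -> leb3 A <= M%:E -> benergy A < +oo ->
    S (fine (benergy A) / fine (leb3 A))%R.
  move=> mA A0 AM Eoo; exists A; split=> //; rewrite divfK.
    by rewrite fineK// (ge0_fin_numE (benergy_ge0 mA)).
  by rewrite gt_eqF// fine_gt0// A0 lty.
have S0 r : S r -> (0 <= r)%R.
  move=> [A [mA A0 AM E]]; have := benergy_ge0 mA; rewrite E lee_fin.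
  by rewrite pmulr_lge0// fine_gt0// A0 lty.
have hS : has_inf S.
  split; last by exists 0%R => r /S0.
  exists (fine (benergy (box 1)) / fine (leb3 (box 1 : set E3)))%R; apply: ratio.
  - exact: measurable_box.
  - by rewrite leb3_box1 lte_fin.
  - by rewrite leb3_box1 lee_fin.
  - exact: benergy_box_lty.
pose e := inf S; have e0 : (0 <= e)%R.
  by apply: lb_le_inf; [case: hS|move=> r /S0].
have Hmin A : measurable A -> leb3 A <= M%:E -> (e * fine (leb3 A))%:E <= benergy A.
  move=> mA AM; have [A0|A0] := eqVneq (leb3 A) 0.
    by rewrite A0 /= mulr0 benergy_ge0.
  have {}A0 : 0 < leb3 A by rewrite lt_neqAle eq_sym A0 (measure_ge0 leb3 A).
  have V0 : (0 < fine (leb3 A))%R by rewrite fine_gt0// A0 lty.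
  have [Eoo|Eoo] := ltP (benergy A) +oo; last by apply: le_trans Eoo; rewrite leey.
  rewrite -(fineK (_ : benergy A \is a fin_num)); last by rewrite (ge0_fin_numE (benergy_ge0 mA)).
  rewrite lee_fin -ler_pdivlMr//; apply: ge_inf; first by case: hS.
  exact: ratio.
pose T := (Num.truncn (4 / (e + 1))%R).+1.
have eT : (4 / (e + 1) <= T%:R)%R := ltW (truncnS_gt _).
have e10 : (0 < e + 1)%R by rewrite ltr_wpDl.
have c0 : (0 < pi / 6 * (4 / (e + 1)) ^+ 3)%R.
  by rewrite mulr_gt0 ?divr_gt0 ?pi_gt0// exprn_gt0// divr_gt0.
have ex n : exists O, [/\ measurable O, leb3 O <= M%:E,
    benergy O <= (e * fine (leb3 O) + M / n.+1%:R)%:E &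
    (pi / 6 * (4 / (e + 1)) ^+ 3)%:E <= leb3 (O `&` box T%:R)].
  have n0 : (0 < n.+1%:R^-1 :> R)%R by rewrite invr_gt0.
  have [r [A [mA A0 AM E]] re] := inf_adherent n0 hS.
  apply: (@centered_competitor A) => //; rewrite E lee_fin ler_wpM2r// ?fine_ge0//.
  exact: ltW.
have [Om_ HO] := choice ex.
have [Om [mOm Om0 OmM OmE]] := limit_minimizer e0 M0 c0 Hmin HO.
by exists e, Om.
Qed.

End existence.

(** * Interaction across level sets and the volume bound *)

Section planar_cuts.
Context {R : realType}.
Notation lam := (@lebesgue_measure R).
Notation mR := (measurableTypeR R).
Notation E2 := (mR * mR)%type.
Notation E3 := (E2 * mR)%type.
Notation E6 := (E3 * E3)%type.
Notation leb3 := (@leb3 R).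
Notation leb6 := (@leb6 R).
Notation R3 := (R * R * R)%type.
Local Open Scope ereal_scope.

Definition cross (A : set E3) (psi : R3 -> R) (t : R) : \bar R :=
  coul (A `&` sublevel psi t) (A `\` sublevel psi t) +
  coul (A `\` sublevel psi t) (A `&` sublevel psi t).

(** Pairs of points of A together with a level that separates them. Sections at fixed t give
    [cross]; sections at a fixed pair are intervals of length |psi x - psi y|. Tonelli between the
    two gives [integral_cross]. *)
Definition separated (A : set E3) (psi : R3 -> R) : set (E6 * mR) :=
  [set w | (A `*` A) w.1 /\ (psi w.1.1 <= w.2)%R != (psi w.1.2 <= w.2)%R].

Lemma measurable_separated A psi : measurable A -> continuous psi ->
  measurable (separated A psi).
Proof.
move=> mA cpsi; have mpsi := continuous_measurable3 cpsi.
have m1 : measurable_fun setT (fun w : E6 * mR => psi w.1.1 : mR).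
  apply: (measurableT_comp mpsi); exact: (measurableT_comp measurable_fst measurable_fst).
have m2 : measurable_fun setT (fun w : E6 * mR => psi w.1.2 : mR).
  apply: (measurableT_comp mpsi); exact: (measurableT_comp measurable_snd measurable_fst).
pose D1 := [set w : E6 * mR | w.2 - psi w.1.1 < 0]%R.
pose D2 := [set w : E6 * mR | w.2 - psi w.1.2 < 0]%R.
have mD1 : measurable D1 by apply: measurable_lt; exact: measurable_funB.
have mD2 : measurable D2 by apply: measurable_lt; exact: measurable_funB.
have -> : separated A psi = ((A `*` A) `*` setT) `&` ((D1 `\` D2) `|` (D2 `\` D1)).
  apply/seteqP; split=> w; rewrite /separated /D1 /D2 /setI /setU /setD /= !subr_lt0.
    move=> [Aw]; rewrite [(psi w.1.1 <= _)%R]leNgt [(psi w.1.2 <= _)%R]leNgt.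
    move=> h; split=> //; move: h; case: ltP => _; case: ltP => _ // _; [left|right] => //.
  move=> [[Aw _] h]; split => //; move: h.
  rewrite [(psi w.1.1 <= _)%R]leNgt [(psi w.1.2 <= _)%R]leNgt.
  by case: ltP => _; case: ltP => _ // [] [].
apply: measurableI; first by apply: measurableX => //; exact: measurable_setX6.
by apply: measurableU; exact: measurableD.
Qed.

Lemma cross_mem A psi t : measurable A -> continuous psi -> cross A psi t =
  \int[leb6]_z ((dist z)^-1%:E * (\1_(separated A psi) (z, t))%:E).
Proof.
move=> mA cpsi; have mS : measurable (sublevel psi t) := measurable_sublevel t cpsi.
have mI := measurableI _ _ mA mS; have mD := measurableD mA mS.
have m2 := measurable_setX6.
rewrite /cross !coul_mem -(ge0_integralD leb6 measurableT (fun z _ => idist_indic_ge0 _ z)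
  (measurable_idist_indic (m2 _ _ _ mI mD)) (fun z _ => idist_indic_ge0 _ z)
  (measurable_idist_indic (m2 _ _ _ mD mI))).
apply: eq_integral => z _; rewrite -!EFinM -!EFinD; congr (_%:E).
have E : \1_(separated A psi) (z, t) = (((z.1 \in A) && (z.2 \in A)) &&
    ((z.1 \in sublevel psi t) != (z.2 \in sublevel psi t)))%:R :> R.
  have Ez (x : E3) : (x \in sublevel psi t) = (psi x <= t)%R.
    by apply/idP/idP; rewrite inE.
  rewrite indicE !Ez; congr (nat_of_bool _)%:R; apply/idP/idP.
    by rewrite inE => -[[? ?] ->]; rewrite andbT; apply/andP; split; rewrite inE.
  by rewrite !inE => /andP[/andP[]]; rewrite !inE.
rewrite E !indicE !in_setX !in_setD !in_setI.
by case: (z.1 \in A); case: (z.1 \in sublevel psi t); case: (z.2 \in A);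
  case: (z.2 \in sublevel psi t) => /=; rewrite ?mulr0 ?mulr1 ?addr0 ?add0r.
Qed.

Lemma integral_separated A psi z : \int[lam]_t (\1_(separated A psi) (z, t) : R)%:E =
  (`|psi z.1 - psi z.2| * \1_(A `*` A) z)%:E.
Proof.
have [Az|Az] := pselect ((A `*` A) z); last first.
  rewrite [\1_(A `*` A) z]indicE memNset// mulr0; apply: integral0_eq => t _.
  by rewrite indicE memNset// => -[].
rewrite [\1_(A `*` A) z]indicE mem_set// mulr1.
pose a := Num.min (psi z.1) (psi z.2); pose b := Num.max (psi z.1) (psi z.2).
transitivity (\int[lam]_t (\1_(`[a, b[%classic : set mR) t : R)%:E).
  apply: eq_integral => t _; congr (_%:E); rewrite !indicE; congr (nat_of_bool _)%:R.
  apply/idP/idP; rewrite !inE /separated /= in_itv /= ge_min lt_max ![(t < _)%R]ltNge.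
    by move=> [_]; case: (psi z.1 <= t)%R; case: (psi z.2 <= t)%R.
  move=> h; split=> //; move: h; rewrite /a /b.
  by case: (psi z.1 <= t)%R; case: (psi z.2 <= t)%R.
rewrite (integral_indic _ measurableT)//= setIT lebesgue_measure_itv /= lte_fin /a /b.
case: (ltgtP (psi z.1) (psi z.2)) => [h|h|->].
- by rewrite h -EFinB distrC gtr0_norm// subr_gt0.
- by rewrite h -EFinB gtr0_norm// subr_gt0.
- by rewrite ltxx subrr normr0.
Qed.

Lemma integral_cross A psi : measurable A -> continuous psi ->
  measurable_fun setT (cross A psi : mR -> \bar R) /\
  \int[lam]_t cross A psi t =
  \int[leb6]_z ((dist z)^-1 * (`|psi z.1 - psi z.2| * \1_(A `*` A) z))%:E.
Proof.
move=> mA cpsi; have mS := measurable_separated mA cpsi.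
pose f (w : E6 * mR) : \bar R := (dist w.1)^-1%:E * (\1_(separated A psi) w)%:E.
have mf : measurable_fun setT f.
  apply: emeasurable_funM; first exact: (measurableT_comp (@measurable_idist R)).
  by apply/measurable_EFinP; exact: measurable_indic.
have f0 w : 0 <= f w by rewrite mule_ge0 ?idist_ge0// lee_fin.
have cE : cross A psi = fun t => \int[leb6]_z f (z, t).
  by apply/funext => t; rewrite cross_mem.
split; first by rewrite cE; exact: (@measurable_fun_fubini_tonelli_G _ _ E6 mR R leb6 f mf f0).
rewrite cE -(@fubini_tonelli _ _ E6 mR R leb6 lam _ mf f0).
apply: eq_integral => z _; rewrite /f /=.
have m1 : measurable_fun setT (fun t : mR => (\1_(separated A psi) (z, t) : R)%:E).
  apply/measurable_EFinP; apply: (measurableT_comp (measurable_indic mS)).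
  exact: pair1_measurable.
have i0 (t : mR) : setT t -> 0 <= (\1_(separated A psi) (z, t) : R)%:E.
  by move=> _; rewrite lee_fin.
have d0 : (0 <= (dist z)^-1)%R by rewrite invr_ge0 dist_ge0.
apply: (etrans (ge0_integralZl_EFin lam measurableT i0 m1 d0)).
by rewrite integral_separated -EFinM.
Qed.

Lemma measureD_null d (T : measurableType d) (m : {measure set T -> \bar R}) (P B : set T) :
  measurable P -> measurable B -> m P < +oo -> m (P `&` B) = m P -> m (P `\` B) = 0.
Proof.
move=> mP mB Poo E; apply: (etrans (measureD mP mB Poo)).
change (m P - m (P `&` B) = 0); rewrite E subee//.
by rewrite ge0_fin_numE.
Qed.

Lemma leb6_offdiag (A : set E3) : measurable A -> leb3 A < +oo ->
  leb6 ((A `*` A) `&` offdiag) = leb3 A * leb3 A.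
Proof.
move=> mA Aoo; rewrite -(leb6_setX mA mA); have mAA := measurable_setX6 mA mA.
have mo := @measurable_offdiag R; have mP := measurable_pairs 1 mA mA.
have mI := measurableI _ _ mP mo; have mD := measurableD mP mo.
have mAo := measurableI _ _ mAA mo.
have PE : leb6 (pairs A A 1 `\` offdiag) = 0.
  exact: (measureD_null mP mo (near_lty 1 mA mA Aoo) (near_offdiag 1 mA mA Aoo)).
apply/eqP; rewrite eq_le; apply/andP; split.
  by apply: le_measure; rewrite ?inE; [exact: mAo|exact: mAA|move=> z []].
rewrite -[leRHS]adde0 -PE; apply: (measure_subU leb6 mAA mAo mD) => z Az.
have [zo|zo] := pselect (offdiag z); [by left|right; split=> //; split; [exact: Az.1|exact: Az.2|]].
by apply: le_lt_trans (ltr01); rewrite leNgt; exact/negP.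
Qed.

End planar_cuts.

Section bounded_volume.
Context {R : realType}.
Notation lam := (@lebesgue_measure R).
Notation mR := (measurableTypeR R).
Notation E2 := (mR * mR)%type.
Notation E3 := (E2 * mR)%type.
Notation E6 := (E3 * E3)%type.
Notation leb3 := (@leb3 R).
Notation leb6 := (@leb6 R).
Notation R3 := (R * R * R)%type.
Local Open Scope ereal_scope.

Definition minimizes (e M : R) (A : set E3) := [/\ measurable A, leb3 A <= M%:E,
  benergy A <= (e * fine (leb3 A))%:E &
  forall B, measurable B -> leb3 B <= M%:E -> (e * fine (leb3 B))%:E <= benergy B].

Lemma minimizes_lty e M A : minimizes e M A -> leb3 A < +oo.
Proof. by move=> [_ AM _ _]; apply: le_lt_trans AM _; rewrite ltry. Qed.

Let cancel_cut (x y : \bar R) (e : R) (V1 V2 V : R) (b1 b2 b : \bar R) :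
  (V = V1 + V2)%R -> (e * V1)%:E <= b1 -> (e * V2)%:E <= b2 -> b <= (e * V)%:E ->
  b1 + b2 + (2^-1)%:E * x <= b + (2 * 1)%:E * y -> x <= 4%:E * y.
Proof.
move=> -> h1 h2 h3 h4.
have : (e * (V1 + V2))%:E + (2^-1)%:E * x <= (e * (V1 + V2))%:E + (2 * 1)%:E * y.
  apply: (@le_trans _ _ (b1 + b2 + (2^-1)%:E * x)).
    by apply: leeD2r; rewrite mulrDr EFinD; exact: leeD.
  by apply: le_trans h4 _; apply: leeD2r.
rewrite leeD2lE// => h.
have -> : x = 2%:E * ((2^-1)%:E * x) by rewrite muleA -EFinM divff// mul1e.
have -> : 4%:E * y = 2%:E * ((2 * 1)%:E * y) by rewrite muleA -EFinM; congr (_%:E * _); ring.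
exact: lee_wpmul2l.
Qed.

(** Each piece has energy at least e times its volume, while A has at most e |A|, so the interaction
    saved by the cut cannot exceed its price: cross / 2 <= 2 cost, with L = 1 in [benergy_cut]. *)
Lemma cross_le_cost e M A psi g t : minimizes e M A -> grad3 psi g ->
  (forall x, enorm (g x) <= 1)%R -> cross A psi t <= 4%:E * cost psi A t.
Proof.
move=> mi Gpsi g1; have Aoo := minimizes_lty mi; case: (mi) => mA AM Ae Amin.
have Eoo : benergy A < +oo by apply: le_lt_trans Ae _; rewrite ltry.
have mS : measurable (sublevel psi t) := measurable_sublevel t (grad3_continuous Gpsi).
have mI := measurableI _ _ mA mS; have mD := measurableD mA mS.
have AI : leb3 (A `&` sublevel psi t) <= leb3 A by apply: le_measure; rewrite ?inE// => z [].
have AD : leb3 (A `\` sublevel psi t) <= leb3 A by apply: le_measure; rewrite ?inE// => z [].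
have VE : fine (leb3 A) =
    (fine (leb3 (A `&` sublevel psi t)) + fine (leb3 (A `\` sublevel psi t)))%R.
  rewrite -fineD.
  - congr fine; rewrite -{1}(setUIDK A (sublevel psi t)).
    by apply: (measureU leb3 mI mD); rewrite setIACA setICr setI0.
  - by rewrite (ge0_fin_numE (measure_ge0 leb3 _)); exact: le_lt_trans AI Aoo.
  - by rewrite (ge0_fin_numE (measure_ge0 leb3 _)); exact: le_lt_trans AD Aoo.
have H := benergy_cut mA Aoo Eoo Gpsi ltr01 (fun x _ _ => g1 x).
exact: (cancel_cut VE (Amin _ mI (le_trans AI AM)) (Amin _ mD (le_trans AD AM)) Ae (H t)).
Qed.

Lemma integral_cross_le e M A psi g : minimizes e M A -> grad3 psi g ->
  (forall x, enorm (g x) <= 1)%R -> \int[lam]_t cross A psi t <= 8%:E * leb3 A.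
Proof.
move=> mi Gpsi g1; have [mA AM Ae Amin] := mi; have cpsi := grad3_continuous Gpsi.
have mc := measurable_cost mA cpsi.
apply: (@le_trans _ _ (\int[lam]_t (4%:E * cost psi A t))).
  apply: ge0_le_integral => //.
  - by move=> t _; rewrite adde_ge0// coul_ge0.
  - by have [] := integral_cross mA cpsi.
  - exact: measurable_funeM.
  - by move=> t _; exact: cross_le_cost mi Gpsi g1.
rewrite ge0_integralZl_EFin//; last by move=> t _; exact: cost_ge0.
have -> : 8%:E * leb3 A = 4%:E * (2%:E * leb3 A).
  by rewrite muleA -EFinM; congr (_%:E * _); ring.
by apply: lee_wpmul2l => //; exact: coarea.
Qed.

Lemma coord_sum_ge (A : set E3) (z : E6) :
  (\1_((A `*` A) `&` offdiag) z <=
    (dist z)^-1 * (`|z.1.1.1 - z.2.1.1| * \1_(A `*` A) z) +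
    ((dist z)^-1 * (`|z.1.1.2 - z.2.1.2| * \1_(A `*` A) z) +
     (dist z)^-1 * (`|z.1.2 - z.2.2| * \1_(A `*` A) z)) :> R)%R.
Proof.
rewrite -!mulrDr -!mulrDl addrA [\1_(_ `&` _) z]indicE [\1_(A `*` A) z]indicE in_setI.
have d0 := dist_ge0 z.
have S0 : (dist z <= `|z.1.1.1 - z.2.1.1| + `|z.1.1.2 - z.2.1.2| + `|z.1.2 - z.2.2|)%R.
  exact: enorm_le_coord.
case: (z \in A `*` A) => /=; last by rewrite !mulr0.
rewrite mulr1; have [zo|zo] := pselect (offdiag z).
  by rewrite mem_set//= ler_pdivlMl// mulr1.
by rewrite memNset//= mulr_ge0 ?invr_ge0// (le_trans d0).
Qed.

Let measurable_gap (A : set E3) (psi : R3 -> R) : measurable A -> continuous psi ->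
  measurable_fun setT
    (fun z : E6 => ((dist z)^-1 * (`|psi z.1 - psi z.2| * \1_(A `*` A) z))%:E).
Proof.
move=> mA /continuous_measurable3 mpsi.
have /measurable_EFinP mi := @measurable_idist R.
apply/measurable_EFinP; apply: measurable_funM; first exact: mi.
apply: measurable_funM; last by apply: measurable_indic; exact: measurable_setX6.
apply: measurableT_comp => //; apply: measurable_funB.
  exact: (measurableT_comp mpsi measurable_fst).
exact: (measurableT_comp mpsi measurable_snd).
Qed.

Let gap_ge0 (A : set E3) (psi : R3 -> R) (z : E6) :
  0 <= ((dist z)^-1 * (`|psi z.1 - psi z.2| * \1_(A `*` A) z))%:E.
Proof. by rewrite lee_fin mulr_ge0 ?invr_ge0 ?dist_ge0// mulr_ge0. Qed.

(* Cutting along the planes [x_i = t] saves the interaction across the plane.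
   Integrated over [t] and summed over [i], these interactions are at least
   [|A|^2], because [|x_1 - y_1| + |x_2 - y_2| + |x_3 - y_3| >= |x - y|]. *)
Lemma volume_bound e M A : minimizes e M A -> (fine (leb3 A) <= 24)%R.
Proof.
move=> mi; have Aoo := minimizes_lty mi; have [mA AM Ae Amin] := mi.
pose psi1 (x : R3) : R := x.1.1; pose psi2 (x : R3) : R := x.1.2; pose psi3 (x : R3) : R := x.2.
have c1 : continuous psi1 := grad3_continuous (@grad3_coord1 R).
have c2 : continuous psi2 := grad3_continuous (@grad3_coord2 R).
have c3 : continuous psi3 := grad3_continuous (@grad3_coord3 R).
have u1 : (enorm (@e1 R) <= 1)%R by rewrite /enorm /= expr1n expr0n /= !addr0 sqrtr1.
have u2 : (enorm (@e2 R) <= 1)%R by rewrite /enorm /= expr1n expr0n /= addr0 add0r sqrtr1.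
have u3 : (enorm (@e3 R) <= 1)%R by rewrite /enorm /= expr1n expr0n /= !add0r sqrtr1.
have I1 := integral_cross_le mi (@grad3_coord1 R) (fun=> u1).
have I2 := integral_cross_le mi (@grad3_coord2 R) (fun=> u2).
have I3 := integral_cross_le mi (@grad3_coord3 R) (fun=> u3).
rewrite (integral_cross mA c1).2 in I1; rewrite (integral_cross mA c2).2 in I2.
rewrite (integral_cross mA c3).2 in I3.
have m1 := measurable_gap mA c1; have m2 := measurable_gap mA c2; have m3 := measurable_gap mA c3.
have mo := measurableI _ _ (measurable_setX6 mA mA) (@measurable_offdiag R).
(* Each of the three directions contributes 8 |A|, that is 4 from [cross_le_cost] times 2 from
   [coarea]; hence 24. *)
have H : leb3 A * leb3 A <= 8%:E * leb3 A + (8%:E * leb3 A + 8%:E * leb3 A).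
  rewrite -(leb6_offdiag mA Aoo) -(integral_indic_T leb6 mo).
  apply: le_trans (leeD I1 (leeD I2 I3)).
  rewrite -(ge0_integralD leb6 measurableT (fun z _ => gap_ge0 A psi2 z) m2
    (fun z _ => gap_ge0 A psi3 z) m3).
  rewrite -(ge0_integralD leb6 measurableT (fun z _ => gap_ge0 A psi1 z) m1
    (fun z _ => adde_ge0 (gap_ge0 A psi2 z) (gap_ge0 A psi3 z)) (emeasurable_funD m2 m3)).
  apply: ge0_le_integral => //.
  - by apply/measurable_EFinP; exact: measurable_indic.
  - by apply: emeasurable_funD => //; exact: emeasurable_funD.
  - by move=> z _; rewrite -!EFinD lee_fin; exact: coord_sum_ge.
move: H; rewrite (fine_leb3 Aoo) -!EFinM -!EFinD lee_fin.
have V0 : (0 <= fine (leb3 A))%R := fine_ge0 (measure_ge0 leb3 A).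
move: V0; move: (fine (leb3 A)) => v; rewrite le_eqVlt => /predU1P[<-//|v0].
have -> : (8 * v + (8 * v + 8 * v) = 24 * v)%R by ring.
by rewrite (ler_pM2r v0).
Qed.

End bounded_volume.

(** * Removing the volume cap; sets without far pairs *)

Section global_minimum.
Context {R : realType}.
Notation mR := (measurableTypeR R).
Notation E2 := (mR * mR)%type.
Notation E3 := (E2 * mR)%type.
Notation leb3 := (@leb3 R).
Notation leb6 := (@leb6 R).
Notation R3 := (R * R * R)%type.
Local Open Scope ereal_scope.

(** Let e be the constant for the cap 24 and e' the one for the cap max (24, |A|). By [volume_bound]
    the minimizer for the larger cap has volume at most 24, so it competes for the smaller one and e
    <= e'. *)
Lemma global_minimizer : exists e (Om : set E3),
  [/\ (0 <= e)%R, [/\ measurable Om, 0 < leb3 Om & leb3 Om < +oo],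
   benergy Om = (e * fine (leb3 Om))%:E &
   forall A, measurable A -> leb3 A < +oo -> (e * fine (leb3 A))%:E <= benergy A].
Proof.
have M24 : (8 <= 24 :> R)%R by lra.
have [e [Om [e0 [mOm Om0 OmM] OmE Hmin]]] := constrained_minimizer M24.
have Omoo : leb3 Om < +oo by apply: le_lt_trans OmM _; rewrite ltry.
exists e, Om; split=> //.
  by apply/eqP; rewrite eq_le OmE Hmin.
move=> A mA Aoo.
have M8 : (8 <= Num.max 24 (fine (leb3 A)))%R by rewrite le_max M24.
have [e' [Om' [e'0 [mOm' Om'0 Om'M] Om'E Hmin']]] := constrained_minimizer M8.
have V24 := volume_bound (And4 mOm' Om'M Om'E Hmin').
have Om'oo : leb3 Om' < +oo by apply: le_lt_trans Om'M _; rewrite ltry.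
have AM : leb3 A <= (Num.max 24 (fine (leb3 A)))%:E.
  by rewrite {1}(fine_leb3 Aoo) lee_fin le_max lexx orbT.
apply: le_trans (Hmin' A mA AM); rewrite lee_fin.
apply: ler_wpM2r; first exact: fine_ge0 (measure_ge0 leb3 A).
have Om'24 : leb3 Om' <= 24%:E by rewrite (fine_leb3 Om'oo) lee_fin.
have V0 : (0 < fine (leb3 Om'))%R by rewrite fine_gt0// Om'0 Om'oo.
by rewrite -(ler_pM2r V0) -lee_fin; apply: le_trans (Hmin _ mOm' Om'24) Om'E.
Qed.

Lemma integral0_null d (T : measurableType d) (m : {measure set T -> \bar R}) (D : set T)
    (f : T -> \bar R) : measurable D -> measurable_fun D f ->
  (forall x, D x -> 0 < f x) -> \int[m]_(x in D) f x = 0 -> m D = 0.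
Proof.
move=> mD mf f0 If; apply: measure_negligible => //.
have /(ae_eq_integral_abs m mD mf) : \int[m]_(x in D) `|f x| = 0.
  rewrite -[RHS]If; apply: eq_integral => x; rewrite inE => Dx.
  by rewrite gee0_abs// ltW// f0.
apply: negligibleS => x Dx /(_ Dx) E.
by have := f0 x Dx; rewrite E ltxx.
Qed.

(** For each t the parts of A in psi <= t and in psi >= t + T form a product of far pairs, so one of
    them is null. The slab starts just below the supremum of the t for which it is the first. A box
    that carries some of the mass of A shows that such t exist and are bounded. *)
Lemma far_null_slab (A : set E3) (psi : R3 -> R) (T eta : R) : measurable A ->
  0 < leb3 A -> leb3 A < +oo -> continuous psi ->
  (forall x y : R3, `|psi x - psi y| <= enorm (x - y))%R ->
  (forall (n : nat) x, box n%:R x -> `|psi x| <= n%:R)%R ->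
  leb6 (far A T) = 0 -> (0 < eta)%R ->
  exists2 a, measurable [set x : E3 | a <= psi x <= a + T + eta]%R &
  leb3 (A `\` [set x : E3 | a <= psi x <= a + T + eta]%R) = 0.
Proof.
move=> mA A0 Aoo cpsi lip bnd far0 eta0.
have mle t : measurable (sublevel psi t) := measurable_sublevel t cpsi.
have mge t : measurable [set x : E3 | (t <= psi x)%R].
  rewrite -[X in measurable X]setCK; apply: measurableC.
  have -> : ~` [set x : E3 | (t <= psi x)%R] = [set x : E3 | (psi x < t)%R].
    by apply/seteqP; split=> z /=; [move/negP; rewrite -ltNge|move=> h; apply/negP; rewrite -ltNge].
  exact: measurable_lt (continuous_measurable3 cpsi).
have split_null t : leb3 (A `&` sublevel psi t) = 0 \/ leb3 (A `&` [set x | t + T <= psi x]%R) = 0.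
  have m1 := measurableI _ _ mA (mle t); have m2 := measurableI _ _ mA (mge (t + T)%R).
  have : leb6 ((A `&` sublevel psi t) `*` (A `&` [set x | t + T <= psi x]%R)) = 0.
    apply/eqP; rewrite eq_le (measure_ge0 leb6) andbT -far0.
    apply: le_measure; rewrite ?inE; [exact: measurable_setX6|exact: measurable_far|].
    move=> z [[A1 z1] [A2 z2]]; split; first by split.
    apply: le_trans (lip z.1 z.2); rewrite distrC; apply: le_trans (ler_norm _).
    by rewrite lerBrDl; apply: le_trans z2; rewrite lerD2r.
  rewrite (leb6_setX m1 m2) => /eqP; rewrite mule_eq0 => /orP[] /eqP; [by left|by right].
have [n An] : exists n : nat, leb3 (A `\` box n%:R) < leb3 A.
  have V0 : (0 < fine (leb3 A))%R by rewrite fine_gt0// A0 Aoo.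
  by have [n] := tail_small mA Aoo V0; rewrite -(fine_leb3 Aoo); exists n.
have mb := @measurable_box R n%:R.
have notnull (B : set E3) : measurable B -> leb3 (A `&` B) = 0 ->
    (forall x, box n%:R x -> B x) -> False.
  move=> mB B0 nB; have mI := measurableI _ _ mA mB; have mD := measurableD mA mb.
  have : leb3 A <= leb3 (A `&` B) + leb3 (A `\` box n%:R).
    apply: (measure_subU leb3 mA mI mD) => x Ax.
    have [bx|bx] := pselect (box n%:R x); last by right.
    by left; split=> //; exact: nB.
  by rewrite B0 add0e leNgt An.
pose P := [set t | leb3 (A `&` sublevel psi t) = 0].
have subP t t' : (t <= t')%R -> P t' -> P t.
  move=> tt' Pt'; apply/eqP; rewrite eq_le (measure_ge0 leb3) andbT -Pt'.
  apply: le_measure; rewrite ?inE; [exact: measurableI|exact: measurableI|].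
  by move=> x [Ax xt]; split=> //; exact: le_trans xt tt'.
have hP : has_sup P.
  split.
    exists (- (n%:R + `|T|))%R; have [//|h] := split_null (- (n%:R + `|T|))%R.
    exfalso; apply: (notnull _ (mge _) h) => x /bnd; rewrite /= ler_norml => /andP[h1 _].
    apply: le_trans h1; rewrite opprD -addrA gerDl addrC subr_le0 ler_norm//.
  exists n%:R => t Pt; rewrite leNgt; apply/negP => nt.
  apply: (notnull _ (mle t) Pt) => x /bnd; rewrite ler_norml => /andP[_ h2].
  exact: le_trans h2 (ltW nt).
have e2 : (0 < eta / 2)%R by rewrite divr_gt0.
have [t Pt ts] := sup_adherent e2 hP.
have nPt : ~ P (t + eta)%R.
  move=> Pe; have := ub_le_sup hP.2 Pe.
  by move: ts e2; set s := sup P; move: eta0; clear; lra.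
have [//|h2] := split_null (t + eta)%R.
have mslab : measurable [set x : E3 | t <= psi x <= t + T + eta]%R.
  have -> : [set x : E3 | t <= psi x <= t + T + eta]%R =
      [set x | t <= psi x]%R `&` sublevel psi (t + T + eta).
    by apply/seteqP; split=> x; rewrite /sublevel /setI /=; [move/andP|move=> [-> ->]].
  exact: measurableI.
exists t; first exact: mslab.
apply/eqP; rewrite eq_le (measure_ge0 leb3) andbT.
have m1 := measurableI _ _ mA (mle t).
have m2 := measurableI _ _ mA (mge (t + eta + T)%R).
apply: (@le_trans _ _ (leb3 (A `&` sublevel psi t) + leb3 (A `&` [set x | t + eta + T <= psi x]%R))).
  apply: (measure_subU leb3 (measurableD mA mslab) m1 m2).
  move=> x [Ax /negP]; rewrite negb_and -!ltNge => /orP[h|h].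
    by left; split; [exact: Ax|exact: ltW].
  by right; split; [exact: Ax|apply: ltW; rewrite addrAC].
by rewrite Pt h2 adde0.
Qed.

Let cube_limit (v T : R) : (0 < T)%R ->
  (forall eta, 0 < eta -> v <= (T + eta) ^+ 3)%R -> (v <= T ^+ 3)%R.
Proof.
move=> T0 H; apply/ler_addgt0Pr => e e0.
pose c := (3 * T ^+ 2 + 3 * T + 1)%R.
have c0 : (0 < c)%R by rewrite /c addr_gt0// addr_gt0 ?mulr_gt0 ?exprn_gt0.
pose s := Num.min 1%R (e / c)%R.
have s0 : (0 < s)%R by rewrite lt_min ltr01 divr_gt0.
have s1 : (s <= 1)%R by rewrite ge_min lexx.
have sc : (s * c <= e)%R by rewrite -ler_pdivlMr// ge_min lexx orbT.
apply: le_trans (H s s0) _.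
have -> : ((T + s) ^+ 3 = T ^+ 3 + s * (3 * T ^+ 2 + 3 * T * s + s * s))%R by ring.
rewrite lerD2l; apply: le_trans sc; apply: ler_wpM2l; first exact: ltW.
rewrite /c; apply: lerD; last by apply: mulr_ile1 => //; exact: ltW.
by rewrite lerD2l ler_piMr// mulr_ge0// ltW.
Qed.

(** Slabs of width T + eta in the three coordinate directions confine A to a cube up to a null set;
    then eta tends to 0. *)
Lemma far_null_volume (A : set E3) (T : R) : measurable A ->
  0 < leb3 A -> leb3 A < +oo -> (0 < T)%R -> leb6 (far A T) = 0 ->
  (fine (leb3 A) <= T ^+ 3)%R.
Proof.
move=> mA A0 Aoo T0 far0.
apply: (cube_limit T0) => eta eta0; have Te : (0 <= T + eta)%R by rewrite addr_ge0// ltW.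
have c1 := grad3_continuous (@grad3_coord1 R).
have c2 := grad3_continuous (@grad3_coord2 R).
have c3 := grad3_continuous (@grad3_coord3 R).
have [a1 mS1 N1] := far_null_slab mA A0 Aoo c1 (fun x y => norm_coord1_le (x - y)%R)
  (fun n x b => let: And3 h _ _ := (boxE n%:R x).1 b in h) far0 eta0.
have [a2 mS2 N2] := far_null_slab mA A0 Aoo c2 (fun x y => norm_coord2_le (x - y)%R)
  (fun n x b => let: And3 _ h _ := (boxE n%:R x).1 b in h) far0 eta0.
have [a3 mS3 N3] := far_null_slab mA A0 Aoo c3 (fun x y => norm_coord3_le (x - y)%R)
  (fun n x b => let: And3 _ _ h := (boxE n%:R x).1 b in h) far0 eta0.
pose B : set E3 := (`[a1, (a1 + T + eta)%R] `*` `[a2, (a2 + T + eta)%R]) `*` `[a3, (a3 + T + eta)%R].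
have le_add a : (a <= a + T + eta)%R by rewrite -addrA lerDl.
have mB : measurable B by do 2![apply: measurableX => //]; exact: measurable_itv.
have BE : leb3 B = ((T + eta) ^+ 3)%:E.
  apply: (etrans (leb3_brick (le_add a1) (le_add a2) (le_add a3))).
  by congr (_%:E); ring.
have mD := measurableD mA mB.
have D0 : leb3 (A `\` B) <= 0 + (0 + 0).
  have m1 := measurableD mA mS1; have m2 := measurableD mA mS2; have m3 := measurableD mA mS3.
  rewrite -{1}N1 -{1}N2 -N3.
  apply: le_trans (leeD2l _ (measure_subU leb3 (measurableU _ _ m2 m3) m2 m3 (fun x h => h))).
  apply: (measure_subU leb3 mD m1 (measurableU _ _ m2 m3)) => x [Ax nB].
  apply: contrapT => /not_orP[n1 /not_orP[n2 n3]]; apply: nB.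
  have get (S : set E3) : ~ (A `\` S) x -> S x by move=> h; apply: contrapT => ?; apply: h.
  by split; [split|]; rewrite /= in_itv /=; [exact: (get _ n1)|exact: (get _ n2)|exact: (get _ n3)].
have : leb3 A <= leb3 B + leb3 (A `\` B).
  apply: (measure_subU leb3 mA mB mD) => x Ax.
  by have [bx|bx] := pselect (B x); [left|right].
move=> /le_trans/(_ (leeD2l _ D0)); rewrite BE !adde0 (fine_leb3 Aoo) lee_fin.
exact.
Qed.

End global_minimum.

(** * Strict inequality *)

Section strictness.
Context {R : realType}.
Notation mR := (measurableTypeR R).
Notation E2 := (mR * mR)%type.
Notation E3 := (E2 * mR)%type.
Notation leb3 := (@leb3 R).
Notation leb6 := (@leb6 R).
Local Open Scope ereal_scope.

(** At x = pi / 6 the identity sin (3 x) = 1 reads (2 sin x - 1)^2 (sin x + 1) = 0, so sin x = 1 /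
    2; the mean value theorem then gives 1 / 2 = sin x < x. *)
Lemma pi_gt3 : (3 < pi :> R)%R.
Proof.
have pi0 := @pi_gt0 R; pose x : R := (pi / 6)%R.
have x0 : (0 < x)%R by rewrite divr_gt0.
have xpi : (x < pi)%R by rewrite /x ltr_pdivrMr// ltr_pMr// ltr1n.
have s0 : (0 < sin x)%R by apply: sin_gt0_pi; rewrite x0.
have s3 : (sin x = 2^-1)%R.
  have E : (pi / 2 = x + (x + x))%R by rewrite /x; field.
  have := @sin_pihalf R; rewrite E !sinD !cosD => H.
  have c2 : (cos x * cos x = 1 - sin x * sin x)%R.
    by have := cos2Dsin2 x; rewrite !expr2 => <-; rewrite addrK.
  have : ((2 * sin x - 1) ^+ 2 * (sin x + 1) = 0)%R.
    move: H c2; move: (sin x) (cos x) => s c H c2.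
    have -> : ((2 * s - 1) ^+ 2 * (s + 1) =
      1 - (s * (c * c - s * s) + c * (s * c + c * s)) + s * 3 * (c * c + s * s - 1))%R by ring.
    by rewrite H c2; ring.
  move/eqP; rewrite mulf_eq0 expf_eq0 /= (gt_eqF (addr_gt0 s0 ltr01)) orbF subr_eq0 => /eqP E1.
  by move: E1; clear; move: (sin x) => s; lra.
have ds (y : R) : y \in `]0%R, x[ -> is_derive y 1%R (@sin R) (cos y) by move=> _; exact: is_derive_sin.
have cs : {within `[0%R, x], continuous (@sin R)}.
  by apply: continuous_subspaceT; exact: continuous_sin.
have [c] := MVT x0 ds cs; rewrite in_itv /= => /andP[c0 cx].
rewrite sin0 !subr0 s3 => E.
have c1 : (cos c < 1)%R.
  rewrite -(@cos0 R) ltr_cos// in_itv /= ?lexx ?(ltW pi0)//.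
  by rewrite (ltW c0) (ltW (lt_trans cx xpi)).
have : (2^-1 < x)%R by rewrite E -[ltRHS]mul1r ltr_pM2r.
by rewrite /x ltr_pdivlMr// (_ : 2^-1 * 6 = 3)%R//; field.
Qed.

Let root_le (f : R) : (0 < f)%R -> (36 * pi <= f ^+ 3)%R -> ((36 * pi) `^ (3^-1) <= f)%R.
Proof.
move=> f0 H; have -> : f = ((f ^+ 3) `^ (3^-1))%R.
  by rewrite -powR_mulrn ?ltW// -powRrM divff// powRr1// ltW.
apply: ge0_ler_powR => //; rewrite ?nnegrE ?invr_ge0//.
- by rewrite mulr_ge0 ?pi_ge0.
- by rewrite exprn_ge0 ?ltW.
Qed.

(* AM-GM for [2 / T], [2 / T] and [pi / 3 * T ^+ 2]. *)
Let amgm (T : R) : (0 < T)%R -> ((36 * pi) `^ (3^-1) <= 4 / T + pi / 3 * T ^+ 2)%R.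
Proof.
move=> T0; have pi0 := @pi_gt0 R.
apply: root_le; first by rewrite addr_gt0 ?mulr_gt0 ?divr_gt0 ?invr_gt0 ?exprn_gt0.
(* In terms of z the difference is ((z + 12)^3 - 972 z) / (27 T^3), with a double root at the
   equality case z = 6. *)
rewrite -subr_ge0; set z := (pi * T ^+ 3)%R.
have -> : ((4 / T + pi / 3 * T ^+ 2) ^+ 3 - 36 * pi = (z - 6) ^+ 2 * (z + 48) / (27 * T ^+ 3))%R.
  by rewrite /z; field; rewrite gt_eqF.
have z0 : (0 < z)%R by rewrite mulr_gt0// exprn_gt0.
apply: divr_ge0; apply: mulr_ge0 => //; first exact: sqr_ge0.
  by rewrite addr_ge0// ltW.
by rewrite exprn_ge0// ltW.
Qed.

Let far_arith (p a b s : R) (F : \bar R) : (s <= p + 2^-1 * (a + b))%R ->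
  p%:E + (2^-1)%:E * (a%:E + b%:E + F) <= s%:E -> F <= 0.
Proof.
move=> H; case: F => [r| |] //.
  rewrite -!EFinD !lee_fin => h.
  rewrite -(ler_pM2l (_ : 0 < 2^-1 :> R)%R) ?mulr0; last by rewrite invr_gt0.
  rewrite -(lerD2l (p + 2^-1 * (a + b))%R) addr0; apply: le_trans H.
  by move: h; rewrite [(2^-1 * (_ + r))%R]mulrDr addrA.
by rewrite addey// gt0_muley ?lte_fin ?invr_gt0// addey.
Qed.

Lemma near_le_square (A : set E3) (T : R) : measurable A -> leb3 A < +oo ->
  (fine (near_pairs A A T) <= fine (leb3 A) * fine (leb3 A))%R.
Proof.
move=> mA Aoo; rewrite -lee_fin (fineK (near_fin_num T mA mA Aoo)) EFinM -(fine_leb3 Aoo).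
rewrite -(leb6_setX mA mA); apply: le_measure; rewrite ?inE.
- exact: measurable_pairs.
- exact: measurable_setX6.
- by move=> z [].
Qed.

(** This allows T = 4 |A| / P(A). For p <= 0, [key_estimate] at T = |A| + 1 would give 4/3 pi T^3
    |A| <= G(T) <= |A|^2, although 4/3 pi T^3 > |A|. *)
Lemma perimeter_gt0 (A : set E3) (p : R) : measurable A -> 0 < leb3 A -> leb3 A < +oo ->
  perimeter A <= p%:E -> (0 < p)%R.
Proof.
move=> mA A0 Aoo Ap; rewrite ltNge; apply/negP => p0.
have V0 : (0 < fine (leb3 A))%R by rewrite fine_gt0// A0 Aoo.
have T0 : (0 < fine (leb3 A) + 1)%R by rewrite addr_gt0.
have := key_estimate mA Aoo Ap T0.
have G : (fine (near_pairs A A (fine (leb3 A) + 1)) <= fine (leb3 A) * fine (leb3 A))%R.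
  exact: near_le_square.
move: G; set G := fine (near_pairs _ _ _); move: V0 T0; move: (fine (leb3 A)) => v v0 T0 GV.
have q : (pi / 4 * (v + 1) ^+ 4 * p <= 0)%R.
  by rewrite mulr_ge0_le0// mulr_ge0 ?exprn_ge0 ?divr_ge0 ?pi_ge0// ltW.
have c3 : (1 <= 4 / 3 * pi :> R)%R by have := pi_gt3; lra.
have h : (v * (v + 1) <= v * (v + 1) ^+ 3)%R.
  by apply: ler_wpM2l; [exact: ltW|rewrite ler_eXnr// lerDr ltW].
have h2 : (v * (v + 1) ^+ 3 <= 4 / 3 * pi * (v + 1) ^+ 3 * v)%R.
  rewrite mulrC -mulrA ler_peMl// mulr_ge0 ?exprn_ge0// ltW//.
by move: q h h2 GV v0; move: (pi / 4 * _ * p)%R (_ * pi * _ * v)%R => a b; clear; nra.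
Qed.

Let lower_arith (v p T G : R) : (0 < v)%R -> (0 < T)%R -> (T * p = 4 * v)%R ->
  (4 / 3 * pi * T ^+ 3 * v <= G + pi / 4 * T ^+ 4 * p)%R ->
  (pi / 3 * T ^+ 3 * v <= G)%R.
Proof.
move=> v0 T0 Tp; have -> : (pi / 4 * T ^+ 4 * p = pi * T ^+ 3 * v)%R.
  have -> : (pi / 4 * T ^+ 4 * p = pi / 4 * T ^+ 3 * (T * p))%R by ring.
  by rewrite Tp; field.
have -> : (4 / 3 * pi * T ^+ 3 * v = pi / 3 * T ^+ 3 * v + pi * T ^+ 3 * v)%R by field.
by rewrite lerD2r.
Qed.

(** With p = 4 v / T both lower bounds for the Coulomb part equal pi / 3 T^2 v, so half of their sum
    is again pi / 3 T^2 v, while p accounts for 4 / T. *)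
Let energy_arith (v e p T : R) : (0 < v)%R -> (0 < T)%R -> (T * p = 4 * v)%R ->
  (e <= 4 / T + pi / 3 * T ^+ 2)%R ->
  (e * v <= p + 2^-1 * ((2 / 3 * pi * v * T ^+ 2 - pi / 12 * p * T ^+ 3) +
    T^-1 * (pi / 3 * T ^+ 3 * v)))%R.
Proof.
move=> v0 T0 Tp eT; have TN : T != 0%R by rewrite gt_eqF.
have -> : (p = 4 * v / T)%R by rewrite -Tp (mulrC T) mulfK.
apply: le_trans (_ : (4 / T + pi / 3 * T ^+ 2) * v <= _)%R; first by rewrite ler_pM2r.
by rewrite le_eqVlt; apply/orP; left; apply/eqP; field.
Qed.

Lemma energy_ratio_gt (A : set E3) (e : R) : measurable A -> 0 < leb3 A -> leb3 A < +oo ->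
  benergy A <= (e * fine (leb3 A))%:E -> ((36 * pi) `^ (3^-1) < e)%R.
Proof.
move=> mA A0 Aoo Ae; rewrite ltNge; apply/negP => eK.
have V0 : (0 < fine (leb3 A))%R by rewrite fine_gt0// A0 Aoo.
have Pfin : perimeter A \is a fin_num.
  rewrite (ge0_fin_numE (perimeter_ge0 mA)); apply: le_lt_trans (perimeter_le_benergy mA) _.
  by apply: le_lt_trans Ae _; rewrite ltry.
have Ap : perimeter A <= (fine (perimeter A))%:E by rewrite fineK.
have p0 := perimeter_gt0 mA A0 Aoo Ap.
set p := fine (perimeter A) in Ap p0; pose T := (4 * fine (leb3 A) / p)%R.
have T0 : (0 < T)%R by rewrite divr_gt0// mulr_gt0.
have Tp : (T * p = 4 * fine (leb3 A))%R by rewrite /T divfK// gt_eqF.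
have eT := le_trans eK (amgm T0).
have GV := lower_arith V0 T0 Tp (key_estimate mA Aoo Ap T0).
have pT : (p * T <= 4 * fine (leb3 A))%R by rewrite mulrC Tp.
have I := near_integral_ge mA Aoo Ap T0 pT.
have Ti : (0 <= T^-1)%R by rewrite invr_ge0 ltW.
(* If e did not exceed the constant, the perimeter and the near pairs would already use up e |A|,
   leaving nothing for the far pairs. *)
have far0 : \int[leb6]_(z in far A T) (dist z)^-1%:E <= 0.
  apply: (far_arith (energy_arith V0 T0 Tp eT)); apply: le_trans Ae.
  rewrite /benergy (coul_split mA Aoo T0) -{1}(fineK Pfin) leeD2l//.
  apply: lee_wpmul2l; first by rewrite lee_fin.
  apply: leeD2r; apply: leeD; first exact: I.
  rewrite EFinM; apply: lee_wpmul2l; first by rewrite lee_fin.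
  by rewrite -(fineK (near_fin_num T mA mA Aoo)) lee_fin.
have farE : \int[leb6]_(z in far A T) (dist z)^-1%:E = 0.
  by apply/eqP; rewrite eq_le far0 integral_ge0// => z _; exact: idist_ge0.
have F0 : leb6 (far A T) = 0.
  apply: (integral0_null (measurable_far T mA) _ _ farE).
    by apply: measurable_funTS; exact: measurable_idist.
  by move=> z [_ zT]; rewrite lte_fin invr_gt0; exact: lt_le_trans T0 zT.
have VT := far_null_volume mA A0 Aoo T0 F0.
(* This is pi / 3 T^3 |A| <= G(T) <= |A|^2, which contradicts |A| <= T^3 since pi > 3. *)
have := le_trans GV (near_le_square T mA Aoo).
rewrite (ler_pM2r V0) leNgt => /negP; apply; apply: le_lt_trans VT _.
by rewrite ltr_pMl ?exprn_gt0// ltr_pdivlMr// mul1r pi_gt3.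
Qed.

End strictness.

(** * From Lebesgue measurable to Borel sets *)

Section reduction.
Context {R : realType}.
Notation mR := (measurableTypeR R).
Notation E2 := (mR * mR)%type.
Notation E3 := (E2 * mR)%type.
Notation leb3 := (@leb3 R).
Local Open Scope ereal_scope.
Notation cE3 := (caratheodory_type ((@borel_lebesgue3 R)^*)%mu).

Section null_difference.
Variables (Om B : set E3).
Hypotheses (mOm : lebesgue_measurable3 Om) (mB : measurable B) (OmB : Om `<=` B).
Hypothesis N0 : lebesgue3 (B `\` Om) = 0.

Let mB' : @measurable _ cE3 B := measurable_lebesgue3 mB.
Let mN : @measurable _ cE3 (B `\` Om) := measurableD mB' mOm.
Let DN : B `\` (B `\` Om) = Om.
Proof. by rewrite setDD setIidr. Qed.

Lemma integral_null_difference (f : E3 -> \bar R) : measurable_fun setT f ->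
  \int[lebesgue3]_(x in Om) f x = \int[lebesgue3]_(x in B) f x.
Proof.
move=> mf; rewrite integralE [RHS]integralE -{1 2}DN.
have mf' : measurable_fun setT (f : cE3 -> \bar R).
  exact: (measurableT_comp mf (@measurable_cara_id R)).
congr (_ - _).
- apply/esym/(ge0_negligible_integral mN mB' _ _ N0); last by move=> x _; exact: funepos_ge0.
  by apply: measurable_funTS; exact: measurable_funepos.
- apply/esym/(ge0_negligible_integral mN mB' _ _ N0); last by move=> x _; exact: funeneg_ge0.
  by apply: measurable_funTS; exact: measurable_funeneg.
Qed.

Lemma perimeter_null_difference : perimeter Om = perimeter B.
Proof.
congr ereal_sup; apply/seteqP; split => _ [X tX <-]; exists X => //;
  [apply/esym|]; apply: integral_null_difference; apply/measurable_EFinP;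
  by apply: measurable_divergence; case: tX.
Qed.

Lemma coulomb_null_difference : coulomb Om = coulomb B.
Proof.
congr (_ * _); pose N : set (cE3 * cE3) := (B `\` Om) `*` B `|` B `*` (B `\` Om).
have mNB : measurable ((B `\` Om) `*` B : set (cE3 * cE3)) by exact: measurableX.
have mBN : measurable (B `*` (B `\` Om) : set (cE3 * cE3)) by exact: measurableX.
have -> : Om `*` Om = (B `*` B) `\` N.
  apply/seteqP; split=> z; rewrite /N /setX /setD /setU /=.
    move=> [h1 h2]; split; first by split; exact: OmB.
    by move=> [[[_ nO]]|[_ [_ nO]]].
  move=> [[B1 B2] nN]; split; apply: contrapT => nO; apply: nN; [by left|by right].
apply/esym/ge0_negligible_integral.
- exact: measurableU.
- exact: measurableX.
- apply: measurable_funTS.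
  exact: (measurableT_comp (@measurable_kernel R) (@measurable_cara_pair_id R)).
- by move=> z _; exact: ge0_kernel.
apply: null_set_setU => //.
  apply: (etrans (@product_measure1E _ _ cE3 cE3 R lebesgue3 lebesgue3 _ _ mN mB')).
  exact: (etrans (congr1 (fun x => x * lebesgue3 B) N0) (mul0e _)).
apply: (etrans (@product_measure1E _ _ cE3 cE3 R lebesgue3 lebesgue3 _ _ mB' mN)).
exact: (etrans (congr1 (fun x => lebesgue3 B * x) N0) (mule0 _)).
Qed.

Lemma energy_null_difference : energy Om = benergy B.
Proof.
rewrite -(benergyE mB) /energy perimeter_null_difference coulomb_null_difference.
reflexivity.
Qed.

End null_difference.

(** Measurability and finite volume of Om turn the equality of measures with its Borel hull into a
    null difference, which changes neither perimeter nor Coulomb energy. *)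
Lemma admissible_borel (Om : set E3) : admissible Om -> exists B : set E3,
  [/\ measurable B, leb3 B = lebesgue3 Om & energy Om = benergy B].
Proof.
move=> [mOm Om0 Omoo]; have [B [mB OmB BE]] := borel_hull Omoo.
exists B; split; [exact: mB|by rewrite -lebesgue3E|].
apply: (energy_null_difference mOm mB OmB).
have mB' : @measurable _ cE3 B := measurable_lebesgue3 mB.
have mOm' : @measurable _ cE3 Om := mOm.
have Boo : lebesgue3 B < +oo by move: Omoo; rewrite -BE.
apply: (etrans (@measureD _ cE3 R lebesgue3 B Om mB' mOm' Boo)).
rewrite (setIidr OmB).
apply: (etrans (congr1 (fun x => x - lebesgue3 Om) BE)); apply: subee.
by rewrite (ge0_fin_numE (ltW Om0)).
Qed.

Lemma fine_leb3_gt0 (A : set E3) : 0 < leb3 A -> leb3 A < +oo -> (0 < fine (leb3 A))%R.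
Proof. by move=> A0 Aoo; rewrite fine_gt0// A0 Aoo. Qed.

Lemma div_leb3 (A : set E3) (x : \bar R) : 0 < leb3 A -> leb3 A < +oo ->
  x / leb3 A = x * ((fine (leb3 A))^-1)%:E.
Proof.
move=> A0 Aoo; have V0 := fine_leb3_gt0 A0 Aoo.
by rewrite [in LHS](fine_leb3 Aoo) inver gt_eqF.
Qed.

End reduction.

Theorem corollary19 (R : realType) :
  exists2 e_star : R,
    is_minimum (energy_per_volume R) e_star%:E &
    (36 * pi) `^ (3^-1) < e_star.
Proof.
have [e [Om [e0 [mOm Om0 Omoo] OmE Hmin]]] := @global_minimizer R.
exists e; last by apply: energy_ratio_gt mOm Om0 Omoo _; rewrite OmE.
split.
  exists Om; first by split; rewrite ?lebesgue3E//; exact: measurable_lebesgue3.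
  rewrite lebesgue3E// (div_leb3 _ Om0 Omoo) benergyE// OmE -EFinM mulfK//.
  by rewrite gt_eqF// fine_leb3_gt0.
move=> _ [A adA <-]; have [B [mB BA EB]] := admissible_borel adA.
have [_ A0 Aoo] := adA; move: A0 Aoo; rewrite -BA EB => B0 Boo.
have V0 := fine_leb3_gt0 B0 Boo; rewrite (div_leb3 _ B0 Boo).
have -> : (e%:E = (e * fine (leb3 B))%:E * ((fine (leb3 B))^-1)%:E)%E.
  by rewrite -EFinM mulfK// gt_eqF.
apply: lee_wpmul2r; first by rewrite lee_fin invr_ge0 ltW.
exact: Hmin.
Qed.
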